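(* Assume that $A$ is continuous and that assumptions (S) and (D) of the context hold. Then the solution to the system of reflected BSDEs $$\begin{cases}Y_t^i=\xi^i+\int_t^Tf_s^i\,dA_s+\int_t^T g^i_s\,ds+\int_t^T\int_E U_s^i(e)(\rho_s^i(e)-1)\phi_s(de)dA_s\\ \qquad-\int_t^T\int_EU_s^i(e)\,q(dsde)-\int_t^TZ_s^i\,dW_s+K_T^i-K_t^i,\\ Y_t^i\geq \max_{j\in \mathbb{A}_i}(Y^j_t-C_t(i,j)),\\ \int_0^T\big(Y_t^i- \max_{j\in \mathbb{A}_i}(Y^j_t-C_t(i,j))\big)dK_t^i=0,\end{cases}\qquad i\in\mathcal J,\ t\in[0,T],$$ is unique: if $(Y^i,U^i,Z^i,K^i)_{i\in\mathcal J}$ and $(\bar Y^i,\bar U^i,\bar Z^i,\bar K^i)_{i\in\mathcal J}$ are two solutions, then for every $i\in\mathcal J$, $Y^i=\bar Y^i$ and $K^i=\bar K^i$ up to indistinguishability, and $U^i=\bar U^i$, $Z^i=\bar Z^i$ as equivalence classes in their respective spaces.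
   Context: Setting. Fix $T>0$. $(\Omega,\mathcal F,\mathbb P)$ is a probability space with expectation $\mathbb E$, $(E,\mathcal E)$ is a Borel space (homeomorphic to a Borel subset of a compact metric space), $W$ is a $d$-dimensional Wiener process and $(T_n,\zeta_n)_{n\ge1}$ is a marked point process with marks $\zeta_n\in E$, independent of $W$: with $T_0=0$, a.s. $T_n\le T_{n+1}$, $T_n<\infty\Rightarrow T_n<T_{n+1}$, and (non-explosion) $T_n\to+\infty$. Its random measure is $p(dtde)=\sum_{n\ge1,\,T_n<\infty}\delta_{(T_n,\zeta_n)}(dtde)$. $\mathbb F=(\mathcal F_t)_{t\ge0}$ is the completed filtration generated by $p$ and $W$, $\mathcal P$ its predictable $\sigma$-algebra. The predictable compensator of $p$ has the form $\phi_t(\omega,de)dA_t(\omega)$, where $\phi_t(\omega,\cdot)$ is a probability on $(E,\mathcal E)$, $\phi_t(C)$ is predictable for every $C\in\mathcal E$, and $A$ is an increasing process with $A_0=0$, assumed continuous. $q(dtde)=p(dtde)-\phi_t(de)dA_t$, and integrals against $q$ are differences of the ordinary integrals against $p$ and $\phi\,dA$. $\int_a^b$ denotes integration over $(a,b]$. Spaces (of equivalence classes). $L^{2,\beta}(A)$: progressive $X$ with $\mathbb E[\int_0^Te^{\beta A_s}|X_s|^2dA_s]<\infty$. $L^{2,\beta}(p)$: $\mathcal P\otimes\mathcal E$-measurable $U$ with $\mathbb E[\int_0^T\int_Ee^{\beta A_s}|U_s(e)|^2\phi_s(de)dA_s]<\infty$. $L^{2,\beta}(W)$: progressive $Z$ (real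 or $\mathbb R^d$-valued as appropriate) with $\mathbb E[\int_0^Te^{\beta A_s}|Z_s|^2ds]<\infty$. $\mathcal I^2$: càdlàg increasing predictable $K$ with $\mathbb E[K_T^2]<\infty$. Data. $\mathcal J=\{1,\dots,m\}$ ($m\ge2$), $\mathbb A_i=\mathcal J\setminus\{i\}$. For each $i$, $\rho^i_s(e)\ge0$ is $\mathcal P\otimes\mathcal E$-measurable. Assumption (S): there is a constant $M$ with $0\le\rho^i_t(e)\le M$ for all $i$, and there is $\eta>3+M^4$ with $\mathbb E[e^{\eta A_T}]<\infty$. Set $M'=\max(|M-1|,1)$. Assumption (D): for some $\hat\beta>(M')^2$ and all $i\in\mathcal J$: (i) $\xi^i$ is $\mathcal F_T$-measurable with $\mathbb E[e^{\hat\beta A_T}|\xi^i|^2]<\infty$; (ii) $f^i$ is progressive in $L^{2,\hat\beta}(A)$; (iii) $g^i$ is progressive in $L^{2,\hat\beta}(W)$; (iv) $C_t(i,j)$, $i,j\in\mathcal J$, are continuous adapted processes, $C_t(i,j)\ge0$ for $i\ne j$, $C_t(i,i)=0$, $\inf_t(C_t(i,j)+C_t(j,l)-C_t(i,l))>0$ for all $i\ne j\ne l$ (that is, $i\neq j$ and $j\neq l$; $i=l$ allowed), and $\mathbb E[\sup_te^{\hat\beta A_t}C_t(i,j)]<\infty$ for all $i,j$; (v) $\xi^i\ge\xi^j-C_T(i,j)$ a.s. for all $i,j\in\mathcal J$. Solution of the system: for all $i$ and all $(M')^2<\beta<\hat\beta$, $Y^i$ is adapted càdlàg in $L^{2,\beta}(A)\cap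 L^{2,\beta}(W)$, $U^i\in L^{2,\beta}(p)$, $Z^i\in L^{2,\beta}(W)$, $K^i\in\mathcal I^2$ is increasing and continuous with $K^i_0=0$. *)

(* Defs.v *)
From HB Require Import structures.
From mathcomp Require Import all_boot all_order all_algebra.
From mathcomp Require Import all_classical all_reals all_analysis.
From mathcomp Require Import measurable_realfun.

Set Implicit Arguments.
Unset Strict Implicit.
Unset Printing Implicit Defensive.
Import Order.TTheory GRing.Theory Num.Theory.
Import numFieldNormedType.Exports.

Local Open Scope classical_set_scope.
Local Open Scope ring_scope.

Notation borelType E := (g_sigma_algebraType (@open E)).

(* [h] is a homeomorphism of [E] onto the Borel subset [range h] of the
   compact metric space [X]. *)
Definition borel_space (R : realType) (E : topologicalType) : Prop :=
  exists (X : metricType R) (h : E -> X),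
    [/\ compact [set: X],
        <<s @open X >> (range h),
        injective h
      & forall U : set E,
          open U <-> exists2 V : set X, open V & U = h @^-1` V].

Section stieltjes.
Context (R : realType).

Definition is_cumulative (g : R -> R) : Prop :=
  nondecreasing g /\ right_continuous g.

Definition cumulative_of (g : R -> R) (h : is_cumulative g) : cumulative R R :=
  HB.pack g (isCumulative.Build R _ R g h.1 h.2).

(* Lebesgue-Stieltjes measure of an arbitrary function: the zero measure when
   the function is not nondecreasing and right-continuous. Paths of increasing
   processes have the required regularity only almost surely. *)
Definition stieltjes (g : R -> R) : {measure set (measurableTypeR R) -> \bar R} :=
  match pselect (is_cumulative g) with
  | left h => lebesgue_stieltjes_measure (cumulative_of h)
  | right _ => mzero
  end.

Definition cadlag_on (T : R) (g : R -> R) : Prop :=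
  (forall t, 0 <= t < T -> g x @[x --> t^'+] --> g t) /\
  (forall t, 0 < t <= T -> cvg (g x @[x --> t^'-])).

End stieltjes.

Section filtration.
Context (R : realType) (dO : measure_display) (Omega : measurableType dO).
(* The sigma-algebra at time [t] is the one generated by [G t]. *)
Variable G : R -> set (set Omega).

Definition adapted (T : R) (X : R -> Omega -> R) : Prop :=
  forall t, 0 <= t <= T ->
    measurable_fun [set: g_sigma_algebraType (G t)] (X t).

Definition progressive (T : R) (X : R -> Omega -> R) : Prop :=
  forall t, 0 <= t <= T ->
    measurable_fun
      (`[0, t] `*` [set: g_sigma_algebraType (G t)])
      (fun x : R * g_sigma_algebraType (G t) => X x.1 x.2).

Definition predictable_rectangles : set (set (R * Omega)) :=
  [set S | (exists2 B, <<s G 0 >> B & S = [set 0] `*` B) \/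
           (exists s t B, [/\ 0 <= s < t, <<s G s >> B & S = `]s, t] `*` B])].

(* Its measurable subsets of [0, +oo[ x Omega form the predictable
   sigma-algebra; it is only used restricted to nonnegative times. *)
Definition predType : measurableType _ :=
  g_sigma_algebraType predictable_rectangles.

Definition predictable (I : set R) d' (V : measurableType d')
    (X : R -> Omega -> V) : Prop :=
  measurable_fun (I `*` setT : set predType) (fun x : predType => X x.1 x.2).

Definition predictable_field (I : set R) d1 (E : measurableType d1)
    d2 (V : measurableType d2) (U : R -> Omega -> E -> V) : Prop :=
  measurable_fun ((I `*` setT : set predType) `*` [set: E])
    (fun x : predType * E => U x.1.1 x.1.2 x.2).

End filtration.

Record noise (R : realType) (dO : measure_display) (Omega : measurableType dO)
    (E : ptopologicalType) (dim : nat) := Noise {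
  wiener : R -> Omega -> 'rV[R]_dim;
  jump_time : nat -> Omega -> \bar R;
  mark : nat -> Omega -> E;
  phi : R -> Omega -> probability (borelType E) R;
  cA : R -> Omega -> R
}.

Section setting.
Context (R : realType) (dO : measure_display) (Omega : measurableType dO).
Context (P : probability Omega R) (E : ptopologicalType) (dim : nat).
Variable N : noise R Omega E dim.

Local Notation W := (wiener N).
Local Notation tau := (jump_time N).
Local Notation zeta := (mark N).
Local Notation A := (cA N).

Definition wiener_events (I : set R) : set (set Omega) :=
  [set S | exists s (k : 'I_dim) (B : set R),
     [/\ I s, measurable B & S = [set w | B (W s w ord0 k)]]].

(* The last clause expresses at once that the increment is independent of the
   past and has independent components distributed as N(0, t - s);
   [normal_prob] takes the standard deviation as argument. *)
Definition is_wiener : Prop :=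
  [/\ forall t (k : 'I_dim), 0 <= t ->
        measurable_fun setT (fun w => W t w ord0 k),
      \forall w \ae P, W 0 w = 0,
      \forall w \ae P, forall k : 'I_dim,
        {within `[0, +oo[, continuous (fun t => W t w ord0 k)}
    & forall (s t : R) (H : set Omega) (B : 'I_dim -> set R), 0 <= s < t ->
        <<s wiener_events `[0, s] >> H -> (forall k, measurable (B k)) ->
        P (H `&` [set w | forall k, B k (W t w ord0 k - W s w ord0 k)])
        = (P H * \big[*%E/1]_(k < dim)
                    normal_prob 0 (Num.sqrt (t - s)) (B k))%E].

Definition is_marked_point_process : Prop :=
  [/\ forall n, measurable_fun setT (tau n : Omega -> \bar R),
      forall n, measurable_fun setT (zeta n : Omega -> borelType E),
      forall w, tau 0%N w = 0%E
    & \forall w \ae P,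
        [/\ forall n, (tau n w <= tau n.+1 w)%E,
            forall n, (tau n w < +oo)%E -> (tau n w < tau n.+1 w)%E
          & tau n w @[n --> \oo] --> +oo%E]].

Definition mpp_events : set (set Omega) :=
  [set S | (exists n (B : set (\bar R)),
              measurable B /\ S = tau n.+1 @^-1` B) \/
           (exists n (C : set (borelType E)),
              measurable C /\ S = zeta n.+1 @^-1` C)].

Definition independent_noise : Prop :=
  forall H1 H2, <<s wiener_events `[0, +oo[ >> H1 -> <<s mpp_events >> H2 ->
    P (H1 `&` H2) = (P H1 * P H2)%E.

Definition jump_atom (w : Omega) (n : nat) :
    {measure set (R * borelType E) -> \bar R} :=
  match tau n w with
  | r%:E => \d_((r, zeta n w) : R * borelType E)
  | _ => mzero
  end.

Definition jump_measure (w : Omega) :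
    {measure set (R * borelType E) -> \bar R} :=
  mseries (jump_atom w) 1.

Definition jump_events (t : R) : set (set Omega) :=
  [set S | exists s (C : set (borelType E)) (B : set (\bar R)),
     [/\ 0 <= s <= t, measurable C, measurable B
       & S = [set w | B (jump_measure w (`]0, s] `*` C))]]].

(* Generators of the completed filtration of [p] and [W]. *)
Definition filt (t : R) : set (set Omega) :=
  wiener_events `[0, t] `|` jump_events t
  `|` [set S | measurable S /\ P S = 0%E].

Definition dA (w : Omega) : {measure set (measurableTypeR R) -> \bar R} :=
  stieltjes (fun t => A (Num.max 0 t) w).

Definition increasing_cA : Prop :=
  [/\ forall w, A 0 w = 0,
      \forall w \ae P, {in `[0, +oo[ &, {homo A^~ w : s t / s <= t}},
      \forall w \ae P, forall t, 0 <= t -> A x w @[x --> t^'+] --> A t w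
    & predictable filt `[0, +oo[ A].

Definition continuous_cA : Prop :=
  \forall w \ae P, {within `[0, +oo[, continuous (A^~ w)}.

Definition is_compensator : Prop :=
  (forall C : set (borelType E), measurable C ->
     predictable filt `[0, +oo[ (fun t w => phi N t w C)) /\
  (forall H : R -> Omega -> borelType E -> \bar R,
     (forall t w e, (0 <= H t w e)%E) ->
     predictable_field filt `[0, +oo[ H ->
     (\int[P]_w \int[jump_measure w]_(x in `]0%R, +oo[ `*` setT)
                   H x.1 w x.2
      = \int[P]_w \int[dA w]_(s in `]0%R, +oo[)
                   \int[phi N s w]_e H s w e)%E).

Definition is_setting : Prop :=
  [/\ is_wiener, is_marked_point_process, independent_noise,
      increasing_cA & is_compensator].

Section horizon.
Variable T : R.

Definition sqnorm (v : 'rV[R]_dim) : R := \sum_(k < dim) v ord0 k ^+ 2.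

(* Squared norms of the weighted spaces; two elements represent the same class
   exactly when their difference has norm zero. The argument of [sqnormW] is
   the squared modulus of the process, which may be real or vector valued. *)
Definition sqnormA (beta : R) (X : R -> Omega -> R) : \bar R :=
  (\int[P]_w \int[dA w]_(s in `]0%R, T])
     (expR (beta * A s w) * X s w ^+ 2)%R%:E)%E.

Definition sqnormp (beta : R) (U : R -> Omega -> E -> R) : \bar R :=
  (\int[P]_w \int[dA w]_(s in `]0%R, T]) \int[phi N s w]_e
     (expR (beta * A s w) * U s w e ^+ 2)%R%:E)%E.

Definition sqnormW (beta : R) (X2 : R -> Omega -> R) : \bar R :=
  (\int[P]_w \int[lebesgue_measure]_(s in `]0%R, T])
     (expR (beta * A s w) * X2 s w)%R%:E)%E.

Definition in_L2A (beta : R) (X : R -> Omega -> R) : Prop :=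
  progressive filt T X /\ (sqnormA beta X < +oo)%E.

Definition in_L2p (beta : R) (U : R -> Omega -> E -> R) : Prop :=
  predictable_field filt `[0, T] (U : R -> Omega -> borelType E -> R) /\
  (sqnormp beta U < +oo)%E.

Definition in_L2W (beta : R) (X : R -> Omega -> R) : Prop :=
  progressive filt T X /\ (sqnormW beta (fun s w => (X s w ^+ 2)%R) < +oo)%E.

Definition in_L2W_vec (beta : R) (Z : R -> Omega -> 'rV[R]_dim) : Prop :=
  (forall k, progressive filt T (fun s w => Z s w ord0 k)) /\
  (sqnormW beta (fun s w => sqnorm (Z s w)) < +oo)%E.

Definition in_I2 (K : R -> Omega -> R) : Prop :=
  [/\ predictable filt `[0, T] K,
      \forall w \ae P, cadlag_on T (K^~ w),
      \forall w \ae P, {in `[0, T] &, {homo K^~ w : s t / s <= t}}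
    & (\int[P]_w (K T w ^+ 2)%R%:E < +oo)%E].

(* Step process equal to [sp_val k] on ]sp_time k, sp_time k.+1], k < sp_size *)
Record simple_process := SimpleProcess {
  sp_size : nat;
  sp_time : nat -> R;
  sp_val : nat -> Omega -> 'rV[R]_dim
}.

Definition is_simple (X : simple_process) : Prop :=
  [/\ 0 <= sp_time X 0%N,
      forall k, (k < sp_size X)%N -> sp_time X k <= sp_time X k.+1,
      sp_time X (sp_size X) <= T,
      forall k (j : 'I_dim), (k < sp_size X)%N ->
        measurable_fun [set: g_sigma_algebraType (filt (sp_time X k))]
          (fun w => sp_val X k w ord0 j)
    & exists c, forall k w (j : 'I_dim), (k < sp_size X)%N ->
        `|sp_val X k w ord0 j| <= c].

Definition sp_eval (X : simple_process) (s : R) (w : Omega) : 'rV[R]_dim :=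
  \sum_(k < sp_size X | sp_time X k < s <= sp_time X k.+1) sp_val X k w.

Definition sp_integral (X : simple_process) (t : R) (w : Omega) : R :=
  \sum_(k < sp_size X) \sum_(j < dim) sp_val X k w ord0 j *
    (W (Num.min (sp_time X k.+1) t) w ord0 j
     - W (Num.min (sp_time X k) t) w ord0 j).

(* [I] is a continuous version of t |-> int_0^t Z dW on [0, T], for Z square
   integrable with respect to ds x P: Ito's L^2-extension of [sp_integral]. *)
Definition is_ito_integral (Z : R -> Omega -> 'rV[R]_dim)
    (I : R -> Omega -> R) : Prop :=
  [/\ adapted filt T I,
      \forall w \ae P, {within `[0, T], continuous (I^~ w)}
    & exists X : nat -> simple_process,
        [/\ forall n, is_simple (X n),
            (\int[P]_w \int[lebesgue_measure]_(s in `]0%R, T])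
               (sqnorm (sp_eval (X n) s w - Z s w))%R%:E)%E
              @[n --> \oo] --> 0%E
          & forall t, 0 <= t <= T ->
              (\int[P]_w ((sp_integral (X n) t w - I t w) ^+ 2)%R%:E)%E
                @[n --> \oo] --> 0%E]].

Definition int_phi_dA (U : R -> Omega -> E -> R) (t : R) (w : Omega) : R :=
  \int[dA w]_(s in `]t, T]) (\int[phi N s w]_e U s w e).

Definition int_p (U : R -> Omega -> E -> R) (t : R) (w : Omega) : R :=
  \int[jump_measure w]_(x in `]t, T] `*` setT) U x.1 w x.2.

Definition int_q (U : R -> Omega -> E -> R) (t : R) (w : Omega) : R :=
  int_p U t w - int_phi_dA U t w.

Definition indistinguishable (X Y : R -> Omega -> R) : Prop :=
  \forall w \ae P, forall t, 0 <= t <= T -> X t w = Y t w.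

End horizon.
End setting.

Record bsde_data (R : realType) (dO : measure_display)
    (Omega : measurableType dO) (E : ptopologicalType) (m : nat) := BSDEData {
  xi : 'I_m -> Omega -> R;
  drvA : 'I_m -> R -> Omega -> R;
  drvW : 'I_m -> R -> Omega -> R;
  rho : 'I_m -> R -> Omega -> E -> R;
  cost : 'I_m -> 'I_m -> R -> Omega -> R
}.

Record candidate (R : realType) (dO : measure_display)
    (Omega : measurableType dO) (E : ptopologicalType) (dim m : nat) :=
    Candidate {
  solY : 'I_m -> R -> Omega -> R;
  solU : 'I_m -> R -> Omega -> E -> R;
  solZ : 'I_m -> R -> Omega -> 'rV[R]_dim;
  solK : 'I_m -> R -> Omega -> R
}.

Definition Mprime (R : realType) (M : R) : R := Num.max `|M - 1| 1.

Section system.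
Context (R : realType) (dO : measure_display) (Omega : measurableType dO).
Context (P : probability Omega R) (E : ptopologicalType) (dim m : nat).
Variables (N : noise R Omega E dim) (T : R) (D : bsde_data R Omega E m).

Local Notation F := (filt P N).
Local Notation A := (cA N).
Local Notation C := (cost D).

Definition measurable_rho : Prop :=
  forall i, (forall t w e, 0 <= t <= T -> 0 <= rho D i t w e) /\
    predictable_field F `[0, T] (rho D i : R -> Omega -> borelType E -> R).

Definition assumption_S (M : R) : Prop :=
  (forall i t w e, 0 <= t <= T -> 0 <= rho D i t w e <= M) /\
  (exists2 eta : R, 3 + M ^+ 4 < eta
     & (\int[P]_w (expR (eta * A T w))%R%:E < +oo)%E).

Definition assumption_xi (b : R) (i : 'I_m) : Prop :=
  measurable_fun [set: g_sigma_algebraType (F T)] (xi D i) /\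
  (\int[P]_w (expR (b * A T w) * xi D i w ^+ 2)%R%:E < +oo)%E.

Definition assumption_cost (b : R) : Prop :=
  [/\ forall i j, adapted F T (C i j) /\
        \forall w \ae P, {within `[0, T], continuous (C i j ^~ w)},
      forall i j, i != j ->
        \forall w \ae P, forall t, 0 <= t <= T -> 0 <= C i j t w,
      forall i, \forall w \ae P, forall t, 0 <= t <= T -> C i i t w = 0,
      forall i j l, i != j -> j != l ->
        \forall w \ae P, (0 < ereal_inf
          [set (C i j t w + C j l t w - C i l t w)%R%:E | t in `[0%R, T]])%E
    & forall i j, (\int[P]_w ereal_sup
          [set (expR (b * A t w) * C i j t w)%R%:E | t in `[0%R, T]] < +oo)%E].

Definition assumption_D (M b : R) : Prop :=
  [/\ Mprime M ^+ 2 < b,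
      forall i, [/\ assumption_xi b i, in_L2A P N T b (drvA D i)
                  & in_L2W P N T b (drvW D i)],
      assumption_cost b
    & forall i j, \forall w \ae P, xi D j w - C i j T w <= xi D i w].

(* max_{j <> i} (Y^j_t - C_t(i,j)), with values in \bar R so that the iterated
   maximum has a neutral element; it is finite as soon as m >= 2. *)
Definition obstacle (Y : 'I_m -> R -> Omega -> R) (i : 'I_m) (t : R)
    (w : Omega) : \bar R :=
  \big[Order.max/-oo%E]_(j < m | j != i) (Y j t w - C i j t w)%R%:E.

Definition solution_spaces (beta : R)
    (S : candidate R Omega E dim m) (i : 'I_m) : Prop :=
  [/\ in_L2A P N T beta (solY S i), in_L2W P N T beta (solY S i),
      in_L2p P N T beta (solU S i) & in_L2W_vec P N T beta (solZ S i)].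

Definition is_reflecting (K : R -> Omega -> R) : Prop :=
  [/\ in_I2 P N T K,
      \forall w \ae P, {within `[0, T], continuous (K^~ w)}
    & \forall w \ae P, K 0 w = 0].

Definition dK (K : R -> Omega -> R) (w : Omega) :
    {measure set (measurableTypeR R) -> \bar R} :=
  stieltjes (fun t => K (Num.min (Num.max 0 t) T) w).

Definition bsde_equation (S : candidate R Omega E dim m) (i : 'I_m) : Prop :=
  exists2 I, is_ito_integral P N T (solZ S i) I &
    \forall w \ae P, forall t, 0 <= t <= T ->
      solY S i t w =
        xi D i w
        + \int[dA N w]_(s in `]t, T]) drvA D i s w
        + \int[lebesgue_measure]_(s in `]t, T]) drvW D i s w
        + int_phi_dA N T (fun s w e => solU S i s w e * (rho D i s w e - 1)) t w
        - int_q N T (solU S i) t w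
        - (I T w - I t w)
        + (solK S i T w - solK S i t w).

Definition is_solution (M b : R) (S : candidate R Omega E dim m) : Prop :=
  forall i : 'I_m,
  [/\ adapted F T (solY S i) /\ (\forall w \ae P, cadlag_on T (solY S i ^~ w)),
      (forall beta, Mprime M ^+ 2 < beta < b -> solution_spaces beta S i),
      is_reflecting (solK S i),
      bsde_equation S i
    & (\forall w \ae P, forall t, 0 <= t <= T ->
         (obstacle (solY S) i t w <= (solY S i t w)%R%:E)%E) /\
      (\forall w \ae P,
         (\int[dK (solK S i) w]_(t in `]0%R, T])
            ((solY S i t w)%R%:E - obstacle (solY S) i t w) = 0)%E)].

End system.

(* Main.v *)
(** No Ito formula is used. For two solutions put x^i = Y^i - Ybar^i; it is
    enough to show x^i <= 0, the roles being symmetric. Let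
    psi(x) = (x^+)^(4/3) and b = 1 + M^4/3, so that 3b = 3 + M^4 is an
    admissible exponential moment of A_T. Since 0 <= rho <= M, Young's
    inequality for the exponents 4 and 4/3 gives
      psi'(x) u (1 - rho) + psi(x + u) - psi(x) - psi'(x) u >= - b psi(x),
    so the compensated jumps are absorbed by the weight exp(b A).

    On a grid t = t_0 < ... < t_N = T the convexity inequality
      psi(x_{k+1}) >= psi(x_k) + psi'(x_k) (x_{k+1} - x_k)
    replaces the Ito formula: the increments of the martingales vanish in
    expectation given F_{t_k}, Kbar^i contributes with the good sign, K^i does
    not increase as long as Y^i is far from its obstacle, and the remaining
    errors are Riemann-sum errors that vanish with the mesh. When Y^i comes
    within eps of Y^j - C(i,j), then x^i <= x^j + eps, and one switches from
    component i to component j. Since the sums C(i,j) + C(j,l) - C(i,l) are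
    bounded below by a positive constant on each path, only finitely many
    switches occur, and letting N grow and eps tend to 0 gives x^i <= 0.

    Once Y^i = Ybar^i, both U^i and Ubar^i are the jumps of the same path, so
    they agree on the support of p, hence phi dA-almost everywhere by
    compensation. Then the difference of the stochastic integrals is a
    continuous martingale of finite variation, hence zero, which identifies
    K^i and, by the Ito isometry, Z^i. The path properties that hold almost
    surely are made to hold everywhere by setting all processes to 0 off a
    measurable set G of full probability. *)

Require Import Defs.
From HB Require Import structures.
From mathcomp Require Import all_boot all_order all_algebra.
From mathcomp Require Import all_classical all_reals all_analysis.
From mathcomp Require Import measurable_realfun.
From mathcomp Require Import ring lra.

Set Implicit Arguments.
Unset Strict Implicit.
Unset Printing Implicit Defensive.
Import Order.TTheory GRing.Theory Num.Theory.
Import numFieldNormedType.Exports.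

Local Open Scope classical_set_scope.
Local Open Scope ring_scope.

(** * The convex function (x^+)^(4/3) *)

(** Origin of the exponent 4/3. For (x^+)^p Young's inequality gives the rate b = 1 + (p - 1)
    M^(p/(p-1)). Solutions are only square integrable, so psi of such a variable lies in L^(2/p),
    and Hoelder multiplies b by the conjugate exponent 2/(2 - p). At p = 4/3 this is 3 (1 + M^4/3) =
    3 + M^4, the threshold in (S). Bounding the square of the phi dA-integral of |u| costs a factor
    1 + A_T, which the strict inequality eta > 3 + M^4 pays for.

    Modes and truncations must be known at the left end of each grid cell. A finite automaton run
    along the grid (mode, number of switches, alive flag) takes the place of stopping times. When
    the flag drops, the lost value of psi(x) is bounded in expectation by an integrable [dominator]
    that does not depend on the grid. Every path ends up alive, so dominated convergence removes the
    loss. A switch costs a multiple of eps that grows with the truncation level n, hence the order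
    of choices: n, then eps, then the mesh. *)

Section power_four_thirds.
Context (R : realType).
Implicit Types (x y u rho M n : R).

(** In the variable c = [cbrt x] one has x^+ = c^3, [psi x] = c^4 and [dpsi x] = 4c/3, so every
    inequality about psi becomes polynomial. *)
Definition cbrt x : R := Num.max 0 x `^ 3^-1.

Definition psi x : R := cbrt x ^+ 4.

Definition dpsi x : R := 4 / 3 * cbrt x.

(** The remainder of the first-order expansion at x; with y = x + u it is the jump term that the Ito
    formula would produce. *)
Definition bregman x y : R := psi y - psi x - dpsi x * (y - x).

Lemma cbrt_ge0 x : 0 <= cbrt x.
Proof. exact: powR_ge0. Qed.

Lemma cbrt_cube x : cbrt x ^+ 3 = Num.max 0 x.
Proof.
rewrite /cbrt -powR_mulrn ?powR_ge0// -powRrM mulVf ?pnatr_eq0//.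
by rewrite powRr1// le_max lexx.
Qed.

Lemma le_cbrt x y : x <= y -> cbrt x <= cbrt y.
Proof.
move=> xy; have h : Num.max 0 x <= Num.max 0 y.
  by rewrite ge_max (le_max 0) lexx/= (le_max x) xy orbT.
by rewrite /cbrt ge0_ler_powR// nnegrE le_max lexx.
Qed.

Lemma cbrt_npos x : x <= 0 -> cbrt x = 0.
Proof. by move=> x0; rewrite /cbrt max_l// powR0// invr_eq0 pnatr_eq0. Qed.

Lemma cbrt_le1D x n : 0 <= n -> x <= n -> cbrt x <= 1 + n.
Proof.
move=> n0 xn; have c0 := cbrt_ge0 x; have c3 := cbrt_cube x.
have : Num.max 0 x <= n by rewrite ge_max n0.
by rewrite -c3 => h; nra.
Qed.

Lemma measurable_cbrt : measurable_fun setT cbrt.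
Proof.
apply: (@measurableT_comp _ _ _ _ _ _ (@powR R ^~ 3^-1)) => //.
exact: measurable_maxr.
Qed.

Lemma measurable_psi : measurable_fun setT psi.
Proof. by apply: measurable_funX; exact: measurable_cbrt. Qed.

Lemma measurable_dpsi : measurable_fun setT dpsi.
Proof. by apply: measurable_funM => //; exact: measurable_cbrt. Qed.

Lemma psi_ge0 x : 0 <= psi x. Proof. by rewrite exprn_ge0// cbrt_ge0. Qed.

Lemma dpsi_ge0 x : 0 <= dpsi x. Proof. by rewrite mulr_ge0// cbrt_ge0. Qed.

Lemma psi_npos x : x <= 0 -> psi x = 0.
Proof. by move=> x0; rewrite /psi cbrt_npos// expr0n. Qed.

Lemma psi_eq0 x : psi x = 0 -> x <= 0.
Proof.
move=> /eqP; rewrite expf_eq0/= => /eqP c0.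
by have := cbrt_cube x; rewrite c0 expr0n/= => /esym/eqP; rewrite eq_maxl.
Qed.

Lemma le_psi x y : x <= y -> psi x <= psi y.
Proof.
by move=> xy; rewrite lerXn2r// ?nnegrE ?cbrt_ge0// le_cbrt.
Qed.

(** Young's inequality for the exponents 4 and 4/3, with y^3 as second factor. The difference is a
    square times a sum of squares, so it holds for all signs. *)
Lemma young4 x y : 4 * x * y ^+ 3 <= x ^+ 4 + 3 * y ^+ 4.
Proof.
rewrite -subr_ge0.
have -> : x ^+ 4 + 3 * y ^+ 4 - 4 * x * y ^+ 3
   = (x - y) ^+ 2 * ((x + y) ^+ 2 + 2 * y ^+ 2) by ring.
by rewrite mulr_ge0 ?sqr_ge0// addr_ge0 ?sqr_ge0// mulr_ge0// sqr_ge0.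
Qed.

(** For x <= 0 both [psi x] and [dpsi x] vanish. For x > 0 one has x = a^3 exactly but only y <=
    c^3, which is the right direction since a >= 0; then [young4] concludes. *)
Lemma bregman_ge0 x y : 0 <= bregman x y.
Proof.
rewrite /bregman /psi /dpsi.
have := cbrt_cube x; have := cbrt_cube y.
have := cbrt_ge0 x; have := cbrt_ge0 y.
set a := cbrt x; set c := cbrt y => c0 a0 hc ha.
have [x0|x0] := leP x 0.
  move: ha; rewrite /a cbrt_npos// !expr0n/= mulr0 mul0r !subr0 => _.
  exact: exprn_ge0.
rewrite max_r in ha; last exact: ltW.
have yc : y <= c ^+ 3 by rewrite hc le_max lexx orbT.
have := young4 a c => h.
have : a * (y - x) <= a * (c ^+ 3 - a ^+ 3).
  by rewrite ler_wpM2l// ha lerB.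
have -> : a * (c ^+ 3 - a ^+ 3) = a * c ^+ 3 - a ^+ 4 by ring.
move: h; rewrite -mulrA; set q := a * c ^+ 3; lra.
Qed.

Lemma psi_diff_le x y : psi y - psi x <= dpsi y * (y - x).
Proof. have := bregman_ge0 y x; rewrite /bregman; lra. Qed.

(* The constant [1 + M ^+ 4 / 3] comes from [young4]. *)
Lemma psi_jump_ge0 x u rho M : 0 <= rho <= M ->
  0 <= dpsi x * u - dpsi x * (u * rho) + bregman x (x + u)
       + (1 + M ^+ 4 / 3) * psi x.
Proof.
move=> /andP[r0 rM].
rewrite /bregman (addrC x) addrK.
have -> : dpsi x * u - dpsi x * (u * rho) + (psi (u + x) - psi x - dpsi x * u) +
  (1 + M ^+ 4 / 3) * psi x =
  psi (u + x) - dpsi x * (u * rho) + (M ^+ 4 / 3) * psi x by ring.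
rewrite /psi /dpsi.
have := cbrt_cube x; have := cbrt_cube (u + x).
have := cbrt_ge0 x; have := cbrt_ge0 (u + x).
set a := cbrt x; set c := cbrt (u + x) => c0 a0 hc ha.
have [x0|x0] := leP x 0.
  rewrite /a cbrt_npos// !expr0n/= !mulr0 mul0r subr0 addr0.
  exact: exprn_ge0.
rewrite max_r in ha; last exact: ltW.
have yc' : u + x <= c ^+ 3 by rewrite hc le_max lexx orbT.
have yc : u <= c ^+ 3 by lra.
have rM4 : rho ^+ 4 <= M ^+ 4.
  by rewrite lerXn2r// ?nnegrE// (le_trans r0).
(* Pairing rho with a, not with c, sends its fourth power onto [psi x], where the rate of the
   exponential weight can absorb it. *)
have := young4 (a * rho) c => h.
have h1 : a * rho * u <= a * rho * c ^+ 3 by rewrite ler_wpM2l// mulr_ge0.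
have h2 : (a * rho) ^+ 4 <= M ^+ 4 * a ^+ 4.
  by rewrite exprMn mulrC ler_wpM2r// exprn_ge0.
have -> : 4 / 3 * a * (u * rho) = 4 / 3 * (a * rho * u) by ring.
have -> : M ^+ 4 / 3 * a ^+ 4 = (M ^+ 4 * a ^+ 4) / 3 by ring.
move: h h1 h2; rewrite -(mulrA 4); lra.
Qed.

Definition bregman_cst n : R := 5 + 2 * n ^+ 2 + 2 * n.

(** An upper bound on x suffices because psi vanishes on the negatives; quadratic growth in u is
    what the square integrability of u allows. The fourth power of the cube root is compared with
    the sixth through c^4 <= 1 + c^6. *)
Lemma bregman_le x u n : 0 <= n -> x <= n ->
  bregman x (x + u) <= bregman_cst n * (1 + u ^+ 2).
Proof.
move=> n0 xn; rewrite /bregman.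
have -> : x + u - x = u by ring.
have := psi_ge0 x.
have hx := cbrt_le1D n0 xn; have x0 := cbrt_ge0 x.
have hpsi : psi (x + u) <= 1 + (n + `|u|) ^+ 2.
  rewrite /psi; have := cbrt_ge0 (x + u); have := cbrt_cube (x + u).
  set c := cbrt _ => hc c0.
  have c3 : c ^+ 3 <= n + `|u|.
    by rewrite hc ge_max addr_ge0//= lerD// ler_norm.
  have : (c ^+ 3) ^+ 2 <= (n + `|u|) ^+ 2.
    by rewrite lerXn2r// ?nnegrE ?exprn_ge0// addr_ge0.
  move=> h6; suff : c ^+ 4 <= 1 + (c ^+ 3) ^+ 2 by move/le_trans; apply; lra.
  rewrite -exprM; have [c1|c1] := leP c 1.
    by rewrite (le_trans (exprn_ile1 4 c0 c1))// lerDl exprn_ge0.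
  have /le_trans -> // : c ^+ 4 <= c ^+ (3 * 2) by rewrite ler_weXn2l// ltW.
  by rewrite lerDr.
have hd : - (dpsi x * u) <= 2 * (1 + n) * `|u|.
  rewrite -mulrN; have := ler_norm (- u); rewrite normrN => hu.
  rewrite (le_trans (ler_wpM2l (dpsi_ge0 x) hu))// ler_wpM2r// /dpsi; lra.
have hu : u ^+ 2 = `|u| ^+ 2 by rewrite real_normK// num_real.
rewrite hu /bregman_cst; have := normr_ge0 u; move: hpsi hd {hu}; move: `|u| => v hpsi hd v0 p0.
have : (n + v) ^+ 2 <= 2 * n ^+ 2 + 2 * v ^+ 2.
  by have := sqr_ge0 (n - v); lra.
have : v <= (1 + v ^+ 2) / 2 by have := sqr_ge0 (1 - v); lra.
move=> hv hnv.
have : 2 * (1 + n) * v <= (1 + n) * (1 + v ^+ 2).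
  by rewrite -mulrA (mulrCA 2) ler_wpM2l ?addr_ge0//; lra.
have : 0 <= n ^+ 2 * v ^+ 2 by rewrite mulr_ge0 ?sqr_ge0.
have : 0 <= n * v ^+ 2 by rewrite mulr_ge0 ?sqr_ge0.
have := sqr_ge0 v; have := sqr_ge0 n.
move: hpsi hd hv hnv p0; generalize (psi (x + u)) (dpsi x * u) (psi x).
by move=> p d q; lra.
Qed.

End power_four_thirds.

(** * Regulated paths and grid sums *)

Section paths.
Context (R : realType).
Implicit Types (a b T s t r eta : R) (f g L : R -> R) (rs : seq R).

(** Compactness in finite-subcover form, with a radius that may depend on the point; it serves the
    passages below from local to uniform control of a path. *)
Lemma segment_gauge a b (d : R -> R) : (forall t, 0 < d t) ->
  exists2 ts : seq R, (forall t, t \in ts -> a <= t <= b) &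
    forall s, a <= s <= b -> exists2 t, t \in ts & `|s - t| < d t.
Proof.
move=> d0; have := @segment_compact R a b.
rewrite compact_cover => /(_ R [set` `[a, b]] (fun t => ball t (d t))).
case=> [t _|t tab|D' D'D cov].
- exact: ball_open.
- by exists t => //; apply: ballxx.
- exists (finmap.enum_fset D') => [t /D'D|s sab]; first by rewrite inE /= in_itv.
  have [|t tD' /= ts] := cov s; first by rewrite /= in_itv.
  by exists t => //; rewrite distrC.
Qed.

(** The exceptional list [rs] plays the role of a partition. The interval is open on the left
    because a cadlag path changes on arrival at a jump time, so a jump at t itself counts as lying
    in ]s, t]. *)
Definition osc_pts a b f eta rs : Prop := forall s t, a <= s -> s <= t -> t <= b ->
  (forall r, r \in rs -> ~~ (s < r <= t)) -> `|f s - f t| < eta.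

Definition regulated a b f : Prop :=
  forall eta, 0 < eta -> exists rs, osc_pts a b f eta rs.

Lemma osc_pts_sub a b f eta rs rs' : {subset rs <= rs'} ->
  osc_pts a b f eta rs -> osc_pts a b f eta rs'.
Proof. by move=> ss H s t as_ st tb h; apply: H => // r /ss; exact: h. Qed.

Lemma regulatedN a b f : regulated a b f -> regulated a b (fun t => - f t).
Proof.
move=> rf eta /rf[rs H]; exists rs => s t as_ st tb /(H _ _ as_ st tb).
by rewrite -opprD normrN.
Qed.

Lemma regulatedD a b f g : regulated a b f -> regulated a b g ->
  regulated a b (fun t => f t + g t).
Proof.
move=> rf rg eta eta0; have e2 : 0 < eta / 2 by rewrite divr_gt0.
have [rs H] := rf _ e2; have [rs' H'] := rg _ e2.
exists (rs ++ rs') => s t as_ st tb h.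
have -> : f s + g s - (f t + g t) = f s - f t + (g s - g t) by ring.
rewrite (le_lt_trans (ler_normD _ _))// (splitr eta) ltrD//.
- by apply: H => // r hr; apply: h; rewrite mem_cat hr.
- by apply: H' => // r hr; apply: h; rewrite mem_cat hr orbT.
Qed.

Lemma regulatedB a b f g : regulated a b f -> regulated a b g ->
  regulated a b (fun t => f t - g t).
Proof. by move=> rf /regulatedN; exact: regulatedD. Qed.

Lemma osc_pts_seq (I : finType) a b (f : I -> R -> R) eta : 0 < eta ->
  (forall i, regulated a b (f i)) -> exists rs, forall i, osc_pts a b (f i) eta rs.
Proof.
move=> e0 rf; pose c i := sval (cid (rf i eta e0)).
exists (flatten [seq c i | i <- enum I]) => i.
apply: (osc_pts_sub _ (svalP (cid (rf i eta e0)))) => r rc.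
by apply/flatten_mapP; exists i => //; rewrite mem_enum.
Qed.

Lemma continuous_within_dist a b f : {within `[a, b], continuous f} ->
  forall t eta, a <= t <= b -> 0 < eta ->
  exists2 d, 0 < d & forall s, a <= s <= b -> `|s - t| < d -> `|f s - f t| < eta.
Proof.
move=> /subspace_continuousP cf t eta tab eta0.
have /cvgrPdist_lt /(_ eta eta0) := cf t tab.
rewrite near_withinE => -[d /= d0 H]; exists d => // s sab st.
by rewrite distrC; apply: H => //=; rewrite distrC.
Qed.

Lemma continuous_itv_sub a b a' b' f : a <= a' -> b' <= b ->
  {within `[a, b], continuous f} -> {within `[a', b'], continuous f}.
Proof.
move=> aa bb; apply: continuous_subspaceW => t /=; rewrite !in_itv/= => /andP[h1 h2].
by rewrite (le_trans aa h1) (le_trans h2 bb).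
Qed.

(** Uniform continuity. The cover uses half radii, so that s and t lie in the full ball of a common
    centre once their distance is below the least half radius. *)
Lemma continuous_modulus a b f : {within `[a, b], continuous f} ->
  forall eta, 0 < eta ->
  exists2 d, 0 < d & forall s t, a <= s <= b -> a <= t <= b -> `|s - t| < d ->
    `|f s - f t| < eta.
Proof.
move=> cf eta eta0.
have e2 : 0 < eta / 2 by rewrite divr_gt0.
have H t : exists d, 0 < d /\ (a <= t <= b -> forall s, a <= s <= b ->
    `|s - t| < d -> `|f s - f t| < eta / 2).
  have [tab|ntab] := boolP (a <= t <= b); last by exists 1.
  by have [d d0 h] := continuous_within_dist cf tab e2; exists d.
have /choice[d hd] := H.
have [ts tsab hts] := @segment_gauge a b (fun t => d t / 2)
  (fun t => divr_gt0 (hd t).1 (ltr0n R 2)).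
have [m m0 hm] : exists2 m, 0 < m & forall t, t \in ts -> m <= d t / 2.
  elim: ts {tsab hts} => [|t ts [m m0 hm]]; first by exists 1.
  exists (Num.min m (d t / 2)).
    by rewrite lt_min m0 divr_gt0//; case: (hd t).
  move=> u; rewrite inE => /orP[/eqP ->|/hm]; first by rewrite ge_min lexx orbT.
  by move=> h; rewrite ge_min h.
exists m => // s t sab tab st.
have [c cts sc] := hts _ sab; have cab := tsab _ cts.
have mc := hm _ cts; have [dc0 hc] := hd c.
have -> : f s - f t = (f s - f c) - (f t - f c) by ring.
rewrite (le_lt_trans (ler_normB _ _))// (splitr eta) ltrD//; apply: hc => //.
  by rewrite (lt_le_trans sc)// ler_pdivrMr// ler_peMr ?ler1n// ltW.
have -> : t - c = (s - c) - (s - t) by ring.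
by rewrite (le_lt_trans (ler_normB _ _))// (splitr (d c)) ltrD// (lt_le_trans st).
Qed.

Lemma continuous_regulated a b f : {within `[a, b], continuous f} ->
  regulated a b f.
Proof.
move=> cf eta eta0; have [d d0 hd] := continuous_modulus cf eta0.
have [ts tsab hts] := @segment_gauge a b (fun=> d / 3)
  (fun=> divr_gt0 d0 (ltr0n R 3)).
(* An interval ]s, t] with s within d / 3 of a centre c cannot pass c + d / 3 without containing it,
   hence is shorter than d when it avoids the list. *)
exists (ts ++ [seq t + d / 3 | t <- ts]) => s t as_ st tb h.
have sab : a <= s <= b by rewrite as_ (le_trans st).
have tab : a <= t <= b by rewrite tb (le_trans as_).
apply: hd => //; rewrite distrC ger0_norm ?subr_ge0//.
have [c cts sc] := hts _ sab.
have /h : c + d / 3 \in ts ++ [seq t + d / 3 | t <- ts].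
  by rewrite mem_cat; apply/orP; right; apply: map_f.
rewrite negb_and -leNgt -ltNge => /orP[|]; move: sc; rewrite ltr_norml; lra.
Qed.

(** Around each centre c the path is close to [f c] on the right and to its left limit on the left.
    Listing both c and c + d c as exceptional keeps the interval on one side of c. *)
Lemma cadlag_regulated T f : cadlag_on T f -> regulated 0 T f.
Proof.
move=> [rc lc] eta eta0; have e2 : 0 < eta / 2 by rewrite divr_gt0.
have H t : exists d, 0 < d /\ (0 <= t <= T ->
    (forall s, t <= s -> s <= T -> s < t + d -> `|f s - f t| < eta / 2) /\
    exists l, forall s, 0 <= s -> t - d < s -> s < t -> `|f s - l| < eta / 2).
  have [/andP[t0 tT]|nt] := boolP (0 <= t <= T); last by exists 1.
  have [d1 d10 h1] : exists2 d, 0 < d & forall s, t <= s -> s <= T -> s < t + d ->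
      `|f s - f t| < eta / 2.
    have [tT'|Tt] := ltP t T; last first.
      exists 1 => // s ts sT _; have -> : s = t by apply/le_anti; rewrite ts (le_trans sT).
      by rewrite subrr normr0.
    have /cvgrPdist_lt /(_ _ e2) : f x @[x --> t^'+] --> f t.
      by apply: rc; rewrite t0.
    rewrite near_withinE => -[d /= d0 hd]; exists d => // s.
    rewrite le_eqVlt => /orP[/eqP -> _ _|ts sT sd]; first by rewrite subrr normr0.
    rewrite distrC; apply: hd => //=.
    by rewrite distrC ger0_norm ?subr_ge0 ?(ltW ts)// ltrBlDl.
  have [d2 d20 h2] : exists2 d, 0 < d & exists l, forall s, 0 <= s -> t - d < s ->
      s < t -> `|f s - l| < eta / 2.
    move: t0; rewrite le_eqVlt => /orP[/eqP <-|t0].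
      exists 1 => //; exists 0 => s s0 _; lra.
    have /cvg_ex[l] : cvg (f x @[x --> t^'-]) by apply: lc; rewrite t0.
    move=> /cvgrPdist_lt /(_ _ e2).
    rewrite near_withinE => -[d /= d0 hd]; exists d => //; exists l => s s0 sd st.
    rewrite distrC; apply: hd => //=.
    by rewrite ger0_norm ?subr_ge0 ?(ltW st)//; lra.
  exists (Num.min d1 d2); split; first by rewrite lt_min d10.
  move=> _; split; first by move=> s ts sT sd; apply: h1 => //;
    rewrite (lt_le_trans sd)// lerD2l ge_min lexx.
  case: h2 => l h2; exists l => s s0 sd st; apply: h2 => //.
  by rewrite (le_lt_trans _ sd)// lerB// ge_min lexx orbT.
have /choice[d hd] := H.
have [ts tsT hts] := @segment_gauge 0 T d (fun t => (hd t).1).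
exists (ts ++ [seq t + d t | t <- ts]) => s t s0 st tT h.
have [|c cts] := hts s; first by rewrite s0 (le_trans st).
rewrite ltr_norml => /andP[sc1 sc2].
have [_ /(_ (tsT _ cts))[hr [l hl]]] := hd c.
have hc : ~~ (s < c <= t) by apply: h; rewrite mem_cat cts.
have hcd : ~~ (s < c + d c <= t).
  by apply: h; rewrite mem_cat (map_f (fun t => t + d t)) ?orbT.
have [cs|sc] := leP c s.
  have -> : f s - f t = (f s - f c) - (f t - f c) by ring.
  have tcd : t < c + d c.
    by rewrite ltNge; apply: contra hcd => ->; rewrite andbT; lra.
  rewrite (le_lt_trans (ler_normB _ _))// (splitr eta) ltrD//; apply: hr => //.
  - exact: le_trans tT.
  - lra.
  - exact: le_trans st.
have tc : t < c by rewrite ltNge; apply: contra hc => ->; rewrite sc.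
have -> : f s - f t = (f s - l) - (f t - l) by ring.
rewrite (le_lt_trans (ler_normB _ _))// (splitr eta) ltrD//; apply: hl => //.
- lra.
- exact: le_trans st.
- lra.
Qed.

(** [N] encodes N + 1 equal cells, so the mesh never divides by zero. *)
Definition grid a b N k : R := a + (b - a) * (k%:R / N.+1%:R).

Lemma grid0 a b N : grid a b N 0 = a.
Proof. by rewrite /grid mul0r mulr0 addr0. Qed.

Lemma gridN a b N : grid a b N N.+1 = b.
Proof. by rewrite /grid divff ?pnatr_eq0// mulr1 addrC subrK. Qed.

Lemma gridS a b N k : grid a b N k.+1 - grid a b N k = (b - a) / N.+1%:R.
Proof.
by rewrite /grid opprD addrACA subrr add0r -mulrBr -mulrBl -natrB// subSnn mul1r.
Qed.

Lemma le_grid a b N k l : a <= b -> (k <= l)%N -> grid a b N k <= grid a b N l.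
Proof.
move=> ab kl; rewrite lerD2l ler_wpM2l ?subr_ge0// ler_wpM2r ?invr_ge0//.
by rewrite ler_nat.
Qed.

Lemma grid_itv a b N k : a <= b -> (k <= N.+1)%N -> a <= grid a b N k <= b.
Proof.
move=> ab kN; rewrite -{1}(grid0 a b N) -[X in _ <= _ <= X](gridN a b N).
by rewrite !le_grid.
Qed.

Lemma grid_mesh a b d : 0 < d -> exists N0, forall N, (N0 <= N)%N ->
  (b - a) / N.+1%:R < d.
Proof.
move=> d0; exists (Num.truncn (`|b - a| / d)) => N hN.
rewrite (le_lt_trans (ler_norm _))// normrM normfV (ger0_norm (ler0n _ _)).
rewrite ltr_pdivrMr// -ltr_pdivrMl// mulrC.
rewrite (lt_le_trans (truncnS_gt _))//.
by rewrite ler_nat.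
Qed.

Definition in_step a b N k r : bool := grid a b N k < r <= grid a b N k.+1.

Lemma in_step_inj a b N k l r : a <= b ->
  in_step a b N k r -> in_step a b N l r -> k = l.
Proof.
move=> ab; wlog kl : k l / (k <= l)%N => [W h1 h2|].
  by have [/W|/ltnW/W h] := leqP k l; [exact|apply/esym/h].
move=> /andP[h1 h2] /andP[h3 h4]; apply/eqP; rewrite eqn_leq kl leqNgt/=.
by apply/negP => /(@le_grid a b N _ _ ab); lra.
Qed.

(** Exchange the sums: cells are disjoint, so each exceptional point is seen by at most one cell and
    costs at most eta. *)
Lemma sum_grid_pts a b N rs (c : nat -> R) eta : a <= b -> 0 <= eta ->
  (forall k, 0 <= c k) ->
  (forall k, (k < N.+1)%N -> forall r, r \in rs -> in_step a b N k r -> c k <= eta) ->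
  \sum_(k < N.+1) (\sum_(r <- rs) (in_step a b N k r)%:R * c k) <= (size rs)%:R * eta.
Proof.
move=> ab eta0 c0 hc; rewrite exchange_big/=.
have -> : (size rs)%:R * eta = \sum_(r <- rs) eta.
  by rewrite big_const_seq count_predT iter_addr_0 mulr_natl.
rewrite big_seq [leRHS]big_seq; apply: ler_sum => r rrs.
have [[k hk]|nk] := pselect (exists k : 'I_N.+1, in_step a b N k r).
  rewrite (bigD1 k)//= hk mul1r big1 ?addr0; first exact: hc hk.
  move=> l lk; have [hl|] := boolP (in_step a b N l r); last by rewrite mul0r.
  by case/eqP: lk; apply/val_inj/(in_step_inj ab hl hk).
rewrite big1// => k _; have [hk|] := boolP (in_step a b N k r).
  by exfalso; apply: nk; exists k.
by rewrite mul0r.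
Qed.

Lemma telescope_grid a b N L :
  \sum_(k < N.+1) (L (grid a b N k.+1) - L (grid a b N k)) = L b - L a.
Proof.
by rewrite -(big_mkord xpredT (fun k => L (grid a b N k.+1) - L (grid a b N k)))
  telescope_sumr// grid0 gridN.
Qed.

(** For errors concentrated at finitely many times, such as jumps: only the cells holding these
    times contribute, and their number is bounded independently of N. *)
Lemma sum_grid_pts_cvg0 a b rs (e : nat -> nat -> R) : a <= b ->
  (forall N k, 0 <= e N k) ->
  (forall N k, (k < N.+1)%N ->
     (forall r, r \in rs -> ~~ in_step a b N k r) -> e N k = 0) ->
  (forall r eta, r \in rs -> 0 < eta -> exists N0, forall N, (N0 <= N)%N ->
     forall k, (k < N.+1)%N -> in_step a b N k r -> e N k <= eta) ->
  \sum_(k < N.+1) e N k @[N --> \oo] --> 0.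
Proof.
move=> ab e0 en er; apply/cvgrPdist_le => /= eta eta0.
have [N0 HN0] : exists N0, forall N, (N0 <= N)%N -> forall r, r \in rs ->
    forall k, (k < N.+1)%N -> in_step a b N k r -> e N k <= eta / (size rs).+1%:R.
  have : 0 < eta / (size rs).+1%:R by rewrite divr_gt0.
  move: (eta / _) => eta1 eta10.
  elim: rs er {en} => [|r rs IH] er; first by exists 0%N.
  have [|N1 hN1] := IH; first by move=> r' e' r'rs; apply: er; rewrite inE r'rs orbT.
  have [N2 hN2] := er r eta1 (mem_head _ _) eta10.
  exists (maxn N1 N2) => N; rewrite geq_max => /andP[h1 h2] r'.
  rewrite inE => /orP[/eqP ->|r'rs]; first exact: hN2.
  exact: hN1.
exists N0 => //= N /= N0N; rewrite sub0r normrN ger0_norm ?sumr_ge0//.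
apply: (@le_trans _ _ ((size rs)%:R * (eta / (size rs).+1%:R))); last first.
  rewrite mulrCA ger_pMr// ler_pdivrMr// mul1r ler_nat.
  exact: leqnSn.
apply: le_trans (sum_grid_pts (c := e N) ab _ _ _).
- apply: ler_sum => k _.
  have [[r [rrs hr]]|nr] := pselect (exists r, r \in rs /\ in_step a b N k r).
    by rewrite (big_rem r)//= hr mul1r lerDl sumr_ge0// => r' _; rewrite mulr_ge0.
  have -> : e N k = 0.
    by apply: en => // r rrs; apply/negP => hr; apply: nr; exists r.
  by rewrite big1// => r _; rewrite mulr0.
- by rewrite divr_ge0 ?ltW.
- exact: e0.
- by move=> k kN r rrs hr; exact: (HN0 N N0N r rrs k kN hr).
Qed.

(** There are two kinds of cells. Without exceptional points the error is at most eta1 and the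
    increments of L telescope; the others are at most [size rs] many, and there the increment of the
    continuous L is small while the error is merely bounded. *)
Lemma riemann_error_cvg0 a b L (e : nat -> nat -> R) B : a <= b ->
  (forall s t, a <= s -> s <= t -> t <= b -> L s <= L t) ->
  {within `[a, b], continuous L} ->
  (forall N k, 0 <= e N k <= B) ->
  (forall eta, 0 < eta -> exists rs, forall N k, (k < N.+1)%N ->
    (forall r, r \in rs -> ~~ in_step a b N k r) -> e N k <= eta) ->
  \sum_(k < N.+1) e N k * (L (grid a b N k.+1) - L (grid a b N k)) @[N --> \oo] --> 0.
Proof.
move=> ab ndL cL eB er; apply/cvgrPdist_le => /= eta eta0.
have B0 : 0 <= B by case/andP: (eB 0 0) => /le_trans; exact.
have dL0 N k : (k < N.+1)%N -> 0 <= L (grid a b N k.+1) - L (grid a b N k).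
  move=> kN; rewrite subr_ge0 ndL// ?le_grid//.
    by case/andP: (@grid_itv a b N k ab (ltnW kN)).
  by case/andP: (@grid_itv a b N k.+1 ab kN).
(* The added 1, here and in eta2 below, keeps the denominators positive. *)
pose eta1 := eta / 2 / (1 + (L b - L a)).
have Lab : 0 <= L b - L a by rewrite subr_ge0 ndL.
have eta10 : 0 < eta1 by rewrite !divr_gt0// ltr_wpDr.
have [rs hrs] := er _ eta10.
pose eta2 := eta / 2 / (1 + (size rs)%:R * B).
have sB : 0 <= (size rs)%:R * B by rewrite mulr_ge0.
have eta20 : 0 < eta2 by rewrite !divr_gt0// ltr_wpDr.
have [d d0 hd] := continuous_modulus cL eta20.
have [N0 hN0] := @grid_mesh a b d d0.
exists N0 => //= N /= /hN0 mesh; rewrite sub0r normrN.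
rewrite ger0_norm; last first.
  by apply: sumr_ge0 => k _; rewrite mulr_ge0 ?dL0//; case/andP: (eB N k).
have step k : (k < N.+1)%N -> L (grid a b N k.+1) - L (grid a b N k) <= eta2.
  move=> kN; rewrite (le_trans (ler_norm _))// ltW// hd ?grid_itv// 1?ltnW//.
  by rewrite gridS ger0_norm// divr_ge0 ?subr_ge0.
pose c k := if (k < N.+1)%N then B * (L (grid a b N k.+1) - L (grid a b N k)) else 0.
have c0 k : 0 <= c k by rewrite /c; case: ifPn => // kN; rewrite mulr_ge0 ?dL0.
apply: (@le_trans _ _ (\sum_(k < N.+1) (eta1 * (L (grid a b N k.+1) - L (grid a b N k))
   + \sum_(r <- rs) (in_step a b N k r)%:R * c k))).
  apply: ler_sum => k _.
  have s0 : 0 <= \sum_(r <- rs) (in_step a b N k r)%:R * c k.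
    by apply: sumr_ge0 => r _; rewrite mulr_ge0.
  have [[r [rrs hr]]|nr] := pselect (exists r, r \in rs /\ in_step a b N k r).
    apply: ler_wpDl; first by rewrite mulr_ge0 ?dL0// ltW.
    rewrite (big_rem r)//= hr mul1r ler_wpDr ?sumr_ge0// => [r' _|].
      by rewrite mulr_ge0.
    by rewrite /c ltn_ord ler_wpM2r ?dL0//; case/andP: (eB N k).
  apply: ler_wpDr => //; rewrite ler_wpM2r ?dL0// hrs// => r rrs.
  by apply/negP => hr; apply: nr; exists r.
rewrite big_split/= -mulr_sumr telescope_grid (splitr eta) lerD//.
  by rewrite /eta1 mulrAC ler_pdivrMr ?ltr_wpDr// ler_wpM2l ?divr_ge0 ?(ltW eta0)// lerDr.
apply: (@le_trans _ _ ((size rs)%:R * (B * eta2))).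
  apply: sum_grid_pts => //; first by rewrite mulr_ge0// ltW.
  by move=> k kN r _ _; rewrite /c kN ler_wpM2l ?step.
rewrite mulrA /eta2 mulrCA ger_pMr ?divr_gt0// ler_pdivrMr ?ltr_wpDr//.
by rewrite mul1r lerDr.
Qed.

Lemma in_step_dist a b N k r : a <= b -> in_step a b N k r ->
  r - grid a b N k <= (b - a) / N.+1%:R /\ grid a b N k.+1 - r <= (b - a) / N.+1%:R.
Proof. by move=> ab /andP[h1 h2]; rewrite -(gridS a b N k); split; lra. Qed.

End paths.

(** * Real-valued and lower integrals *)

Section real_integral.
Context d (T : measurableType d) (R : realType) (mu : {measure set T -> \bar R}).
Implicit Types (f g : T -> R) (D : set T).

Definition Rintegrable D f : Prop := mu.-integrable D (EFin \o f).

Lemma Rintegrable_measurable D f : Rintegrable D f -> measurable_fun D f.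
Proof. by move=> /integrableP[/measurable_EFinP]. Qed.

Lemma Rintegrable_le D f g : measurable D -> measurable_fun D f ->
  (forall x, D x -> `|f x| <= g x) -> Rintegrable D g -> Rintegrable D f.
Proof.
move=> mD mf fg; apply: le_integrable => //; first exact/measurable_EFinP.
by move=> x Dx /=; rewrite lee_fin (le_trans (fg x Dx))// ler_norm.
Qed.

Lemma RintegrableD D f g : measurable D -> Rintegrable D f -> Rintegrable D g ->
  Rintegrable D (fun x => f x + g x).
Proof. by move=> mD fi gi; have := integrableD mD fi gi. Qed.

Lemma RintegrableB D f g : measurable D -> Rintegrable D f -> Rintegrable D g ->
  Rintegrable D (fun x => f x - g x).
Proof. by move=> mD fi gi; have := integrableB mD fi gi. Qed.

Lemma RintegrableZ D c f : measurable D -> Rintegrable D f ->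
  Rintegrable D (fun x => c * f x).
Proof. by move=> mD fi; have := integrableZl mD c fi. Qed.

Lemma Rintegrable_abs D f : measurable D -> Rintegrable D f ->
  Rintegrable D (fun x => `|f x|).
Proof.
move=> mD fi; apply: (@le_integrable _ _ _ _ _ mD _ _ _ _ fi).
  by apply/measurable_EFinP; apply: measurableT_comp => //; exact: Rintegrable_measurable.
by move=> x Dx /=; rewrite lee_fin normr_id.
Qed.

Lemma Rintegrable_sum D (I : Type) (s : seq I) (h : I -> T -> R) : measurable D ->
  (forall i, Rintegrable D (h i)) -> Rintegrable D (fun x => \sum_(i <- s) h i x).
Proof.
move=> mD hi; elim: s => [|i s IH].
  by rewrite /Rintegrable; under eq_fun do rewrite big_nil; exact: integrable0.
rewrite /Rintegrable /comp; under eq_fun do rewrite big_cons.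
exact: RintegrableD.
Qed.

Lemma Rintegral_sum D (I : Type) (s : seq I) (h : I -> T -> R) : measurable D ->
  (forall i, Rintegrable D (h i)) ->
  \int[mu]_(x in D) (\sum_(i <- s) h i x) = \sum_(i <- s) \int[mu]_(x in D) h i x.
Proof.
move=> mD hi; elim: s => [|i s IH].
  by under eq_Rintegral do rewrite big_nil; rewrite big_nil Rintegral_cst// mul0r.
under eq_Rintegral do rewrite big_cons.
by rewrite RintegralD ?big_cons ?IH//; [exact: hi|exact: Rintegrable_sum].
Qed.

Lemma EFin_Rintegral D f : measurable D -> Rintegrable D f ->
  (\int[mu]_(x in D) f x)%:E = (\int[mu]_(x in D) (f x)%:E)%E.
Proof. by move=> mD fi; rewrite fineK//; exact: integrable_fin_num. Qed.

Lemma ge0_Rintegrable D f : measurable D -> measurable_fun D f ->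
  (forall x, D x -> 0 <= f x) -> (\int[mu]_(x in D) (f x)%:E < +oo)%E ->
  Rintegrable D f.
Proof.
move=> mD mf f0 foo; apply/integrableP; split; first exact/measurable_EFinP.
rewrite (eq_integral (fun x => (f x)%:E))// => x /[!inE] Dx /=.
by rewrite ger0_norm ?f0.
Qed.

Lemma Rintegral_lin4 D f1 f2 f3 f4 : measurable D -> Rintegrable D f1 ->
  Rintegrable D f2 -> Rintegrable D f3 -> Rintegrable D f4 ->
  Rintegrable D (fun x => f1 x - f2 x + f3 x + f4 x) /\
  \int[mu]_(x in D) (f1 x - f2 x + f3 x + f4 x) =
  \int[mu]_(x in D) f1 x - \int[mu]_(x in D) f2 x + \int[mu]_(x in D) f3 x
  + \int[mu]_(x in D) f4 x.
Proof.
move=> mD i1 i2 i3 i4; have i12 := RintegrableB mD i1 i2.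
have i123 := RintegrableD mD i12 i3.
split; first exact: RintegrableD.
by rewrite (RintegralD mD i123 i4) (RintegralD mD i12 i3) (RintegralB mD i1 i2).
Qed.

Lemma Rintegral_ge0_eq0 f : Rintegrable setT f -> (forall x, 0 <= f x) ->
  \int[mu]_x f x = 0 -> {ae mu, forall x, f x = 0}.
Proof.
move=> fi f0 i0; have := EFin_Rintegral measurableT fi; rewrite i0 => /esym e0.
have := @ae_eq_integral_abs _ _ _ mu _ measurableT (EFin \o f)
  (measurable_int mu fi).
rewrite (eq_integral (fun x => (f x)%:E)); last first.
  by move=> x _ /=; rewrite ger0_norm.
by move=> [/(_ e0) + _]; apply: filterS => x /(_ I) [].
Qed.

Lemma Rdominated_cvg (F : nat -> T -> R) f g :
  (forall n, measurable_fun setT (F n)) ->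
  (forall x, F n x @[n --> \oo] --> f x) ->
  (forall n x, `|F n x| <= g x) -> Rintegrable setT g ->
  measurable_fun setT f ->
  Rintegrable setT f /\ \int[mu]_x F n x @[n --> \oo] --> \int[mu]_x f x.
Proof.
move=> mF Ff Fg gi mf.
have fi : Rintegrable setT f.
  apply: (Rintegrable_le _ mf _ gi) => // x _.
  have Fa : `|F n x| @[n --> \oo] --> `|f x| by apply: cvg_norm; exact: Ff.
  by apply: (ler_cvg_to Fa (cvg_cst (g x))); near=> n; exact: Fg.
split=> //.
have Fi n : Rintegrable setT (F n) by apply: (Rintegrable_le _ (mF n) _ gi).
have H : (\int[mu]_x (F n x)%:E)%E @[n --> \oo] --> (\int[mu]_x (f x)%:E)%E.
  apply: (@dominated_cvg _ _ _ mu setT measurableT (fun n x => (F n x)%:E)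
    (EFin \o f) (EFin \o g)) => //.
  - by move=> n; exact/measurable_EFinP.
  - by move=> x _; apply: cvg_EFin; [near=> n|exact: Ff].
  - by move=> n x _ /=; rewrite lee_fin.
by apply: fine_cvg; rewrite EFin_Rintegral.
Unshelve. all: by end_near. Qed.

(** Monotone convergence in which integrability of the limit is part of the conclusion; it removes
    truncations from a uniform bound. *)
Lemma Rmonotone_bound (F : nat -> T -> R) f (C : R) :
  (forall n, Rintegrable setT (F n)) -> (forall n x, 0 <= F n x) ->
  (forall x, {homo F ^~ x : m n / (m <= n)%N >-> m <= n}) ->
  (forall x, F n x @[n --> \oo] --> f x) ->
  (forall n, \int[mu]_x F n x <= C) ->
  Rintegrable setT f /\ \int[mu]_x f x <= C.
Proof.
move=> Fi F0 Fnd Ff FC.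
have mf : measurable_fun setT f.
  apply: (measurable_fun_cvg (h := F)) => //.
    by move=> n; exact: Rintegrable_measurable (Fi n).
have f0 x : 0 <= f x.
  by apply: (ler_cvg_to (cvg_cst 0) (Ff x)); near=> n; exact: F0.
have lim_le : (\int[mu]_x (f x)%:E <= C%:E)%E.
  have Fcv : (\int[mu]_x (F n x)%:E @[n --> \oo] --> \int[mu]_x (f x)%:E)%E.
    have -> : (\int[mu]_x (f x)%:E = \int[mu]_x (limn (fun n => (F n x)%:E)))%E.
      apply: eq_integral => x _; apply/esym/cvg_lim => //.
      by apply: cvg_EFin; [near=> n|exact: Ff].
    apply: (@cvg_monotone_convergence _ _ _ mu setT measurableT (fun n x => (F n x)%:E)).
    - by move=> n; apply/measurable_EFinP; exact: Rintegrable_measurable (Fi n).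
    - by move=> n x _; rewrite lee_fin.
    - by move=> x _ m n mn; rewrite lee_fin Fnd.
  rewrite -(cvg_lim _ Fcv)//; apply: lime_le; first by apply/cvg_ex; eexists; exact: Fcv.
  by near=> n; rewrite -EFin_Rintegral// lee_fin.
have fi : Rintegrable setT f.
  by apply: ge0_Rintegrable => //; rewrite (le_lt_trans lim_le)// ltry.
by split=> //; rewrite -lee_fin EFin_Rintegral.
Unshelve. all: by end_near. Qed.

End real_integral.

Section simple_approximation.
Context d (T : measurableType d) (R : realType).
Import HBNNSimple.

(** Stated over an arbitrary measurable type so that it can be applied over a sub-sigma-algebra: the
    sets of the approximation then belong to that sigma-algebra. *)
Lemma simple_approximation (H : T -> R) : measurable_fun setT H ->
  (forall w, 0 <= H w) ->
  exists F : nat -> T -> R,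
    [/\ forall w, F n w @[n --> \oo] --> H w,
        forall n w, 0 <= F n w <= H w
      & forall n, exists s : seq (R * set T),
          (forall p, p \in s -> measurable p.2) /\
          forall w, F n w = \sum_(p <- s) p.1 * \1_(p.2) w].
Proof.
move=> mH H0; have mHE : measurable_fun setT (EFin \o H) by exact/measurable_EFinP.
pose F n : T -> R := nnsfun_approx measurableT mHE n.
have HF w : F n w @[n --> \oo] --> H w.
  have /fine_cvg := @cvg_nnsfun_approx _ T R setT measurableT (EFin \o H) mHE
    (fun x _ => H0 x) w I.
  exact.
have ndF w : nondecreasing_seq (F ^~ w).
  by move=> m n mn; have /lefP := nd_nnsfun_approx measurableT mHE mn; exact.
exists F; split=> // n.
  move=> w; apply/andP; split; first exact: fun_ge0.
  have := nondecreasing_cvgn_le (ndF w) (cvgP _ (HF w)) n.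
  by rewrite (cvg_lim _ (HF w)).
rewrite /F; set h := nnsfun_approx _ _ n.
exists [seq (r, h @^-1` [set r]) | r <- finmap.enum_fset (fset_set (range h))]; split.
  by move=> _ /mapP[r _ ->] /=; exact: measurable_funPTI.
move=> w; rewrite big_map (fimfunE h) fsbig_finite//=.
Qed.

End simple_approximation.

Section generated_sigma_algebra.
Context d (T : measurableType d) (R : realType) (P : probability T R).
Variables (G : set (set T)).
Hypothesis Gmeas : <<s G>> `<=` measurable.
Local Notation TG := (g_sigma_algebraType G).

Lemma sub_measurable_fun d' (U : measurableType d') (H : T -> U) :
  measurable_fun [set: TG] (H : TG -> U) -> measurable_fun [set: T] H.
Proof.
by move=> mH _ B mB; apply: Gmeas; have := mH measurableT B mB.
Qed.

(** Stands for E[H V] = E[H E[V | G]] = 0 without conditional expectations: positive and negative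
    parts of H, then simple functions over G, then dominated convergence with bound c |V|. *)
Lemma Rintegral_orth (V H : T -> R) (c : R) : Rintegrable P setT V ->
  (forall B, <<s G>> B -> \int[P]_(w in B) V w = 0) ->
  measurable_fun [set: TG] (H : TG -> R) -> (forall w, `|H w| <= c) ->
  Rintegrable P setT (fun w => H w * V w) /\ \int[P]_w (H w * V w) = 0.
Proof.
move=> Vi V0; have mV := Rintegrable_measurable Vi.
wlog H0 : H / forall w, 0 <= H w => [W mH Hc|].
  have mp : measurable_fun [set: TG] ((fun w => Num.max (H w) 0) : TG -> R).
    exact: measurable_maxr.
  have mn : measurable_fun [set: TG] ((fun w => Num.max (- H w) 0) : TG -> R).
    by apply: measurable_maxr => //; exact: measurableT_comp.
  have [||ip ep] := W _ _ mp; first by move=> w; rewrite le_max lexx orbT.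
    move=> w; have := Hc w; have [h|h] := leP (H w) 0; rewrite ?normr0//.
    exact: le_trans.
  have [||i_n en] := W _ _ mn; first by move=> w; rewrite le_max lexx orbT.
    move=> w; have := Hc w; have [h|h] := leP (- H w) 0; rewrite ?normr0 ?normrN//.
    exact: le_trans.
  have HE w : H w * V w = Num.max (H w) 0 * V w - Num.max (- H w) 0 * V w.
    rewrite -mulrBl; congr (_ * _); have [h|h] := leP (H w) 0.
      by rewrite max_l ?oppr_ge0// sub0r opprK.
    by rewrite max_r ?subr0// oppr_le0 ltW.
  split; first by rewrite /Rintegrable /comp; under eq_fun do rewrite HE;
    exact: RintegrableB.
  by under eq_Rintegral do rewrite HE; rewrite RintegralB// ep en subr0.
move=> mH Hc.
have [F [HF FH sF]] := @simple_approximation _ TG R H mH H0.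
have iF n : Rintegrable P setT (fun w => F n w * V w) /\ \int[P]_w (F n w * V w) = 0.
  have [s [ms hs]] := sF n.
  have mB p : p \in s -> d.-measurable p.2 by move=> /ms; exact: Gmeas.
  have hE w : F n w * V w = \sum_(i < size s)
      ((nth (0, set0) s i).1 * (\1_((nth (0, set0) s i).2) w * V w)).
    by rewrite hs mulr_suml (big_nth (0, set0)) big_mkord; apply: eq_bigr => i _;
      rewrite mulrA.
  have ii (i : 'I_(size s)) : Rintegrable P setT (fun w => \1_((nth (0, set0) s i).2) w * V w).
    apply: (@Rintegrable_le _ _ _ _ _ _ (fun w => `|V w|)) => //; last exact: Rintegrable_abs.
      apply: measurable_funM => //; apply: measurable_indic.
      by apply: mB; exact: mem_nth.
    by move=> w _; rewrite normrM ler_piMl// indicE; case: (_ \in _); rewrite ?normr0 ?normr1.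
  have iZ (i : 'I_(size s)) := RintegrableZ (nth (0, set0) s i).1 measurableT (ii i).
  split.
    by rewrite /Rintegrable /comp; under eq_fun do rewrite hE; exact: Rintegrable_sum.
  under eq_Rintegral do rewrite hE.
  rewrite Rintegral_sum// big1// => i _; rewrite RintegralZl//; last exact: ii.
  rewrite (_ : \int[P]_x _ = \int[P]_(x in (nth (0, set0) s i).2) V x).
    by rewrite V0 ?mulr0//; apply: ms; exact: mem_nth.
  rewrite [RHS]Rintegral_mkcond; apply: eq_Rintegral => w _.
  by rewrite patchE indicE; case: (_ \in _); rewrite ?mul1r ?mul0r.
have mF n : measurable_fun [set: T] (fun w : T => F n w * V w).
  by have [/Rintegrable_measurable] := iF n.
have [] := @Rdominated_cvg _ T _ P (fun n w => F n w * V w) (fun w => H w * V w)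
  (fun w => c * `|V w|) mF.
- by move=> w; apply: cvgM; [exact: HF|exact: cvg_cst].
- move=> n w; rewrite normrM ler_wpM2r//; have /andP[F0 FHw] := FH n w.
  by rewrite ger0_norm// (le_trans FHw)// (le_trans (ler_norm _)).
- by apply: RintegrableZ => //; exact: Rintegrable_abs.
- by apply: measurable_funM => //; exact: sub_measurable_fun.
move=> ? cv; split=> //.
have : \int[P]_w (F n w * V w) @[n --> \oo] --> 0.
  by under eq_fun do rewrite (iF _).2; exact: cvg_cst.
by move/cvg_lim => <-//; apply/esym/cvg_lim.
Qed.

End generated_sigma_algebra.

Section nonmeasurable_integrals.
Context d (T : measurableType d) (R : realType) (mu : {measure set T -> \bar R}).
Local Open Scope ereal_scope.
Import HBNNSimple.

(* The path functionals of the statement are measurable only up to null sets,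
   so their integrals have to be compared through the lower integral. *)
Lemma lower_integral_le (D : set T) (f g : T -> \bar R) : (forall x, D x -> 0 <= f x) ->
  (forall x, D x -> f x <= g x) -> \int[mu]_(x in D) f x <= \int[mu]_(x in D) g x.
Proof.
move=> f0 fg; rewrite integral_mkcond [leRHS]integral_mkcond.
have f0' x : 0 <= (f \_ D) x by rewrite patchE; case: ifPn => // /[!inE]; exact: f0.
have g0' x : 0 <= (g \_ D) x.
  by rewrite patchE; case: ifPn => // /[!inE] Dx; exact: le_trans (f0 x Dx) (fg x Dx).
rewrite !ge0_integralTE//; apply: ge_ereal_sup => _ [h /= hf <-].
apply: ereal_sup_ubound; exists h => //= x.
apply: (le_trans (hf x)); rewrite !patchE; case: ifPn => // /[!inE]; exact: fg.
Qed.

(** The lower integral sees f only through the simple functions below it, and each of these is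
    compared with g almost everywhere. *)
Lemma lower_integral_ae_le (D : set T) (f g : T -> \bar R) : measurable D ->
  (forall x, D x -> 0 <= f x) -> (forall x, D x -> 0 <= g x) -> measurable_fun D g ->
  {ae mu, forall x, D x -> f x <= g x} -> \int[mu]_(x in D) f x <= \int[mu]_(x in D) g x.
Proof.
move=> mD f0 g0 mg fg; rewrite integral_mkcond [leRHS]integral_mkcond.
have f0' x : 0 <= (f \_ D) x by rewrite patchE; case: ifPn => // /[!inE]; exact: f0.
have g0' x : 0 <= (g \_ D) x by rewrite patchE; case: ifPn => // /[!inE]; exact: g0.
rewrite [leLHS]ge0_integralTE//; apply: ge_ereal_sup => _ [h /= hf <-].
rewrite -integralT_nnsfun; apply: ae_ge0_le_integral => //.
- by move=> x _; rewrite lee_fin; exact: fun_ge0.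
- exact/measurable_EFinP.
- exact/(measurable_restrictT _ mD).
apply: filterS fg => x h1 _; apply: (le_trans (hf x)); rewrite !patchE.
by case: ifPn => // /[!inE]; exact: h1.
Qed.

Lemma lower_integral_ae0 (D : set T) (f : T -> \bar R) : measurable D ->
  (forall x, D x -> 0 <= f x) -> {ae mu, forall x, D x -> f x = 0} -> \int[mu]_(x in D) f x = 0.
Proof.
move=> mD f0 fe; apply/eqP; rewrite eq_le integral_ge0// andbT.
rewrite -[leRHS](integral0 mu D); apply: lower_integral_ae_le => //.
by apply: filterS fe => x h /h ->.
Qed.

End nonmeasurable_integrals.

(** * Predictable fields *)

Lemma measurable_fun_generated d (T : measurableType d) (U : pointedType)
    (G : set (set U)) (h : T -> g_sigma_algebraType G) :
  (forall B, G B -> measurable (h @^-1` B)) -> measurable_fun setT h.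
Proof.
move=> Gh _ B mB; rewrite setTI; move: B mB.
suff : <<s G>> `<=` [set B | measurable (h @^-1` B)] by exact.
apply: smallest_sub => //; split=> /=.
- by rewrite preimage_set0; exact: measurable0.
- by move=> A mA; rewrite setTD preimage_setC; exact: measurableC.
- by move=> A mA; rewrite preimage_bigcup; exact: bigcupT_measurable.
Qed.

Section predictable_lemmas.
Context (R : realType) d (Omega : measurableType d) dE (E : measurableType dE).
Variable F : R -> set (set Omega).

Lemma measurable_predictable_ocitv (s t : R) : 0 <= s ->
  measurable (`]s, t] `*` setT : set (Defs.predType F)).
Proof.
move=> s0; have [st|ts] := ltP s t; last first.
  by rewrite set_itv_ge ?bnd_simp -?leNgt// set0X; exact: measurable0.
apply: sub_gen_smallest; right; exists s, t, setT; split=> //.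
  by rewrite s0.
exact: (@measurableT _ (g_sigma_algebraType (F s))).
Qed.

Lemma measurable_predictable_ccitv (T : R) : 0 <= T ->
  measurable (`[0, T] `*` setT : set (Defs.predType F)).
Proof.
move=> T0; have -> : `[0, T] `*` setT =
    ([set 0] `*` setT) `|` (`]0, T] `*` setT) :> set (Defs.predType F).
  apply/seteqP; split=> -[r w] /=; rewrite !in_itv/=.
    move=> [/andP[r0 rT] _]; have [->|rn0] := eqVneq r 0; [by left|right].
    by rewrite lt_neqAle eq_sym rn0 r0.
  by move=> [[-> _]|[/andP[/ltW -> ->]]]//; rewrite lexx.
apply: measurableU; last exact: measurable_predictable_ocitv.
apply: sub_gen_smallest; left; exists setT => //.
exact: (@measurableT _ (g_sigma_algebraType (F 0))).
Qed.

Lemma measurable_predictable_coitv :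
  measurable (`[0, +oo[ `*` setT : set (Defs.predType F)).
Proof.
have -> : `[0%R, +oo[ `*` setT = \bigcup_n (`[0%R, n%:R] `*` setT) :> set (R * Omega).
  apply/seteqP; split=> -[r w] /=; rewrite in_itv/= ?andbT => -[].
    move=> r0 _; exists (Num.truncn r).+1 => //=; rewrite in_itv/= r0.
    by split=> //; exact/ltW/truncnS_gt.
  by move=> n _ [/=]; rewrite !in_itv/= => /andP[-> _].
by apply: bigcupT_measurable => n; exact: measurable_predictable_ccitv.
Qed.

(** The preimages are rectangles ]s, t] x B with B in F_s. In this way a weight known at the left
    end of a grid cell becomes a predictable integrand on that cell. *)
Lemma predictable_field_past d' (V : measurableType d') (s t : R) (y : Omega -> V) :
  0 <= s -> measurable_fun [set: g_sigma_algebraType (F s)]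
    (y : g_sigma_algebraType (F s) -> V) ->
  predictable_field F `]s, t] (fun _ w (_ : E) => y w).
Proof.
move=> s0 my mD Y mY.
have [st|ts] := ltP s t; last first.
  by rewrite set_itv_ge ?bnd_simp -?leNgt// !set0X set0I; exact: measurable0.
rewrite (_ : _ `&` _ = (`]s, t] `*` (y @^-1` Y)) `*` setT); last first.
  by apply/seteqP; split=> -[[r w] e] /=; tauto.
apply: measurableX => //; apply: sub_gen_smallest; right; exists s, t, (y @^-1` Y).
split=> //; first by rewrite s0.
by have := my measurableT Y mY; rewrite setTI.
Qed.

Lemma measurable_pair_predictable (w : Omega) :
  measurable_fun [set: R] ((fun r => (r, w)) : R -> Defs.predType F).
Proof.
apply: measurable_fun_generated => S rS; case: rS => [[B mB ->]|[s [t [B [st mB ->]]]]].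
  have [Bw|nBw] := pselect (B w).
    by rewrite (_ : _ @^-1` _ = [set 0])//; apply/seteqP; split=> r //= [].
  by rewrite (_ : _ @^-1` _ = set0)//; apply/seteqP; split=> r //= [].
have [Bw|nBw] := pselect (B w).
  rewrite (_ : _ @^-1` _ = [set` `]s, t]])//.
  by apply/seteqP; split=> r //= [].
by rewrite (_ : _ @^-1` _ = set0)//; apply/seteqP; split=> r //= [].
Qed.

Lemma measurable_id_predictable :
  (forall t, 0 <= t -> <<s F t>> `<=` measurable) ->
  measurable_fun [set: R * Omega] (id : R * Omega -> Defs.predType F).
Proof.
move=> Fm; apply: measurable_fun_generated => S rS; rewrite preimage_id.
case: rS => [[B mB ->]|[s [t [B [/andP[s0 st] mB ->]]]]].
  by apply: measurableX => //; exact: (Fm 0).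
by apply: measurableX => //; exact: (Fm s).
Qed.

Lemma predictable_field_section d' (V : measurableType d') (I : set R)
    (f : R -> Omega -> E -> V) (w : Omega) :
  measurable (I `*` setT : set (Defs.predType F)) ->
  predictable_field F I f ->
  measurable_fun (I `*` [set: E]) (fun x : R * E => f x.1 w x.2).
Proof.
move=> mI mf.
pose h (x : R * E) : Defs.predType F * E := ((x.1, w), x.2).
have mh : measurable_fun [set: R * E] h.
  apply/measurable_fun_pairP; split=> /=.
    exact: (measurableT_comp (measurable_pair_predictable w)).
  exact: measurable_snd.
have -> : (fun x : R * E => f x.1 w x.2) =
  (fun x : Defs.predType F * E => f x.1.1 x.1.2 x.2) \o h by [].
apply: (measurable_comp _ _ mf).
- exact: measurableX.
- by move=> _ [[r e] /= [Ir _] <-].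
- apply: measurable_funTS; exact: mh.
Qed.

Lemma predictable_field_joint d' (V : measurableType d') (I : set R)
    (f : R -> Omega -> E -> V) :
  (forall t, 0 <= t -> <<s F t>> `<=` measurable) ->
  measurable (I `*` setT : set (Defs.predType F)) ->
  predictable_field F I f ->
  measurable_fun ((I `*` [set: Omega]) `*` [set: E])
    (fun x : (R * Omega) * E => f x.1.1 x.1.2 x.2).
Proof.
move=> Fm mI mf.
pose h (x : (R * Omega) * E) : Defs.predType F * E := (x.1, x.2).
have mh : measurable_fun [set: (R * Omega) * E] h.
  apply/measurable_fun_pairP; split=> /=; last exact: measurable_snd.
  exact: (measurableT_comp (measurable_id_predictable Fm) measurable_fst).
have -> : (fun x : (R * Omega) * E => f x.1.1 x.1.2 x.2) =
  (fun x : Defs.predType F * E => f x.1.1 x.1.2 x.2) \o h.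
  by apply/funext => -[[]].
apply: (measurable_comp _ _ mf).
- exact: measurableX.
- by move=> _ [[[r w] e] /= [[Ir _] _] <-].
- apply: measurable_funTS; exact: mh.
Qed.

(** The section at time t of a generating rectangle is empty, or a set of F_s with s < t, or a set
    of F_0 when t = 0; monotonicity places all of them in F_t. *)
Lemma predictable_adapted d' (V : measurableType d') (I : set R) (X : R -> Omega -> V) t :
  (forall s t, 0 <= s -> s <= t -> <<s F s>> `<=` <<s F t>>) ->
  measurable (I `*` setT : set (Defs.predType F)) -> 0 <= t -> I t ->
  predictable F I X ->
  measurable_fun [set: g_sigma_algebraType (F t)]
    (X t : g_sigma_algebraType (F t) -> V).
Proof.
move=> Fmono mI t0 It mX.
pose h (w : g_sigma_algebraType (F t)) : Defs.predType F := (t, w).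
have mh : measurable_fun setT h.
  apply: measurable_fun_generated => S rS; case: rS => [[B mB ->]|[s [r [B [/andP[s0 sr] mB ->]]]]].
    have [t00|/eqP tn] := eqVneq t 0.
      rewrite (_ : _ @^-1` _ = B); last by apply/seteqP; split=> w //= [].
      exact: (Fmono 0).
    by rewrite (_ : _ @^-1` _ = set0)//; apply/seteqP; split=> w //= [].
  have [str|nstr] := boolP (s < t <= r); last first.
    rewrite (_ : _ @^-1` _ = set0)//; apply/seteqP; split=> w //= [].
    by rewrite in_itv/= (negbTE nstr).
  rewrite (_ : _ @^-1` _ = B).
    by apply: (Fmono s) => //; apply: ltW; case/andP: str.
  by apply/seteqP; split=> w //=; rewrite in_itv/= str => // -[].
rewrite (_ : X t = (fun x : Defs.predType F => X x.1 x.2) \o h)//.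
apply: (measurable_comp _ _ mX) => //.
by move=> _ [w _ <-].
Qed.

Lemma predictable_field_sub d' (V : measurableType d') (I J : set R)
    (f : R -> Omega -> E -> V) :
  measurable (I `*` setT : set (Defs.predType F)) -> J `<=` I ->
  predictable_field F I f -> predictable_field F J f.
Proof.
move=> mI JI; apply: measurable_funS; first exact: measurableX.
by move=> [[r w] e] [[/JI]].
Qed.

End predictable_lemmas.

(** * Random measures and gap processes *)

Section core_structures.
Context (R : realType) d (Omega : measurableType d) (P : probability Omega R).
Context dE (E : measurableType dE) (F : R -> set (set Omega)) (T M : R).

Definition strip (s t : R) : set (R * E) := `]s, t] `*` setT.

Definition bcst : R := 1 + M ^+ 4 / 3.

(** What the comparison asks of the noise, with all path properties holding everywhere. [rmp] is the
    jump measure, [rmq] its compensator phi dA, and [rmj] lists the finitely many atoms of [rmp] up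
    to T, so that integrals against [rmp] are finite sums. *)
Record random_measures := RandomMeasures {
  rmA : R -> Omega -> R;
  rmp : Omega -> {measure set (R * E) -> \bar R};
  rmq : Omega -> {measure set (R * E) -> \bar R};
  rmj : Omega -> seq (R * E);
  rm_sub : forall t, 0 <= t -> <<s F t>> `<=` measurable;
  rm_mono : forall s t, 0 <= s -> s <= t -> <<s F s>> `<=` <<s F t>>;
  rmA_adapted : forall t, 0 <= t ->
    measurable_fun [set: g_sigma_algebraType (F t)] (rmA t);
  rmA0 : forall w, rmA 0 w = 0;
  rmA_homo : forall w s t, 0 <= s -> s <= t -> t <= T -> rmA s w <= rmA t w;
  rmA_cont : forall w, {within `[0, T], continuous (rmA ^~ w)};
  rmq_mass : forall w s t, 0 <= s -> s <= t -> t <= T ->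
    rmq w (strip s t) = (rmA t w - rmA s w)%:E;
  rmj_uniq : forall w, uniq [seq z.1 | z <- rmj w];
  rmp_jumps : forall w s t (f : R * E -> R), 0 <= s -> t <= T ->
    (forall z, 0 <= f z) -> measurable_fun (strip s t) f ->
    (\int[rmp w]_(z in strip s t) (f z)%:E)%E
      = (\sum_(z <- rmj w | s < z.1 <= t) f z)%:E;
  rm_comp : forall s t (f : R -> Omega -> E -> R), 0 <= s -> s <= t -> t <= T ->
    (forall r w e, 0 <= f r w e) -> predictable_field F `]s, t] f ->
    [/\ measurable_fun setT (fun w => \int[rmp w]_(z in strip s t) (f z.1 w z.2)%:E)%E,
        measurable_fun setT (fun w => \int[rmq w]_(z in strip s t) (f z.1 w z.2)%:E)%E
      & (\int[P]_w \int[rmp w]_(z in strip s t) (f z.1 w z.2)%:E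
         = \int[P]_w \int[rmq w]_(z in strip s t) (f z.1 w z.2)%:E)%E];
  rm_exp : Rintegrable P setT (fun w => expR (3 * bcst * rmA T w))
}.

(** Abstracts the difference x = Y - Ybar of one component. Here [gpJ] is the difference of the Ito
    integrals, [gpK] reflects the first solution and [gpL] the second. The drift U (rho - 1) and the
    compensator inside q combine, so that only the p-integral of u and the phi dA-integral of u rho
    appear in [gpx_eqn]. *)
Record gap_process (S : random_measures) := GapProcess {
  gpx : R -> Omega -> R;
  gpu : R -> Omega -> E -> R;
  gpr : R -> Omega -> E -> R;
  gpJ : R -> Omega -> R;
  gpK : R -> Omega -> R;
  gpL : R -> Omega -> R;
  gpx_adapted : forall t, 0 <= t <= T ->
    measurable_fun [set: g_sigma_algebraType (F t)] (gpx t);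
  gpu_pred : predictable_field F `[0, T] gpu;
  gpr_pred : predictable_field F `[0, T] gpr;
  gpr_bound : forall t w e, 0 <= t <= T -> 0 <= gpr t w e <= M;
  gpJ_orth : forall s t, 0 <= s -> s <= t -> t <= T ->
    Rintegrable P setT (fun w => gpJ t w - gpJ s w) /\
    forall B, <<s F s>> B -> \int[P]_(w in B) (gpJ t w - gpJ s w) = 0;
  gpK_meas : forall t, 0 <= t <= T -> measurable_fun setT (gpK t);
  gpL_meas : forall t, 0 <= t <= T -> measurable_fun setT (gpL t);
  gpK_homo : forall w s t, 0 <= s -> s <= t -> t <= T -> gpK s w <= gpK t w;
  gpL_homo : forall w s t, 0 <= s -> s <= t -> t <= T -> gpL s w <= gpL t w;
  gpK0 : forall w, gpK 0 w = 0;
  gpL0 : forall w, gpL 0 w = 0;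
  gpK_cont : forall w, {within `[0, T], continuous (gpK ^~ w)};
  gpK_int : Rintegrable P setT (gpK T);
  gpL_int : Rintegrable P setT (gpL T);
  gpu_path : forall w, Rintegrable (rmq S w) (strip 0 T) (fun z => gpu z.1 w z.2 ^+ 2);
  gpu_sq : (\int[P]_w \int[rmq S w]_(z in strip 0 T) (gpu z.1 w z.2 ^+ 2)%:E < +oo)%E;
  gpx_eqn : forall w s t, 0 <= s -> s <= t -> t <= T ->
    gpx t w - gpx s w =
      \int[rmp S w]_(z in strip s t) gpu z.1 w z.2
      - \int[rmq S w]_(z in strip s t) (gpu z.1 w z.2 * gpr z.1 w z.2)
      + (gpJ t w - gpJ s w) - (gpK t w - gpK s w) + (gpL t w - gpL s w);
  gpx_reg : forall w, regulated 0 T (gpx ^~ w);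
  gpx_jump : forall w z eta, z \in rmj S w -> 0 < z.1 <= T -> 0 < eta ->
    exists2 delta, 0 < delta & forall s t, 0 <= s -> s < z.1 -> z.1 <= t -> t <= T ->
      z.1 - s < delta -> t - z.1 < delta ->
      `|gpx t w - gpx s w - gpu z.1 w z.2| <= eta;
  gpx_end : forall w, gpx T w = 0;
  gp_dom : Rintegrable P setT (fun w => expR (bcst * rmA S T w) *
    psi ((1 + M) * \int[rmq S w]_(z in strip 0 T) `|gpu z.1 w z.2| + gpK T w))
}.

End core_structures.

Arguments strip {R dE} E s t.

(** * Compensation of signed integrands dominated by 1 + u^2 *)

Section compensation.
Context (R : realType) d (Omega : measurableType d) (P : probability Omega R).
Context dE (E : measurableType dE) (F : R -> set (set Omega)) (T M : R).
Variables (S : random_measures P E F T M) (X : gap_process S).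
Hypotheses (T0 : 0 <= T) (M0 : 0 <= M).
Local Notation A := (rmA S).
Local Notation p := (rmp S).
Local Notation q := (rmq S).
Local Notation x := (gpx X).
Local Notation u := (gpu X).
Local Notation b := (bcst M).

Implicit Types (s t : R) (w : Omega).

Lemma bcst_gt0 : 0 < b. Proof. by rewrite ltr_wpDr// divr_ge0// exprn_ge0. Qed.

Lemma measurable_strip s t : measurable (strip E s t : set (R * E)).
Proof. by apply: measurableX. Qed.

Lemma strip_sub s t : 0 <= s -> t <= T -> strip E s t `<=` strip E 0 T.
Proof.
move=> s0 tT [r e] [/=]; rewrite !in_itv/= => /andP[sr rt] _; split=> //.
by rewrite /= in_itv/= (le_lt_trans s0 sr) (le_trans rt tT).
Qed.

Lemma A_ge0 t w : 0 <= t <= T -> 0 <= A t w.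
Proof. by move=> /andP[t0 tT]; rewrite -(rmA0 S w) rmA_homo. Qed.

Lemma A_meas t : 0 <= t -> measurable_fun setT (A t).
Proof.
by move=> t0; apply: (sub_measurable_fun (rm_sub S t0)); exact: rmA_adapted.
Qed.

Lemma x_meas t : 0 <= t <= T -> measurable_fun setT (x t).
Proof.
move=> t0T; apply: (sub_measurable_fun (rm_sub S (_ : 0 <= t))) (gpx_adapted X t0T).
by case/andP: t0T.
Qed.

Lemma pred_sub s t (f : R -> Omega -> E -> R) : 0 <= s -> t <= T ->
  predictable_field F `[0, T] f -> predictable_field F `]s, t] f.
Proof.
move=> s0 tT; apply: predictable_field_sub.
  exact: measurable_predictable_ccitv.
move=> r /=; rewrite !in_itv/= => /andP[sr rt].
by rewrite (ltW (le_lt_trans s0 sr)) (le_trans rt tT).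
Qed.

Lemma pred_section s t (f : R -> Omega -> E -> R) w : 0 <= s ->
  predictable_field F `]s, t] f ->
  measurable_fun (strip E s t) (fun z => f z.1 w z.2).
Proof.
move=> s0; apply: predictable_field_section.
exact: measurable_predictable_ocitv.
Qed.

Lemma one_sq_path w : Rintegrable (q w) (strip E 0 T) (fun z => 1 + u z.1 w z.2 ^+ 2).
Proof.
apply: RintegrableD; [exact: measurable_strip| |exact: gpu_path].
apply: ge0_Rintegrable => //; first exact: measurable_strip.
by rewrite integral_cst ?mul1e ?rmq_mass ?ltry//; exact: measurable_strip.
Qed.

Lemma u_pred : predictable_field F `]0, T] u.
Proof. exact: pred_sub (gpu_pred X). Qed.

Lemma one_sq_pred : predictable_field F `]0, T] (fun r w e => 1 + u r w e ^+ 2).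
Proof.
by apply: measurable_funD => //; apply: measurable_funX; exact: u_pred.
Qed.

Lemma Rintegrable_AT : Rintegrable P setT (A T).
Proof.
have b0 := bcst_gt0.
apply: (@Rintegrable_le _ _ _ _ _ _ (fun w => (3 * b)^-1 * expR (3 * b * A T w))) => //.
- exact: A_meas.
- move=> w _; rewrite ger0_norm ?A_ge0 ?T0 ?lexx//.
  rewrite -ler_pdivrMl ?invr_gt0 ?mulr_gt0// invrK.
  by rewrite (le_trans _ (expR_ge1Dx _))// lerDr.
- by apply: RintegrableZ => //; exact: rm_exp.
Qed.

Lemma one_sq_fin : (\int[P]_w \int[q w]_(z in strip E 0 T) (1 + u z.1 w z.2 ^+ 2)%:E < +oo)%E.
Proof.
have [||_ mq _] := @rm_comp _ _ _ _ _ _ _ _ _ S 0 T (fun r w e => u r w e ^+ 2)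
  (lexx 0) T0 (lexx T) _ _.
- by move=> *; exact: sqr_ge0.
- by apply: measurable_funX; exact: u_pred.
rewrite (_ : (fun w => _) = (fun w => (A T w)%:E +
    \int[q w]_(z in strip E 0 T) (u z.1 w z.2 ^+ 2)%:E)%E); last first.
  apply/funext => w; under eq_integral do rewrite EFinD.
  rewrite ge0_integralD//=.
  - by rewrite integral_cst ?mul1e ?rmq_mass ?rmA0 ?subr0//; exact: measurable_strip.
  - exact: measurable_strip.
  - by move=> z _; rewrite lee_fin sqr_ge0.
  - by apply/measurable_EFinP; exact: (Rintegrable_measurable (gpu_path X w)).
rewrite ge0_integralD//=.
- rewrite lte_add_pinfty//; last exact: gpu_sq.
  by rewrite -EFin_Rintegral ?ltry//; exact: Rintegrable_AT.
- by move=> w _; rewrite lee_fin A_ge0 ?T0 ?lexx.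
- by apply/measurable_EFinP; exact: A_meas.
- by move=> w _; apply: integral_ge0 => z _; rewrite lee_fin sqr_ge0.
Qed.

(** Growth at most 1 + u^2 is what the L^2 bound on u makes integrable for the compensator; the
    integrands used below with the compensation formula belong to this class. *)
Definition admissible (s t : R) (f : R -> Omega -> E -> R) : Prop :=
  predictable_field F `]s, t] f /\
  exists C, forall r w e, s < r <= t -> `|f r w e| <= C * (1 + u r w e ^+ 2).

Definition jump_int (s t : R) (f : R -> Omega -> E -> R) w := \int[p w]_(z in strip E s t) f z.1 w z.2.
Definition comp_int (s t : R) (f : R -> Omega -> E -> R) w := \int[q w]_(z in strip E s t) f z.1 w z.2.

Lemma admissible_path s t f w : 0 <= s -> s <= t -> t <= T -> admissible s t f ->
  Rintegrable (p w) (strip E s t) (fun z => f z.1 w z.2) /\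
  Rintegrable (q w) (strip E s t) (fun z => f z.1 w z.2).
Proof.
move=> s0 st tT [pf [C fC]]; have mS := measurable_strip s t.
have mf := pred_section w s0 pf; split.
  apply/integrableP; split; first exact/measurable_EFinP.
  rewrite (eq_integral (fun z => (`|f z.1 w z.2|)%:E)); last by move=> z _.
  rewrite rmp_jumps ?ltry//; exact: measurableT_comp.
apply: (Rintegrable_le mS mf (g := fun z => C * (1 + u z.1 w z.2 ^+ 2))).
  by move=> [r e] [/=]; rewrite in_itv/= => rst _; exact: fC.
apply: RintegrableZ => //; apply: (integrableS _ mS _ (one_sq_path w)).
- exact: measurable_strip.
- exact: strip_sub.
Qed.

Lemma compensation_ge0 s t f : 0 <= s -> s <= t -> t <= T -> admissible s t f ->
  (forall r w e, 0 <= f r w e) ->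
  [/\ Rintegrable P setT (jump_int s t f), Rintegrable P setT (comp_int s t f)
    & \int[P]_w jump_int s t f w = \int[P]_w comp_int s t f w].
Proof.
move=> s0 st tT af f0; have [pf [C fC]] := af.
have [mp mq pq] := rm_comp S s0 st tT f0 pf.
have ep w : (jump_int s t f w)%:E = (\int[p w]_(z in strip E s t) (f z.1 w z.2)%:E)%E.
  rewrite EFin_Rintegral//; first exact: measurable_strip.
  by case: (admissible_path w s0 st tT af).
have eq w : (comp_int s t f w)%:E = (\int[q w]_(z in strip E s t) (f z.1 w z.2)%:E)%E.
  rewrite EFin_Rintegral//; first exact: measurable_strip.
  by case: (admissible_path w s0 st tT af).
have epf : (fun w => \int[p w]_(z in strip E s t) (f z.1 w z.2)%:E)%E = EFin \o jump_int s t f.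
  by apply/funext => w /=; rewrite ep.
have eqf : (fun w => \int[q w]_(z in strip E s t) (f z.1 w z.2)%:E)%E = EFin \o comp_int s t f.
  by apply/funext => w /=; rewrite eq.
rewrite epf in mp pq; rewrite eqf in mq pq.
have p0 w : 0 <= jump_int s t f w by exact: Rintegral_ge0.
have q0 w : 0 <= comp_int s t f w by exact: Rintegral_ge0.
(* Finiteness is proved on the compensator side, where 1 + u^2 is a majorant of finite integral; the
   equality of expectations then carries it to the jumps. *)
have qfin : (\int[P]_w (comp_int s t f w)%:E < +oo)%E.
  have [|m1 m2 _] := @rm_comp _ _ _ _ _ _ _ _ _ S 0 T (fun r w e => 1 + u r w e ^+ 2)
    (lexx 0) T0 (lexx T) _ one_sq_pred.
    by move=> *; rewrite addr_ge0// sqr_ge0.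
  apply: (@le_lt_trans _ _ (\int[P]_w (`|C|%:E * \int[q w]_(z in strip E 0 T)
     (1 + u z.1 w z.2 ^+ 2)%:E))%E).
    apply: lower_integral_le => w _; first by rewrite lee_fin q0.
    rewrite eq -(ge0_integralZl _ (measurable_strip 0 T)); last 3 first.
    - by apply/measurable_EFinP; exact: (Rintegrable_measurable (one_sq_path w)).
    - by move=> z _; rewrite lee_fin addr_ge0 ?sqr_ge0.
    - by rewrite lee_fin normr_ge0.
    apply: (@le_trans _ _ (\int[q w]_(z in strip E s t) (`|C|%:E * (1 + u z.1 w z.2 ^+ 2)%:E)))%E.
      apply: lower_integral_le => [z _|[r e] [/=]]; first by rewrite lee_fin f0.
      rewrite in_itv/= => rst _; rewrite lee_fin (le_trans (ler_norm _))//.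
      by rewrite (le_trans (fC _ _ _ rst))// ler_wpM2r ?ler_norm ?addr_ge0 ?sqr_ge0.
    apply: (ge0_subset_integral _ (measurable_strip s t) (measurable_strip 0 T)).
    - apply/measurable_EFinP; apply: measurable_funM; first exact: measurable_cst.
      exact: Rintegrable_measurable (one_sq_path w).
    - by move=> z _; rewrite mule_ge0 ?lee_fin ?normr_ge0 ?addr_ge0 ?sqr_ge0.
    - exact: strip_sub.
  rewrite ge0_integralZl//; last 1 first.
    by move=> w _; rewrite integral_ge0// => z _; rewrite lee_fin addr_ge0// sqr_ge0.
  by rewrite lte_mul_pinfty// one_sq_fin.
split.
- apply: ge0_Rintegrable; [exact: measurableT|exact/measurable_EFinP| |].
    by move=> w _; exact: p0.
  by rewrite [ltLHS]pq.
- apply: ge0_Rintegrable; [exact: measurableT|exact/measurable_EFinP| |exact: qfin].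
  by move=> w _; exact: q0.
- by rewrite /Rintegral; congr fine.
Qed.

Lemma compensation s t f : 0 <= s -> s <= t -> t <= T -> admissible s t f ->
  [/\ Rintegrable P setT (jump_int s t f), Rintegrable P setT (comp_int s t f)
    & \int[P]_w jump_int s t f w = \int[P]_w comp_int s t f w].
Proof.
move=> s0 st tT af; have [pf [C fC]] := af.
pose fp r w e := Num.max (f r w e) 0.
pose fn r w e := Num.max (- f r w e) 0.
have ap : admissible s t fp.
  split; first by apply: measurable_maxr.
  exists C => r w e rst; have := fC r w e rst; rewrite /fp.
  by have [h|h] := leP (f r w e) 0; rewrite ?normr0//; exact: le_trans.
have an : admissible s t fn.
  split; first by apply: measurable_maxr => //; exact: measurableT_comp.
  exists C => r w e rst; have := fC r w e rst; rewrite /fn.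
  by have [h|h] := leP (- f r w e) 0; rewrite ?normr0 ?normrN//; exact: le_trans.
have fE r w e : f r w e = fp r w e - fn r w e.
  rewrite /fp /fn; have [h|h] := leP (f r w e) 0.
    by rewrite max_l ?oppr_ge0// sub0r opprK.
  by rewrite max_r ?subr0// oppr_le0 ltW.
have [ip iq epq] : [/\ Rintegrable P setT (jump_int s t fp), Rintegrable P setT (comp_int s t fp)
    & \int[P]_w jump_int s t fp w = \int[P]_w comp_int s t fp w].
  by apply: compensation_ge0 => // r w e; rewrite le_max lexx orbT.
have [ip' iq' epq'] : [/\ Rintegrable P setT (jump_int s t fn), Rintegrable P setT (comp_int s t fn)
    & \int[P]_w jump_int s t fn w = \int[P]_w comp_int s t fn w].
  by apply: compensation_ge0 => // r w e; rewrite le_max lexx orbT.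
have eP : jump_int s t f = (fun w => jump_int s t fp w - jump_int s t fn w).
  apply/funext => w; rewrite /jump_int; under eq_Rintegral do rewrite fE.
  rewrite RintegralB; [by []|exact: measurable_strip| |].
    by case: (admissible_path w s0 st tT ap).
  by case: (admissible_path w s0 st tT an).
have eQ : comp_int s t f = (fun w => comp_int s t fp w - comp_int s t fn w).
  apply/funext => w; rewrite /comp_int; under eq_Rintegral do rewrite fE.
  rewrite RintegralB; [by []|exact: measurable_strip| |].
    by case: (admissible_path w s0 st tT ap).
  by case: (admissible_path w s0 st tT an).
rewrite eP eQ; split; [exact: RintegrableB|exact: RintegrableB|].
by rewrite (RintegralB measurableT ip ip') (RintegralB measurableT iq iq') epq epq'.
Qed.

End compensation.

(** * One-step and terminal estimates *)

(** The absorption that ends a Young argument: 4a <= a + 3e, and the a on the right is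
    subtracted. *)
Lemma le_absorb (R : realType) (a i e : R) : a <= i -> 4 * i <= a + 3 * e -> a <= e.
Proof. lra. Qed.

Lemma young_absorb (R : realType) (m0 m1 m2 m3 m4 a e g : R) : e <= g ->
  m0 - m1 + m2 - m3 <= m4 -> 4 * m4 <= a + 3 * e ->
  4 * (m0 - m1 + (m2 - m3) + 0) <= a + 3 * g.
Proof. lra. Qed.

Section one_step.
Context (R : realType) d (Omega : measurableType d) (P : probability Omega R).
Context dE (E : measurableType dE) (F : R -> set (set Omega)) (T M : R).
Variables (S : random_measures P E F T M) (X : gap_process S).
Hypotheses (T0 : 0 <= T) (M0 : 0 <= M).
Implicit Types (s t : R) (w : Omega).
Local Notation A := (rmA S).
Local Notation p := (rmp S).
Local Notation q := (rmq S).
Local Notation x := (gpx X).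
Local Notation u := (gpu X).
Local Notation rho := (gpr X).
Local Notation J := (gpJ X).
Local Notation K := (gpK X).
Local Notation L := (gpL X).
Local Notation b := (bcst M).
Local Notation Ip := (jump_int S).
Local Notation adm := (admissible X).

Definition jump_cost s (r : R) w (e : E) : R := bregman (x s w) (x s w + u r w e).

(** The defects of the discrete convexity argument on ]s, t]: compensation produces [psi (x s)]
    where the exponential weight acts on [psi (x t)]; the actual increment of x differs from its
    jumps; and K pushes x down. *)
Definition step_error s t w : R :=
  b * (A t w - A s w) * Num.max (psi (x s w) - psi (x t w)) 0
  + Num.max (Ip s t (jump_cost s) w - bregman (x s w) (x t w)) 0
  + dpsi (x s w) * (K t w - K s w).

(** Bounds in expectation the weighted [psi (x s)] on every event of F_s, for all s at once; its
    integrability is the field [gp_dom]. *)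
Definition dominator w : R := expR (b * A T w) *
  psi ((1 + M) * \int[q w]_(z in strip E 0 T) `|u z.1 w z.2| + K T w).

Section interval.
Variables (s t : R).
Hypotheses (s0 : 0 <= s) (st : s <= t) (tT : t <= T).

Let sT : s <= T. Proof. exact: le_trans tT. Qed.

Let t0 : 0 <= t. Proof. exact: le_trans st. Qed.

Lemma past_pred (y : Omega -> R) :
  measurable_fun [set: g_sigma_algebraType (F s)] (y : g_sigma_algebraType (F s) -> R) ->
  predictable_field F `]s, t] (fun _ w (_ : E) => y w).
Proof. exact: predictable_field_past. Qed.

Lemma u_pred_st : predictable_field F `]s, t] u.
Proof. exact: pred_sub (gpu_pred X). Qed.

Lemma rho_pred_st : predictable_field F `]s, t] rho.
Proof. exact: pred_sub (gpr_pred X). Qed.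

Lemma rho_le (r : R) w e : s < r <= t -> 0 <= rho r w e <= M.
Proof.
move=> /andP[sr rt]; apply: (gpr_bound X).
by rewrite (ltW (le_lt_trans s0 sr)) (le_trans rt).
Qed.

Lemma norm_le_one_sq (v : R) : `|v| <= 1 + v ^+ 2.
Proof.
rewrite -(real_normK (num_real v)); have := sqr_ge0 (`|v| - 1).
have := normr_ge0 v; nra.
Qed.

Lemma adm_lin (y : Omega -> R) c :
  measurable_fun [set: g_sigma_algebraType (F s)] (y : g_sigma_algebraType (F s) -> R) ->
  (forall w, `|y w| <= c) -> adm s t (fun r w e => y w * u r w e).
Proof.
move=> my yc; split.
  by apply: measurable_funM; [exact: past_pred|exact: u_pred_st].
exists c => r w e _; rewrite normrM ler_pM//; exact: norm_le_one_sq.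
Qed.

Lemma adm_rho (y : Omega -> R) c :
  measurable_fun [set: g_sigma_algebraType (F s)] (y : g_sigma_algebraType (F s) -> R) ->
  (forall w, `|y w| <= c) -> adm s t (fun r w e => y w * (u r w e * rho r w e)).
Proof.
move=> my yc; split.
  apply: measurable_funM; first exact: past_pred.
  by apply: measurable_funM; [exact: u_pred_st|exact: rho_pred_st].
exists (c * M) => r w e rst; have /andP[r0 rM] := rho_le w e rst.
rewrite !normrM -mulrA ler_pM ?mulr_ge0// mulrC ler_pM//.
  by rewrite ger0_norm.
exact: norm_le_one_sq.
Qed.

(** [H] vanishes where x_s > n, so [bregman_le] applies wherever the product is non-zero. *)
Lemma adm_breg (H : Omega -> R) c n :
  measurable_fun [set: g_sigma_algebraType (F s)] (H : g_sigma_algebraType (F s) -> R) ->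
  (forall w, 0 <= H w <= c) -> 0 <= n -> (forall w, H w != 0 -> x s w <= n) ->
  adm s t (fun r w e => H w * jump_cost s r w e).
Proof.
move=> mH Hc n0 Hn; split.
  apply: measurable_funM; first exact: past_pred.
  have px : predictable_field F `]s, t] (fun _ w (_ : E) => x s w).
    by apply: past_pred; apply: gpx_adapted; rewrite s0.
  have pxu : predictable_field F `]s, t] (fun r w e => x s w + u r w e).
    by apply: measurable_funD; [exact: px|exact: u_pred_st].
  apply: measurable_funB; first apply: measurable_funB.
  - by apply: (@measurableT_comp _ _ _ _ _ _ (@psi R)); [exact: measurable_psi|exact: pxu].
  - by apply: (@measurableT_comp _ _ _ _ _ _ (@psi R)); [exact: measurable_psi|exact: px].
  - apply: measurable_funM; last by apply: measurable_funB; [exact: pxu|exact: px].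
    by apply: (@measurableT_comp _ _ _ _ _ _ (@dpsi R)); [exact: measurable_dpsi|exact: px].
exists (c * bregman_cst n) => r w e _.
have [->|/Hn xn] := eqVneq (H w) 0.
  have /andP[H0 /(le_trans H0) c0] := Hc w.
  rewrite mul0r normr0 !mulr_ge0// ?addr_ge0 ?sqr_ge0 ?mulr_ge0 ?sqr_ge0//.
have /andP[H0 Hcw] := Hc w.
rewrite ger0_norm ?mulr_ge0 ?bregman_ge0// -mulrA ler_pM ?bregman_ge0//.
exact: bregman_le.
Qed.

Lemma p_integrable w (f : R * E -> R) : measurable_fun (strip E s t) f ->
  Rintegrable (p w) (strip E s t) f.
Proof.
move=> mf; apply/integrableP; split; first exact/measurable_EFinP.
rewrite (eq_integral (fun z => (`|f z|)%:E)); last by move=> z _.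
by rewrite rmp_jumps ?ltry//; exact: measurableT_comp.
Qed.

Lemma mu_section w : measurable_fun (strip E s t) (fun z => u z.1 w z.2).
Proof. exact: pred_section u_pred_st. Qed.

Lemma adm_u : adm s t u.
Proof.
split; first exact: u_pred_st.
by exists 1 => r w e _; rewrite mul1r; exact: norm_le_one_sq.
Qed.

Lemma adm_urho : adm s t (fun r w e => u r w e * rho r w e).
Proof.
split; first by apply: measurable_funM; [exact: u_pred_st|exact: rho_pred_st].
exists M => r w e rst; have /andP[r0 rM] := rho_le w e rst.
rewrite normrM mulrC ler_pM//; first by rewrite ger0_norm.
exact: norm_le_one_sq.
Qed.

Lemma comp_int_ge0 (f : R -> Omega -> E -> R) w :
  (forall r e, s < r <= t -> 0 <= f r w e) -> 0 <= comp_int S s t f w.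
Proof. by move=> f0; apply: Rintegral_ge0 => -[r e] [/=]; rewrite in_itv/= => /f0. Qed.

Lemma comp_intD (f g : R -> Omega -> E -> R) w :
  Rintegrable (q w) (strip E s t) (fun z => f z.1 w z.2) ->
  Rintegrable (q w) (strip E s t) (fun z => g z.1 w z.2) ->
  comp_int S s t (fun r w e => f r w e + g r w e) w =
  comp_int S s t f w + comp_int S s t g w.
Proof. by move=> fi gi; rewrite /comp_int RintegralD//; exact: measurable_strip. Qed.

Lemma comp_intB (f g : R -> Omega -> E -> R) w :
  Rintegrable (q w) (strip E s t) (fun z => f z.1 w z.2) ->
  Rintegrable (q w) (strip E s t) (fun z => g z.1 w z.2) ->
  comp_int S s t (fun r w e => f r w e - g r w e) w =
  comp_int S s t f w - comp_int S s t g w.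
Proof. by move=> fi gi; rewrite /comp_int RintegralB//; exact: measurable_strip. Qed.

Lemma comp_intZ (f : R -> Omega -> E -> R) (y : Omega -> R) w :
  Rintegrable (q w) (strip E s t) (fun z => f z.1 w z.2) ->
  comp_int S s t (fun r w e => y w * f r w e) w = y w * comp_int S s t f w.
Proof. by move=> fi; rewrite /comp_int RintegralZl//; exact: measurable_strip. Qed.

Lemma jump_intZ (f : R -> Omega -> E -> R) (y : Omega -> R) w :
  measurable_fun (strip E s t) (fun z => f z.1 w z.2) ->
  jump_int S s t (fun r w e => y w * f r w e) w = y w * jump_int S s t f w.
Proof.
by move=> mf; rewrite /jump_int RintegralZl//;
  [exact: measurable_strip|exact: p_integrable].
Qed.

Lemma comp_int_cst (y : Omega -> R) w :
  comp_int S s t (fun _ w _ => y w) w = y w * (A t w - A s w).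
Proof.
by rewrite /comp_int Rintegral_cst ?rmq_mass//; exact: measurable_strip.
Qed.

Lemma jump_cost_section w :
  measurable_fun (strip E s t) (fun z => jump_cost s z.1 w z.2).
Proof.
rewrite /jump_cost /bregman.
have mxu : measurable_fun (strip E s t) (fun z => x s w + u z.1 w z.2).
  by apply: measurable_funD => //; exact: mu_section.
apply: measurable_funB; first apply: measurable_funB => //.
  by apply: (@measurableT_comp _ _ _ _ _ _ (@psi R)) => //; exact: measurable_psi.
by apply: measurable_funM => //; apply: measurable_funB.
Qed.

Lemma gap_increment w : x t w - x s w =
  jump_int S s t u w - comp_int S s t (fun r w e => u r w e * rho r w e) w
  + (J t w - J s w) - (K t w - K s w) + (L t w - L s w).
Proof. exact: gpx_eqn. Qed.

Lemma dK_bound w : 0 <= K t w - K s w <= K T w.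
Proof.
rewrite subr_ge0 gpK_homo//= lerBlDr -[leLHS]addr0 lerD ?gpK_homo//.
by rewrite -(gpK0 X w) gpK_homo.
Qed.

Lemma dL_bound w : 0 <= L t w - L s w <= L T w.
Proof.
rewrite subr_ge0 gpL_homo//= lerBlDr -[leLHS]addr0 lerD ?gpL_homo//.
by rewrite -(gpL0 X w) gpL_homo.
Qed.

Lemma dA_bound w : 0 <= A t w - A s w <= A T w.
Proof.
rewrite subr_ge0 rmA_homo//= lerBlDr -[leLHS]addr0 lerD ?rmA_homo//.
by rewrite -(rmA0 S w) rmA_homo.
Qed.

Lemma s0T : 0 <= s <= T. Proof. by rewrite s0 sT. Qed.
Lemma t0T : 0 <= t <= T. Proof. by rewrite t0 tT. Qed.

(** Expand psi at x_s by definition of [bregman], insert the equation for the increment of x, and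
    use exp(y) >= 1 + y. The increment of L is dropped because dpsi >= 0, and the positive parts in
    [step_error] take up the terms of unknown sign. *)
Lemma step_pointwise (H : Omega -> R) w : 0 <= H w ->
  H w * psi (x s w) + H w * dpsi (x s w) * (J t w - J s w)
  + (H w * dpsi (x s w) * jump_int S s t u w
     - H w * dpsi (x s w) * comp_int S s t (fun r w e => u r w e * rho r w e) w
     + H w * jump_int S s t (jump_cost s) w
     + H w * (b * psi (x s w)) * (A t w - A s w))
  <= H w * (expR (b * (A t w - A s w)) * psi (x t w)) + H w * step_error s t w.
Proof.
move=> H0; rewrite -[leRHS]mulrDr -!(mulrA (H w)) -!mulrDr -!mulrBr -!mulrDr.
apply: ler_wpM2l => //; rewrite /step_error.
have hx := gap_increment w; rewrite /bregman.
have /andP[a0 _] := dA_bound w; have /andP[k0 _] := dK_bound w.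
have /andP[l0 _] := dL_bound w.
have z0 := psi_ge0 (x t w); have y0 := psi_ge0 (x s w).
have d0 := dpsi_ge0 (x s w); have b0 := bcst_gt0 M0.
have hl := mulr_ge0 d0 l0.
have he := expR_ge1Dx (b * (A t w - A s w)).
have hm : psi (x s w) - psi (x t w) <= Num.max (psi (x s w) - psi (x t w)) 0.
  by rewrite le_max lexx.
have hba := mulr_ge0 (ltW b0) a0.
have := ler_wpM2l hba hm; have := ler_wpM2r z0 he.
move: (Num.max (psi (x s w) - psi (x t w)) 0) => m.
move=> h1 h2.
have : jump_int S s t (jump_cost s) w
    - (psi (x t w) - psi (x s w) - dpsi (x s w) * (x t w - x s w)) <=
  Num.max (jump_int S s t (jump_cost s) w
    - (psi (x t w) - psi (x s w) - dpsi (x s w) * (x t w - x s w))) 0.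
  by rewrite le_max lexx.
move: (Num.max (_ - (_ - _ - _ * _)) 0) => m'; rewrite hx => hm' {hx hba hm he}.
move: hm' h1 h2 hl z0 y0 {a0 k0 l0 d0 b0 H0}.
move: (jump_int S s t u w) (comp_int S s t _ w) (jump_int S s t _ w) => j1 c1 j2.
move: (A t w - A s w) (K t w - K s w) (L t w - L s w) (J t w - J s w) => a k l j.
by move: (psi (x t w)) (psi (x s w)) (dpsi (x s w)) (expR _) => z y dp ex; lra.
Qed.

Section step.
Variables (H : Omega -> R) (c n : R).
Hypotheses (mH : measurable_fun [set: g_sigma_algebraType (F s)]
    (H : g_sigma_algebraType (F s) -> R))
  (Hc : forall w, 0 <= H w <= c) (n0 : 0 <= n) (Hn : forall w, H w != 0 -> x s w <= n).

Let c0 : 0 <= c. Proof. by have /andP[h /(le_trans h)] := Hc point. Qed.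

Let mHO : measurable_fun setT H.
Proof. exact: (sub_measurable_fun (rm_sub S s0)). Qed.

Lemma weight_dpsi w : 0 <= H w * dpsi (x s w) <= c * (2 * (1 + n)).
Proof.
have /andP[h0 hc] := Hc w.
rewrite mulr_ge0 ?dpsi_ge0//=; have [->|/Hn xn] := eqVneq (H w) 0.
  by rewrite mul0r !mulr_ge0// addr_ge0.
by rewrite ler_pM ?dpsi_ge0// /dpsi; have := cbrt_le1D n0 xn; have := cbrt_ge0 (x s w); lra.
Qed.

Lemma weight_psi w : 0 <= H w * psi (x s w) <= c * psi n.
Proof.
have /andP[h0 hc] := Hc w.
rewrite mulr_ge0 ?psi_ge0//=; have [->|/Hn xn] := eqVneq (H w) 0.
  by rewrite mul0r mulr_ge0// psi_ge0.
by rewrite ler_pM ?psi_ge0// le_psi.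
Qed.

Lemma weight_dpsi_meas : measurable_fun [set: g_sigma_algebraType (F s)]
  ((fun w => H w * dpsi (x s w)) : g_sigma_algebraType (F s) -> R).
Proof.
apply: measurable_funM => //.
apply: (@measurableT_comp _ _ _ _ _ _ (@dpsi R)); first exact: measurable_dpsi.
by apply: gpx_adapted; exact: s0T.
Qed.

Lemma Rintegrable_dA : Rintegrable P setT (fun w => A t w - A s w).
Proof.
apply: (Rintegrable_le _ _ _ (Rintegrable_AT S T0 M0)) => //.
  by apply: measurable_funB; exact: A_meas.
by move=> w _; have /andP[a0 aT] := dA_bound w; rewrite ger0_norm.
Qed.

Lemma Rintegrable_dK : Rintegrable P setT (fun w => K t w - K s w).
Proof.
apply: (Rintegrable_le _ _ _ (gpK_int X)) => //.
  by apply: measurable_funB; apply: gpK_meas; rewrite ?s0T ?t0T.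
by move=> w _; have /andP[a0 aT] := dK_bound w; rewrite ger0_norm.
Qed.

Let adm3 : adm s t (fun r w e => H w * jump_cost s r w e).
Proof. exact: adm_breg Hc n0 Hn. Qed.

Let dpsi_abs w : `|H w * dpsi (x s w)| <= c * (2 * (1 + n)).
Proof. by have /andP[h1 h2] := weight_dpsi w; rewrite ger0_norm. Qed.

Lemma Rintegrable_step_error : Rintegrable P setT (fun w => H w * step_error s t w).
Proof.
have [i3 _ _] := compensation T0 M0 s0 st tT adm3.
have HE w : H w * step_error s t w =
   b * (A t w - A s w) * (H w * Num.max (psi (x s w) - psi (x t w)) 0)
  + Num.max (jump_int S s t (fun r w e => H w * jump_cost s r w e) w
       - H w * bregman (x s w) (x t w)) 0
  + H w * dpsi (x s w) * (K t w - K s w).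
  have /andP[h0 _] := Hc w.
  rewrite jump_intZ; last exact: jump_cost_section.
  have -> : Num.max (H w * jump_int S s t (jump_cost s) w - H w * bregman (x s w) (x t w)) 0
     = H w * Num.max (jump_int S s t (jump_cost s) w - bregman (x s w) (x t w)) 0.
    by rewrite -mulrBr maxr_pMr// mulr0.
  by rewrite /step_error; ring.
have mpt : measurable_fun setT (fun w => psi (x t w)).
  apply: (@measurableT_comp _ _ _ _ _ _ (@psi R)); first exact: measurable_psi.
  by apply: x_meas; rewrite t0T.
have mps : measurable_fun setT (fun w => psi (x s w)).
  apply: (@measurableT_comp _ _ _ _ _ _ (@psi R)); first exact: measurable_psi.
  by apply: x_meas; rewrite s0T.
have mds : measurable_fun setT (fun w => dpsi (x s w)).
  apply: (@measurableT_comp _ _ _ _ _ _ (@dpsi R)); first exact: measurable_dpsi.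
  by apply: x_meas; rewrite s0T.
have mxt : measurable_fun setT (x t) by apply: x_meas; rewrite t0T.
have mxs : measurable_fun setT (x s) by apply: x_meas; rewrite s0T.
have mdA := Rintegrable_measurable Rintegrable_dA.
have mdK := Rintegrable_measurable Rintegrable_dK.
have bd : Rintegrable P setT (fun w => b * (c * psi n) * (A t w - A s w)
   + jump_int S s t (fun r w e => H w * jump_cost s r w e) w
   + c * (2 * (1 + n)) * (K t w - K s w)).
  apply: RintegrableD => //; first apply: RintegrableD => //.
    by apply: RintegrableZ => //; exact: Rintegrable_dA.
  by apply: RintegrableZ => //; exact: Rintegrable_dK.
have -> : (fun w => H w * step_error s t w) = (fun w =>
   b * (A t w - A s w) * (H w * Num.max (psi (x s w) - psi (x t w)) 0)
  + Num.max (jump_int S s t (fun r w e => H w * jump_cost s r w e) w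
       - H w * bregman (x s w) (x t w)) 0
  + H w * dpsi (x s w) * (K t w - K s w)) by apply/funext.
apply: (Rintegrable_le _ _ _ bd) => //.
  apply: measurable_funD; first apply: measurable_funD.
  - apply: measurable_funM; first exact: measurable_funM.
    apply: measurable_funM => //; apply: measurable_maxr => //.
    exact: measurable_funB.
  - apply: measurable_maxr => //; apply: measurable_funB.
      exact: Rintegrable_measurable i3.
    apply: measurable_funM => //; rewrite /bregman.
    apply: measurable_funB; first exact: measurable_funB.
    by apply: measurable_funM => //; exact: measurable_funB.
  - by apply: measurable_funM => //; exact: measurable_funM.
move=> w _; have /andP[h0 hc] := Hc w.
have /andP[a0 _] := dA_bound w; have /andP[k0 _] := dK_bound w.
have b0 := bcst_gt0 M0; have /andP[d0 dn] := weight_dpsi w.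
have /andP[p0 pn] := weight_psi w.
have m0 : 0 <= Num.max (psi (x s w) - psi (x t w)) 0 by rewrite le_max lexx orbT.
have j0 : 0 <= jump_int S s t (fun r w e => H w * jump_cost s r w e) w.
  by apply: Rintegral_ge0 => z _; rewrite mulr_ge0// bregman_ge0.
rewrite ger0_norm; last first.
  rewrite !addr_ge0//; last by rewrite mulr_ge0.
    by rewrite !mulr_ge0// ltW.
  by rewrite le_max lexx orbT.
rewrite lerD//; first rewrite lerD//.
- rewrite mulrAC ler_wpM2r// ler_wpM2l ?(ltW b0)// (le_trans _ pn)//.
  by rewrite ler_wpM2l// ge_max psi_ge0 lerBlDr lerDl psi_ge0.
- by rewrite ge_max j0 andbT lerBlDr lerDl mulr_ge0// bregman_ge0.
- by rewrite ler_wpM2r.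
Qed.

Let adm1 : adm s t (fun r w e => H w * dpsi (x s w) * u r w e).
Proof. exact: adm_lin weight_dpsi_meas dpsi_abs. Qed.

Let adm2 : adm s t (fun r w e => H w * dpsi (x s w) * (u r w e * rho r w e)).
Proof. exact: adm_rho weight_dpsi_meas dpsi_abs. Qed.

(** Once the jump integrals are replaced by their compensators, the integrand is H times the
    left-hand side of [psi_jump_ge0], at every time and mark. *)
Lemma compensated_ge0 w :
  0 <= comp_int S s t (fun r w e => H w * dpsi (x s w) * u r w e) w
     - comp_int S s t (fun r w e => H w * dpsi (x s w) * (u r w e * rho r w e)) w
     + comp_int S s t (fun r w e => H w * jump_cost s r w e) w
     + H w * (b * psi (x s w)) * (A t w - A s w).
Proof.
have [_ c1] := admissible_path T0 w s0 st tT adm1.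
have [_ c2] := admissible_path T0 w s0 st tT adm2.
have [_ c3] := admissible_path T0 w s0 st tT adm3.
rewrite -(comp_int_cst (fun w => H w * (b * psi (x s w)))).
have cc : Rintegrable (q w) (strip E s t) (fun=> H w * (b * psi (x s w))).
  apply/integrableP; split; first exact/measurable_EFinP.
  rewrite (eq_integral (cst `|H w * (b * psi (x s w))|%:E)); last by [].
  rewrite integral_cst; last exact: measurable_strip.
  by rewrite rmq_mass -?EFinM ?ltry.
have c12 := RintegrableB (measurable_strip s t) c1 c2.
have c123 := RintegrableD (measurable_strip s t) c12 c3.
rewrite -(comp_intB c1 c2).
rewrite -(comp_intD (f := fun r w e => _ - _) c12 c3).
rewrite -(comp_intD (f := fun r w e => _ - _ + _) c123 cc).
apply: comp_int_ge0 => r e rst; rewrite /jump_cost.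
have h := psi_jump_ge0 (x s w) (u r w e) (rho_le w e rst).
have /andP[h0 _] := Hc w; have := mulr_ge0 h0 h; rewrite -/b.
move: (H w) (dpsi _) (psi _) (u _ _ _) (rho _ _ _) b (bregman _ _) => a1 a2 a3 a4 a5 a6 a7.
by rewrite !mulrDr mulrN !mulrA.
Qed.

Lemma Rintegrable_weight_dA :
  Rintegrable P setT (fun w => H w * (b * psi (x s w)) * (A t w - A s w)).
Proof.
have iA := RintegrableZ (b * (c * psi n)) measurableT Rintegrable_dA.
apply: (Rintegrable_le measurableT _ _ iA).
  apply: measurable_funM; last exact: Rintegrable_measurable Rintegrable_dA.
  apply: measurable_funM; first exact: mHO.
  apply: measurable_funM; first exact: measurable_cst.
  apply: (@measurableT_comp _ _ _ _ _ _ (@psi R)); first exact: measurable_psi.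
  by apply: x_meas; exact: s0T.
move=> w _; have /andP[a0 _] := dA_bound w; have /ltW b0 := bcst_gt0 M0.
have /andP[p0 pn] := weight_psi w.
rewrite mulrCA ger0_norm.
  by apply: ler_wpM2r => //; apply: ler_wpM2l.
by apply: mulr_ge0 => //; apply: mulr_ge0.
Qed.

Lemma Rintegrable_weight_psi : Rintegrable P setT (fun w => H w * psi (x s w)).
Proof.
apply: (Rintegrable_le measurableT _ _
  (finite_measure_integrable_cst P (c * psi n) measurableT)).
  apply: measurable_funM; first exact: mHO.
  apply: (@measurableT_comp _ _ _ _ _ _ (@psi R)); first exact: measurable_psi.
  by apply: x_meas; exact: s0T.
by move=> w _; have /andP[p0 pn] := weight_psi w; rewrite ger0_norm.
Qed.

(** Expectation of [step_pointwise]: the martingale increment is orthogonal to the F_s-measurable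
    weight, the jump terms may be compensated, and the compensated sum is non-negative. *)
Lemma step_ineq :
  Rintegrable P setT (fun w => H w * (expR (b * (A t w - A s w)) * psi (x t w))) ->
  \int[P]_w (H w * psi (x s w)) <=
  \int[P]_w (H w * (expR (b * (A t w - A s w)) * psi (x t w)))
  + \int[P]_w (H w * step_error s t w).
Proof.
move=> iD.
have iE := Rintegrable_step_error.
have [p1 q1 e1] := compensation T0 M0 s0 st tT adm1.
have [p2 q2 e2] := compensation T0 M0 s0 st tT adm2.
have [p3 q3 e3] := compensation T0 M0 s0 st tT adm3.
have [dJi dJ0] := gpJ_orth X s0 st tT.
have [iJ eJ] := Rintegral_orth (rm_sub S s0) dJi dJ0 weight_dpsi_meas dpsi_abs.
have iA := Rintegrable_weight_dA; have iS := Rintegrable_weight_psi.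
have G'0 := compensated_ge0.
(* The same linear combination with jump integrals, and next with compensated ones: the two
   expectations agree term by term. *)
have [iG eG] := Rintegral_lin4 measurableT p1 q2 p3 iA.
have [_ eG'] := Rintegral_lin4 measurableT q1 q2 q3 iA.
cbv beta in iG, eG, eG'; rewrite e1 e3 -eG' in eG.
have iSJ := RintegrableD measurableT iS iJ.
have iL := RintegrableD measurableT iSJ iG.
rewrite -(RintegralD measurableT iD iE).
have eL := RintegralD measurableT iSJ iG; have eSJ := RintegralD measurableT iS iJ.
cbv beta in iSJ, iL, eL, eSJ; rewrite eSJ eJ addr0 eG in eL.
have EG0 := @Rintegral_ge0 _ _ _ P setT _ (fun w _ => G'0 w).
rewrite -(lerDl (\int[P]_w (H w * psi (x s w)))) -eL in EG0; apply: (le_trans EG0).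
apply: (le_Rintegral measurableT iL (RintegrableD measurableT iD iE)).
move=> w _; have /andP[h0 _] := Hc w.
rewrite (jump_intZ (fun w => H w * dpsi (x s w)) (mu_section w)).
rewrite (comp_intZ (fun w => H w * dpsi (x s w))); last first.
  by case: (admissible_path T0 w s0 st tT adm_urho).
rewrite (jump_intZ H (jump_cost_section w)).
exact: step_pointwise h0.
Qed.

End step.

End interval.
(** Pointwise u rho - u <= (1 + M) |u|, and enlarging the strip to ]0, T] makes the bound
    independent of s. *)
Lemma drift_bound s w : 0 <= s -> s <= T ->
  comp_int S s T (fun r w e => u r w e * rho r w e) w - comp_int S s T u w
  <= (1 + M) * \int[q w]_(z in strip E 0 T) `|u z.1 w z.2|.
Proof.
move=> s0 sT.
have [_ c1] := admissible_path T0 w s0 sT (lexx T) (adm_urho s0 (lexx T)).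
have [_ c2] := admissible_path T0 w s0 sT (lexx T) (adm_u s0 (lexx T)).
have [_ c3] := admissible_path T0 w (lexx 0) T0 (lexx T) (adm_u (lexx 0) (lexx T)).
have mS := measurable_strip (E := E) s T; have mS0 := measurable_strip (E := E) 0 T.
have c3a := Rintegrable_abs mS0 c3.
have c3s : Rintegrable (q w) (strip E s T) (fun z => `|u z.1 w z.2|).
  by apply: (integrableS _ mS _ c3a) => //; exact: strip_sub.
rewrite -(comp_intB c1 c2) -(RintegralZl _ mS0 c3a).
apply: (@le_trans _ _ (\int[q w]_(z in strip E s T) ((1 + M) * `|u z.1 w z.2|))).
  apply: le_Rintegral => //.
  - exact: (RintegrableB mS c1 c2).
  - exact: (RintegrableZ (1 + M) mS c3s).
  - move=> [r e] [/=]; rewrite in_itv/= => rst _.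
    have /andP[r0 rM] := rho_le s0 (lexx T) w e rst.
    have := ler_norm (u r w e); have := ler_norm (- u r w e); rewrite normrN.
    have := normr_ge0 (u r w e); move: r0 rM.
    by move: (`|u r w e|) (u r w e) (rho r w e) => v uu rr *; nra.
rewrite -lee_fin !EFin_Rintegral//; last 2 first.
- exact: (RintegrableZ (1 + M) mS0 c3a).
- exact: (RintegrableZ (1 + M) mS c3s).
apply: ge0_subset_integral => //.
- by apply/measurable_EFinP; exact: (Rintegrable_measurable (RintegrableZ (1 + M) mS0 c3a)).
- by move=> z _; rewrite lee_fin mulr_ge0// addr_ge0.
- exact: strip_sub.
Qed.

Lemma u_norm_ge0 w : 0 <= (1 + M) * \int[q w]_(z in strip E 0 T) `|u z.1 w z.2|.
Proof. by apply: mulr_ge0; [exact: addr_ge0|exact: Rintegral_ge0]. Qed.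

Lemma dominator_ge0 w : 0 <= dominator w.
Proof. by rewrite mulr_ge0 ?expR_ge0 ?psi_ge0. Qed.

Section stop.
Variables (s : R) (H : Omega -> R).
Hypotheses (s0 : 0 <= s) (sT : s <= T)
  (mH : measurable_fun [set: g_sigma_algebraType (F s)]
    (H : g_sigma_algebraType (F s) -> R))
  (H01 : forall w, 0 <= H w <= 1).

Let mHO : measurable_fun setT H.
Proof. exact: (sub_measurable_fun (rm_sub S s0)). Qed.

Lemma Rintegrable_H_dominator : Rintegrable P setT (fun w => H w * dominator w).
Proof.
apply: (Rintegrable_le measurableT _ _ (gp_dom X)).
  by apply: measurable_funM => //; exact: (Rintegrable_measurable (gp_dom X)).
move=> w _; have /andP[h0 h1] := H01 w.
have d0 := dominator_ge0 w.
by rewrite ger0_norm; [exact: ler_piMl|exact: mulr_ge0].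
Qed.

(** Truncations of the weight H exp(b A_s) and of [cbrt (x s)]. The absorption below needs the
    expectation of g h^4 to be finite beforehand, and the orthogonality of J needs the test variable
    y = g h to be bounded. *)
Let gN (N : nat) w : R := H w * Num.min (expR (b * A s w)) N%:R.
Let hN (N : nat) w : R := Num.min (cbrt (x s w)) N%:R.

Let gN_bound N w : 0 <= gN N w <= N%:R.
Proof.
have /andP[h0 h1] := H01 w; rewrite /gN mulr_ge0 ?le_min ?expR_ge0//=.
have m1 : Num.min (expR (b * A s w)) N%:R <= N%:R by rewrite ge_min lexx orbT.
by rewrite -[leRHS]mul1r ler_pM ?le_min ?expR_ge0/=.
Qed.

Let hN_bound N w : 0 <= hN N w <= N%:R.
Proof. by rewrite /hN le_min cbrt_ge0 ler0n/= ge_min lexx orbT. Qed.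

Let mgN N : measurable_fun [set: g_sigma_algebraType (F s)]
  (gN N : g_sigma_algebraType (F s) -> R).
Proof.
apply: measurable_funM => //; apply: measurable_minr => //.
by apply: measurableT_comp => //; apply: measurable_funM => //; exact: rmA_adapted.
Qed.

Let mhN N : measurable_fun [set: g_sigma_algebraType (F s)]
  (hN N : g_sigma_algebraType (F s) -> R).
Proof.
apply: measurable_minr => //.
apply: (@measurableT_comp _ _ _ _ _ _ (@cbrt R)); first exact: measurable_cbrt.
by apply: gpx_adapted; rewrite s0 sT.
Qed.

Let yN N w := gN N w * hN N w.

Let myN N : measurable_fun [set: g_sigma_algebraType (F s)]
  (yN N : g_sigma_algebraType (F s) -> R).
Proof. exact: measurable_funM. Qed.

Let yN_bound N w : 0 <= yN N w <= N%:R * N%:R.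
Proof.
have /andP[g0 g1] := gN_bound N w; have /andP[h0 h1] := hN_bound N w.
by rewrite mulr_ge0//= ler_pM.
Qed.

Let yN_abs N w : `|yN N w| <= N%:R * N%:R.
Proof. by have /andP[h0 h1] := yN_bound N w; rewrite ger0_norm. Qed.

Let yN_int N (f : Omega -> R) : Rintegrable P setT f ->
  Rintegrable P setT (fun w => yN N w * f w).
Proof.
move=> fi; have i := RintegrableZ (N%:R * N%:R) measurableT (Rintegrable_abs measurableT fi).
apply: (Rintegrable_le measurableT _ _ i).
  apply: measurable_funM; last exact: Rintegrable_measurable fi.
  exact: (sub_measurable_fun (rm_sub S s0) (myN N)).
by move=> w _; rewrite normrM ler_wpM2r.
Qed.

Let gh4_int N : Rintegrable P setT (fun w => gN N w * hN N w ^+ 4).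
Proof.
apply: (Rintegrable_le measurableT _ _
  (finite_measure_integrable_cst P (N%:R * N%:R ^+ 4) measurableT)).
  apply: measurable_funM; first exact: (sub_measurable_fun (rm_sub S s0) (mgN N)).
  by apply: measurable_funX; exact: (sub_measurable_fun (rm_sub S s0) (mhN N)).
move=> w _; have /andP[g0 g1] := gN_bound N w; have /andP[h0 h1] := hN_bound N w.
rewrite ger0_norm; last by rewrite mulr_ge0// exprn_ge0.
apply: ler_pM; rewrite ?exprn_ge0//.
by rewrite lerXn2r// nnegrE.
Qed.

Let V w := (1 + M) * \int[q w]_(z in strip E 0 T) `|u z.1 w z.2| + K T w.

Let KT_ge0 w : 0 <= K T w.
Proof. by rewrite -(gpK0 X w) gpK_homo. Qed.

(** Since x_T = 0, the equation on ]s, T] expresses x_s; it is tested against y = g h, using h^4 <=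
    h x_s for the truncated cube root. *)
Let stop_lower N w : gN N w * hN N w ^+ 4 <=
  comp_int S s T (fun r w e => yN N w * (u r w e * rho r w e)) w
  - jump_int S s T (fun r w e => yN N w * u r w e) w
  + (yN N w * (K T w - K s w) - yN N w * (L T w - L s w) - yN N w * (J T w - J s w)) + 0.
Proof.
rewrite (comp_intZ (yN N)); last first.
  by case: (admissible_path T0 w s0 sT (lexx T) (adm_urho s0 (lexx T))).
rewrite (jump_intZ s0 (lexx T) (yN N)); last exact: mu_section.
have := gap_increment s0 sT (lexx T) w; rewrite gpx_end.
have /andP[g0 _] := gN_bound N w; have /andP[h0 _] := hN_bound N w.
have h4 : hN N w ^+ 4 <= hN N w * x s w.
  have [x0|x0] := leP (x s w) 0.
    have -> : hN N w = 0 by rewrite /hN cbrt_npos// min_l.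
    by rewrite expr0n/= mul0r.
  have hc := cbrt_cube (x s w); rewrite max_r in hc; last exact: ltW.
  rewrite exprS ler_wpM2l// -hc lerXn2r// ?nnegrE ?cbrt_ge0//.
  by rewrite /hN ge_min lexx.
have := ler_wpM2l g0 h4; rewrite /yN.
move: (jump_int S s T u w) (comp_int S s T _ w) => j1 c1.
move: (gN N w) (hN N w) (x s w) => g h xs.
move: (K T w - K s w) (L T w - L s w) (J T w - J s w) => k l j h1 h2.
move: h1; have -> : xs = - (0 - xs) by ring.
by rewrite h2 => /le_trans; apply; rewrite le_eqVlt; apply/orP; left; apply/eqP; ring.
Qed.

(** [young4], applied to h and to the cube root of V, the argument of psi in [dominator], gives 4 h
    V <= h^4 + 3 psi(V). *)
Let stop_upper N w : 4 * (
  comp_int S s T (fun r w e => yN N w * (u r w e * rho r w e)) w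
  - comp_int S s T (fun r w e => yN N w * u r w e) w
  + (yN N w * (K T w - K s w) - yN N w * (L T w - L s w)) + 0) <=
  gN N w * hN N w ^+ 4 + 3 * (H w * dominator w).
Proof.
rewrite (comp_intZ (yN N)); last first.
  by case: (admissible_path T0 w s0 sT (lexx T) (adm_urho s0 (lexx T))).
rewrite (comp_intZ (yN N)); last first.
  by case: (admissible_path T0 w s0 sT (lexx T) (adm_u s0 (lexx T))).
have d1 := drift_bound w s0 sT.
have /andP[_ k1] := dK_bound s0 sT (lexx T) w.
have /andP[l0 _] := dL_bound s0 sT (lexx T) w.
have /andP[g0 _] := gN_bound N w; have /andP[h0 _] := hN_bound N w.
have /andP[y0 _] := yN_bound N w.
have v3 : cbrt (V w) ^+ 3 = V w.
  by rewrite cbrt_cube max_r// addr_ge0 ?u_norm_ge0 ?KT_ge0.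
have hy := young4 (hN N w) (cbrt (V w)).
have gd : gN N w * psi (V w) <= H w * dominator w.
  have /andP[H0 H1] := H01 w.
  rewrite /dominator mulrA ler_wpM2r ?psi_ge0// ler_wpM2l//.
  rewrite ge_min ler_expR ler_wpM2l ?(ltW (bcst_gt0 M0))//.
  exact: rmA_homo.
have := ler_wpM2l g0 hy; rewrite v3.
have : yN N w * (comp_int S s T (fun r w e => u r w e * rho r w e) w -
    comp_int S s T u w + (K T w - K s w) - (L T w - L s w)) <= yN N w * V w.
  by rewrite ler_wpM2l// /V; lra.
move: gd; rewrite /yN /psi.
move: (cbrt (V w)) => v.
move: (comp_int S s T u w) (comp_int S s T _ w) (V w) => j1 c1 VV.
move: (gN N w) (hN N w) (H w * _) => g h D.
move: (K T w - K s w) (L T w - L s w) => k l h1 h2 h3.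
rewrite !mulrDr !mulrN in h2.
have h3' : 4 * (g * h * VV) <= g * h ^+ 4 + 3 * (g * v ^+ 4).
  move: h3; rewrite mulrDr (mulrCA g 3); have -> // : g * (4 * h * VV) = 4 * (g * h * VV).
  by ring.
exact: young_absorb h1 h2 h3'.
Qed.

(** In expectation the jump integral becomes its compensator and J drops out, so [stop_upper] bounds
    the right side of [stop_lower], and a quarter of the left side is absorbed. *)
Lemma stop_truncated N :
  \int[P]_w (gN N w * hN N w ^+ 4) <= \int[P]_w (H w * dominator w).
Proof.
have a1 := adm_rho s0 (lexx T) (myN N) (yN_abs N).
have a2 := adm_lin s0 (lexx T) (myN N) (yN_abs N).
have [_ q1 _] := compensation T0 M0 s0 sT (lexx T) a1.
have [p2 q2 e2] := compensation T0 M0 s0 sT (lexx T) a2.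
have [dJi dJ0] := gpJ_orth X s0 sT (lexx T).
have [iJ eJ] := Rintegral_orth (rm_sub S s0) dJi dJ0 (myN N) (yN_abs N).
have iK := yN_int N (Rintegrable_dK s0 sT (lexx T)).
have iL : Rintegrable P setT (fun w => yN N w * (L T w - L s w)).
  apply: yN_int; apply: (Rintegrable_le measurableT _ _ (gpL_int X)).
    by apply: measurable_funB; apply: gpL_meas; rewrite ?s0 ?sT ?T0 ?lexx.
  move=> w _; have /andP[l0 l1] := dL_bound s0 sT (lexx T) w.
  by rewrite ger0_norm.
have iKL := RintegrableB measurableT iK iL.
have iKLJ := RintegrableB measurableT iKL iJ.
have i0 : Rintegrable P setT (fun=> 0 : R) by exact: finite_measure_integrable_cst.
have [j1 E1] := Rintegral_lin4 measurableT q1 p2 iKLJ i0.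
have [j2 E2] := Rintegral_lin4 measurableT q1 q2 iKL i0.
have EKLJ := RintegralB measurableT iKL iJ.
cbv beta in j1, E1, j2, E2, EKLJ; rewrite EKLJ eJ subr0 e2 -E2 in E1.
have iD := Rintegrable_H_dominator.
have i4 := RintegrableZ 4 measurableT j2.
have i4' := RintegrableD measurableT (gh4_int N) (RintegrableZ 3 measurableT iD).
have le1 := le_Rintegral measurableT (gh4_int N) j1 (fun w _ => stop_lower N w).
have le2 := le_Rintegral measurableT i4 i4' (fun w _ => stop_upper N w).
rewrite (RintegralZl _ measurableT j2) (RintegralD measurableT (gh4_int N)
  (RintegrableZ 3 measurableT iD)) (RintegralZl _ measurableT iD) in le2.
rewrite E1 in le1.
exact: le_absorb le1 le2.
Qed.

(* [x s] is estimated by what remains of the equation after conditioning: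
   the martingale terms vanish and Young's inequality absorbs the weight. *)
Lemma stop_ineq :
  Rintegrable P setT (fun w => H w * (expR (b * A s w) * psi (x s w))) /\
  \int[P]_w (H w * (expR (b * A s w) * psi (x s w))) <= \int[P]_w (H w * dominator w).
Proof.
apply: (Rmonotone_bound gh4_int) => [n w|w m n mn|w|]; last exact: stop_truncated.
- have /andP[g0 _] := gN_bound n w; have /andP[h0 _] := hN_bound n w.
  by rewrite mulr_ge0// exprn_ge0.
- have /andP[g0 _] := gN_bound m w; have /andP[h0 _] := hN_bound m w.
  have /andP[h0' _] := hN_bound n w; have /andP[H0 _] := H01 w.
  have mnR : m%:R <= n%:R :> R by rewrite ler_nat.
  rewrite ler_pM ?exprn_ge0//.
    by rewrite ler_wpM2l// le_min !ge_min lexx mnR orbT.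
  by rewrite lerXn2r ?nnegrE// le_min !ge_min lexx mnR orbT.
(* At each outcome both truncations are eventually inactive, so the monotone limit is attained. *)
have [N1 hN1] : exists N1 : nat, forall n, (N1 <= n)%N ->
    expR (b * A s w) <= n%:R /\ cbrt (x s w) <= n%:R.
  exists (Num.truncn (Num.max (expR (b * A s w)) (cbrt (x s w)))).+1 => n hn.
  have h : Num.max (expR (b * A s w)) (cbrt (x s w)) <= n%:R.
    by rewrite ltW// (lt_le_trans (truncnS_gt _))// ler_nat.
  by move: h; rewrite ge_max => /andP[].
apply: cvg_near_cst; exists N1 => //= n /hN1[h1 h2].
by rewrite /gN /hN /psi !min_l// mulrA.
Qed.

End stop.

End one_step.

(** * Convergence of the discretization errors *)

Lemma same_step_dist (R : realType) (s t y y' mesh g : R) : s < y -> y <= t ->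
  s < y' -> y' <= t -> t - y <= mesh -> y - s <= mesh -> mesh < g -> `|y' - y| < g.
Proof. by move=> *; rewrite ltr_norml; apply/andP; split; lra. Qed.

Lemma sum_of_gaps_le (R : realType) (a b c v v' s e1 e2 eta : R) : a - b <= s ->
  s <= e1 -> - (v - v') <= e2 -> e1 + e2 <= eta -> a - c - v - (b - c - v') <= eta.
Proof. by move=> *; lra. Qed.

Section step_errors.
Context (R : realType) d (Omega : measurableType d) (P : probability Omega R).
Context dE (E : measurableType dE) (F : R -> set (set Omega)) (T M : R) (m : nat).
Variables (S : random_measures P E F T M) (X : gap_process S) (D : 'I_m -> R -> Omega -> R).
Hypotheses (T0 : 0 <= T) (M0 : 0 <= M).
Implicit Types (s t : R) (w : Omega).
Local Notation A := (rmA S).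
Local Notation x := (gpx X).
Local Notation u := (gpu X).
Local Notation K := (gpK X).
Local Notation b := (bcst M).
Hypothesis D_adapted : forall j t, 0 <= t <= T ->
  measurable_fun [set: g_sigma_algebraType (F t)] (D j t : g_sigma_algebraType (F t) -> R).
Hypothesis D_reg : forall j w, regulated 0 T (D j ^~ w).
Hypothesis D_flat : forall w s t eta, 0 <= s -> s <= t -> t <= T -> 0 < eta ->
  (forall r j, s < r <= t -> eta <= D j r w) -> K t w = K s w.

Variables (t0 n eps : R).
Hypotheses (t00 : 0 <= t0) (t0T : t0 <= T) (n0 : 0 <= n) (eps0 : 0 < eps).

(** Tested at the left end of a cell only, hence adapted: x is below the truncation level and every
    [D j] exceeds eps, so that K stays constant until some [D j] has moved by a definite amount. *)
Definition calm t w : bool := (x t w <= n) && [forall j, eps < D j t w].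

Definition calm_weight t w : R := (calm t w)%:R.

Definition step_errors N w : R :=
  \sum_(k < N.+1) calm_weight (grid t0 T N k) w *
     step_error X (grid t0 T N k) (grid t0 T N k.+1) w.

Lemma calm_weight01 t w : 0 <= calm_weight t w <= 1.
Proof. by rewrite /calm_weight ler0n lern1 leq_b1. Qed.

Lemma calm_weight_neq0 t w : calm_weight t w != 0 -> x t w <= n.
Proof. by rewrite /calm_weight /calm; case: (x t w <= n) => //=; rewrite eqxx. Qed.

Lemma measurable_calm_weight t : 0 <= t <= T ->
  measurable_fun [set: g_sigma_algebraType (F t)]
    (calm_weight t : g_sigma_algebraType (F t) -> R).
Proof.
move=> tT.
have -> : calm_weight t = \1_[set w | calm t w].
  apply/funext => w; rewrite /calm_weight indicE; congr (_%:R).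
  by case: (boolP (calm t w)) => h; [rewrite mem_set|rewrite memNset//; exact/negP].
apply: measurable_indic.
have -> : [set w | calm t w] = [set w | x t w <= n] `&`
    \bigcap_(j in [set: 'I_m]) [set w | eps < D j t w].
  apply/seteqP; split=> w /=; rewrite /calm.
    by move=> /andP[? /forallP h]; split=> // j _; exact: h.
  by move=> [-> h] /=; apply/forallP => j; exact: h.
apply: measurableI.
  rewrite -[X in measurable X]setTI; apply: measurable_fun_le => //.
  exact: gpx_adapted.
apply: fin_bigcap_measurable => // j _;
have -> : [set w | eps < D j t w] = ~` ([set: Omega] `&` [set w | D j t w <= eps]).
  by rewrite setTI; apply/seteqP; split=> w /=; rewrite ltNge => /negP.
by apply: measurableC; apply: measurable_fun_le => //; exact: D_adapted.
Qed.

Let tt_itv N k : (k <= N.+1)%N -> 0 <= grid t0 T N k <= T.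
Proof.
move=> kN; have /andP[h1 h2] := @grid_itv R t0 T N k t0T kN.
by rewrite h2 (le_trans t00 h1).
Qed.

Let step_le N k : grid t0 T N k <= grid t0 T N k.+1.
Proof. exact: le_grid. Qed.

Let tt0 N k : (k <= N.+1)%N -> 0 <= grid t0 T N k.
Proof. by move=> /tt_itv/andP[]. Qed.

Let ttT N k : (k <= N.+1)%N -> grid t0 T N k <= T.
Proof. by move=> /tt_itv/andP[]. Qed.

Lemma step_error_ge0 s t w : 0 <= s -> s <= t -> t <= T -> 0 <= step_error X s t w.
Proof.
move=> s0 st tT; have b0 := bcst_gt0 M0.
rewrite /step_error !addr_ge0//.
- have /andP[a0 _] := dA_bound S s0 st tT w.
  by rewrite !mulr_ge0 ?(ltW b0)// le_max lexx orbT.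
- by rewrite le_max lexx orbT.
- by rewrite mulr_ge0 ?dpsi_ge0//; have /andP[] := dK_bound X s0 st tT w.
Qed.

Lemma jump_int_sum (f : R -> Omega -> E -> R) s t w : 0 <= s -> t <= T ->
  (forall z, 0 <= f z.1 w z.2) ->
  measurable_fun (strip E s t) (fun z => f z.1 w z.2) ->
  jump_int S s t f w = \sum_(z <- rmj S w | s < z.1 <= t) f z.1 w z.2.
Proof. by move=> s0 tT f0 mf; rewrite /jump_int /Rintegral rmp_jumps. Qed.

Lemma jump_cost_sum s t w : 0 <= s -> s <= t -> t <= T ->
  jump_int S s t (jump_cost X s) w =
  \sum_(z <- rmj S w | s < z.1 <= t) bregman (x s w) (x s w + u z.1 w z.2).
Proof.
move=> s0 st tT; rewrite jump_int_sum//; last exact: jump_cost_section.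
by move=> z; exact: bregman_ge0.
Qed.

Definition jumps_total w : R := jump_int S 0 T (fun r w e => 1 + u r w e ^+ 2) w.

Lemma jumps_totalE w :
  jumps_total w = \sum_(z <- rmj S w | 0 < z.1 <= T) (1 + u z.1 w z.2 ^+ 2).
Proof.
rewrite /jumps_total jump_int_sum//.
- by move=> z; rewrite addr_ge0// sqr_ge0.
- exact: (pred_section w (lexx 0) (one_sq_pred X T0)).
Qed.

Lemma Rintegrable_jumps_total : Rintegrable P setT jumps_total.
Proof.
have a : admissible X 0 T (fun r w e => 1 + u r w e ^+ 2).
  split; first exact: (one_sq_pred X T0).
  by exists 1 => r w e _; rewrite mul1r ger0_norm// addr_ge0// sqr_ge0.
by have [] := compensation T0 M0 (lexx 0) T0 (lexx T) a.
Qed.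

Lemma sum_steps_le N (js : seq (R * E)) (f : R * E -> R) : (forall z, 0 <= f z) ->
  \sum_(k < N.+1) \sum_(z <- js | grid t0 T N k < z.1 <= grid t0 T N k.+1) f z
  <= \sum_(z <- js | 0 < z.1 <= T) f z.
Proof.
move=> f0; under eq_bigr do rewrite big_mkcond.
rewrite exchange_big/= [leRHS]big_mkcond/=; apply: ler_sum => z _.
have [[k hk]|nk] := pselect (exists k : 'I_N.+1, in_step t0 T N k z.1).
  rewrite (bigD1 k)//= -/(in_step t0 T N k z.1) hk big1 ?addr0; last first.
    move=> l lk; case: ifPn => // hl; case/eqP: lk.
    by apply/val_inj/(in_step_inj t0T hl hk).
  case/andP: hk => h1 h2; rewrite (le_lt_trans (tt0 _) h1) ?(ltnW (ltn_ord k))//=.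
  by rewrite (le_trans h2)// ttT.
rewrite big1 => [|k _]; first by case: ifP.
by case: ifPn => // hk; exfalso; apply: nk; exists k.
Qed.

Lemma dpsi_le (y z : R) : 0 <= z -> y <= z -> dpsi y <= dpsi z.
Proof. by move=> z0 yz; rewrite /dpsi ler_wpM2l ?divr_ge0// le_cbrt. Qed.

(** A majorant independent of N, for dominated convergence: the three parts of [step_error] are
    summed separately, by telescoping for A and K and jump by jump for the second. *)
Lemma step_errors_bound N w : 0 <= step_errors N w <=
  b * psi n * A T w + bregman_cst n * jumps_total w + dpsi n * K T w.
Proof.
have b0 := bcst_gt0 M0; apply/andP; split.
  apply: sumr_ge0 => k _; rewrite mulr_ge0//.
  by apply: step_error_ge0 => //; [rewrite tt0// ltnW|rewrite ttT].
have Cn : 0 <= bregman_cst n by rewrite /bregman_cst !addr_ge0// mulr_ge0// exprn_ge0.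
apply: (@le_trans _ _ (\sum_(k < N.+1) (
   b * psi n * (A (grid t0 T N k.+1) w - A (grid t0 T N k) w)
   + \sum_(z <- rmj S w | grid t0 T N k < z.1 <= grid t0 T N k.+1)
       bregman_cst n * (1 + u z.1 w z.2 ^+ 2)
   + dpsi n * (K (grid t0 T N k.+1) w - K (grid t0 T N k) w)))).
  apply: ler_sum => k _.
  have s0 := tt0 (ltnW (ltn_ord k)); have tT := ttT (ltn_ord k); have st := step_le N k.
  have /andP[a0 _] := dA_bound S s0 st tT w.
  have /andP[k0 _] := dK_bound X s0 st tT w.
  have sum0 : 0 <= \sum_(z <- rmj S w | grid t0 T N k < z.1 <= grid t0 T N k.+1)
       bregman_cst n * (1 + u z.1 w z.2 ^+ 2).
    by apply: sumr_ge0 => z _; rewrite mulr_ge0// addr_ge0// sqr_ge0.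
  have bp0 : 0 <= b * psi n by rewrite mulr_ge0 ?psi_ge0// ltW.
  rewrite /calm_weight; case: (boolP (calm _ _)) => [/andP[xn _]|_]; last first.
    by rewrite mul0r !addr_ge0// mulr_ge0// dpsi_ge0.
  rewrite mul1r /step_error; apply: lerD; first apply: lerD.
  - rewrite mulrAC ler_wpM2r// ler_wpM2l ?(ltW b0)// ge_max psi_ge0 andbT.
    by rewrite lerBlDr (le_trans (le_psi xn))// lerDl psi_ge0.
  - rewrite ge_max sum0 andbT lerBlDr; apply: ler_wpDr; first exact: bregman_ge0.
    by rewrite jump_cost_sum//; apply: ler_sum => z _; exact: bregman_le.
  - by rewrite ler_wpM2r// dpsi_le.
rewrite !big_split/= -!mulr_sumr.
rewrite (telescope_grid t0 T N (A ^~ w)) (telescope_grid t0 T N (K ^~ w)).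
rewrite lerD//; first rewrite lerD//.
- apply: ler_wpM2l; first by apply: mulr_ge0; [exact: ltW|exact: psi_ge0].
  by rewrite lerBlDr lerDl A_ge0// t00.
- rewrite jumps_totalE mulr_sumr.
  by apply: (sum_steps_le N (rmj S w)) => z; rewrite mulr_ge0// addr_ge0// sqr_ge0.
- rewrite ler_wpM2l ?dpsi_ge0// lerBlDr lerDl -(gpK0 X w).
  exact: gpK_homo.
Qed.

(** A Riemann-sum error for the continuous integrator A: the integrand is small unless the cell
    contains one of the finitely many points where the regulated path x oscillates. [psi_diff_le]
    turns a small change of x into one of psi, since x <= n where the weight lives. *)
Lemma step_drift_cvg0 w : \sum_(k < N.+1) (calm_weight (grid t0 T N k) w *
    Num.max (psi (x (grid t0 T N k) w) - psi (x (grid t0 T N k.+1) w)) 0) *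
    (A (grid t0 T N k.+1) w - A (grid t0 T N k) w) @[N --> \oo] --> 0.
Proof.
apply: (@riemann_error_cvg0 R t0 T (A ^~ w) (fun N k => calm_weight (grid t0 T N k) w *
    Num.max (psi (x (grid t0 T N k) w) - psi (x (grid t0 T N k.+1) w)) 0) (psi n)) => //.
- by move=> s t ts st tT; apply: rmA_homo => //; exact: le_trans ts.
- by apply: (@continuous_itv_sub R 0 T t0 T (A ^~ w) t00 (lexx T)); exact: rmA_cont.
- move=> N k; rewrite mulr_ge0 ?le_max ?lexx ?orbT//= /calm_weight.
  case: (boolP (calm _ _)) => [/andP[xn _]|_]; last by rewrite mul0r psi_ge0.
  by rewrite mul1r ge_max psi_ge0 andbT lerBlDr (le_trans (le_psi xn))// lerDl psi_ge0.
move=> eta eta0; have eta1 : 0 < eta / (1 + dpsi n) by rewrite divr_gt0// ltr_pwDl// dpsi_ge0.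
have [rs hrs] := gpx_reg X w eta1; exists rs => N k kN hk.
rewrite /calm_weight; case: (boolP (calm _ _)) => [/andP[xn _]|_]; last first.
  by rewrite mul0r ltW.
rewrite mul1r ge_max (ltW eta0) andbT.
have hx := hrs _ _ (tt0 (ltnW kN)) (step_le N k) (ttT kN) hk.
rewrite (le_trans (psi_diff_le _ _))// (le_trans (ler_norm _))// normrM.
rewrite (ger0_norm (dpsi_ge0 _)).
apply: (@le_trans _ _ (dpsi n * (eta / (1 + dpsi n)))).
  by apply: ler_pM; [exact: dpsi_ge0|exact: normr_ge0|exact: dpsi_le|exact: ltW].
rewrite mulrCA ger_pMr// ler_pdivrMr ?ltr_pwDl ?dpsi_ge0// mul1r.
by rewrite lerDr.
Qed.

Lemma step_reflection_cvg0 w : \sum_(k < N.+1)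
    (calm_weight (grid t0 T N k) w * dpsi n) *
    (K (grid t0 T N k.+1) w - K (grid t0 T N k) w) @[N --> \oo] --> 0.
Proof.
(* Cells on which K does not change are given error 0. On a calm cell without an eps / 2 oscillation
   all [D j] stay above eps / 2, so K does not change there and only exceptional cells remain. *)
pose e N k := if K (grid t0 T N k.+1) w == K (grid t0 T N k) w then 0
  else calm_weight (grid t0 T N k) w * dpsi n.
rewrite (_ : (fun N => _) = (fun N => \sum_(k < N.+1) e N k *
    (K (grid t0 T N k.+1) w - K (grid t0 T N k) w))); last first.
  apply/funext => N; apply: eq_bigr => k _; rewrite /e.
  by case: eqP => // ->; rewrite subrr !mulr0.
apply: (@riemann_error_cvg0 R t0 T (K ^~ w) e (dpsi n)) => //.
- by move=> s t ts st tT; apply: gpK_homo => //; exact: le_trans ts.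
- by apply: (@continuous_itv_sub R 0 T t0 T (K ^~ w) t00 (lexx T)); exact: gpK_cont.
- move=> N k; rewrite /e; case: eqP => _; first by rewrite lexx dpsi_ge0.
  have /andP[c0 c1] := calm_weight01 (grid t0 T N k) w.
  by rewrite mulr_ge0 ?dpsi_ge0//= ler_piMl ?dpsi_ge0.
move=> eta eta0; have e2 : 0 < eps / 2 by rewrite divr_gt0.
have [rs hrs] := osc_pts_seq e2 (fun j => D_reg j w).
exists rs => N k kN hk; rewrite /e; case: eqP => [_|]; first exact: ltW.
rewrite /calm_weight; case: (boolP (calm _ _)) => [/andP[_ /forallP Dk]|_ _]; last first.
  by rewrite mul0r ltW.
case; apply: (D_flat (eta := eps / 2)) => //; rewrite ?tt0 ?ttT//; first exact: ltnW.
move=> r j /andP[kr rk].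
have := hrs j (grid t0 T N k) r (tt0 (ltnW kN)) (ltW kr) (le_trans rk (ttT kN)).
have hr r' : r' \in rs -> ~~ (grid t0 T N k < r' <= r).
  move=> /hk; apply: contra => /andP[h1 h2]; rewrite /in_step h1/=.
  exact: le_trans rk.
by move=> /(_ hr); have := Dk j; rewrite ltr_norml => h /andP[_]; lra.
Qed.

Lemma jump_isolated (js : seq (R * E)) (r : R) :
  exists2 g, 0 < g & forall z, z \in js -> `|z.1 - r| < g -> z.1 = r.
Proof.
elim: js => [|z js [g g0 hg]]; first by exists 1.
have [zr|zr] := eqVneq z.1 r.
  exists g => // z'; rewrite inE => /orP[/eqP ->//|]; exact: hg.
exists (Num.min g `|z.1 - r|).
  by rewrite lt_min g0 normr_gt0 subr_eq0.
move=> z'; rewrite inE lt_min => /orP[/eqP ->|z'js] /andP[h1 h2]; last exact: hg.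
by rewrite ltxx in h2.
Qed.

(** Without a jump in the cell the jump integral is zero and the positive part vanishes, because
    [bregman] is non-negative. In a fine grid a cell holds at most one jump z, and there x moves by
    the size u of that jump up to an error that tends to 0. *)
Lemma step_jump_cvg0 w : \sum_(k < N.+1) (calm_weight (grid t0 T N k) w *
    Num.max (jump_int S (grid t0 T N k) (grid t0 T N k.+1) (jump_cost X (grid t0 T N k)) w
      - bregman (x (grid t0 T N k) w) (x (grid t0 T N k.+1) w)) 0) @[N --> \oo] --> 0.
Proof.
pose e N k := if (k < N.+1)%N then calm_weight (grid t0 T N k) w *
    Num.max (jump_int S (grid t0 T N k) (grid t0 T N k.+1) (jump_cost X (grid t0 T N k)) w
      - bregman (x (grid t0 T N k) w) (x (grid t0 T N k.+1) w)) 0 else 0.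
rewrite (_ : (fun N => _) = (fun N => \sum_(k < N.+1) e N k)); last first.
  by apply/funext => N; apply: eq_bigr => k _; rewrite /e ltn_ord.
apply: (@sum_grid_pts_cvg0 R t0 T [seq z.1 | z <- rmj S w]) => //.
- move=> N k; rewrite /e; case: ifP => // _.
  by rewrite mulr_ge0// le_max lexx orbT.
- move=> N k kN hk; rewrite /e kN jump_cost_sum ?tt0 ?ttT//; last exact: ltnW.
  rewrite big_seq_cond big1; last first.
    move=> z /andP[zj hz]; exfalso; move: hz; apply/negP; apply: hk.
    exact: map_f.
  by rewrite sub0r max_r ?mulr0// oppr_le0 bregman_ge0.
move=> r eta /mapP[z zj ->] eta0.
(* Majorises the sum of the two slopes met below: at x_s + u for the change of psi, at x_s for the
   linear term. The 1 keeps it positive. *)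
pose B := 1 + dpsi (n + `|u z.1 w z.2|) + dpsi n.
have B0 : 0 < B by rewrite !ltr_wpDr ?dpsi_ge0.
have [zT|nzT] := boolP (0 < z.1 <= T); last first.
  exists 0%N => N _ k kN hk; exfalso; move/negP: nzT; apply.
  case/andP: hk => h1 h2; rewrite (le_lt_trans (tt0 (ltnW kN)) h1)/=.
  by rewrite (le_trans h2)// ttT.
have [delta delta0 hd] := gpx_jump X zj zT (divr_gt0 eta0 B0).
have [g g0 hg] := jump_isolated (rmj S w) z.1.
have dg0 : 0 < Num.min delta g by rewrite lt_min delta0.
have [N0 hN0] := @grid_mesh R t0 T _ dg0.
exists N0 => N /hN0; rewrite lt_min => /andP[md mg] k kN hk.
have [dk1 dk2] := in_step_dist t0T hk.
rewrite /e kN /calm_weight; case: (boolP (calm _ _)) => [/andP[xn _]|_]; last first.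
  by rewrite mul0r ltW.
rewrite mul1r ge_max (ltW eta0) andbT jump_cost_sum ?tt0 ?ttT//; last exact: ltnW.
have uj : uniq (rmj S w) by exact: map_uniq (rmj_uniq S w).
have -> : \sum_(z' <- rmj S w | grid t0 T N k < z'.1 <= grid t0 T N k.+1)
    bregman (x (grid t0 T N k) w) (x (grid t0 T N k) w + u z'.1 w z'.2) =
    bregman (x (grid t0 T N k) w) (x (grid t0 T N k) w + u z.1 w z.2).
  rewrite big_mkcond (bigD1_seq z)//= -/(in_step t0 T N k z.1) hk big_seq_cond big1 ?addr0//.
  move=> z' /andP[z'j z'z]; case: ifPn => // hz'.
  have [e1 e2] := in_step_dist t0T hz'.
  have zz : z'.1 = z.1.
    move: hk hz' => /andP[k1 k2] /andP[k3 k4].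
    by apply: hg => //; exact: same_step_dist k1 k2 k3 k4 dk2 dk1 mg.
  have := rmj_uniq S w.
  move=> /uniqP -/(_ 0) inj.
  have i1 := index_mem z (rmj S w); have i2 := index_mem z' (rmj S w).
  have : index z (rmj S w) = index z' (rmj S w).
    apply: inj; rewrite ?inE ?size_map ?i1 ?i2//.
    by rewrite !(nth_map z) ?i1 ?i2// !nth_index.
  move=> /(congr1 (nth z (rmj S w))); rewrite !nth_index// => zE.
  by rewrite zE eqxx in z'z.
case/andP: (hk) => k1 k2.
have := hd _ _ (tt0 (ltnW kN)) k1 k2 (ttT kN) (le_lt_trans dk1 md) (le_lt_trans dk2 md).
move: xn; rewrite /bregman; move: (x (grid t0 T N k) w) (x (grid t0 T N k.+1) w) => y y' yn.
clear hd; move: (u z.1 w z.2) @B B0 => v B B0 hv.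
have -> : y + v - y = v by rewrite addrAC subrr add0r.
have h1 := psi_diff_le y' (y + v).
have h2 : dpsi (y + v) * (y + v - y') <= dpsi (n + `|v|) * (eta / B).
  rewrite (le_trans (ler_norm _))// normrM (ger0_norm (dpsi_ge0 _)) ler_pM ?dpsi_ge0//.
    by apply: dpsi_le; [rewrite addr_ge0|rewrite lerD// ler_norm].
  by rewrite -normrN (le_trans _ hv)//; have -> : - (y + v - y') = y' - y - v by ring.
have h3 : - (dpsi y * (v - (y' - y))) <= dpsi n * (eta / B).
  rewrite (le_trans (ler_norm _))// normrN normrM (ger0_norm (dpsi_ge0 _)) ler_pM ?dpsi_ge0 ?dpsi_le//.
  by rewrite -normrN (le_trans _ hv)//; have -> : - (v - (y' - y)) = y' - y - v by ring.
have h4 : (dpsi (n + `|v|) + dpsi n) * (eta / B) <= eta.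
  by rewrite mulrCA ger_pMr// ler_pdivrMr// mul1r /B lerD2r lerDr.
rewrite mulrDl in h4; rewrite mulrBr in h3.
exact: sum_of_gaps_le h1 h2 h3 h4.
Qed.

Lemma step_errors_cvg0 w : step_errors N w @[N --> \oo] --> 0.
Proof.
have -> : (fun N => step_errors N w) = (fun N =>
    b * (\sum_(k < N.+1) (calm_weight (grid t0 T N k) w *
      Num.max (psi (x (grid t0 T N k) w) - psi (x (grid t0 T N k.+1) w)) 0) *
      (A (grid t0 T N k.+1) w - A (grid t0 T N k) w))
    + \sum_(k < N.+1) (calm_weight (grid t0 T N k) w *
      Num.max (jump_int S (grid t0 T N k) (grid t0 T N k.+1) (jump_cost X (grid t0 T N k)) w
        - bregman (x (grid t0 T N k) w) (x (grid t0 T N k.+1) w)) 0)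
    + \sum_(k < N.+1) (calm_weight (grid t0 T N k) w * dpsi (x (grid t0 T N k) w)) *
      (K (grid t0 T N k.+1) w - K (grid t0 T N k) w)).
  apply/funext => N; rewrite /step_errors mulr_sumr -!big_split/=.
  by apply: eq_bigr => k _; rewrite /step_error; ring.
rewrite -[X in _ --> X](_ : b * 0 + 0 + 0 = 0); last by rewrite mulr0 !addr0.
apply: cvgD; first apply: cvgD.
- by apply: cvgMr; exact: step_drift_cvg0.
- exact: step_jump_cvg0.
(* In the reflection part [dpsi (x s)] is replaced by [dpsi n], which is larger wherever the weight
   is non-zero. *)
apply: (@squeeze_cvgr _ _ _ _ (cst 0) (fun N => \sum_(k < N.+1)
    (calm_weight (grid t0 T N k) w * dpsi n) *
    (K (grid t0 T N k.+1) w - K (grid t0 T N k) w))).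
- near=> N; rewrite sumr_ge0 /=; last first.
    move=> k _; apply: mulr_ge0.
      by apply: mulr_ge0; [exact: ler0n|exact: dpsi_ge0].
    by have /andP[] := dK_bound X (tt0 (ltnW (ltn_ord k))) (step_le N k) (ttT (ltn_ord k)) w.
  apply: ler_sum => k _; rewrite ler_wpM2r//.
    by have /andP[] := dK_bound X (tt0 (ltnW (ltn_ord k))) (step_le N k) (ttT (ltn_ord k)) w.
  rewrite /calm_weight; case: (boolP (calm _ _)) => [/andP[xn _]|_]; last by rewrite !mul0r.
  by rewrite ler_wpM2l// dpsi_le.
- exact: cvg_cst.
- exact: step_reflection_cvg0.
Unshelve. all: by end_near. Qed.

Lemma Rintegrable_calm_step N k : (k < N.+1)%N ->
  Rintegrable P setT (fun w => calm_weight (grid t0 T N k) w *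
     step_error X (grid t0 T N k) (grid t0 T N k.+1) w).
Proof.
move=> kN; apply: (@Rintegrable_step_error _ _ _ _ _ _ _ _ _ _ X T0 M0 _ _ _ _ _ _ 1 n) => //.
- exact/tt0/ltnW.
- exact: ttT.
- by apply: measurable_calm_weight; exact/tt_itv/ltnW.
- by move=> w; exact: calm_weight01.
- by move=> w; exact: calm_weight_neq0.
Qed.

Lemma Rintegrable_step_errors N : Rintegrable P setT (step_errors N).
Proof.
have h : forall k : 'I_N.+1, Rintegrable P setT (fun w =>
    calm_weight (grid t0 T N k) w * step_error X (grid t0 T N k) (grid t0 T N k.+1) w).
  by move=> k; exact: Rintegrable_calm_step.
exact: (Rintegrable_sum (index_enum _) measurableT h).
Qed.

Lemma Rintegral_step_errors_cvg0 : \int[P]_w step_errors N w @[N --> \oo] --> 0.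
Proof.
have iB : Rintegrable P setT (fun w =>
    b * psi n * A T w + bregman_cst n * jumps_total w + dpsi n * K T w).
  apply: RintegrableD => //; first apply: RintegrableD => //.
  - by apply: RintegrableZ => //; exact: Rintegrable_AT.
  - by apply: RintegrableZ => //; exact: Rintegrable_jumps_total.
  - by apply: RintegrableZ => //; exact: gpK_int.
have [] := @Rdominated_cvg _ _ _ P step_errors (cst 0) _ _ _ _ iB.
- by move=> N; exact: Rintegrable_measurable (Rintegrable_step_errors N).
- exact: step_errors_cvg0.
- by move=> N w; have /andP[e0 e1] := step_errors_bound N w; rewrite ger0_norm.
- exact: measurable_cst.
by move=> _; rewrite Rintegral_cst// mul0r.
Qed.

End step_errors.

(** * Switching between modes *)

Section discrete.
Context d (T : measurableType d).
Implicit Types (C : countType).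

(** All subsets of the countable type are allowed, so composition with any function keeps the
    property; the automaton below can be assembled without measurability conditions on its
    transition function. *)
Definition discrete C (f : T -> C) : Prop := forall B : set C, measurable (f @^-1` B).

Lemma discreteP C (f : T -> C) : (forall c, measurable (f @^-1` [set c])) -> discrete f.
Proof.
move=> mf B.
have -> : f @^-1` B = \bigcup_(k in [set: nat])
    (if unpickle k is Some c then if pselect (B c) is left _ then f @^-1` [set c] else set0
     else set0).
  apply/seteqP; split=> [w /= Bw|w /= [k _]].
    exists (pickle (f w)) => //; rewrite pickleK; by case: pselect.
  case: (unpickle k) => //= c; case: pselect => //= Bc fc.
  by have -> : f w = c.
apply: bigcup_measurable => k _; case: (unpickle k) => // c.
by case: pselect.
Qed.

Lemma discrete_comp C C' (g : C -> C') (f : T -> C) : discrete f ->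
  discrete (fun w => g (f w)).
Proof. by move=> mf B; exact: (mf (g @^-1` B)). Qed.

Lemma discrete_pair C C' (f : T -> C) (g : T -> C') : discrete f -> discrete g ->
  discrete (fun w => (f w, g w)).
Proof.
move=> mf mg; apply: discreteP => -[c c'].
rewrite (_ : _ @^-1` _ = f @^-1` [set c] `&` g @^-1` [set c']); first exact: measurableI.
by apply/seteqP; split=> w /= [-> ->].
Qed.

Lemma discrete_ffun (I : finType) C (f : I -> T -> C) : (forall i, discrete (f i)) ->
  discrete (fun w => [ffun i => f i w]).
Proof.
move=> mf; apply: discreteP => g.
rewrite (_ : _ @^-1` _ = \bigcap_(i in [set: I]) f i @^-1` [set g i]).
  by apply: fin_bigcap_measurable => // i _; exact: mf.
apply/seteqP; split=> [w /= <- i _ /=|w /= h]; first by rewrite ffunE.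
by apply/ffunP => i; rewrite ffunE; exact: h.
Qed.

Lemma discrete_le (R : realType) (f : T -> R) (e : R) : measurable_fun setT f ->
  discrete (fun w => f w <= e).
Proof.
move=> mf; apply: discreteP => -[].
  rewrite (_ : _ @^-1` _ = setT `&` f @^-1` `]-oo, e]); first exact: mf.
  by rewrite setTI; apply/seteqP; split=> w /=; rewrite in_itv.
rewrite (_ : _ @^-1` _ = setT `&` f @^-1` `]e, +oo[); first exact: mf.
by rewrite setTI; apply/seteqP; split=> w /=; rewrite in_itv/= andbT ltNge; case: (f w <= e).
Qed.

Lemma discrete_cst C (c : C) : discrete (fun=> c).
Proof.
move=> B; have [Bc|Bc] := pselect (B c).
  by rewrite (_ : _ @^-1` _ = setT)//; apply/seteqP; split.
by rewrite (_ : _ @^-1` _ = set0)//; apply/seteqP; split.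
Qed.

Lemma discrete_measurable (R : realType) C (f : T -> C) (g : C -> R) : discrete f ->
  measurable_fun setT (fun w => g (f w)).
Proof. by move=> mf _ B _; rewrite setTI; exact: (mf (g @^-1` B)). Qed.

End discrete.

(** Any t is compared with the last exceptional point before it, or with a if there is none; the
    path takes finitely many values at these points. *)
Lemma regulated_bounded (R : realType) (a b : R) (f : R -> R) : regulated a b f ->
  exists B, forall t, a <= t <= b -> `|f t| <= B.
Proof.
move=> /(_ 1 ltr01)[rs hrs].
have [B hB] : exists B : R, forall r, r \in a :: rs -> `|f r| <= B.
  elim: (a :: rs) => [|r s [B hB]]; first by exists 0.
  exists (Num.max `|f r| B) => r'; rewrite inE => /orP[/eqP ->|/hB h].
    by rewrite le_max lexx.
  by rewrite le_max h orbT.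
exists (B + 1) => t /andP[at_ tb].
have [l lrs [al lt lmax]] : exists2 l, l \in a :: rs & [/\ a <= l, l <= t &
    forall r, r \in rs -> ~~ (l < r <= t)].
  elim: rs {hrs hB} => [|r rs [l lrs [al lt lmax]]].
    by exists a; rewrite ?inE ?eqxx.
  have [/andP[lr rt]|nlr] := boolP (l < r <= t).
    exists r; first by rewrite !inE eqxx orbT.
    split=> //; first by rewrite (le_trans al)// ltW.
    move=> r'; rewrite inE => /orP[/eqP ->|/lmax]; first by rewrite ltxx.
    by apply: contra => /andP[h ->]; rewrite (lt_trans lr h).
  exists l; first by move: lrs; rewrite !inE => /orP[->|->]; rewrite ?orbT.
  by split=> // r'; rewrite inE => /orP[/eqP ->|/lmax].
have := hrs _ _ al lt tb lmax; have := hB _ lrs.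
rewrite distrC => h1 h2; rewrite -(subrK (f l) (f t)) addrC.
by rewrite (le_trans (ler_normD _ _))// lerD// ltW.
Qed.

(** Makes the number of exceptional points up to the current time a counter that must increase
    between two switches. *)
Lemma count_le_lt (R : realType) (rs : seq R) (s t r : R) : r \in rs -> s < r <= t ->
  (count (fun u => (u <= s)%R) rs < count (fun u => (u <= t)%R) rs)%N.
Proof.
move=> rrs /andP[sr rt]; elim: rs rrs => //= u rs IH; rewrite inE => /orP[/eqP <-|/IH].
  rewrite rt leNgt sr/= add0n add1n ltnS; apply: sub_count => v /= vs.
  by rewrite (le_trans vs)// (le_trans (ltW sr)).
move=> h; rewrite -addnS leq_add//; case: (boolP (u <= s)) => //= us.
by rewrite (le_trans us)// (le_trans (ltW sr)).
Qed.

Lemma loop_gap (R : realType) (c d1 d2 e : R) : c <= d1 + d2 -> d1 <= e -> c - e <= d2.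
Proof. by move=> *; lra. Qed.

Lemma gap_drop (R : realType) (c d1 d2 e : R) : c - e <= d1 -> d2 <= e -> e <= c / 4 ->
  0 < c -> c / 2 <= d1 - d2.
Proof. by move=> *; lra. Qed.

Lemma gap_large (R : realType) (c d2 e : R) : c - e <= d2 -> e <= c / 4 -> 0 < c -> e < d2.
Proof. by move=> *; lra. Qed.

Lemma cvg_sum0 (R : realType) (I : Type) (s : seq I) (f : I -> nat -> R) :
  (forall i, f i n @[n --> \oo] --> 0) -> \sum_(i <- s) f i n @[n --> \oo] --> 0.
Proof.
move=> cf; elim: s => [|i s IH].
  by under eq_fun do rewrite big_nil; exact: cvg_cst.
rewrite (_ : (fun n => _) = f i \+ (fun n => \sum_(j <- s) f j n)).
  have h := cvgD (cf i) IH; rewrite addr0 in h; exact: h.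
by apply/funext => n; rewrite big_cons.
Qed.

(** One induction step along the grid: [en], [ep], [en'] are the energies before the decision, after
    it and one step later, [ks] the price of the switches so far, [dk] the dominator mass still
    alive and [al] the probability of being alive. *)
Lemma chain_arith (R : realType) (g err en en' ep ks ks' d0 dk dk' kn al al' : R) :
  en + ks <= ep + ks' + (dk - dk') + kn * (al - al') -> ep <= en' + g ->
  err + en + ks + (d0 - dk) + kn * (1 - al) <=
  err + g + en' + ks' + (d0 - dk') + kn * (1 - al').
Proof. by rewrite !mulrBr => *; lra. Qed.

Lemma end_arith (R : realType) (kp n sw al err dom : R) : 0 <= n -> 0 <= kp ->
  sw <= n -> 0 <= al -> err + kp * sw + dom + kp * n * (1 - al) <= err + 2 * (kp * n) + dom.
Proof.
move=> n0 k0 /(ler_wpM2l k0) s a; have := mulr_ge0 (mulr_ge0 k0 n0) a.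
by rewrite mulrBr mulr1 => ?; lra.
Qed.

Section switching.
Context (R : realType) dO (Omega : measurableType dO) (P : probability Omega R).
Context dE (E : measurableType dE) (F : R -> set (set Omega)) (T M : R) (m : nat).
Variables (S : random_measures P E F T M) (X : 'I_m -> gap_process S).
(** To be read as d i j = Y^i - Y^j + C(i,j) for the first solution, the distance of Y^i to one
    branch of its obstacle. [d_gap] then expresses that the second solution respects its obstacle,
    and [d_loop] combines the loop condition on the costs with d >= 0. *)
Variables (d : 'I_m -> 'I_m -> R -> Omega -> R) (c : Omega -> R).
Hypotheses (T0 : 0 <= T) (M0 : 0 <= M).
Implicit Types (s t : R) (w : Omega).
Local Notation A := (rmA S).
Local Notation x i := (gpx (X i)).
Local Notation b := (bcst M).
Hypothesis d_adapted : forall i j t, 0 <= t <= T ->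
  measurable_fun [set: g_sigma_algebraType (F t)] (d i j t : g_sigma_algebraType (F t) -> R).
Hypothesis d_reg : forall i j w, regulated 0 T (d i j ^~ w).
Hypothesis d_gap : forall i j t w, i != j -> 0 <= t <= T -> x i t w - x j t w <= d i j t w.
Hypothesis d_loop : forall i j l t w, i != j -> j != l -> 0 <= t <= T ->
  c w <= d i j t w + d j l t w.
Hypothesis c_gt0 : forall w, 0 < c w.
Hypothesis d_flat : forall i w s t eta, 0 <= s -> s <= t -> t <= T -> 0 < eta ->
  (forall r j, j != i -> s < r <= t -> eta <= d i j r w) -> gpK (X i) t w = gpK (X i) s w.

Variables (t0 : R) (i0 : 'I_m).
Hypotheses (t00 : 0 <= t0) (t0T : t0 <= T).

Section fixed_grid.
Variables (n N : nat) (eps : R).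
Hypothesis eps0 : 0 < eps.

Local Notation tt k := (grid t0 T N k).

Definition cheap k w : {ffun 'I_m -> {ffun 'I_m -> bool}} :=
  [ffun i => [ffun j => (j != i) && (d i j (tt k) w <= eps)]].

Definition safe k w : bool :=
  (A (tt k) w <= n%:R) && [forall i, x i (tt k) w <= n%:R].

Definition next_mode (v : {ffun 'I_m -> {ffun 'I_m -> bool}}) a : 'I_m :=
  if [pick j | v a j] is Some j then j else a.

(** The flag survives only if the grid time is safe, the counter is at most n, and the new mode has
    no cheap exit. The conjunct [s.2] makes a lost flag stay lost. *)
Definition switch (v : {ffun 'I_m -> {ffun 'I_m -> bool}} * bool)
    (s : 'I_m * nat * bool) : 'I_m * nat * bool :=
  let a := next_mode v.1 s.1.1 in
  let k := (s.1.2 + (a != s.1.1))%N in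
  (a, k, [&& s.2, v.2, (k <= n)%N & [forall j, ~~ v.1 a j]]).

(* Mode, number of switches so far, and whether no bound has been exceeded,
   before the decision taken at the k-th grid time. *)
Fixpoint state k w : 'I_m * nat * bool :=
  if k is k'.+1 then switch (cheap k' w, safe k' w) (state k' w) else (i0, 0%N, true).

Local Notation mode k w := (state k w).1.1.
Local Notation switches k w := (state k w).1.2.
Local Notation alive k w := (state k w).2.

Let tt_itv k : (k <= N.+1)%N -> 0 <= tt k <= T.
Proof.
move=> kN; have /andP[h1 h2] := @grid_itv R t0 T N k t0T kN.
by rewrite h2 (le_trans t00 h1).
Qed.

Lemma state_discrete_mono (C : countType) (f : Omega -> C) k l : (k <= l)%N ->
  discrete (f : g_sigma_algebraType (F (tt k)) -> C) -> (l <= N.+1)%N ->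
  discrete (f : g_sigma_algebraType (F (tt l)) -> C).
Proof.
move=> kl mf lN B; apply: (rm_mono S _ _ (mf B)).
  by have /andP[] := tt_itv (leq_trans kl lN).
exact: le_grid.
Qed.

Lemma decision_discrete k : (k <= N.+1)%N ->
  discrete ((fun w => (cheap k w, safe k w)) : g_sigma_algebraType (F (tt k)) -> _).
Proof.
move=> kN; apply: discrete_pair.
  apply: discrete_ffun => i; apply: discrete_ffun => j.
  apply: (discrete_comp (andb (j != i))); apply: discrete_le.
  by apply: d_adapted; exact: tt_itv.
apply: (@discrete_comp _ (g_sigma_algebraType (F (tt k))) _ _ (fun p => p.1 && p.2)
  (fun w => (A (tt k) w <= n%:R, [forall i, x i (tt k) w <= n%:R]))).
apply: discrete_pair.
  by apply: discrete_le; apply: rmA_adapted; have /andP[] := tt_itv kN.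
have -> : (fun w => [forall i, x i (tt k) w <= n%:R]) =
    (fun w => [forall i, [ffun i => x i (tt k) w <= n%:R] i]).
  by apply/funext => w; apply: eq_forallb => i; rewrite ffunE.
apply: (@discrete_comp _ (g_sigma_algebraType (F (tt k))) _ _
  (fun g : {ffun 'I_m -> bool} => [forall i, g i])).
by apply: discrete_ffun => i; apply: discrete_le; apply: gpx_adapted; exact: tt_itv.
Qed.

(** The decision at grid time k uses only data of that time, so the state with index k + 1 is
    already known at time [tt k]. This is why it can weight the increment over the k-th cell. *)
Lemma state_post_discrete k : (k <= N)%N ->
  discrete (state k : g_sigma_algebraType (F (tt k)) -> _) ->
  discrete (state k.+1 : g_sigma_algebraType (F (tt k)) -> _).
Proof.
move=> kN mk.
apply: (@discrete_comp _ (g_sigma_algebraType (F (tt k))) _ _ (fun p => switch p.1 p.2)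
  (fun w => ((cheap k w, safe k w), state k w))).
by apply: discrete_pair => //; apply: decision_discrete; exact: leq_trans (leqnSn N).
Qed.

Lemma state_discrete k : (k <= N.+1)%N ->
  discrete (state k : g_sigma_algebraType (F (tt k)) -> _).
Proof.
elim: k => [_|k IH kN]; first exact: discrete_cst.
apply: (@state_discrete_mono _ _ k) => //; apply: state_post_discrete => //.
exact: IH (ltnW kN).
Qed.

Lemma alive_facts k w : alive k.+1 w -> [/\ alive k w, A (tt k) w <= n%:R,
  forall i, x i (tt k) w <= n%:R, (switches k.+1 w <= n)%N &
  forall j, j != mode k.+1 w -> eps < d (mode k.+1 w) j (tt k) w].
Proof.
move=> /= /and4P[al /andP[hA /forallP hx] hs /forallP hv]; split=> //.
move=> j ja; have := hv j; rewrite !ffunE negb_and ja/= -ltNge; exact.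
Qed.

Lemma switches_le k w : alive k w -> (switches k w <= n)%N.
Proof. by case: k => // k /alive_facts[]. Qed.

Lemma switchP k w : (mode k.+1 w = mode k w /\ switches k.+1 w = switches k w /\
      (forall j, j != mode k w -> eps < d (mode k w) j (tt k) w)) \/
  [/\ mode k.+1 w != mode k w, switches k.+1 w = (switches k w).+1 &
      d (mode k w) (mode k.+1 w) (tt k) w <= eps].
Proof.
rewrite /= /next_mode; case: pickP => [j|h].
  by rewrite !ffunE => /andP[ji dj]; right; rewrite ji addn1.
left; rewrite eqxx addn0; split=> //; split=> // j ji.
by have := h j; rewrite !ffunE ji/= => /negbT; rewrite -ltNge.
Qed.

(** After a switch every exit of the new mode is at least c - eps away, by the loop condition,
    whereas the next switch needs an exit of at most eps. So some [d i j] has dropped by c / 2 in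
    between, which requires an exceptional point of its path. *)
Lemma switches_bound w (rs : seq R) : eps <= c w / 4 ->
  (forall p : 'I_m * 'I_m, osc_pts 0 T (d p.1 p.2 ^~ w) (c w / 2) rs) ->
  forall k, (k <= N.+1)%N -> (switches k w <= (size rs).+1)%N.
Proof.
move=> ec hrs.
(* The index l is the grid time of the latest switch; the counter is at most one more than the
   number of exceptional points up to it. *)
have inv k : (k <= N.+1)%N -> switches k w = 0%N \/ exists2 l, (l < k)%N &
    (switches k w <= (count (fun r => (r <= tt l)%R) rs).+1)%N /\
    forall j, j != mode k w -> c w - eps <= d (mode k w) j (tt l) w.
  elim: k => [_|k IH kN]; first by left.
  have kN' : (k <= N.+1)%N by exact: ltnW.
  have [[-> [-> _]]|[ne -> de]] := switchP k w.
    have [->|[l lk [h1 h2]]] := IH kN'; [by left|right].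
    by exists l; [exact: ltnW|].
  right; exists k => //; split; last first.
    move=> j ja; have nej : mode k w != mode k.+1 w by rewrite eq_sym.
    have aj : mode k.+1 w != j by rewrite eq_sym.
    exact: loop_gap (d_loop w nej aj (tt_itv kN')) de.
  have [->|[l lk [h1 h2]]] := IH kN'; first by rewrite ltnS.
  rewrite ltnS (leq_trans h1)//.
  have hc := h2 _ ne.
  have lN := leq_trans (ltnW lk) kN'.
  have ltk : tt l <= tt k by apply: le_grid => //; exact: ltnW.
  have [r rrs /andP[lr rk]] : exists2 r, r \in rs & tt l < r <= tt k.
    apply: contrapT => no.
    have := hrs (mode k w, mode k.+1 w) (tt l) (tt k).
    have /andP[l0 _] := tt_itv lN; have /andP[_ kT] := tt_itv kN'.
    move=> /(_ l0 ltk kT) /=.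
    have nor r : r \in rs -> ~~ (tt l < r <= tt k).
      by move=> rrs; apply/negP => h; apply: no; exists r.
    move=> /(_ nor); rewrite ltNge => /negP; apply.
    rewrite (le_trans _ (ler_norm _))//; exact: gap_drop hc de ec (c_gt0 w).
  by apply: (count_le_lt rrs); rewrite lr.
move=> k kN; have [->//|[l _ [h _]]] := inv k kN.
by rewrite (leq_trans h)// ltnS count_size.
Qed.

(** Given the bounds, the flag could only fail through a cheap exit of the new mode, and right after
    a cheap switch the loop condition excludes a second one at the same time. *)
Lemma stays_alive w : eps <= c w / 4 -> (forall k, (k <= N.+1)%N -> (switches k w <= n)%N) ->
  (forall t, 0 <= t <= T -> A t w <= n%:R) ->
  (forall i t, 0 <= t <= T -> x i t w <= n%:R) -> alive N.+1 w.
Proof.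
move=> ec hs hA hx; have : (N.+1 <= N.+1)%N by [].
elim: {-2}N.+1 => [//|k IH kN]; have kN' := ltnW kN.
have h0 := switchP k w; have hk := hs _ kN.
move: h0 hk; rewrite /= => h0 hk; rewrite IH// hk /safe hA ?tt_itv//=.
rewrite (introT forallP) ?andTb => [|i]; last by rewrite hx ?tt_itv.
apply/forallP => j; rewrite !ffunE negb_and negbK -ltNge.
case: eqVneq => //= jn; case: h0 => [[e [_ h]]|[ne _ de]].
  by rewrite e in jn *; exact: h.
set a' := next_mode _ _ in ne de jn *.
have nej : mode k w != a' by rewrite eq_sym.
have aj : a' != j by rewrite eq_sym.
exact: gap_large (loop_gap (d_loop w nej aj (tt_itv kN')) de) ec (c_gt0 w).
Qed.

Definition weight k a w : R := ((mode k w == a) && alive k w)%:R.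

(** Two indices, because a step of the grid moves them in turn: the decision replaces k by k + 1
    while the time is still l = k, and the motion then advances the time. *)
Definition energy k l w : R :=
  \sum_a weight k a w * (expR (b * A (tt l) w) * psi (x a (tt l) w)).

Lemma energyE k l w : energy k l w =
  (alive k w)%:R * (expR (b * A (tt l) w) * psi (x (mode k w) (tt l) w)).
Proof.
rewrite /energy (bigD1 (mode k w))//= /weight eqxx big1 ?addr0// => a /negbTE am.
by rewrite eq_sym am mul0r.
Qed.

Local Notation kappa := (expR (b * n%:R) * dpsi n%:R * eps).
Local Notation cell := (fun i k w => expR (b * A (tt k) w) * psi (x i (tt k) w)).

Let kappa0 : 0 <= kappa.
Proof. by apply: mulr_ge0; [apply: mulr_ge0; [exact: expR_ge0|exact: dpsi_ge0]|exact: ltW]. Qed.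

Let cell_ge0 i k w : 0 <= cell i k w.
Proof. by apply: mulr_ge0; [exact: expR_ge0|exact: psi_ge0]. Qed.

(** A switch lowers the current x by at most eps, since d <= eps there, hence psi by at most dpsi(n)
    eps, with a weight of at most exp(b n): this is one unit [kappa], paid by the counter. If the
    flag is lost, the energy and at most n units are charged to the last two terms. *)
Lemma decision_pointwise k w : (k <= N.+1)%N ->
  energy k k w + kappa * ((alive k w)%:R * (switches k w)%:R) <=
  energy k.+1 k w + kappa * ((alive k.+1 w)%:R * (switches k.+1 w)%:R)
  + \sum_i ((alive k w)%:R - (alive k.+1 w)%:R) * cell i k w
  + kappa * n%:R * ((alive k w)%:R - (alive k.+1 w)%:R).
Proof.
move=> kN; rewrite !energyE; have := @alive_facts k w; have := @switches_le k w.
have := switchP k w; case: (alive k.+1 w) => h1 h2 h3; last first.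
  rewrite !mul0r mulr0 subr0 !add0r -mulr_sumr.
  case: (alive k w) h2 => h2; last by rewrite !mul0r !mulr0 !add0r.
  rewrite !mul1r mulr1 lerD ?ler_wpM2l// ?ler_nat ?h2//.
  by rewrite (bigD1 (mode k w))//= lerDl sumr_ge0// => i _; exact: cell_ge0.
have [-> hA hx hs _] := h3 erefl.
rewrite !mul1r subrr !mulr0 addr0 [X in _ <= _ + _ + X]big1 ?addr0 => [|i _]; last by rewrite mul0r.
case: h1 => [[-> [-> _]]//|[ne -> de]].
rewrite -natr1 mulrDr mulr1 addrA addrAC lerD2r.
have mn : mode k w != mode k.+1 w by rewrite eq_sym.
have gap := le_trans (d_gap w mn (tt_itv kN)) de.
have e1 : expR (b * A (tt k) w) <= expR (b * n%:R).
  by rewrite ler_expR ler_wpM2l// ltW// bcst_gt0.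
have h : psi (x (mode k w) (tt k) w) - psi (x (mode k.+1 w) (tt k) w) <= dpsi n%:R * eps.
  rewrite (le_trans (psi_diff_le _ _))//.
  apply: (@le_trans _ _ (dpsi (x (mode k w) (tt k) w) * eps)).
    by apply: ler_wpM2l => //; exact: dpsi_ge0.
  by apply: ler_wpM2r; [exact: ltW|exact: dpsi_le].
rewrite -lerBlDl -mulrBr -mulrA.
apply: (@le_trans _ _ (expR (b * A (tt k) w) * (dpsi n%:R * eps))).
  by apply: ler_wpM2l => //; exact: expR_ge0.
by apply: ler_wpM2r => //; apply: mulr_ge0; [exact: dpsi_ge0|exact: ltW].
Qed.

Lemma state_meas (g : 'I_m * nat * bool -> R) k : (k <= N.+1)%N ->
  measurable_fun [set: g_sigma_algebraType (F (tt k))]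
    ((fun w => g (state k w)) : g_sigma_algebraType (F (tt k)) -> R).
Proof. by move=> kN; exact: (discrete_measurable g (state_discrete kN)). Qed.

Lemma state_post_meas (g : 'I_m * nat * bool -> R) k : (k <= N)%N ->
  measurable_fun [set: g_sigma_algebraType (F (tt k))]
    ((fun w => g (state k.+1 w)) : g_sigma_algebraType (F (tt k)) -> R).
Proof.
move=> kN; have h := state_post_discrete kN (state_discrete (leq_trans kN (leqnSn N))).
exact: (discrete_measurable g h).
Qed.

Lemma weight_post_meas k a : (k <= N)%N ->
  measurable_fun [set: g_sigma_algebraType (F (tt k))]
    (weight k.+1 a : g_sigma_algebraType (F (tt k)) -> R).
Proof. exact: (state_post_meas (fun z => ((z.1.1 == a) && z.2)%:R)). Qed.

Lemma stop_lost_meas k : (k <= N)%N ->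
  measurable_fun [set: g_sigma_algebraType (F (tt k))]
    ((fun w => (alive k w)%:R - (alive k.+1 w)%:R) : g_sigma_algebraType (F (tt k)) -> R).
Proof.
move=> kN; apply: measurable_funB.
  exact: (state_meas (fun z => z.2%:R) (leq_trans kN (leqnSn N))).
exact: (state_post_meas (fun z => z.2%:R) kN).
Qed.

Lemma alive_lost w k : 0 <= ((alive k w)%:R - (alive k.+1 w)%:R : R) <= 1.
Proof.
have := @alive_facts k w; case: (alive k.+1 w) => [[]// -> *|_].
  by rewrite subrr lexx ler01.
by rewrite subr0 ler0n lern1 leq_b1.
Qed.

Lemma alive_meas k : (k <= N.+1)%N -> measurable_fun setT (fun w => (alive k w)%:R : R).
Proof.
move=> kN; have h := state_meas (fun z => z.2%:R) kN.
apply: (sub_measurable_fun (rm_sub S _) h).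
by have /andP[] := tt_itv kN.
Qed.

Lemma switches_int k : (k <= N.+1)%N ->
  Rintegrable P setT (fun w => (alive k w)%:R * (switches k w)%:R).
Proof.
move=> kN.
have h := state_meas (fun z => z.2%:R * z.1.2%:R) kN.
apply: (@Rintegrable_le _ _ _ _ _ _ (fun=> n%:R)) => //.
- apply: (sub_measurable_fun (rm_sub S _) h).
  by have /andP[] := tt_itv kN.
- move=> w _; have := @switches_le k w; case: (alive k w) => h'.
    by rewrite mul1r ger0_norm// ler_nat h'.
  by rewrite mul0r normr0.
by apply: finite_measure_integrable_cst.
Qed.

Lemma alive_int k : (k <= N.+1)%N -> Rintegrable P setT (fun w => (alive k w)%:R).
Proof.
move=> kN; apply: (@Rintegrable_le _ _ _ _ _ _ (fun=> 1)) => //.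
- exact: alive_meas.
- by move=> w _; rewrite ger0_norm// lern1 leq_b1.
by apply: finite_measure_integrable_cst.
Qed.

Lemma weight01 k a w : 0 <= weight k a w <= 1.
Proof. by rewrite /weight ler0n lern1 leq_b1. Qed.

Lemma weighted_cell_int k l a : (k <= l)%N -> (l <= N.+1)%N ->
  Rintegrable P setT (fun w => weight k a w * cell a l w).
Proof.
move=> kl lN; have /andP[l0 lT] := tt_itv lN.
have mw : measurable_fun [set: g_sigma_algebraType (F (tt l))]
    (weight k a : g_sigma_algebraType (F (tt l)) -> R).
  have h := state_discrete_mono kl (state_discrete (leq_trans kl lN)) lN.
  exact: (discrete_measurable (fun z : 'I_m * nat * bool => ((z.1.1 == a) && z.2)%:R : R) h).
by have [] := stop_ineq (X a) T0 M0 l0 lT mw (weight01 k a).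
Qed.

Lemma weighted_cell_post_int k a : (k <= N)%N ->
  Rintegrable P setT (fun w => weight k.+1 a w * cell a k w).
Proof.
move=> kN; have /andP[l0 lT] := tt_itv (leq_trans kN (leqnSn N)).
by have [] := stop_ineq (X a) T0 M0 l0 lT (weight_post_meas a kN) (weight01 k.+1 a).
Qed.

Lemma alive_dom_int k i : (k <= N.+1)%N ->
  Rintegrable P setT (fun w => (alive k w)%:R * dominator (X i) w).
Proof.
move=> kN; apply: (Rintegrable_le measurableT _ _ (gp_dom (X i))).
  by apply: measurable_funM; [exact: alive_meas|exact: Rintegrable_measurable (gp_dom (X i))].
move=> w _; have d0 := dominator_ge0 (X i) w.
change (`|(alive k w)%:R * dominator (X i) w| <= dominator (X i) w).
rewrite ger0_norm; last by apply: mulr_ge0.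
by apply: ler_piMl => //; rewrite lern1 leq_b1.
Qed.

(** [stop_ineq], with the indicator of losing the flag at time k as weight, bounds the lost energy
    by the dominator on that event; these contributions telescope over the grid. *)
Lemma decision_ineq k : (k <= N)%N ->
  \int[P]_w energy k k w + kappa * \int[P]_w ((alive k w)%:R * (switches k w)%:R) <=
  \int[P]_w energy k.+1 k w
  + kappa * \int[P]_w ((alive k.+1 w)%:R * (switches k.+1 w)%:R)
  + \sum_i (\int[P]_w ((alive k w)%:R * dominator (X i) w) -
            \int[P]_w ((alive k.+1 w)%:R * dominator (X i) w))
  + kappa * n%:R * (\int[P]_w (alive k w)%:R - \int[P]_w (alive k.+1 w)%:R).
Proof.
move=> kN; have kN' : (k <= N.+1)%N := leq_trans kN (leqnSn N).
have /andP[k0 kT] := tt_itv kN'.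
have i1 : Rintegrable P setT (energy k k).
  by apply: Rintegrable_sum => // a; exact: weighted_cell_int.
have i2 : Rintegrable P setT (energy k.+1 k).
  by apply: Rintegrable_sum => // a; exact: weighted_cell_post_int.
have i3 := switches_int kN'; have i4 := switches_int (kN : (k.+1 <= N.+1)%N).
have st i := stop_ineq (X i) T0 M0 k0 kT (stop_lost_meas kN) (fun w => alive_lost w k).
have i5 := Rintegrable_sum (index_enum _) measurableT (fun i => (st i).1).
have i6 := RintegrableB measurableT (alive_int kN') (alive_int (kN : (k.+1 <= N.+1)%N)).
have := le_Rintegral measurableT
  (RintegrableD measurableT i1 (RintegrableZ kappa measurableT i3))
  (RintegrableD measurableT (RintegrableD measurableT (RintegrableD measurableT i2
    (RintegrableZ kappa measurableT i4)) i5) (RintegrableZ (kappa * n%:R) measurableT i6))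
  (fun w _ => decision_pointwise w kN').
rewrite (RintegralD measurableT i1 (RintegrableZ kappa measurableT i3)).
rewrite (RintegralZl _ measurableT i3).
rewrite (RintegralD measurableT (RintegrableD measurableT (RintegrableD measurableT i2
    (RintegrableZ kappa measurableT i4)) i5) (RintegrableZ (kappa * n%:R) measurableT i6)).
rewrite (RintegralZl _ measurableT i6).
rewrite (RintegralD measurableT (RintegrableD measurableT i2
    (RintegrableZ kappa measurableT i4)) i5).
rewrite (RintegralD measurableT i2 (RintegrableZ kappa measurableT i4)).
rewrite (RintegralZl _ measurableT i4).
rewrite (RintegralB measurableT (alive_int kN') (alive_int (kN : (k.+1 <= N.+1)%N))).
rewrite (Rintegral_sum _ measurableT (fun i => (st i).1)).
move=> h; apply: (le_trans h); rewrite lerD2r lerD2l; apply: ler_sum => i _.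
rewrite (le_trans (st i).2)// -(RintegralB measurableT (alive_dom_int i kN')
  (alive_dom_int i (kN : (k.+1 <= N.+1)%N))).
by under eq_Rintegral do rewrite mulrBl.
Qed.

(** [calm] quantifies over all modes, while the obstacle of i excludes i itself; the value 1 + eps
    makes the diagonal entry pass the test. *)
Definition far i j t w : R := if j == i then 1 + eps else d i j t w.

Definition calm_error i k w : R := calm_weight (X i) (far i) n%:R eps (tt k) w *
     step_error (X i) (tt k) (tt k.+1) w.

Lemma weight_calm k a w : weight k.+1 a w <= calm_weight (X a) (far a) n%:R eps (tt k) w.
Proof.
rewrite /weight; case: (boolP (_ && _)) => [/andP[/eqP am al]|_]; last first.
  by have /andP[] := calm_weight01 (X a) (far a) n%:R eps (tt k) w.
have [_ _ hx _ hd] := alive_facts al.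
rewrite /calm_weight /calm hx/=; have -> // : [forall j, eps < far a j (tt k) w].
by apply/forallP => j; rewrite /far; case: eqVneq => [_|ja]; [rewrite ltrDr|rewrite -am hd// am].
Qed.

Lemma far_adapted i j t : 0 <= t <= T ->
  measurable_fun [set: g_sigma_algebraType (F t)] (far i j t : g_sigma_algebraType (F t) -> R).
Proof.
move=> tT; rewrite /far; case: (j == i); [exact: measurable_cst|exact: d_adapted].
Qed.

(** [step_ineq] for the weight exp(b A) restricted to the current mode. Being alive bounds this
    weight by exp(b n) and makes the cell calm. *)
Lemma moving_ineq k a : (k <= N)%N ->
  \int[P]_w (weight k.+1 a w * cell a k w) <=
  \int[P]_w (weight k.+1 a w * cell a k.+1 w)
  + expR (b * n%:R) * \int[P]_w calm_error a k w.
Proof.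
move=> kN; have kN' : (k <= N.+1)%N := leq_trans kN (leqnSn N).
have /andP[k0 kT] := tt_itv kN'; have /andP[_ lT] := tt_itv (kN : (k.+1 <= N.+1)%N).
have kl : tt k <= tt k.+1 by exact: le_grid.
pose H w := weight k.+1 a w * expR (b * A (tt k) w).
have b0 := bcst_gt0 M0.
have act w : weight k.+1 a w != 0 -> A (tt k) w <= n%:R /\ x a (tt k) w <= n%:R.
  rewrite /weight; case: (boolP (_ && _)) => [/andP[_ al] _|_]; last by rewrite eqxx.
  by have [_ hA hx _ _] := alive_facts al.
have mH : measurable_fun [set: g_sigma_algebraType (F (tt k))]
    (H : g_sigma_algebraType (F (tt k)) -> R).
  apply: measurable_funM; first exact: weight_post_meas.
  apply: (@measurableT_comp _ _ _ _ _ _ (@expR R)); first exact: measurable_expR.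
  by apply: measurable_funM => //; exact: rmA_adapted.
have Hc w : 0 <= H w <= expR (b * n%:R).
  have /andP[w0 w1] := weight01 k.+1 a w.
  rewrite /H mulr_ge0 ?expR_ge0//=.
  have [->|/act[hA _]] := eqVneq (weight k.+1 a w) 0; first by rewrite mul0r expR_ge0.
  rewrite -[leRHS]mul1r ler_pM ?expR_ge0// ler_expR ler_wpM2l//; exact: ltW.
have Hn w : H w != 0 -> x a (tt k) w <= n%:R.
  by rewrite mulf_eq0 negb_or => /andP[/act[]].
have HE : (fun w => H w * (expR (b * (A (tt k.+1) w - A (tt k) w)) * psi (x a (tt k.+1) w)))
    = (fun w => weight k.+1 a w * cell a k.+1 w).
  apply/funext => w; rewrite /H -mulrA; congr (_ * _); rewrite mulrA -expRD.
  by congr (expR _ * _); ring.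
have iE : Rintegrable P setT
    (fun w => H w * (expR (b * (A (tt k.+1) w - A (tt k) w)) * psi (x a (tt k.+1) w))).
  by rewrite HE; exact: weighted_cell_int.
have := step_ineq T0 M0 k0 kl lT mH Hc (ler0n _ _) Hn iE.
rewrite HE; have -> : (fun w => H w * psi (x a (tt k) w)) = (fun w => weight k.+1 a w * cell a k w).
  by apply/funext => w; rewrite /H mulrA.
move=> h; apply: (le_trans h); rewrite lerD2l.
have iC : Rintegrable P setT (calm_error a k).
  by apply: Rintegrable_calm_step => // j t; exact: far_adapted.
rewrite -(RintegralZl _ measurableT iC); apply: le_Rintegral => //.
- by apply: (Rintegrable_step_error T0 M0 k0 kl lT mH Hc (ler0n _ _) Hn).
- exact: RintegrableZ.
move=> w _; rewrite /calm_error mulrA; apply: ler_wpM2r.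
  exact: step_error_ge0.
rewrite /H mulrC; have [->|/act[hA _]] := eqVneq (weight k.+1 a w) 0.
  rewrite mulr0; apply: mulr_ge0; first exact: expR_ge0.
  by have /andP[] := calm_weight01 (X a) (far a) n%:R eps (tt k) w.
have /andP[w0 _] := weight01 k.+1 a w.
apply: ler_pM; [exact: expR_ge0|exact: w0| |exact: weight_calm].
by rewrite ler_expR ler_wpM2l// ltW.
Qed.

(** Induction over the grid, alternating [decision_ineq] and [moving_ineq]. At T the energy vanishes
    since x_T = 0. The price [kappa * n] occurs twice: for the switches made and for the counter
    lost with the flag. *)
Lemma switching_ineq :
  \int[P]_w (expR (b * A t0 w) * psi (x i0 t0 w)) <=
  expR (b * n%:R) * \sum_a \int[P]_w step_errors (X a) (far a) t0 n%:R eps N w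
  + 2 * (kappa * n%:R)
  + \sum_i \int[P]_w ((1 - (alive N.+1 w)%:R) * dominator (X i) w).
Proof.
have chain k : (k <= N.+1)%N -> \int[P]_w energy 0 0 w <=
    expR (b * n%:R) * \sum_(l < k) \sum_a \int[P]_w calm_error a l w
    + \int[P]_w energy k k w + kappa * \int[P]_w ((alive k w)%:R * (switches k w)%:R)
    + \sum_i (\int[P]_w dominator (X i) w - \int[P]_w ((alive k w)%:R * dominator (X i) w))
    + kappa * n%:R * (1 - \int[P]_w (alive k w)%:R).
  elim: k => [_|k IH kN].
    rewrite big_ord0 mulr0 add0r /=.
    under [X in _ + kappa * X]eq_Rintegral do rewrite mulr0.
    rewrite Rintegral_cst// mul0r mulr0 addr0.
    rewrite [X in _ <= _ + X + _]big1 => [|i _]; last first.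
      by apply/eqP; rewrite subr_eq0; apply/eqP; apply: eq_Rintegral => w _; rewrite mul1r.
    rewrite Rintegral_cst// mul1r.
    have -> : fine (P setT) = 1 by rewrite probability_setT.
    by rewrite subrr mulr0 !addr0.
  have kN' : (k <= N.+1)%N := ltnW kN.
  apply: (le_trans (IH kN')).
  have h1 := decision_ineq (kN : (k <= N)%N).
  have h2 : \int[P]_w energy k.+1 k w <= \int[P]_w energy k.+1 k.+1 w
      + expR (b * n%:R) * \sum_a \int[P]_w calm_error a k w.
    rewrite (Rintegral_sum _ measurableT (fun a => weighted_cell_post_int a (kN : (k <= N)%N))).
    rewrite (Rintegral_sum _ measurableT (fun a => weighted_cell_int a (leqnn _) kN)).
    by rewrite mulr_sumr -big_split/=; apply: ler_sum => a _; exact: moving_ineq.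
  have -> : \sum_(l < k.+1) \sum_a \int[P]_w calm_error a l w =
      \sum_(l < k) \sum_a \int[P]_w calm_error a l w + \sum_a \int[P]_w calm_error a k w.
    by rewrite big_ord_recr.
  rewrite [expR _ * (_ + _)]mulrDr.
  move: h1 h2; rewrite !sumrB.
  exact: chain_arith.
apply: (le_trans _ (le_trans (chain N.+1 (leqnn _)) _)).
  under [leRHS]eq_Rintegral do rewrite energyE/= mul1r grid0; exact: lexx.
have e0 : \int[P]_w energy N.+1 N.+1 w = 0.
  rewrite -[RHS](mul0r (fine (P setT))) -(Rintegral_cst _ measurableT 0).
  apply: eq_Rintegral => w _; rewrite energyE gridN gpx_end psi_npos//.
  by rewrite !mulr0.
rewrite e0 addr0.
have s1 : \int[P]_w ((alive N.+1 w)%:R * (switches N.+1 w)%:R) <= n%:R.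
  have -> : n%:R = \int[P]_w (cst (n%:R : R)) w.
    rewrite Rintegral_cst//; have -> : fine (P setT) = 1 by rewrite probability_setT.
    by rewrite mulr1.
  apply: le_Rintegral => //; first exact: switches_int.
    exact: finite_measure_integrable_cst.
  move=> w _; have := @switches_le N.+1 w; case: (alive N.+1 w) => h.
    by rewrite mul1r ler_nat h.
  by rewrite mul0r.
have s2 : 0 <= \int[P]_w (alive N.+1 w)%:R by apply: Rintegral_ge0.
have s3 : expR (b * n%:R) * \sum_(l < N.+1) \sum_a \int[P]_w calm_error a l w =
    expR (b * n%:R) * \sum_a \int[P]_w step_errors (X a) (far a) t0 n%:R eps N w.
  congr (_ * _); rewrite exchange_big/=; apply: eq_bigr => a _.
  have ic (l : 'I_N.+1) : Rintegrable P setT (calm_error a l).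
    by apply: Rintegrable_calm_step => // j t; exact: far_adapted.
  by rewrite -(Rintegral_sum _ measurableT ic).
have s4 : \sum_i (\int[P]_w dominator (X i) w - \int[P]_w ((alive N.+1 w)%:R * dominator (X i) w))
   = \sum_i \int[P]_w ((1 - (alive N.+1 w)%:R) * dominator (X i) w).
  apply: eq_bigr => i _; rewrite -(RintegralB measurableT (gp_dom (X i)) (alive_dom_int i (leqnn _))).
  by apply: eq_Rintegral => w _; rewrite mulrBl mul1r.
rewrite s3 s4; move: (kappa0) s1 s2; by apply: end_arith.
Qed.

End fixed_grid.

(** On a fixed path n eventually exceeds the bounds of x and A and the number of possible switches,
    and [eps n] falls below c / 4; this is so whatever the grids [N n]. *)
Lemma eventually_alive w (eps : nat -> R) (N : nat -> nat) :
  (forall n, 0 < eps n) -> eps n @[n --> \oo] --> 0 ->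
  \forall n \near \oo, (state n (N n) (eps n) (N n).+1 w).2.
Proof.
move=> eps0 epsc.
have [rs hrs] := @osc_pts_seq _ ('I_m * 'I_m)%type 0 T (fun p => d p.1 p.2 ^~ w) (c w / 2)
  (divr_gt0 (c_gt0 w) (ltr0n R 2)) (fun p => d_reg p.1 p.2 w).
have [B hB] : exists B, forall i t, 0 <= t <= T -> x i t w <= B.
  have /choice[B hB] := fun i => regulated_bounded (gpx_reg (X i) w).
  exists (\big[Num.max/0]_i B i) => i t tT; rewrite (le_trans (ler_norm _))//.
  by rewrite (le_trans (hB i t tT))// le_bigmax.
near=> n; have nB : Num.max (Num.max B (A T w)) (size rs).+1%:R <= n%:R.
  by near: n; exact: nbhs_infty_ger.
move: nB; rewrite !ge_max => /andP[/andP[nB nA]]; rewrite ler_nat => nrs.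
have ec : eps n <= c w / 4.
  near: n; move/cvgrPdist_lt : epsc => /(_ _ (divr_gt0 (c_gt0 w) (ltr0n R 4))).
  apply: filterS => n; rewrite sub0r normrN => h; apply: ltW.
  exact: le_lt_trans (ler_norm _) h.
apply: stays_alive => //.
- move=> k kN; apply: leq_trans nrs.
  exact: switches_bound ec hrs _ kN.
- by move=> t /andP[t0' tT]; rewrite (le_trans _ nA)// rmA_homo.
- by move=> i t tT; rewrite (le_trans _ nB)// hB.
Unshelve. all: by end_near. Qed.

Lemma gap_at_le0 : {ae P, forall w, x i0 t0 w <= 0}.
Proof.
pose k0 n : R := expR (b * n%:R) * dpsi n%:R * n%:R.
have k00 n : 0 <= k0 n.
  by apply: mulr_ge0 => //; apply: mulr_ge0; [exact: expR_ge0|exact: dpsi_ge0].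
(* Chosen so that the price 2 kappa n of the switches, which equals [eps n] times 2 [k0 n], is at
   most 1 / (n + 1). *)
pose eps n : R := n.+1%:R^-1 / (1 + 2 * k0 n).
have q0 n : 0 < 1 + 2 * k0 n by rewrite ltr_pwDl// mulr_ge0.
have eps0 n : 0 < eps n by rewrite divr_gt0.
have epsle n : eps n <= n.+1%:R^-1.
  by rewrite ler_pdivrMr// ler_peMr// lerDl mulr_ge0.
have epsc : eps n @[n --> \oo] --> 0.
  apply: (@squeeze_cvgr _ _ _ _ (fun=> 0) (fun n => n.+1%:R^-1)).
  - by near=> n; rewrite (ltW (eps0 n)) epsle.
  - exact: cvg_cst.
  - exact: cvg_harmonic.
(* With n and [eps n] fixed, the mesh is refined until the weighted step errors fall below 1 / (n +
   1). *)
have small n : exists N, expR (b * n%:R) * (\sum_a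
    \int[P]_w step_errors (X a) (far (eps n) a) t0 n%:R (eps n) N w) <= n.+1%:R^-1.
  have h : (fun N => expR (b * n%:R) * (\sum_a
    \int[P]_w step_errors (X a) (far (eps n) a) t0 n%:R (eps n) N w)) @ \oo --> (0 : R).
    rewrite -[X in _ --> X](mulr0 (expR (b * n%:R))); apply: cvgMr.
    apply: cvg_sum0 => a.
    apply: Rintegral_step_errors_cvg0 => //.
    - by move=> j t; exact: far_adapted.
    - move=> j w; rewrite /far; case: (j == a) => // eta eta0.
      by exists [::] => s t _ _ _ _; rewrite subrr normr0.
    - move=> w s t eta s0 st tT eta0 hf; apply: (d_flat s0 st tT eta0).
      by move=> r j /negbTE ja rst; have := hf r j rst; rewrite /far ja.
  have n1 : 0 < n.+1%:R^-1 :> R by rewrite invr_gt0.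
  have /cvgrPdist_lt/(_ _ n1)[N _ /(_ N (leqnn N))] := h.
  by rewrite sub0r normrN => hN; exists N; rewrite ltW// (le_lt_trans (ler_norm _) hN).
have /choice[N hN] := small.
pose g n w := \sum_i ((1 - (state n (N n) (eps n) (N n).+1 w).2%:R) * dominator (X i) w).
pose tot w := \sum_i dominator (X i) w.
have itot : Rintegrable P setT tot.
  by apply: Rintegrable_sum => // i; exact: gp_dom.
have al01 n w : 0 <= (1 - (state n (N n) (eps n) (N n).+1 w).2%:R : R) <= 1.
  by rewrite subr_ge0 lern1 leq_b1 gerBl ler0n.
have ig n i : Rintegrable P setT
    (fun w => (1 - (state n (N n) (eps n) (N n).+1 w).2%:R) * dominator (X i) w).
  rewrite (_ : (fun w => _) = (fun w => dominator (X i) w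
      - (state n (N n) (eps n) (N n).+1 w).2%:R * dominator (X i) w)).
    apply: RintegrableB => //; first exact: gp_dom.
    by apply: alive_dom_int.
  by apply/funext => w; rewrite mulrBl mul1r.
have [_ cg] : Rintegrable P setT (cst (0 : R)) /\
    \int[P]_w g n w @[n --> \oo] --> \int[P]_w (cst (0 : R)) w.
  apply: (@Rdominated_cvg _ _ _ P g (cst 0) tot) => //.
  - move=> n; apply: Rintegrable_measurable.
    by apply: Rintegrable_sum => // i; exact: ig.
  - move=> w; apply: cvg_near_cst.
    apply: filterS (eventually_alive w N eps0 epsc) => n al.
    by rewrite /g al subrr big1// => i _; rewrite mul0r.
  move=> n w; rewrite ger0_norm; last first.
    apply: sumr_ge0 => i _; apply: mulr_ge0; last exact: dominator_ge0.
    by have /andP[] := al01 n w.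
  apply: ler_sum => i _; apply: ler_piMl; first exact: dominator_ge0.
  by have /andP[] := al01 n w.
rewrite Rintegral_cst// mul0r in cg.
pose f w := expR (b * A t0 w) * psi (x i0 t0 w).
have f0 w : 0 <= f w by apply: mulr_ge0; [exact: expR_ge0|exact: psi_ge0].
have fi : Rintegrable P setT f.
  have h1 : measurable_fun [set: g_sigma_algebraType (F t0)]
    (cst 1 : g_sigma_algebraType (F t0) -> R) by exact: measurable_cst.
  have h2 w : 0 <= (cst 1 : Omega -> R) w <= 1 by rewrite ler01 lexx.
  have [] := stop_ineq (X i0) T0 M0 t00 t0T h1 h2.
  by rewrite (_ : (fun w => _) = f)//; apply/funext => w; rewrite mul1r.
have fle n : \int[P]_w f w <= 2 * n.+1%:R^-1 + \int[P]_w g n w.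
  rewrite (le_trans (switching_ineq n (N n) (eps0 n)))//.
  rewrite (Rintegral_sum _ measurableT (ig n)) lerD2r.
  have -> : 2 / n.+1%:R = n.+1%:R^-1 + n.+1%:R^-1 :> R by rewrite mulr_natl mulr2n.
  apply: lerD; first exact: hN.
  rewrite (_ : _ * (_ * _ * _ * _) = eps n * (2 * k0 n)); last by rewrite /k0; ring.
  by rewrite mulrAC ler_pdivrMr// ler_wpM2l ?invr_ge0// lerDr.
have f_le0 : \int[P]_w f w <= 0.
  have hc : 2 * n.+1%:R^-1 + \int[P]_w g n w @[n --> \oo] --> (2 * 0 + 0 : R).
    by apply: cvgD cg; apply: cvgMr; exact: cvg_harmonic.
  rewrite -[leRHS](_ : 2 * 0 + 0 = 0); last by rewrite mulr0 addr0.
  rewrite -(cvg_lim (@Rhausdorff R) hc); apply: limr_ge; first by apply/cvg_ex; eexists; exact: hc.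
  by near=> n; exact: fle.
have fe : \int[P]_w f w = 0.
  by apply/eqP; rewrite eq_le f_le0 Rintegral_ge0.
apply: filterS (Rintegral_ge0_eq0 fi f0 fe) => w /eqP; rewrite mulf_eq0.
by rewrite gt_eqF ?expR_gt0//= => /eqP/psi_eq0.
Unshelve. all: by end_near. Qed.

End switching.

(** * Gaussian moments *)

Section density.
Context d (T : measurableType d) (R : realType).
Variables (mu nu : {measure set T -> \bar R}) (p : T -> R).
Hypotheses (p0 : forall x, 0 <= p x) (mp : measurable_fun setT p)
  (nuE : forall U, measurable U -> nu U = (\int[mu]_(x in U) (p x)%:E)%E).

Import HBNNSimple.

Let integral_density_nnsfun (f : {nnsfun T >-> R}) :
  (\int[nu]_x (f x)%:E = \int[mu]_x ((f x)%:E * (p x)%:E))%E.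
Proof.
under [in LHS]eq_integral do rewrite fimfunE -fsumEFin//.
rewrite ge0_integral_fsum//; last 2 first.
  - by move=> r; exact/measurable_EFinP/measurableT_comp.
  - by move=> r z _; rewrite EFinM nnfun_muleindic_ge0.
transitivity (\int[mu]_x (\sum_(r \in range f)
    (r * \1_(f @^-1` [set r]) x)%:E * (p x)%:E))%E; last first.
  apply: eq_integral => x _; rewrite [in RHS]fimfunE -fsumEFin//.
  by rewrite -ge0_mule_fsuml// => r; rewrite EFinM nnfun_muleindic_ge0.
rewrite ge0_integral_fsum//; last 2 first.
  - move=> r; apply: emeasurable_funM; last exact/measurable_EFinP.
    exact/measurable_EFinP/measurableT_comp.
  - move=> r z _; rewrite mule_ge0 ?lee_fin//.
    by have := nnfun_muleindic_ge0 f r z; rewrite -EFinM lee_fin.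
apply: eq_fsbigr => r _.
have [r0|r0] := leP 0 r; last first.
  rewrite integral0_eq => [|x _]; last by rewrite preimage_nnfun0// indic0 mulr0.
  by rewrite integral0_eq// => x _; rewrite preimage_nnfun0// indic0 mulr0 mul0e.
under eq_integral do rewrite EFinM.
rewrite ge0_integralZl//; last exact/measurable_EFinP.
rewrite integral_indic// setIT nuE//.
rewrite [X in _ = X](_ : _ = \int[mu]_x (r%:E * ((\1_(f @^-1` [set r]) x)%:E * (p x)%:E)))%E;
  last by apply: eq_integral => x _; rewrite EFinM muleA.
rewrite ge0_integralZl//.
- congr (_ * _)%E; rewrite integral_mkcond; apply: eq_integral => x _.
  by rewrite patchE indicE; case: ifPn; rewrite ?mul1e ?mul0e.
- apply: emeasurable_funM; last exact/measurable_EFinP.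
  exact/measurable_EFinP.
- by move=> x _; rewrite mule_ge0 ?lee_fin.
Qed.

Lemma integral_density (f : T -> \bar R) : (forall x, 0 <= f x)%E ->
  measurable_fun setT f ->
  (\int[nu]_x f x = \int[mu]_x (f x * (p x)%:E))%E.
Proof.
move=> f0 mf; pose f_ := nnsfun_approx measurableT mf.
transitivity (\int[nu]_x (lim ((f_ n x)%:E @[n --> \oo])))%E.
  by apply/eq_integral => z _; apply/esym/cvg_lim => //=; exact: cvg_nnsfun_approx.
rewrite monotone_convergence//; last 3 first.
  by move=> n; exact/measurable_EFinP.
  by move=> n z _; rewrite lee_fin.
  by move=> z _ a b ab; rewrite lee_fin; exact/lefP/nd_nnsfun_approx.
under [in LHS]eq_fun do rewrite integral_density_nnsfun.
rewrite -monotone_convergence//; last 3 first.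
  by move=> n; apply: emeasurable_funM; exact/measurable_EFinP.
  by move=> n z _; rewrite mule_ge0 ?lee_fin.
  move=> z _ a b ab; rewrite lee_wpmul2r ?lee_fin//.
  exact/lefP/nd_nnsfun_approx.
apply: eq_integral => z _; apply/cvg_lim => //.
apply: cvgeZr => //; exact: cvg_nnsfun_approx.
Qed.

End density.

Section normal_moments.
Context (R : realType).
Implicit Types (s x : R).
Local Notation mu := (@lebesgue_measure R).

Let msqr : measurable_fun [set: measurableTypeR R] (fun x : measurableTypeR R => (x : R) ^+ 2).
Proof. exact: measurable_funX. Qed.

Let mabs : measurable_fun [set: measurableTypeR R] (fun x : measurableTypeR R => `|x : R|).
Proof. exact: normr_measurable. Qed.

Lemma normal_pdf_scale s x : 0 < s -> s * normal_pdf 0 s (s * x) = normal_pdf 0 1 x.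
Proof.
move=> s0; rewrite !normal_pdfE ?gt_eqF// mulrA; congr (_ * _).
  rewrite /normal_peak expr1n mul1r -mulrnAr sqrtrM ?sqr_ge0//.
  by rewrite sqrtr_sqr (gtr0_norm s0) invfM mulrA divff ?mul1r// gt_eqF.
rewrite /normal_fun !subr0 expr1n; congr expR.
rewrite exprMn -mulr_natr -[1 *+ 2]mulr_natr mul1r.
by field; rewrite gt_eqF.
Qed.

Lemma integral_normal_prob s (f : R -> R) : (forall x, 0 <= f x) -> measurable_fun setT f ->
  (\int[normal_prob 0 s]_x (f x)%:E = \int[mu]_x (f x * normal_pdf 0 s x)%:E)%E.
Proof.
move=> f0 mf; rewrite (@integral_density _ _ _ mu _ (normal_pdf 0 s)) => //.
- exact: normal_pdf_ge0.
- exact: measurable_normal_pdf.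
- exact/measurable_EFinP.
Qed.

(** The substitution of s x for x, with [normal_pdf_scale], reduces every variance to the standard
    one. *)
Lemma integral_normal_prob_sqr s : 0 < s ->
  (\int[normal_prob 0 s]_x (x ^+ 2)%:E =
   (s ^+ 2)%:E * \int[normal_prob 0 1]_x (x ^+ 2)%:E)%E.
Proof.
move=> s0.
have m2 : measurable_fun setT (fun x : R => x ^+ 2) by exact: measurable_funX.
rewrite !integral_normal_prob// => [|x|x]; rewrite ?sqr_ge0//.
have dF (x : R) : is_derive x 1 ( *%R s : R -> R) s.
  rewrite (_ : *%R s = s \*: id); last by apply/funext.
  by apply: is_derive_eq; exact: mulr1.
have F' : derive1 ( *%R s : R -> R) = cst s.
  by apply/funext => x; rewrite derive1E; apply: derive_val.
rewrite (@increasing_ge0_integration_by_substitutionT R ( *%R s)).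
- rewrite F' -ge0_integralZl//=.
  + apply: eq_integral => x _; rewrite /= -EFinM; congr (_%:E).
    change ((s * x) ^+ 2 * normal_pdf 0 s (s * x) * s = s ^+ 2 * (x ^+ 2 * normal_pdf 0 1 x)).
    by rewrite -(normal_pdf_scale x s0); ring.
  + apply/measurable_EFinP/measurable_funM => //; exact: measurable_normal_pdf.
  + by move=> x _; rewrite lee_fin mulr_ge0 ?sqr_ge0 ?normal_pdf_ge0.
  + by rewrite lee_fin sqr_ge0.
- by move=> x y xy; rewrite ltr_pM2l.
- by rewrite F' => ?; exact: cvg_cst.
- by rewrite F'; exact: is_cvg_cst.
- by rewrite F'; exact: is_cvg_cst.
- by move=> x; exact: ex_derive.
- by apply/gt0_cvgMrNy => //; exact: cvg_id.
- by apply/gt0_cvgMry => //; exact: cvg_id.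
- move=> x; apply: cvgM; first exact: exprn_continuous.
  by apply: continuous_normal_pdf; rewrite gt_eqF.
- by move=> x; rewrite mulr_ge0 ?sqr_ge0 ?normal_pdf_ge0.
Qed.

Lemma normal_prob_sqr_fin : (\int[normal_prob 0 1]_x ((x : R) ^+ 2)%:E < +oo)%E.
Proof.
have m2 : measurable_fun setT (fun x : R => x ^+ 2) by exact: measurable_funX.
rewrite integral_normal_prob// => [|x]; last exact: sqr_ge0.
(* x^2 exp(-x^2/2) is dominated by a multiple of the Gaussian density of variance 2, since x^2
   exp(-x^2/4) <= 4; the peaks are the normalising factors. *)
pose c : R := 4 * normal_peak 1 / normal_peak (Num.sqrt 2).
have s2 : Num.sqrt 2 != 0 :> R by rewrite gt_eqF// sqrtr_gt0.
have p2 := normal_peak_gt0 s2.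
have p1 := normal_peak_gt0 (oner_neq0 R).
have c0 : 0 <= c by rewrite divr_ge0 ?mulr_ge0// ltW.
apply: (@le_lt_trans _ _ (\int[mu]_x (c * normal_pdf 0 (Num.sqrt 2) x)%:E)%E).
  apply: ge0_le_integral => //.
  - by move=> x _; rewrite lee_fin mulr_ge0 ?sqr_ge0 ?normal_pdf_ge0.
  - by apply/measurable_EFinP/measurable_funM => //; exact: measurable_normal_pdf.
  - by apply/measurable_EFinP/measurable_funM => //; exact: measurable_normal_pdf.
  move=> x _; rewrite lee_fin !normal_pdfE ?oner_neq0// /normal_fun !subr0 expr1n.
  rewrite sqr_sqrtr// /c -[2 *+ 2]/(2 + 2).
  have -> : - x ^+ 2 / 2 = - x ^+ 2 / (2 + 2) + - (x ^+ 2 / 4) by field.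
  rewrite expRD; set e := expR _; set g := expR (- (x ^+ 2 / 4)).
  have e0 : 0 <= e := expR_ge0 _.
  have hg : x ^+ 2 * g <= 4.
    rewrite /g expRN ler_pdivrMr ?expR_gt0// mulrC -ler_pdivrMr//.
    by rewrite (le_trans _ (expR_ge1Dx _))// lerDr.
  move: p1 p2 hg; move: g (normal_peak 1) (normal_peak (Num.sqrt 2)) => g' q q' q0 q'0 hg.
  have -> : 4 * q / q' * (q' * e) = (q * e) * 4 by field; rewrite gt_eqF.
  have -> : x ^+ 2 * (q * (e * g')) = (q * e) * (x ^+ 2 * g') by ring.
  by rewrite ler_wpM2l// mulr_ge0// ltW.
under eq_integral do rewrite EFinM.
rewrite ge0_integralZl//.
- by rewrite integral_normal_pdf mule1 ltry.
- by apply/measurable_EFinP; exact: measurable_normal_pdf.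
- by move=> x _; rewrite lee_fin normal_pdf_ge0.
Qed.

(** Otherwise the law would be concentrated at 0, which is impossible for a probability dominated by
    Lebesgue measure. *)
Lemma normal_prob_sqr_gt0 : (0 < \int[normal_prob 0 1]_x ((x : R) ^+ 2)%:E)%E.
Proof.
rewrite lt_neqAle; apply/andP; split; last by apply: integral_ge0 => x _; rewrite lee_fin sqr_ge0.
apply/eqP => /esym e0.
have m2 : measurable_fun setT (fun x : R => (x ^+ 2)%:E) by apply/measurable_EFinP/measurable_funX.
have := ae_eq_integral_abs (normal_prob 0 1) measurableT m2.
under eq_integral do rewrite gee0_abs ?lee_fin ?sqr_ge0//.
rewrite e0 => -[/(_ erefl)[N [mN N0 sN]] _].
have : (normal_prob 0 1 ([set: R] `\` [set (0%R : R)]) = 0)%E.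
  apply/eqP; rewrite -measure_le0 -N0 le_measure ?inE//; first exact: measurableD.
  move=> x [_ /= x0]; apply: sN => /= /(_ Logic.I) /= [] /eqP.
  by rewrite sqrf_eq0 => /eqP.
have z0 : (normal_prob 0 1 [set (0%R : R)] = 0)%E.
  have /null_content_dominatesP := @normal_prob_dominates R 0 1.
  by apply => //; exact: lebesgue_measure_set1.
move=> h; have : (normal_prob 0 1 [set: R] = 0)%E.
  rewrite -(setDUK (subsetT [set (0%R : R)])) measureU//.
  - by transitivity (0 + 0 : \bar R)%E; [congr (_ + _)%E; [exact: z0|exact: h]|exact: adde0].
  - exact: measurableD.
  - by rewrite setDIK.
by move/eqP; rewrite probability_setT onee_eq0.
Qed.

(** The second moment of N(0, 1), kept as an abstract constant: scaling, finiteness and positivity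
    carry the isometry. *)
Definition normal_var : R := fine (\int[normal_prob 0 1]_x ((x : R) ^+ 2)%:E)%E.

Lemma normal_var_gt0 : 0 < normal_var.
Proof. by rewrite fine_gt0// normal_prob_sqr_gt0 normal_prob_sqr_fin. Qed.

Lemma normal_varE s : 0 < s ->
  (\int[normal_prob 0 s]_x (x ^+ 2)%:E = (s ^+ 2 * normal_var)%:E)%E.
Proof.
move=> s0; rewrite integral_normal_prob_sqr// [in RHS]EFinM /normal_var fineK//.
by rewrite ge0_fin_numE ?normal_prob_sqr_fin// ltW// normal_prob_sqr_gt0.
Qed.

Lemma Rintegrable_normal_sqr s : 0 < s -> Rintegrable (normal_prob 0 s) setT (fun x => x ^+ 2).
Proof.
move=> s0; apply: (ge0_Rintegrable _ msqr) => // [x _|]; first exact: sqr_ge0.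
by rewrite normal_varE// ltry.
Qed.

Lemma Rintegrable_normal_id s : 0 < s -> Rintegrable (normal_prob 0 s) setT id.
Proof.
move=> s0; have i1 : Rintegrable (normal_prob 0 s) setT (fun x => 1 + x ^+ 2).
  by apply: RintegrableD (Rintegrable_normal_sqr s0) => //; exact: finite_measure_integrable_cst.
by apply: (Rintegrable_le _ _ _ i1) => // x _; exact: norm_le_one_sq.
Qed.

(** The density is even, so the integral of |x| is twice that of the positive part; it is also the
    sum of those of the two parts, which are therefore equal. *)
Lemma normal_mean s : 0 < s -> \int[normal_prob 0 s]_x x = 0.
Proof.
move=> s0; have ii := Rintegrable_normal_id s0.
have sN := gt_eqF s0.
pose pos (x : R) := Num.max x 0; pose neg (x : R) := Num.max (- x) 0.
have mpos : measurable_fun setT pos by apply: measurable_maxr.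
have mneg : measurable_fun setT neg by apply: measurable_maxr => //; exact: measurable_oppr.
have pos0 x : 0 <= pos x by rewrite /pos le_max lexx orbT.
have neg0 x : 0 <= neg x by rewrite /neg le_max lexx orbT.
have ipos : Rintegrable (normal_prob 0 s) setT pos.
  apply: (Rintegrable_le _ _ _ (Rintegrable_abs _ ii)) => // x _.
  by rewrite ger0_norm// /pos ge_max ler_norm normr_ge0.
have ineg : Rintegrable (normal_prob 0 s) setT neg.
  apply: (Rintegrable_le _ _ _ (Rintegrable_abs _ ii)) => // x _.
  by rewrite ger0_norm// /neg ge_max -normrN ler_norm normr_ge0.
have -> : \int[normal_prob 0 s]_x x = \int[normal_prob 0 s]_x (pos x - neg x).
  by apply: eq_Rintegral => x _; rewrite /pos /neg; case: (leP x 0) => h; case: (leP (- x) 0) => h'; lra.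
rewrite RintegralB//; apply/eqP; rewrite subr_eq0 /Rintegral; apply/eqP; congr fine.
pose f (x : R) := `|x| * normal_pdf 0 s x.
have f0 x : 0 <= f x by rewrite mulr_ge0 ?normal_pdf_ge0.
have cf : continuous f.
  move=> x; apply: cvgM; first exact: norm_continuous.
  by apply: continuous_normal_pdf; rewrite sN.
have mf : measurable_fun setT f by exact: continuous_measurable_fun.
have fe : f =1 f \o -%R.
  by move=> x; rewrite /f/= normrN !normal_pdfE ?sN// /normal_fun !subr0 sqrrN.
have abs_fin : (\int[mu]_x (f x)%:E < +oo)%E.
  rewrite -(integral_normal_prob s (@normr_ge0 _ _) mabs).
  have /integrableP[_] := Rintegrable_abs measurableT ii.
  by under eq_integral do rewrite /= ger0_norm//.
rewrite !integral_normal_prob//.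
have sym := ge0_symfun_integralT f0 cf fe.
have hpos : (\int[mu]_x (pos x * normal_pdf 0 s x)%:E =
    \int[mu]_(x in [set x | (0 <= x)%R]) (f x)%:E)%E.
  rewrite [RHS]integral_mkcond; apply: eq_integral => x _; rewrite patchE /pos /f.
  case: ifPn; rewrite ?inE ?notin_setE/= => x0.
    by rewrite max_l// ger0_norm.
  by rewrite max_r ?mul0r// ltW// ltNge; exact/negP.
have hsum : (\int[mu]_x (f x)%:E = \int[mu]_x (pos x * normal_pdf 0 s x)%:E
    + \int[mu]_x (neg x * normal_pdf 0 s x)%:E)%E.
  rewrite -ge0_integralD//; last 4 first.
  - by move=> x _; rewrite lee_fin mulr_ge0 ?normal_pdf_ge0.
  - by apply/measurable_EFinP/measurable_funM => //; exact: measurable_normal_pdf.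
  - by move=> x _; rewrite lee_fin mulr_ge0 ?normal_pdf_ge0.
  - by apply/measurable_EFinP/measurable_funM => //; exact: measurable_normal_pdf.
  apply: eq_integral => x _; rewrite -EFinD; congr (_%:E); rewrite -mulrDl; congr (_ * _).
  have /orP[h|h] := le_total 0 (x : R); rewrite /pos /neg.
    by rewrite (ger0_norm h) max_l// max_r ?oppr_le0// addr0.
  by rewrite (ler0_norm h) max_r// max_l ?oppr_ge0// add0r.
rewrite -hpos hsum in sym; rewrite hsum in abs_fin.
have p0 : (0 <= \int[mu]_x (pos x * normal_pdf 0 s x)%:E)%E.
  by apply: integral_ge0 => x _; rewrite lee_fin mulr_ge0 ?normal_pdf_ge0.
have n0 : (0 <= \int[mu]_x (neg x * normal_pdf 0 s x)%:E)%E.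
  by apply: integral_ge0 => x _; rewrite lee_fin mulr_ge0 ?normal_pdf_ge0.
move: p0 n0 sym abs_fin; move: (integral _ _ _) (integral _ _ _) => [a| |] [b'| |]//.
by rewrite -!EFinD => _ _ [h] _; congr (_%:E); lra.
Qed.

End normal_moments.

(** * Sigma-algebras, independence and the filtration *)

Section pi_system.
Context (R : realType) d (Omega : measurableType d) (P : probability Omega R).
Implicit Types (G : set (set Omega)) (V : Omega -> R).

Lemma Rintegral_setC (B : set Omega) V : measurable B -> Rintegrable P setT V ->
  \int[P]_(w in ~` B) V w = \int[P]_w V w - \int[P]_(w in B) V w.
Proof.
move=> mB iV; have mC := measurableC mB.
have -> : \int[P]_w V w = \int[P]_(w in B) V w + \int[P]_(w in ~` B) V w.
  by rewrite -Rintegral_setU ?setUv//; exact/disj_setPCl.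
by rewrite addrAC subrr add0r.
Qed.

Lemma Rintegral_bigcup0 (B : (set Omega)^nat) V : (forall n, measurable (B n)) ->
  trivIset setT B -> Rintegrable P setT V -> (forall n, \int[P]_(w in B n) V w = 0) ->
  \int[P]_(w in \bigcup_n B n) V w = 0.
Proof.
move=> mB tB iV oB; rewrite /Rintegral integral_bigcup//; last first.
  by apply: integrableS iV => //; exact: bigcup_measurable.
rewrite eseries0// => k _ _.
by rewrite -EFin_Rintegral ?oB//; apply: integrableS iV.
Qed.

(** Dynkin's theorem; complements are covered because the whole space belongs to G and so has
    integral 0. *)
Lemma Rintegral_orth_pi G V : G `<=` measurable -> setI_closed G -> G setT ->
  Rintegrable P setT V -> (forall B, G B -> \int[P]_(w in B) V w = 0) ->
  forall B, <<s G>> B -> \int[P]_(w in B) V w = 0.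
Proof.
move=> Gm GI GT iV orth.
have sGm B : <<s G>> B -> measurable B.
  exact: (smallest_sub (@sigma_algebra_measurable _ Omega) Gm).
apply: (@dynkin_induction _ (g_sigma_algebraType G) G) => //.
- exact: orth.
- by move=> B sB oB; rewrite (Rintegral_setC (sGm _ sB) iV) oB (orth _ GT) subrr.
- by move=> B sB tB oB; apply: Rintegral_bigcup0 => // n; apply: sGm; exact: sB.
Qed.

(** On B the variable X has law P(B) nu: P is restricted to B through a density, pushed forward
    along X, and the two measures are compared on measurable sets. *)
Lemma indep_integral_ge0 (B : set Omega) (X : Omega -> R)
    (nu : probability (measurableTypeR R) R) (g : R -> R) :
  measurable B -> measurable_fun setT X ->
  (forall C : set R, measurable C -> P (B `&` X @^-1` C) = P B * nu C)%E ->
  (forall x, 0 <= g x) -> measurable_fun [set: measurableTypeR R] (g : measurableTypeR R -> R) ->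
  (\int[P]_(w in B) (g (X w))%:E = P B * \int[nu]_x (g x)%:E)%E.
Proof.
move=> mB mX ind g0 mg.
have fB : P B \is a fin_num by exact: fin_num_measure.
have cB : 0 <= fine (P B) by exact: fine_ge0.
transitivity (\int[mrestr P mB]_w (g (X w))%:E)%E.
  have m1 : measurable_fun setT (\1_B : Omega -> R) by exact: measurable_indic.
  rewrite (@integral_density _ _ _ P _ (\1_B)) => //.
  - rewrite [LHS]integral_mkcond; apply: eq_integral => w _.
    by rewrite patchE indicE; case: ifPn; rewrite ?mule1 ?mule0.
  - move=> U mU; rewrite /mrestr integral_indic//; first by rewrite setIC.
  - by move=> w; rewrite lee_fin.
  - by apply/measurable_EFinP; exact: measurableT_comp.
have mX' : measurable_fun setT (X : Omega -> measurableTypeR R) by exact: mX.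
have mg' : measurable_fun setT (fun x : measurableTypeR R => (g x)%:E).
  exact/measurable_EFinP.
have g0' : {in (setT : set (measurableTypeR R)), forall x, 0 <= (g x)%:E}%E.
  by move=> x _; rewrite lee_fin.
rewrite -(ge0_integral_pushforward mX' (mrestr P mB) measurableT mg' g0').
have -> : P B = (NngNum cB)%:num%:E by rewrite /= fineK.
rewrite -ge0_integral_mscale//; last by move=> x _; rewrite lee_fin.
apply: eq_measure_integral => C mC _.
by change (P (X @^-1` C `&` B) = (fine (P B))%:E * nu C)%E; rewrite fineK// setIC ind.
Qed.

Lemma indep_integral (B : set Omega) (X : Omega -> R)
    (nu : probability (measurableTypeR R) R) (g : R -> R) :
  measurable B -> measurable_fun setT X ->
  (forall C : set R, measurable C -> P (B `&` X @^-1` C) = P B * nu C)%E ->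
  Rintegrable nu setT g ->
  Rintegrable P B (fun w => g (X w)) /\
  \int[P]_(w in B) g (X w) = fine (P B) * \int[nu]_x g x.
Proof.
move=> mB mX ind ig.
have mg := Rintegrable_measurable ig.
pose pos (x : R) := Num.max (g x) 0; pose neg (x : R) := Num.max (- g x) 0.
have mpos : measurable_fun [set: measurableTypeR R] (pos : measurableTypeR R -> R).
  by apply: measurable_maxr.
have mneg : measurable_fun [set: measurableTypeR R] (neg : measurableTypeR R -> R).
  by apply: measurable_maxr => //; exact: measurableT_comp.
have pos0 x : 0 <= pos x by rewrite /pos le_max lexx orbT.
have neg0 x : 0 <= neg x by rewrite /neg le_max lexx orbT.
have ipos : Rintegrable nu setT pos.
  apply: (Rintegrable_le _ _ _ (Rintegrable_abs _ ig)) => // x _.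
  by rewrite ger0_norm// /pos ge_max ler_norm normr_ge0.
have ineg : Rintegrable nu setT neg.
  apply: (Rintegrable_le _ _ _ (Rintegrable_abs _ ig)) => // x _.
  by rewrite ger0_norm// /neg ge_max -normrN ler_norm normr_ge0.
have gE x : g x = pos x - neg x.
  have /orP[h|h] := le_total 0 (g x); rewrite /pos /neg.
    by rewrite max_l// max_r ?oppr_le0// subr0.
  by rewrite max_r// max_l ?oppr_ge0// sub0r opprK.
have fB : P B \is a fin_num by exact: fin_num_measure.
have key h : (forall x, 0 <= h x) -> Rintegrable nu setT h ->
    Rintegrable P B (fun w => h (X w)) /\
    \int[P]_(w in B) h (X w) = fine (P B) * \int[nu]_x h x.
  move=> h0 ih; have mh := Rintegrable_measurable ih.
  have E := indep_integral_ge0 mB mX ind h0 mh.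
  have fh : (\int[nu]_x (h x)%:E)%E = (\int[nu]_x h x)%:E by rewrite EFin_Rintegral.
  rewrite fh -(fineK fB) -EFinM in E; split; last by rewrite {1}/Rintegral E.
  apply: ge0_Rintegrable => //; last by rewrite E ltry.
  by apply: measurable_funTS; exact: measurableT_comp.
have [i1 e1] := key _ pos0 ipos; have [i2 e2] := key _ neg0 ineg.
have -> : (fun w => g (X w)) = (fun w => pos (X w) - neg (X w)).
  by apply/funext => w; rewrite gE.
split; first exact: RintegrableB.
rewrite (RintegralB mB i1 i2) e1 e2 -mulrBr -(RintegralB measurableT ipos ineg).
by congr (_ * _); apply: eq_Rintegral => x _; rewrite gE.
Qed.

(** H is truncated to [-n, n] so that the bounded case applies, and |H V| <= H^2 + V^2 provides the
    domination. *)
Lemma Rintegral_orth_L2 (G : set (set Omega)) (V H : Omega -> R) :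
  G `<=` measurable -> measurable_fun setT V ->
  Rintegrable P setT (fun w => V w ^+ 2) ->
  (forall B, <<s G>> B -> \int[P]_(w in B) V w = 0) ->
  measurable_fun [set: g_sigma_algebraType G] (H : g_sigma_algebraType G -> R) ->
  Rintegrable P setT (fun w => H w ^+ 2) ->
  Rintegrable P setT (fun w => H w * V w) /\ \int[P]_w (H w * V w) = 0.
Proof.
move=> Gm mV V2 oV mH H2.
have sGm : <<s G>> `<=` measurable.
  exact: (smallest_sub (@sigma_algebra_measurable _ Omega) Gm).
have mHO : measurable_fun setT H by exact: (sub_measurable_fun sGm).
have iV : Rintegrable P setT V.
  have i1 : Rintegrable P setT (fun w => 1 + V w ^+ 2).
    by apply: RintegrableD V2 => //; exact: finite_measure_integrable_cst.
  by apply: (Rintegrable_le _ _ _ i1) => // w _; exact: norm_le_one_sq.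
pose h (n : nat) w := Num.max (- n%:R) (Num.min (H w) n%:R).
have hn n w : `|h n w| <= n%:R.
  rewrite ler_norml /h le_max lexx/= ge_max ge_min lexx orbT andbT.
  by rewrite (le_trans _ (ler0n _ _))// oppr_le0.
have hH n w : `|h n w| <= `|H w|.
  rewrite /h; have n0 := ler0n R n; have [H0|H0] := leP 0 (H w).
    rewrite max_r; last by rewrite le_min (le_trans _ H0) ?oppr_le0//= (le_trans _ n0)// oppr_le0.
    by rewrite !ger0_norm ?ge_min ?lexx// le_min H0.
  rewrite min_l; last by rewrite (le_trans (ltW H0)).
  rewrite (ltr0_norm H0) ler0_norm; last by rewrite ge_max oppr_le0 n0 ltW.
  by rewrite lerN2 le_max lexx orbT.
have mh n : measurable_fun [set: g_sigma_algebraType G] (h n : g_sigma_algebraType G -> R).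
  by apply: measurable_maxr => //; exact: measurable_minr.
have orth n := @Rintegral_orth _ _ _ P G sGm V (h n) n%:R iV oV (mh n) (hn n).
have iD : Rintegrable P setT (fun w => H w ^+ 2 + V w ^+ 2) by exact: RintegrableD.
have [] := @Rdominated_cvg _ _ _ P (fun n w => h n w * V w) (fun w => H w * V w) _ _ _ _ iD.
- by move=> n; exact: Rintegrable_measurable (orth n).1.
- move=> w; apply: cvgMl; apply: cvg_near_cst.
  near=> n; have nH : `|H w| <= n%:R by near: n; exact: nbhs_infty_ger.
  by move: nH; rewrite ler_norml /h => /andP[h1 h2]; rewrite min_l// max_r.
- move=> n w; rewrite normrM (le_trans (ler_wpM2r _ (hH n w)))//.
  rewrite -(real_normK (num_real (H w))) -(real_normK (num_real (V w))).
  have := sqr_ge0 (`|H w| - `|V w|); rewrite sqrrB.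
  have := mulr_ge0 (normr_ge0 (H w)) (normr_ge0 (V w)).
  by move: (`|H w| * `|V w|) (`|H w| ^+ 2) (`|V w| ^+ 2) => *; lra.
- exact: measurable_funM.
move=> iHV cv; split=> //.
have c0 : \int[P]_w (h n w * V w) @[n --> \oo] --> (0 : R).
  by under eq_fun do rewrite (orth _).2; exact: cvg_cst.
by rewrite -(cvg_lim (@Rhausdorff R) cv) (cvg_lim (@Rhausdorff R) c0).
Unshelve. all: by end_near. Qed.

End pi_system.

Section filtration.
Context (R : realType) dO (Omega : measurableType dO) (P : probability Omega R).
Context (E : ptopologicalType) (dim : nat) (N : noise R Omega E dim).
Local Notation W := (wiener N).
Local Notation tau := (jump_time N).
Local Notation zeta := (mark N).
Local Notation F := (filt P N).
Hypotheses (hW : is_wiener P N) (hp : is_marked_point_process P N)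
  (hI : independent_noise P N).

Definition atom_value (f : R * borelType E -> \bar R) (w : Omega) (n : nat) : \bar R :=
  if tau n w is r%:E then f (r, zeta n w) else 0%E.

Lemma measurable_atom_value d (U : measurableType d) (i : U -> Omega)
    (f : U -> R * borelType E -> \bar R) n :
  measurable_fun setT (fun w => tau n (i w)) ->
  measurable_fun setT ((fun w => zeta n (i w)) : U -> borelType E) ->
  measurable_fun setT (fun x : U * (R * borelType E) => f x.1 x.2) ->
  measurable_fun setT (fun w => atom_value (f w) (i w) n).
Proof.
move=> mt mz mf.
have -> : (fun w => atom_value (f w) (i w) n) = (fun w =>
    if tau n (i w) \is a fin_num then f w (fine (tau n (i w)), zeta n (i w)) else 0%E).
  by apply/funext => w; rewrite /atom_value; case: (tau n (i w)).
apply: measurable_fun_ifT => //.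
- apply: (@measurable_fun_bool _ _ _ _ true).
  rewrite (_ : _ `&` _ = setT `&` (fun w => tau n (i w)) @^-1` [set x | x \is a fin_num]).
    exact: emeasurable_fin_num.
  by apply/seteqP; split.
- have h : measurable_fun setT ((fun w => (w, (fine (tau n (i w)), zeta n (i w))))
      : U -> U * (R * borelType E)).
    apply: measurable_fun_pair => //; apply: measurable_fun_pair => //.
    exact: measurableT_comp.
  exact: (measurableT_comp mf h).
Qed.

Lemma jump_atom_integral (D : set (R * borelType E)) (f : R * borelType E -> \bar R) w n :
  measurable D -> measurable_fun D f ->
  (\int[jump_atom N w n]_(z in D) f z =
   atom_value (fun z => (\1_D z)%:E * f z) w n)%E.
Proof.
move=> mD mf; rewrite /jump_atom /atom_value; case: (tau n w) => [r| |].
- by rewrite integral_dirac.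
- by rewrite integral_measure_zero.
- by rewrite integral_measure_zero.
Qed.

(** The index 0 is not a jump time; the series is shifted by one before the integral is split over
    the sum of measures. *)
Lemma jump_measure_integral (D : set (R * borelType E)) (f : R * borelType E -> \bar R) w :
  measurable D -> measurable_fun D f -> (forall z, D z -> 0 <= f z)%E ->
  (\int[jump_measure N w]_(z in D) f z =
   \sum_(1 <= n <oo) atom_value (fun z => (\1_D z)%:E * f z) w n)%E.
Proof.
move=> mD mf f0; rewrite /jump_measure.
under eq_eseriesr do rewrite -jump_atom_integral//.
have f0' n : (0 <= \int[jump_atom N w n]_(z in D) f z)%E by apply: integral_ge0.
rewrite -nneseries_addn//.
rewrite -(ge0_integral_measure_series (fun n => jump_atom N w (n + 1)) mD f0 mf).
apply: eq_measure_integral => A mA _.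
by rewrite /= /mseries -nneseries_addn.
Qed.

Lemma measurable_atom_sum d (U : measurableType d) (i : U -> Omega)
    (f : U -> R * borelType E -> \bar R) :
  (forall n, measurable_fun setT (fun w => tau n.+1 (i w))) ->
  (forall n, measurable_fun setT ((fun w => zeta n.+1 (i w)) : U -> borelType E)) ->
  (forall w z, 0 <= f w z)%E ->
  measurable_fun setT (fun x : U * (R * borelType E) => f x.1 x.2) ->
  measurable_fun setT (fun w => \sum_(1 <= n <oo) atom_value (f w) (i w) n)%E.
Proof.
move=> mt mz f0 mf.
have f0' n w : (0 <= atom_value (f w) (i w) n)%E by rewrite /atom_value; case: (tau n _).
have -> : (fun w => \sum_(1 <= n <oo) atom_value (f w) (i w) n)%E =
    (fun w => \sum_(n <oo) atom_value (f w) (i w) (n + 1))%E.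
  by apply/funext => w; rewrite nneseries_addn.
apply: ge0_emeasurable_sum => [n w _ _|n _]; first exact: f0'.
by rewrite addn1; exact: measurable_atom_value.
Qed.

Lemma jump_measureE w D : measurable D ->
  jump_measure N w D = (\sum_(1 <= n <oo) atom_value (fun z => (\1_D z)%:E) w n)%E.
Proof.
move=> mD; rewrite /jump_measure /= /mseries; apply: eq_eseriesr => n _.
by rewrite /jump_atom /atom_value; case: (tau n w).
Qed.

Lemma jump_events_mpp t : jump_events N t `<=` <<s mpp_events N>>.
Proof.
move=> S [s [C [B [_ mC mB ->]]]].
pose U := g_sigma_algebraType (mpp_events N).
have mD : measurable (`]0, s] `*` C : set (R * borelType E)) by exact: measurableX.
have h : measurable_fun setT ((fun w => jump_measure N w (`]0, s] `*` C)) : U -> \bar R).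
  have -> : (fun w => jump_measure N w (`]0, s] `*` C)) = (fun w =>
      \sum_(1 <= n <oo) atom_value (fun z => (\1_(`]0, s] `*` C) z)%:E) w n)%E.
    by apply/funext => w; rewrite jump_measureE.
  apply: (@measurable_atom_sum _ U id (fun _ z => (\1_(`]0, s] `*` C) z)%:E)).
  - by move=> n _ A mA; rewrite setTI; apply: sub_sigma_algebra; left; exists n, A.
  - by move=> n _ A mA; rewrite setTI; apply: sub_sigma_algebra; right; exists n, A.
  - by move=> w z; rewrite lee_fin indicE.
  - apply/measurable_EFinP; apply: measurableT_comp => //; exact: measurable_indic.
by have := h measurableT B mB; rewrite setTI.
Qed.

Lemma mpp_events_measurable : <<s mpp_events N>> `<=` measurable.
Proof.
have [mt mz _ _] := hp.
apply: smallest_sub; first exact: sigma_algebra_measurable.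
move=> S [[n [B [mB ->]]]|[n [C [mC ->]]]]; rewrite -[X in measurable X]setTI.
  exact: mt.
exact: mz.
Qed.

Lemma wiener_events_measurable t :
  <<s wiener_events N (`[0, t] : set R)>> `<=` measurable.
Proof.
have [mW _ _ _] := hW.
apply: smallest_sub; first exact: sigma_algebra_measurable.
move=> S [s [k [B [/= s0t mB ->]]]]; rewrite -[X in measurable X]setTI.
by apply: mW => //; move: s0t; rewrite in_itv/= => /andP[].
Qed.

Lemma null_filt t B : measurable B -> P B = 0%E -> <<s F t>> B.
Proof. by move=> mB B0; apply: sub_sigma_algebra; right. Qed.

(** A pi-system generating more than F_t: it contains the whole point process, future included.
    Independence of p and W allows this enlargement, and events of p then need no time
    bookkeeping. *)
Definition past_events (t : R) : set (set Omega) :=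
  [set B | (exists H1 H2, [/\ <<s wiener_events N (`[0, t] : set R)>> H1,
              <<s mpp_events N>> H2 & B = H1 `&` H2])
           \/ (measurable B /\ P B = 0%E)].

Lemma past_events_measurable t : past_events t `<=` measurable.
Proof.
move=> B [[H1 [H2 [h1 h2 ->]]]|[//]].
by apply: measurableI; [exact: wiener_events_measurable h1|exact: mpp_events_measurable].
Qed.

Lemma past_eventsI t : setI_closed (past_events t).
Proof.
move=> A B hA hB; have mA := past_events_measurable hA; have mB := past_events_measurable hB.
case: hA => [[H1 [H2 [h1 h2 eA]]]|[_ A0]]; last first.
  right; split; first exact: measurableI.
  by apply/eqP; rewrite -measure_le0 -A0 le_measure ?inE//; exact: measurableI.
case: hB => [[H1' [H2' [h1' h2' eB]]]|[_ B0]]; last first.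
  right; split; first exact: measurableI.
  by apply/eqP; rewrite -measure_le0 -B0 le_measure ?inE//; exact: measurableI.
left; exists (H1 `&` H1'), (H2 `&` H2'); split.
- exact: (@measurableI _ (g_sigma_algebraType (wiener_events N (`[0, t] : set R)))).
- exact: (@measurableI _ (g_sigma_algebraType (mpp_events N))).
- by rewrite eA eB setIACA.
Qed.

Lemma filt_past t : <<s F t>> `<=` <<s past_events t>>.
Proof.
apply: smallest_sub; first exact: smallest_sigma_algebra.
move=> S [[hS|hS]|hS]; apply: sub_sigma_algebra.
- left; exists S, setT; split; rewrite ?setIT//; first exact: sub_sigma_algebra.
  exact: (@measurableT _ (g_sigma_algebraType (mpp_events N))).
- left; exists setT, S; split; rewrite ?setTI//; last exact: jump_events_mpp hS.
  exact: (@measurableT _ (g_sigma_algebraType (wiener_events N (`[0, t] : set R)))).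
- by right.
Qed.

Lemma past_events_setT t : past_events t setT.
Proof.
left; exists setT, setT; split; rewrite ?setTI//.
  exact: (@measurableT _ (g_sigma_algebraType (wiener_events N (`[0, t] : set R)))).
exact: (@measurableT _ (g_sigma_algebraType (mpp_events N))).
Qed.

Lemma filt_sub t : <<s F t>> `<=` measurable.
Proof.
apply: (subset_trans (@filt_past t)); apply: smallest_sub.
  exact: sigma_algebra_measurable.
exact: past_events_measurable.
Qed.

Lemma filt_mono s t : 0 <= s -> s <= t -> <<s F s>> `<=` <<s F t>>.
Proof.
move=> s0 st; apply: smallest_sub; first exact: smallest_sigma_algebra.
move=> S [[hS|hS]|hS]; apply: sub_sigma_algebra.
- left; left; case: hS => u [k [B [/= us mB ->]]]; exists u, k, B; split => //=.
  move: us; rewrite !in_itv/= => /andP[-> us]; exact: le_trans st.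
- left; right; case: hS => u [C [B [/andP[u0 us] mC mB ->]]]; exists u, C, B; split => //.
  by rewrite u0 (le_trans us).
- by right.
Qed.

Lemma wiener_adapted s t (k : 'I_dim) : 0 <= s -> s <= t ->
  measurable_fun [set: g_sigma_algebraType (F t)]
    ((fun w => W s w ord0 k) : g_sigma_algebraType (F t) -> R).
Proof.
move=> s0 st _ B mB; rewrite setTI; apply: sub_sigma_algebra; left; left.
by exists s, k, B; split => //=; rewrite in_itv/= s0.
Qed.

Lemma wiener_meas s (k : 'I_dim) : 0 <= s -> measurable_fun setT (fun w => W s w ord0 k).
Proof. by have [mW _ _ _] := hW; exact: mW. Qed.

Lemma increment_meas s t (k : 'I_dim) : 0 <= s -> s <= t ->
  measurable_fun setT (fun w => W t w ord0 k - W s w ord0 k).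
Proof.
by move=> s0 st; apply: measurable_funB; apply: wiener_meas => //; exact: le_trans st.
Qed.

Local Notation gauss s t := (normal_prob 0 (Num.sqrt (t - s))).

(** The condition [C k = setT] leaves component k free, so that D can be inserted for it in the
    product formula; the other components of the same increment belong to the conditioning event. *)
Lemma increment_indep s t (k : 'I_dim) (C : 'I_dim -> set R) H1 H2 D : 0 <= s < t ->
  <<s wiener_events N (`[0, s] : set R)>> H1 -> <<s mpp_events N>> H2 ->
  (forall j, measurable (C j)) -> C k = setT -> measurable D ->
  let B := H1 `&` [set w | forall j, C j (W t w ord0 j - W s w ord0 j)] `&` H2 in
  (P (B `&` [set w | D (W t w ord0 k - W s w ord0 k)%R]) = P B * gauss s t D)%E.
Proof.
move=> /[dup] st /andP[s0 st'] h1 h2 mC Ck mD /=.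
have [_ _ _ indW] := hW.
have big (C' : 'I_dim -> set R) : (forall j, measurable (C' j)) ->
    P (H1 `&` [set w | forall j, C' j (W t w ord0 j - W s w ord0 j)] `&` H2) =
    (P H1 * \big[*%E/1]_(j < dim) gauss s t (C' j) * P H2)%E.
  move=> mC'; rewrite hI//; last first.
    apply: (@measurableI _ (g_sigma_algebraType (wiener_events N (`[0, +oo[ : set R)))).
      move: H1 h1; apply: smallest_sub; first exact: smallest_sigma_algebra.
      move=> S [u [j [B [/= us mB ->]]]]; apply: sub_sigma_algebra.
      by exists u, j, B; split => //=; move: us; rewrite !in_itv/= => /andP[->].
    rewrite [X in measurable X](_ : _ = \bigcap_(j in [set: 'I_dim])
        [set w | C' j (W t w ord0 j - W s w ord0 j)]); last first.
      by apply/seteqP; split=> w /= h; [move=> j _; exact: h|move=> j; exact: (h j)].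
    apply: fin_bigcap_measurable => // j _.
    have mi (r : R) : 0 <= r -> measurable_fun setT ((fun w => W r w ord0 j)
        : g_sigma_algebraType (wiener_events N (`[0, +oo[ : set R)) -> R).
      move=> r0 _ B mB; rewrite setTI; apply: sub_sigma_algebra.
      by exists r, j, B; split => //=; rewrite in_itv/= r0.
    rewrite -[X in measurable X]setTI.
    by apply: (measurable_funB (mi t _) (mi s s0)) => //; rewrite (le_trans s0)// ltW.
  by congr (_ * _)%E; exact: indW.
pose C' j := if j == k then D else C j.
have mC' j : measurable (C' j) by rewrite /C'; case: ifP.
have -> : H1 `&` [set w | forall j, C j (W t w ord0 j - W s w ord0 j)] `&` H2
    `&` [set w | D (W t w ord0 k - W s w ord0 k)] =
    H1 `&` [set w | forall j, C' j (W t w ord0 j - W s w ord0 j)] `&` H2.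
  apply/seteqP; split=> w /=.
    move=> [[[hw1 hC] hw2] hD]; split=> //; split=> // j; rewrite /C'.
    by case: eqVneq => [->|_].
  move=> [[hw1 hC] hw2]; split; last by have := hC k; rewrite /C' eqxx.
  split=> //; split=> // j; have := hC j; rewrite /C'.
  by case: eqVneq => [->|//]; rewrite Ck.
rewrite !big// (bigD1 k)//= [in RHS](bigD1 k)//= Ck /C' eqxx probability_setT mul1e.
rewrite (eq_bigr (fun j => gauss s t (C j))) => [|j /negbTE ->//].
by rewrite -!muleA; congr (_ * _)%E; rewrite muleC -muleA.
Qed.

(** The past up to s enlarged by the other components of the same increment. Orthogonality to this
    larger sigma-algebra kills the cross terms between components in the isometry. *)
Definition joint_events (s t : R) (k : 'I_dim) : set (set Omega) :=
  [set S | exists B (C : 'I_dim -> set R), [/\ past_events s B,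
     forall j, measurable (C j), C k = setT
     & S = B `&` [set w | forall j, C j (W t w ord0 j - W s w ord0 j)]]].

Lemma increments_measurable s t (C : 'I_dim -> set R) : 0 <= s -> s <= t ->
  (forall j, measurable (C j)) ->
  measurable [set w | forall j, C j (W t w ord0 j - W s w ord0 j)].
Proof.
move=> s0 st mC.
rewrite [X in measurable X](_ : _ = \bigcap_(j in [set: 'I_dim])
    [set w | C j (W t w ord0 j - W s w ord0 j)]); last first.
  by apply/seteqP; split=> w /= h; [move=> j _; exact: h|move=> j; exact: (h j)].
apply: fin_bigcap_measurable => // j _.
rewrite -[X in measurable X]setTI.
exact: increment_meas.
Qed.

Lemma joint_events_measurable s t k : 0 <= s -> s <= t ->
  joint_events s t k `<=` measurable.
Proof.
move=> s0 st S [B [C [hB mC _ ->]]]; apply: measurableI.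
  exact: past_events_measurable hB.
exact: increments_measurable.
Qed.

Lemma joint_eventsI s t k : setI_closed (joint_events s t k).
Proof.
move=> S S' [B [C [hB mC Ck ->]]] [B' [C' [hB' mC' Ck' ->]]].
exists (B `&` B'), (fun j => C j `&` C' j); split.
- exact: past_eventsI.
- by move=> j; exact: measurableI.
- by rewrite Ck Ck' setTI.
- apply/seteqP; split=> w /=.
    by move=> [[h1 h2] [h3 h4]]; split=> // j.
  by move=> [[h1 h3] h]; split; split=> // j; have [] := h j.
Qed.

Lemma past_joint s t k : past_events s `<=` joint_events s t k.
Proof.
move=> B hB; exists B, (fun=> setT); split=> //.
by apply/seteqP; split=> w //= [].
Qed.

Lemma filt_joint s t k : <<s F s>> `<=` <<s joint_events s t k>>.
Proof.
apply: (subset_trans (@filt_past s)); apply: smallest_sub.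
  exact: smallest_sigma_algebra.
by move=> B hB; apply: sub_sigma_algebra; exact: past_joint.
Qed.

Lemma increment_joint_meas s t (j k : 'I_dim) : j != k ->
  measurable_fun [set: g_sigma_algebraType (joint_events s t k)]
    ((fun w => W t w ord0 j - W s w ord0 j) : g_sigma_algebraType (joint_events s t k) -> R).
Proof.
move=> jk _ B mB; rewrite setTI; apply: sub_sigma_algebra.
exists setT, (fun l => if l == j then B else setT); split.
- exact: past_events_setT.
- by move=> l; case: ifP.
- by rewrite eq_sym (negbTE jk).
- rewrite setTI; apply/seteqP; split=> w /=.
    by move=> h l; case: eqVneq => [->|].
  by move=> /(_ j); rewrite eqxx.
Qed.

Lemma Rintegrable_increment s t k (g : R -> R) : 0 <= s < t ->
  Rintegrable (gauss s t) setT g ->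
  Rintegrable P setT (fun w => g (W t w ord0 k - W s w ord0 k)).
Proof.
move=> /[dup] st /andP[s0 st'] ig.
have mX := increment_meas k s0 (ltW st').
suff ind (C : set R) : measurable C -> (P ([set: Omega] `&`
    (fun w => W t w ord0 k - W s w ord0 k)%R @^-1` C) = P [set: Omega] * gauss s t C)%E.
  by have [] := indep_integral measurableT mX ind ig.
move=> mC; rewrite setTI probability_setT mul1e.
have := increment_indep st
  (@measurableT _ (g_sigma_algebraType (wiener_events N (`[0, s] : set R))))
  (@measurableT _ (g_sigma_algebraType (mpp_events N)))
  (fun _ : 'I_dim => measurableT) (erefl (setT : set R)) mC (k := k).
rewrite /= setTI setIT (_ : [set w | forall j, setT (W t w ord0 j - W s w ord0 j)] = setT).
  by rewrite setTI probability_setT mul1e.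
by apply/seteqP; split.
Qed.

Lemma increment_orth s t k (g : R -> R) : 0 <= s < t ->
  Rintegrable (gauss s t) setT g -> \int[gauss s t]_x g x = 0 ->
  forall B, <<s joint_events s t k>> B ->
    \int[P]_(w in B) g (W t w ord0 k - W s w ord0 k) = 0.
Proof.
move=> /[dup] st /andP[s0 st'] ig g0.
have mX := increment_meas k s0 (ltW st').
have iV := Rintegrable_increment k st ig.
apply: Rintegral_orth_pi => //.
- exact: joint_events_measurable (ltW st').
- exact: joint_eventsI.
- apply: past_joint; exact: past_events_setT.
move=> S [B [C [[[H1 [H2 [h1 h2 ->]]]|[mB B0]] mC Ck ->]]]; last first.
  rewrite /Rintegral null_set_integral//.
  - by apply: measurableI => //; exact: increments_measurable (ltW st') mC.
  - by apply/measurable_EFinP/measurable_funTS; exact: Rintegrable_measurable iV.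
  - apply/eqP; rewrite -measure_le0 -B0 le_measure ?inE//.
    by apply: measurableI => //; exact: increments_measurable (ltW st') mC.
rewrite setIAC.
have mB : measurable (H1 `&` [set w | forall j, C j (W t w ord0 j - W s w ord0 j)] `&` H2).
  apply: measurableI; last exact: mpp_events_measurable.
  apply: measurableI; first exact: wiener_events_measurable h1.
  exact: increments_measurable (ltW st') mC.
have ind D (mD : measurable D) := increment_indep st h1 h2 mC Ck mD.
by have [_ ->] := indep_integral mB mX ind ig; rewrite g0 mulr0.
Qed.

Lemma increment_filt_orth s t k (g : R -> R) : 0 <= s < t ->
  Rintegrable (gauss s t) setT g -> \int[gauss s t]_x g x = 0 ->
  forall B, <<s F s>> B -> \int[P]_(w in B) g (W t w ord0 k - W s w ord0 k) = 0.
Proof. by move=> st ig g0 B /(@filt_joint s t k); exact: increment_orth. Qed.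

End filtration.

(** * Ito integrals as martingales *)

Section L2_limit.
Context (R : realType) d (Omega : measurableType d) (P : probability Omega R).

Lemma Rintegrable_sq (f : Omega -> R) : measurable_fun setT f ->
  Rintegrable P setT (fun w => f w ^+ 2) -> Rintegrable P setT f.
Proof.
move=> mf f2; have i1 : Rintegrable P setT (fun w => 1 + f w ^+ 2).
  by apply: RintegrableD f2 => //; exact: finite_measure_integrable_cst.
by apply: (Rintegrable_le _ _ _ i1) => // w _; exact: norm_le_one_sq.
Qed.

Lemma Rintegrable_sqD (f g : Omega -> R) : measurable_fun setT f -> measurable_fun setT g ->
  Rintegrable P setT (fun w => f w ^+ 2) -> Rintegrable P setT (fun w => g w ^+ 2) ->
  Rintegrable P setT (fun w => (f w + g w) ^+ 2).
Proof.
move=> mf mg f2 g2.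
have i1 : Rintegrable P setT (fun w => 2 * f w ^+ 2 + 2 * g w ^+ 2).
  by apply: RintegrableD => //; exact: RintegrableZ.
apply: (Rintegrable_le _ _ _ i1) => // [|w _].
  by apply: measurable_funX; exact: measurable_funD.
rewrite ger0_norm ?sqr_ge0//; have := sqr_ge0 (f w - g w).
by rewrite sqrrB sqrrD; move: (f w ^+ 2) (g w ^+ 2) (f w * g w) => *; lra.
Qed.

Lemma Rintegrable_sqN (f : Omega -> R) :
  Rintegrable P setT (fun w => f w ^+ 2) -> Rintegrable P setT (fun w => (- f w) ^+ 2).
Proof. by move=> f2; under eq_fun do rewrite sqrrN. Qed.

Lemma L2_limit_sq (f : nat -> Omega -> R) (g : Omega -> R) : (forall n, measurable_fun setT (f n)) ->
  measurable_fun setT g -> (forall n, Rintegrable P setT (fun w => f n w ^+ 2)) ->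
  (\int[P]_w ((f n w - g w) ^+ 2)%:E)%E @[n --> \oo] --> 0%E ->
  Rintegrable P setT (fun w => g w ^+ 2) /\
  forall eta, 0 < eta -> exists n, Rintegrable P setT (fun w => (f n w - g w) ^+ 2) /\
    \int[P]_w ((f n w - g w) ^+ 2) < eta.
Proof.
move=> mf mg f2 cv.
have mh n : measurable_fun setT (fun w => (f n w - g w) ^+ 2).
  by apply: measurable_funX; exact: measurable_funB.
have near0 eta : 0 < eta -> exists n, Rintegrable P setT (fun w => (f n w - g w) ^+ 2) /\
    \int[P]_w ((f n w - g w) ^+ 2) < eta.
  move=> eta0.
  have : (\forall n \near \oo, (\int[P]_w ((f n w - g w) ^+ 2)%:E < eta%:E))%E.
    apply: (cv [set x | (x < eta%:E)%E]); apply: open_nbhs_nbhs; split.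
      exact: open_ereal_lt_ereal.
    by rewrite /= lte_fin.
  move=> [n _ /(_ n (leqnn n)) hn].
  have ii : Rintegrable P setT (fun w => (f n w - g w) ^+ 2).
    apply: ge0_Rintegrable => // [w _|]; first exact: sqr_ge0.
    by rewrite (lt_le_trans hn)// leey.
  by exists n; split=> //; rewrite -lte_fin EFin_Rintegral.
split=> //.
have [n [ii _]] := near0 1 ltr01.
have -> : (fun w => g w ^+ 2) = (fun w => (f n w + - (f n w - g w)) ^+ 2).
  by apply/funext => w; congr (_ ^+ 2); ring.
apply: Rintegrable_sqD => //; last exact: Rintegrable_sqN.
by apply: measurableT_comp => //; exact: measurable_funB.
Qed.

Lemma L2_limit_orth (f : nat -> Omega -> R) (g : Omega -> R) B : (forall n, measurable_fun setT (f n)) ->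
  measurable_fun setT g -> (forall n, Rintegrable P setT (fun w => f n w ^+ 2)) ->
  (\int[P]_w ((f n w - g w) ^+ 2)%:E)%E @[n --> \oo] --> 0%E ->
  measurable B -> (forall n, \int[P]_(w in B) f n w = 0) -> \int[P]_(w in B) g w = 0.
Proof.
move=> mf mg f2 cv mB f0; have [g2 near0] := L2_limit_sq mf mg f2 cv.
have ig := Rintegrable_sq mg g2.
apply/eqP; rewrite -normr_le0; apply/ler_addgt0Pl => e e0; rewrite addr0.
have l0 : 0 < e / 2 by rewrite divr_gt0.
have [n [ii hn]] := near0 ((e / 2) ^+ 2) (exprn_gt0 2 l0).
have if_ := Rintegrable_sq (mf n) (f2 n).
have sB h : Rintegrable P setT h -> Rintegrable P B h by move=> ih; apply: integrableS ih.
have -> : \int[P]_(w in B) g w = - \int[P]_(w in B) (f n w - g w).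
  by rewrite (RintegralB mB (sB _ if_) (sB _ ig)) f0 sub0r opprK.
rewrite normrN.
have id := RintegrableB measurableT if_ ig.
apply: (le_trans (le_normr_Rintegral mB (sB _ id))).
have iD : Rintegrable P setT (fun w => e / 2 + (e / 2)^-1 * (f n w - g w) ^+ 2).
  apply: RintegrableD => //; first exact: finite_measure_integrable_cst.
  exact: RintegrableZ.
(* Young with weight l = e / 2: |y| <= l + y^2 / l. As the squared error is below l^2, the two parts
   are at most e / 2 each. *)
apply: (@le_trans _ _ (\int[P]_w (e / 2 + (e / 2)^-1 * (f n w - g w) ^+ 2))).
  apply: (@le_trans _ _ (\int[P]_w `|f n w - g w|)).
    rewrite -lee_fin (EFin_Rintegral mB (sB _ (Rintegrable_abs measurableT id))).
    rewrite (EFin_Rintegral measurableT (Rintegrable_abs measurableT id)).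
    apply: ge0_subset_integral => //.
    by apply/measurable_EFinP; exact: Rintegrable_measurable (Rintegrable_abs measurableT id).
  apply: le_Rintegral => //; first exact: Rintegrable_abs.
  move=> w _; move: (e / 2) l0 => l l0; rewrite -(real_normK (num_real (f n w - g w))).
  have := normr_ge0 (f n w - g w); move: `|_| => y y0.
  have -> : l + l^-1 * y ^+ 2 = (l ^+ 2 + y ^+ 2) / l by field; rewrite gt_eqF.
  by rewrite ler_pdivlMr//; have := sqr_ge0 (l - y); nra.
rewrite (RintegralD measurableT (finite_measure_integrable_cst P (e / 2) measurableT)
  (RintegrableZ _ measurableT ii)).
rewrite (RintegralZl _ measurableT ii) Rintegral_cst//.
rewrite (_ : fine (P setT) = 1); last by rewrite probability_setT.
rewrite mulr1 [leRHS](splitr e) lerD2l ler_pdivrMl// -expr2.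
exact: ltW.
Qed.

End L2_limit.

Section ito.
Context (R : realType) dO (Omega : measurableType dO) (P : probability Omega R).
Context (E : ptopologicalType) (dim : nat) (N : noise R Omega E dim) (T : R).
Local Notation W := (wiener N).
Local Notation F := (filt P N).
Hypotheses (hW : is_wiener P N) (hp : is_marked_point_process P N)
  (hI : independent_noise P N).
Local Notation incr s t k := (fun w => W t w ord0 k - W s w ord0 k).

Lemma increment_sq_int s t k : 0 <= s -> s <= t ->
  Rintegrable P setT (fun w => incr s t k w ^+ 2).
Proof.
move=> s0; rewrite le_eqVlt => /orP[/eqP <-|st].
  under eq_fun do rewrite subrr expr0n.
  exact: finite_measure_integrable_cst.
have q : 0 < Num.sqrt (t - s) by rewrite sqrtr_gt0 subr_gt0.
have st' : 0 <= s < t by rewrite s0.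
exact: (Rintegrable_increment hW hI k (g := fun x => x ^+ 2) st' (Rintegrable_normal_sqr q)).
Qed.

Lemma increment_int s t k : 0 <= s -> s <= t -> Rintegrable P setT (incr s t k).
Proof.
move=> s0 st; apply: Rintegrable_sq; first exact: (increment_meas hW).
exact: increment_sq_int.
Qed.

Lemma increment_mean0 s t k B : 0 <= s -> s <= t -> <<s F s>> B ->
  \int[P]_(w in B) incr s t k w = 0.
Proof.
move=> s0; rewrite le_eqVlt => /orP[/eqP <-|st] sB.
  under eq_Rintegral do rewrite subrr.
  rewrite Rintegral_cst ?mul0r//; exact: (filt_sub hW hp sB).
have q : 0 < Num.sqrt (t - s) by rewrite sqrtr_gt0 subr_gt0.
have st' : 0 <= s < t by rewrite s0.
exact: (increment_filt_orth hW hp hI k st' (Rintegrable_normal_id q) (normal_mean q)).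
Qed.

Lemma weighted_increment_orth r t k (H : Omega -> R) c s B : 0 <= s -> s <= r -> r <= t ->
  measurable_fun [set: g_sigma_algebraType (F r)] (H : g_sigma_algebraType (F r) -> R) ->
  (forall w, `|H w| <= c) -> <<s F s>> B ->
  \int[P]_(w in B) (H w * incr r t k w) = 0.
Proof.
move=> s0 sr rt mH Hc sB; have r0 := le_trans s0 sr.
have sB' : <<s F r>> B by exact: (filt_mono s0 sr).
have mB : measurable B by exact: (filt_sub hW hp sB).
have mH' : measurable_fun [set: g_sigma_algebraType (F r)]
    ((fun w => \1_B w * H w) : g_sigma_algebraType (F r) -> R).
  by apply: measurable_funM => //; exact: measurable_indic.
have Hc' w : `|\1_B w * H w| <= c.
  rewrite normrM; apply: le_trans (Hc w); rewrite ler_piMl// ger0_norm.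
    by rewrite indicE lern1 leq_b1.
  by rewrite indicE.
have [_ <-] := Rintegral_orth (filt_sub hW hp (t := r)) (increment_int k r0 rt)
  (fun B => increment_mean0 k r0 rt) mH' Hc'.
rewrite /Rintegral [in LHS]integral_mkcond; congr fine; apply: eq_integral => w _.
rewrite patchE indicE; case: ifPn => _; first by rewrite mul1r.
by rewrite !mul0r.
Qed.

Lemma weighted_increment_sq (H : Omega -> R) c r t k : 0 <= r -> r <= t ->
  measurable_fun setT H -> (forall w, `|H w| <= c) ->
  Rintegrable P setT (fun w => (H w * incr r t k w) ^+ 2).
Proof.
move=> r0 rt mH Hc; have i2 := increment_sq_int k r0 rt.
apply: (Rintegrable_le _ _ _ (RintegrableZ (c ^+ 2) measurableT i2)) => //.
  by apply: measurable_funX; apply: measurable_funM => //; exact: (increment_meas hW).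
move=> w _; rewrite ger0_norm ?sqr_ge0// exprMn ler_wpM2r ?sqr_ge0//.
rewrite -(real_normK (num_real (H w))) lerXn2r ?nnegrE//.
exact: le_trans (normr_ge0 _) (Hc w).
Qed.

Section simple.
Variable X : simple_process R Omega dim.
Hypothesis hX : is_simple P N T X.

Lemma simple_time_le k l : (k <= l)%N -> (l <= sp_size X)%N -> sp_time X k <= sp_time X l.
Proof.
have [_ ht _ _ _] := hX.
elim: l => [|l IH]; first by rewrite leqn0 => /eqP ->.
rewrite leq_eqVlt => /orP[/eqP ->//|kl] lX.
by rewrite (le_trans (IH _ (ltnW lX)))// ht.
Qed.

Lemma simple_time_ge0 k : (k <= sp_size X)%N -> 0 <= sp_time X k.
Proof. by have [h0 _ _ _ _] := hX => kX; rewrite (le_trans h0)// simple_time_le. Qed.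

Lemma simple_val_meas k j : (k < sp_size X)%N -> measurable_fun setT (fun w => sp_val X k w ord0 j).
Proof.
have [_ _ _ mv _] := hX => kX.
exact: (sub_measurable_fun (filt_sub hW hp (t := sp_time X k)) (mv k j kX)).
Qed.

Lemma simple_integral_meas_sq t : 0 <= t ->
  measurable_fun setT (sp_integral N X t) /\
  Rintegrable P setT (fun w => sp_integral N X t w ^+ 2).
Proof.
have [_ ht _ mv [c hc]] := hX => t0.
have h (s : seq 'I_(sp_size X)) : measurable_fun setT (fun w => \sum_(k <- s) \sum_(j < dim)
      sp_val X k w ord0 j * (W (Num.min (sp_time X k.+1) t) w ord0 j
     - W (Num.min (sp_time X k) t) w ord0 j)) /\
    Rintegrable P setT (fun w => (\sum_(k <- s) \sum_(j < dim)
      sp_val X k w ord0 j * (W (Num.min (sp_time X k.+1) t) w ord0 j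
     - W (Num.min (sp_time X k) t) w ord0 j)) ^+ 2).
  elim: s => [|k s [IH1 IH2]].
    under eq_fun do rewrite big_nil; split=> //.
    under eq_fun do rewrite big_nil expr0n.
    exact: finite_measure_integrable_cst.
  have h' (s' : seq 'I_dim) : measurable_fun setT (fun w => \sum_(j <- s')
      sp_val X k w ord0 j * (W (Num.min (sp_time X k.+1) t) w ord0 j
     - W (Num.min (sp_time X k) t) w ord0 j)) /\
    Rintegrable P setT (fun w => (\sum_(j <- s')
      sp_val X k w ord0 j * (W (Num.min (sp_time X k.+1) t) w ord0 j
     - W (Num.min (sp_time X k) t) w ord0 j)) ^+ 2).
    elim: s' => [|j s' [IH1' IH2']].
      under eq_fun do rewrite big_nil; split=> //.
      under eq_fun do rewrite big_nil expr0n.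
      exact: finite_measure_integrable_cst.
    have r0 : 0 <= Num.min (sp_time X k) t by rewrite le_min simple_time_ge0 ?(ltnW (ltn_ord k)).
    have rt : Num.min (sp_time X k) t <= Num.min (sp_time X k.+1) t.
      by rewrite le_min ge_min ht ?(ltn_ord k)//= ge_min lexx orbT.
    have m1 : measurable_fun setT (fun w => sp_val X k w ord0 j *
        (W (Num.min (sp_time X k.+1) t) w ord0 j - W (Num.min (sp_time X k) t) w ord0 j)).
      apply: measurable_funM; first exact: simple_val_meas.
      exact: (increment_meas hW).
    under eq_fun do rewrite big_cons; split; first exact: measurable_funD.
    under eq_fun do rewrite big_cons; apply: Rintegrable_sqD => //.
    apply: (weighted_increment_sq j r0 rt (simple_val_meas j (ltn_ord k))) => w.
    exact: hc.
  have [m1 i1] := h' (index_enum _).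
  under eq_fun do rewrite big_cons; split; first exact: measurable_funD.
  under eq_fun do rewrite big_cons; exact: Rintegrable_sqD.
exact: (h (index_enum _)).
Qed.

Lemma simple_integral_orth s t B : 0 <= s -> s <= t -> <<s F s>> B ->
  \int[P]_(w in B) (sp_integral N X t w - sp_integral N X s w) = 0.
Proof.
have [_ ht _ mv [c hc]] := hX => s0 st sB.
have mB : measurable B by exact: (filt_sub hW hp sB).
(* Clamping the partition times to [s, t] turns the increment of the integral between s and t into a
   sum over the clamped cells, all of which start at or after s. *)
pose cl a : R := Num.max s (Num.min a t).
have cl_ge a : s <= cl a by rewrite le_max lexx.
have cl_le a b : a <= b -> cl a <= cl b.
  by move=> ab; rewrite ge_max cl_ge/= le_max le_min !ge_min ab lexx !orbT.
have split_incr a w j : W (Num.min a t) w ord0 j - W (Num.min a s) w ord0 j =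
    W (cl a) w ord0 j - W s w ord0 j.
  rewrite /cl; have [as_|sa] := leP a s.
    by rewrite (min_l (le_trans as_ st)) max_l// !subrr.
  by rewrite max_r// le_min (ltW sa) st.
have term k j : (k < sp_size X)%N ->
    Rintegrable P B (fun w => sp_val X k w ord0 j *
      (W (cl (sp_time X k.+1)) w ord0 j - W (cl (sp_time X k)) w ord0 j)) /\
    \int[P]_(w in B) (sp_val X k w ord0 j *
      (W (cl (sp_time X k.+1)) w ord0 j - W (cl (sp_time X k)) w ord0 j)) = 0.
  move=> kX; have lek := cl_le _ _ (ht k kX).
  have c0 := le_trans s0 (cl_ge (sp_time X k)).
  split.
    apply: (integrableS measurableT) => //; apply: Rintegrable_sq.
      by apply: measurable_funM; [exact: simple_val_meas|exact: (increment_meas hW)].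
    by apply: (weighted_increment_sq j c0 lek (simple_val_meas j kX)) => w; exact: hc.
  have [tkt|ttk] := leP (sp_time X k) t; last first.
    have e1 : cl (sp_time X k) = cl (sp_time X k.+1).
      by rewrite /cl !min_r// ltW// (lt_le_trans ttk (ht k kX)).
    under eq_Rintegral do rewrite e1 subrr mulr0.
    by rewrite Rintegral_cst// mul0r.
  have kcl : sp_time X k <= cl (sp_time X k) by rewrite /cl (min_l tkt) le_max lexx orbT.
  apply: (weighted_increment_orth j s0 (cl_ge _) lek _ (fun w => hc k w j kX) sB).
  have t0k := simple_time_ge0 (ltnW kX).
  move=> mT Y mY; have := mv k j kX measurableT Y mY; rewrite !setTI => h.
  exact: (filt_mono t0k kcl h).
transitivity (\int[P]_(w in B) \sum_(k < sp_size X) \sum_(j < dim) (sp_val X k w ord0 j *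
      (W (cl (sp_time X k.+1)) w ord0 j - W (cl (sp_time X k)) w ord0 j))).
  apply: eq_Rintegral => w _; rewrite /sp_integral -sumrB; apply: eq_bigr => k _.
  rewrite -sumrB; apply: eq_bigr => j _.
  have h1 := split_incr (sp_time X k.+1) w j; have h2 := split_incr (sp_time X k) w j.
  rewrite -mulrBr; congr (_ * _).
  have -> : W (cl (sp_time X k.+1)) w ord0 j - W (cl (sp_time X k)) w ord0 j =
    (W (cl (sp_time X k.+1)) w ord0 j - W s w ord0 j) -
    (W (cl (sp_time X k)) w ord0 j - W s w ord0 j) by ring.
  by rewrite -h1 -h2; ring.
have i1 (k : 'I_(sp_size X)) : Rintegrable P B (fun w => \sum_(j < dim) (sp_val X k w ord0 j *
      (W (cl (sp_time X k.+1)) w ord0 j - W (cl (sp_time X k)) w ord0 j))).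
  by apply: Rintegrable_sum => // j; have [] := term k j (ltn_ord k).
rewrite (Rintegral_sum _ mB i1) big1// => k _.
rewrite (Rintegral_sum _ mB (fun j => (term k j (ltn_ord k)).1)) big1// => j _.
by have [] := term k j (ltn_ord k).
Qed.

Lemma simple_integral0 w : sp_integral N X 0 w = 0.
Proof.
have [_ ht _ _ _] := hX.
rewrite /sp_integral big1// => k _; rewrite big1// => j _.
rewrite !min_r ?subrr ?mulr0//; first exact/simple_time_ge0/ltnW.
exact: simple_time_ge0.
Qed.

End simple.

Section ito_integral.
Variables (Z : R -> Omega -> 'rV[R]_dim) (I : R -> Omega -> R).
Hypotheses (T0 : 0 <= T) (hZ : is_ito_integral P N T Z I).

Lemma ito_meas t : 0 <= t <= T -> measurable_fun setT (I t).
Proof.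
have [aI _ _] := hZ => tT; exact: (sub_measurable_fun (filt_sub hW hp (t := t)) (aI t tT)).
Qed.

Lemma ito_sq t : 0 <= t <= T -> Rintegrable P setT (fun w => I t w ^+ 2).
Proof.
move=> tT; have [_ _ [X [sX _ cX]]] := hZ; have /andP[t0 _] := tT.
have h n := simple_integral_meas_sq (sX n) t0.
by have [] := L2_limit_sq (fun n => (h n).1) (ito_meas tT) (fun n => (h n).2) (cX t tT).
Qed.

(** The martingale property of simple integrals passes to the L^2 limit of the increments, whose
    squared error is at most twice the sum of those at s and at t. *)
Lemma ito_orth s t B : 0 <= s -> s <= t -> t <= T -> <<s F s>> B ->
  \int[P]_(w in B) (I t w - I s w) = 0.
Proof.
move=> s0 st tT sB; have [_ _ [X [sX _ cX]]] := hZ.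
have sT : 0 <= s <= T by rewrite s0 (le_trans st).
have tT' : 0 <= t <= T by rewrite tT (le_trans s0).
have mB : measurable B by exact: (filt_sub hW hp sB).
have hs n := simple_integral_meas_sq (sX n) s0.
have ht n := simple_integral_meas_sq (sX n) (le_trans s0 st).
have mD n : measurable_fun setT (fun w => sp_integral N (X n) t w - sp_integral N (X n) s w).
  by apply: measurable_funB; [exact: (ht n).1|exact: (hs n).1].
have iD n : Rintegrable P setT
    (fun w => (sp_integral N (X n) t w - sp_integral N (X n) s w) ^+ 2).
  apply: Rintegrable_sqD; [exact: (ht n).1| |exact: (ht n).2|exact/Rintegrable_sqN/(hs n).2].
  by apply: measurableT_comp => //; exact: (hs n).1.
have mI r : 0 <= r <= T -> measurable_fun setT (I r) by exact: ito_meas.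
apply: (L2_limit_orth mD _ iD _ mB) => [| |n].
- by apply: measurable_funB; exact: mI.
- pose e r n := (\int[P]_w ((sp_integral N (X n) r w - I r w) ^+ 2)%:E)%E.
  have me r n : 0 <= r <= T -> measurable_fun setT
      (fun w => (sp_integral N (X n) r w - I r w) ^+ 2).
    move=> /[dup] rT /andP[r0 _]; apply: measurable_funX; apply: measurable_funB; last exact: mI.
    exact: (simple_integral_meas_sq (sX n) r0).1.
  have bound : (2%:E * e t n + 2%:E * e s n)%E @[n --> \oo] --> 0%E.
    rewrite -[X in _ --> X](_ : (2%:E * 0 + 2%:E * 0 = 0 :> \bar R)%E); last by rewrite !mule0 adde0.
    apply: cvgeD; first by rewrite !mule0.
      by apply: cvgeZl => //; exact: cX.
    by apply: cvgeZl => //; exact: cX.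
  apply: (squeeze_cvge _ (cvg_cst 0%E) bound); near=> n.
  apply/andP; split; first by apply: integral_ge0 => w _; rewrite lee_fin sqr_ge0.
  have eZ r : 0 <= r <= T -> (2%:E * e r n =
      \int[P]_w (2%:E * ((sp_integral N (X n) r w - I r w) ^+ 2)%:E))%E.
    move=> rT; rewrite ge0_integralZl//.
    - by apply/measurable_EFinP; exact: me.
    - by move=> w _; rewrite lee_fin sqr_ge0.
  rewrite !eZ//.
  rewrite -ge0_integralD//; last 4 first.
  - by move=> w _; rewrite mule_ge0 ?lee_fin ?sqr_ge0.
  - by apply: measurable_funeM; apply/measurable_EFinP; exact: me.
  - by move=> w _; rewrite mule_ge0 ?lee_fin ?sqr_ge0.
  - by apply: measurable_funeM; apply/measurable_EFinP; exact: me.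
  apply: ge0_le_integral => //.
  - by move=> w _; rewrite lee_fin sqr_ge0.
  - apply/measurable_EFinP/measurable_funX/measurable_funB; first exact: mD.
    by apply: measurable_funB; exact: mI.
  - by apply: emeasurable_funD; apply: measurable_funeM; apply/measurable_EFinP; exact: me.
  move=> w _; rewrite -!EFinM -EFinD lee_fin.
  move: (sp_integral _ _ _ _) (sp_integral _ _ _ _) (I t w) (I s w) => a a' c c'.
  by have := sqr_ge0 (a - c + (a' - c')); nra.
exact: (simple_integral_orth (sX n) s0 st sB).
Unshelve. all: by end_near. Qed.

Lemma ito0 : {ae P, forall w, I 0 w = 0}.
Proof.
have [_ _ [X [sX _ cX]]] := hZ; have T00 : 0 <= (0 : R) <= T by rewrite lexx T0.
have := cX 0 T00; under eq_fun do under eq_integral do rewrite (simple_integral0 (sX _)) sub0r sqrrN.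
move=> /(cvg_lim (@ereal_hausdorff R)); rewrite lim_cst// => e0.
have i2 := ito_sq T00.
have e0' : \int[P]_w (I 0 w ^+ 2) = 0 by rewrite /Rintegral e0.
apply: filterS (Rintegral_ge0_eq0 i2 (fun w => sqr_ge0 _) e0') => w /eqP.
by rewrite sqrf_eq0 => /eqP.
Qed.

End ito_integral.
End ito.

(** * The clock A and the compensator *)

Notation oc a b := (`]a, b]%classic : set (Real.sort _)).

Section stieltjes_measure.
Context (R : realType).
Local Notation RT := (measurableTypeR R).

Lemma stieltjes_ocitv (g : R -> R) a b : is_cumulative g -> a <= b ->
  stieltjes g (oc a b) = (g b - g a)%:E.
Proof.
move=> cg ab; rewrite /stieltjes; case: pselect => // h.
transitivity (wlength (cumulative_of h) (oc a b)); last by rewrite wlength_itv_bnd.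
by apply: measurable_mu_extE; exact: is_ocitv.
Qed.

(** Half-open intervals form a pi-system generating the Borel sets; finiteness of the total mass
    handles complements. *)
Lemma kernel_ocitv d (U : measurableType d) (l : U -> {measure set RT -> \bar R}) :
  (forall w, l w setT \is a fin_num) -> measurable_fun setT (fun w => l w setT) ->
  (forall a b : R, a < b -> measurable_fun setT (fun w => l w (oc a b))) ->
  forall B, measurable B -> measurable_fun setT (fun w => l w B).
Proof.
move=> fl mT mI.
have fB w B : measurable B -> l w B \is a fin_num.
  move=> mB; rewrite ge0_fin_numE//; apply: (le_lt_trans (le_measure (l w) _ _ (@subsetT _ B))).
  - by rewrite inE.
  - by rewrite inE; exact: measurableT.
  - by rewrite ltey_eq fl.
apply: (@dynkin_induction _ RT (R.-ocitv).-measurable).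
- by [].
- by move=> A B; exact: measurableI.
- exact: mT.
- move=> B /ocitvP[->|[[a b] /= ab ->]]; last exact: mI.
  by rewrite (_ : (fun w => l w set0) = cst 0%E)//; apply/funext => w; rewrite measure0.
- move=> B mB mlB.
  have -> : (fun w => l w (~` B)) = (fun w => l w setT - l w B)%E.
    apply/funext => w; rewrite -(setUv B) measureU//; last 2 first.
    + exact: measurableC.
    + by rewrite setICr.
    by rewrite addeAC subee ?add0e// fB.
  exact: emeasurable_funB.
- move=> B mB tB mlB.
  have -> : (fun w => l w (\bigcup_k B k)) = (fun w => \sum_(k <oo) l w (B k))%E.
    apply/funext => w; apply/esym/cvg_lim => //.
    by apply: measure_semi_sigma_additive => //; exact: bigcup_measurable.
  exact: ge0_emeasurable_sum.
Qed.

End stieltjes_measure.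

Lemma integral_mrestr d (T : measurableType d) (R : realType) (mu : {measure set T -> \bar R})
    (D : set T) (mD : measurable D) (f : T -> \bar R) : (forall x, 0 <= f x)%E ->
  measurable_fun setT f -> (\int[mrestr mu mD]_x f x = \int[mu]_(x in D) f x)%E.
Proof.
move=> f0 mf; have m1 : measurable_fun setT (\1_D : T -> R) by exact: measurable_indic.
rewrite (@integral_density _ _ _ mu _ (\1_D)) => //.
- rewrite [RHS]integral_mkcond; apply: eq_integral => w _.
  by rewrite patchE indicE; case: ifPn; rewrite ?mule1 ?mule0.
- by move=> U mU; rewrite /mrestr integral_indic//; first by rewrite setIC.
Qed.

Lemma conull_set (R : realType) d (Omega : measurableType d) (P : probability Omega R)
  (Q : Omega -> Prop) : {ae P, forall w, Q w} ->
  exists G, [/\ measurable G, P (~` G) = 0%E & forall w, G w -> Q w].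
Proof.
move=> [B [mB B0 sB]]; exists (~` B); split; [exact: measurableC|by rewrite setCK|].
by move=> w Bw; apply: contrapT => Qw; exact/Bw/sB.
Qed.

Section kernels.
Context (R : realType) dO (Omega : measurableType dO) (P : probability Omega R).
Context (E : ptopologicalType) (dim : nat) (N : noise R Omega E dim) (T : R).
Local Notation F := (filt P N).
Local Notation A := (cA N).
Local Notation BE := (borelType E).
Local Notation RT := (measurableTypeR R).
Hypotheses (T0 : 0 <= T) (hW : is_wiener P N) (hp : is_marked_point_process P N)
  (hA : predictable F `[0, +oo[ A) (hA0 : forall w, A 0 w = 0)
  (hphi : forall C : set BE, measurable C ->
     predictable F `[0, +oo[ (fun t w => phi N t w C)).

Record regular_noise (w : Omega) : Prop := RegularNoise {
  rn_le : forall n, (jump_time N n w <= jump_time N n.+1 w)%E;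
  rn_lt : forall n, (jump_time N n w < +oo)%E -> (jump_time N n w < jump_time N n.+1 w)%E;
  rn_cvg : jump_time N n w @[n --> \oo] --> +oo%E;
  rn_homo : {in `[0, +oo[ &, {homo A^~ w : s t / s <= t}};
  rn_right : forall t, 0 <= t -> A x w @[x --> t^'+] --> A t w;
  rn_cont : {within `[0, +oo[, continuous (A^~ w)}
}.

Variable G : set Omega.
Hypotheses (mG : measurable G) (G0 : P (~` G) = 0%E)
  (regG : forall w, G w -> regular_noise w).

Lemma good_filt t : <<s F t>> G.
Proof.
rewrite -(setCK G); apply: (@measurableC _ (g_sigma_algebraType (F t))).
by apply: null_filt => //; exact: measurableC.
Qed.

Lemma indic_good_meas t : measurable_fun [set: g_sigma_algebraType (F t)]
  (\1_G : g_sigma_algebraType (F t) -> R).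
Proof. by apply: measurable_indic; exact: good_filt. Qed.

Definition clockA (t : R) (w : Omega) : R := \1_G w * A t w.

Lemma clockA_good t w : G w -> clockA t w = A t w.
Proof. by move=> Gw; rewrite /clockA indicE mem_set// mul1r. Qed.

Lemma clockA_bad t w : ~ G w -> clockA t w = 0.
Proof. by move=> Gw; rewrite /clockA indicE memNset// mul0r. Qed.

Lemma clockA_adapted t : 0 <= t ->
  measurable_fun [set: g_sigma_algebraType (F t)] (clockA t : g_sigma_algebraType (F t) -> R).
Proof.
move=> t0; apply: measurable_funM; first exact: indic_good_meas.
apply: (@predictable_adapted _ _ _ F _ R `[0, +oo[%classic A t) => //.
- by move=> s r s0 sr; exact: filt_mono.
- exact: measurable_predictable_coitv.
- by rewrite /= in_itv/= t0.
Qed.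

Lemma clockA_meas t : 0 <= t -> measurable_fun setT (clockA t).
Proof.
by move=> t0; exact: (sub_measurable_fun (filt_sub hW hp (t := t)) (clockA_adapted t0)).
Qed.

Lemma clockA0 w : clockA 0 w = 0.
Proof. by rewrite /clockA hA0 mulr0. Qed.

Lemma clockA_homo w s t : 0 <= s -> s <= t -> clockA s w <= clockA t w.
Proof.
move=> s0 st; rewrite /clockA indicE; case: (boolP (w \in G)); rewrite ?inE => Gw; last first.
  by rewrite !mul0r.
rewrite !mul1r; apply: (rn_homo (regG Gw)) => //; rewrite in_itv/= ?s0//.
by rewrite (le_trans s0).
Qed.

Lemma clockA_ge0 w t : 0 <= t -> 0 <= clockA t w.
Proof. by move=> t0; rewrite -(clockA0 w) clockA_homo. Qed.

Lemma clockA_cont w : {within `[0, T], continuous (clockA ^~ w)}.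
Proof.
have [Gw|Gw] := pselect (G w).
  rewrite (_ : clockA ^~ w = A ^~ w); last by apply/funext => t; rewrite clockA_good.
  apply: continuous_subspaceW (rn_cont (regG Gw)) => t /=.
  by rewrite !in_itv/= => /andP[-> _].
rewrite (_ : clockA ^~ w = cst 0); last by apply/funext => t; rewrite clockA_bad.
by move=> t; exact: cvg_cst.
Qed.

Lemma cumulative_A w : G w -> is_cumulative (fun t => A (Num.max 0 t) w).
Proof.
move=> Gw; split.
  move=> s t st; apply: (rn_homo (regG Gw)).
  - by rewrite in_itv/= andbT le_max lexx.
  - by rewrite in_itv/= andbT le_max lexx.
  - by rewrite ge_max !le_max lexx/= st orbT.
move=> t; have [t0|t0] := leP 0 t.
  have := rn_right (regG Gw) t0; apply: cvg_trans; apply: near_eq_cvg.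
  near=> s; rewrite max_r//; apply: (le_trans t0); apply: ltW.
  by near: s; exact: nbhs_right_gt.
apply: cvg_near_cst.
near=> s; rewrite max_l//; apply: ltW; near: s; exact: nbhs_right_lt.
Unshelve. all: by end_near. Qed.

Lemma dA_ocitv w s t : G w -> 0 <= s -> s <= t -> dA N w (oc s t) = (A t w - A s w)%:E.
Proof.
move=> Gw s0 st; rewrite /dA stieltjes_ocitv//; last exact: cumulative_A.
by rewrite !max_r// (le_trans s0).
Qed.

Let oT : set RT := oc 0 T.

Let moT : measurable oT. Proof. exact: measurable_itv. Qed.

(* The factor [expR (- A_T)] makes the kernel [clock_kernel] below uniformly bounded. *)
Definition damp (w : Omega) : R := \1_G w * expR (- clockA T w).

Lemma damp_ge0 w : 0 <= damp w.
Proof. by rewrite mulr_ge0 ?indicE ?expR_ge0. Qed.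

Definition clock_kernel (w : Omega) : {measure set RT -> \bar R} :=
  mscale (NngNum (damp_ge0 w)) (mrestr (dA N w) moT).

Lemma clock_kernelE w B : clock_kernel w B = ((damp w)%:E * dA N w (B `&` oT))%E.
Proof. by []. Qed.

Let clamp (a : R) : R := Num.max 0 (Num.min a T).

Let clamp0 a : 0 <= clamp a. Proof. by rewrite /clamp le_max lexx. Qed.

Lemma clock_kernel_itv w a b : a <= b ->
  clock_kernel w (oc a b) = (damp w * (clockA (clamp b) w - clockA (clamp a) w))%:E.
Proof.
move=> ab; rewrite clock_kernelE; have [Gw|Gw] := pselect (G w); last first.
  by rewrite /damp indicE memNset// !mul0r mul0e.
rewrite !clockA_good// [in RHS]EFinM.
have cab : clamp a <= clamp b.

  by rewrite /clamp ge_max le_max lexx/= le_max le_min !ge_min ab lexx !orbT.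
rewrite -(dA_ocitv Gw (clamp0 a) cab).
congr (_ * dA N w _)%E; apply/seteqP; split=> r /=; rewrite /oT/= !in_itv/=.
  move=> [/andP[ar rb] /andP[r0 rT]]; rewrite /clamp gt_max r0 le_max le_min rb rT orbT andbT/=.
  by rewrite gt_min ar.
rewrite /clamp gt_max le_max le_min gt_min => /andP[/andP[r0 h] /orP[h2|/andP[h2 h3]]].
  by rewrite leNgt r0 in h2.
by rewrite h2 h3 r0; case/orP: h => [->//|]; rewrite ltNge h3.
Qed.

Lemma clock_kernel_setT w : clock_kernel w setT = (damp w * clockA T w)%:E.
Proof.
rewrite clock_kernelE setTI; have [Gw|Gw] := pselect (G w); last first.
  by rewrite /damp indicE memNset// !mul0r mul0e.
by rewrite dA_ocitv// hA0 subr0 -clockA_good// EFinM.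
Qed.

Lemma damp_meas : measurable_fun setT damp.
Proof.
apply: measurable_funM; first exact: measurable_indic.
apply: (@measurableT_comp _ _ _ _ _ _ (@expR R)); first exact: measurable_expR.
by apply: measurableT_comp => //; exact: clockA_meas.
Qed.

Lemma clock_kernel_meas B : measurable B -> measurable_fun setT (clock_kernel ^~ B).
Proof.
apply: kernel_ocitv.
- by move=> w; rewrite clock_kernel_setT.
- under eq_fun do rewrite clock_kernel_setT.
  by apply/measurable_EFinP/measurable_funM; [exact: damp_meas|exact: clockA_meas].
- move=> a b /ltW ab; under eq_fun do rewrite clock_kernel_itv//.
  apply/measurable_EFinP/measurable_funM; first exact: damp_meas.
  by apply: measurable_funB; exact: clockA_meas.
Qed.

HB.instance Definition _ := isKernel.Build _ _ Omega RT R clock_kernel clock_kernel_meas.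

Let clock_kernel_uub : measure_fam_uub clock_kernel.
Proof.
exists 2 => w; rewrite clock_kernel_setT lte_fin /damp -mulrA.
have c0 := clockA_ge0 w T0.
have i1 : \1_G w <= 1 :> R by rewrite indicE lern1 leq_b1.
apply: (@le_lt_trans _ _ 1); last by rewrite ltr1n.
have e0 : 0 <= expR (- clockA T w) * clockA T w by rewrite mulr_ge0 ?expR_ge0.
rewrite (le_trans (ler_wpM2r e0 i1))// mul1r.
rewrite expRN mulrC ler_pdivrMr ?expR_gt0// mul1r.
by rewrite (le_trans _ (expR_ge1Dx _))// lerDr.
Qed.

HB.instance Definition _ :=
  Kernel_isFinite.Build _ _ Omega RT R clock_kernel clock_kernel_uub.

(** [phi] is predictable on nonnegative times; clamping the time at 0 yields a kernel on all of R,
    unchanged on ]0, T]. *)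
Definition mark_kernel (x : Omega * RT) : {measure set BE -> \bar R} :=
  phi N (Num.max 0 (x.2 : R)) x.1.

Lemma mark_kernel_meas C : measurable C -> measurable_fun setT (mark_kernel ^~ C).
Proof.
move=> mC.
have h := hphi mC.
apply: (@measurable_comp _ _ _ _ _ _ (`[0, +oo[ `*` setT : set (Defs.predType F))
  (fun x : Defs.predType F => phi N x.1 x.2 C) _
  ((fun x : Omega * RT => (Num.max 0 (x.2 : R), x.1)) : _ -> Defs.predType F)).
- exact: measurable_predictable_coitv.
- by move=> _ [x _ <-] /=; rewrite in_itv/= le_max lexx.
- exact: h.
- have h1 : measurable_fun setT ((fun x : Omega * RT => (Num.max 0 (x.2 : R), x.1)) : _ -> R * Omega).
    apply: measurable_fun_pair => //=.
    by apply: measurable_maxr => //; exact: measurable_snd.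
  have h2 := measurable_id_predictable (fun t _ => filt_sub hW hp (t := t)).
  exact: (measurableT_comp h2 h1).
Qed.

HB.instance Definition _ :=
  isKernel.Build _ _ (Omega * RT)%type BE R mark_kernel mark_kernel_meas.

Let mark_kernel_uub : measure_fam_uub mark_kernel.
Proof.
exists 2 => x; have -> : mark_kernel x setT = 1%E by exact: probability_setT.
by rewrite lte_fin ltr1n.
Qed.

HB.instance Definition _ :=
  Kernel_isFinite.Build _ _ (Omega * RT)%type BE R mark_kernel mark_kernel_uub.

(** The product of the Dirac mass at the time s with the mark law, so that composing with the clock
    gives phi(de) dA on the space of times and marks. *)
Definition graph_kernel (x : Omega * RT) : {measure set (R * BE) -> \bar R} :=
  measure_function_pushforward__canonical__measure_function_Measure (mark_kernel x)
    (pair1_measurable (x.2 : R)).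

Lemma graph_kernel_meas U : measurable U -> measurable_fun setT (graph_kernel ^~ U).
Proof.
move=> mU.
have mi : measurable_fun setT
    ((fun z : (Omega * RT) * BE => (z.1.2 : R, z.2)) : _ -> R * BE).
  apply: measurable_fun_pair => //=.
  by apply: (measurableT_comp (f := (snd : Omega * RT -> R))) => //; exact: measurable_snd.
have mA : (fun z : (Omega * RT) * BE => (z.1.2 : R, z.2)) @^-1` U \in
    (measurable : set (set ((Omega * RT) * BE))).
  by rewrite inE -[X in measurable X]setTI; exact: mi.
have := measurable_fun_xsection_finite_kernel mark_kernel mA.
congr measurable_fun; apply/funext => x; congr (mark_kernel x _).
by apply/seteqP; split=> e /=; rewrite /xsection/= ?inE.
Qed.

HB.instance Definition _ :=
  isKernel.Build _ _ (Omega * RT)%type (R * BE)%type R graph_kernel graph_kernel_meas.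

Let graph_kernel_uub : measure_fam_uub graph_kernel.
Proof.
exists 2 => x; have -> : graph_kernel x setT = 1%E by exact: probability_setT.
by rewrite lte_fin ltr1n.
Qed.

HB.instance Definition _ :=
  Kernel_isFinite.Build _ _ (Omega * RT)%type (R * BE)%type R graph_kernel graph_kernel_uub.

(** The factor exp(A_T) cancels the damping: on G this is phi dA on ]0, T], off G the zero measure.
    Going through finite kernels makes its integrals measurable in w. *)
Definition compensator (w : Omega) : {measure set (R * BE) -> \bar R} :=
  mscale (NngNum (expR_ge0 (clockA T w))) (mkcomp clock_kernel graph_kernel w).

Lemma compensator_meas (f : Omega * (R * BE) -> \bar R) : (forall z, 0 <= f z)%E ->
  measurable_fun setT f ->
  measurable_fun setT (fun w => \int[compensator w]_z f (w, z))%E.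
Proof.
move=> f0 mf.
have -> : (fun w => \int[compensator w]_z f (w, z))%E = (fun w =>
    (expR (clockA T w))%:E * \int[mkcomp clock_kernel graph_kernel w]_z f (w, z))%E.
  apply/funext => w; rewrite /compensator ge0_integral_mscale//.
  exact: measurable_fun_pair2.
apply: emeasurable_funM.
  apply/measurable_EFinP; apply: (@measurableT_comp _ _ _ _ _ _ (@expR R)).
    exact: measurable_expR.
  exact: clockA_meas.
exact: (measurable_fun_integral_sfinite_kernel f (mkcomp clock_kernel graph_kernel)).
Qed.

Lemma graph_kernel_integral_meas w (f : R * BE -> \bar R) : (forall z, 0 <= f z)%E ->
  measurable_fun setT f -> measurable_fun setT (fun s : RT => \int[graph_kernel (w, s)]_z f z)%E.
Proof.
move=> f0 mf; apply: (measurable_fun_pair2 (f := fun x => \int[graph_kernel x]_z f z)%E).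
by apply: measurable_fun_integral_kernel => //; exact: graph_kernel_meas.
Qed.

Lemma graph_kernel_integral w (f : R * BE -> \bar R) (s : R) : (forall z, 0 <= f z)%E ->
  measurable_fun setT f -> 0 < s ->
  (\int[graph_kernel (w, s)]_z f z = \int[phi N s w]_e f (s, e))%E.
Proof.
move=> f0 mf s0; rewrite (ge0_integral_pushforward (pair1_measurable (s : R)))//.
by rewrite /mark_kernel/= max_r// ltW.
Qed.

Lemma phi_integral_meas w (f : R * BE -> \bar R) : (forall z, 0 <= f z)%E ->
  measurable_fun setT f ->
  measurable_fun (oc 0 T : set RT) (fun s : RT => \int[phi N s w]_e f (s, e))%E.
Proof.
move=> f0 mf; apply: eq_measurable_fun (measurable_funTS (graph_kernel_integral_meas w f0 mf)).
move=> s /[!inE]/= /[!in_itv]/= /andP[s0 _]; exact: graph_kernel_integral.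
Qed.

Lemma compensator_integral w (f : R * BE -> \bar R) : G w -> (forall z, 0 <= f z)%E ->
  measurable_fun setT f ->
  (\int[compensator w]_z f z =
   \int[dA N w]_(s in oc 0%R T) \int[phi N s w]_e f (s, e))%E.
Proof.
move=> Gw f0 mf; rewrite /compensator ge0_integral_mscale//.
have mg := graph_kernel_integral_meas w f0 mf.
have g0 (s : RT) : (0 <= \int[graph_kernel (w, s)]_z f z)%E by apply: integral_ge0.
rewrite integral_kcomp// /clock_kernel ge0_integral_mscale// integral_mrestr//.
rewrite muleA -EFinM /= /damp indicE mem_set// mul1r -expRD subrr expR0 mul1e.
apply: eq_integral => s /[!inE]; rewrite /oT/= in_itv/= => /andP[s0 _].
exact: graph_kernel_integral.
Qed.

Lemma compensator_bad w : ~ G w -> compensator w = mzero :> (set (R * BE) -> \bar R).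
Proof.
move=> Gw; apply/funext => B.
change ((expR (clockA T w))%:E * (\int[clock_kernel w]_s graph_kernel (w, s) B) = 0)%E.
rewrite (eq_measure_integral mzero) ?integral_measure_zero ?mule0//.
by move=> C mC _; rewrite clock_kernelE /damp indicE memNset// mul0r mul0e.
Qed.

End kernels.

(** * The jump measure *)

Lemma pmap_fst_uniq (I T : eqType) (T' : Type) (J : I -> option (T * T')) (l : seq I) :
  (forall i j z z', J i = Some z -> J j = Some z' -> z.1 = z'.1 -> i = j) ->
  uniq l -> uniq [seq z.1 | z <- pmap J l].
Proof.
move=> inj; elim: l => //= i l IH /andP[il ul].
case Ji : (J i) => [z|] /=; last exact: IH.
rewrite IH// andbT; apply/negP => zl; move/negP: il; apply.
have {zl} : exists j z', [/\ j \in l, J j = Some z' & z'.1 = z.1].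
  elim: l zl {IH ul} => //= j l IH; case Jj : (J j) => [z'|] /=.
    rewrite inE => /orP[/eqP e|/IH[k [z2 [kl Jk e]]]].
      by exists j, z'; rewrite inE eqxx.
    by exists k, z2; rewrite inE kl orbT.
  by move=> /IH[k [z2 [kl Jk e]]]; exists k, z2; rewrite inE kl orbT.
by move=> [j [z' [jl Jj e]]]; rewrite (inj i j z z').
Qed.

Lemma compensator_phi (R : realType) dO (Omega : measurableType dO) (P : probability Omega R)
    (E : ptopologicalType) dim (N : noise R Omega E dim) : is_compensator P N ->
  forall C : set (borelType E), measurable C ->
    predictable (filt P N) `[0, +oo[ (fun t w => phi N t w C).
Proof. by case. Qed.

Section jumps.
Context (R : realType) dO (Omega : measurableType dO) (P : probability Omega R).
Context (E : ptopologicalType) (dim : nat) (N : noise R Omega E dim) (T M : R).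
Local Notation F := (filt P N).
Local Notation A := (cA N).
Local Notation tau := (jump_time N).
Local Notation zeta := (mark N).
Local Notation BE := (borelType E).
Hypotheses (T0 : 0 <= T) (hW : is_wiener P N) (hp : is_marked_point_process P N)
  (hA : predictable F `[0, +oo[ A) (hA0 : forall w, A 0 w = 0)
  (hcomp : is_compensator P N).

Local Notation hphi := (compensator_phi hcomp).

Variable G : set Omega.
Hypotheses (mG : measurable G) (G0 : P (~` G) = 0%E)
  (regG : forall w, G w -> regular_noise N w).

Lemma last_jump w : G w -> exists K, forall n, (K <= n)%N -> (T%:E < tau n w)%E.
Proof.
move=> Gw; have : (\forall n \near \oo, T%:E < tau n w)%E.
  by have /cvgeyPgt := rn_cvg (regG Gw); apply.
by move=> [K _ hK]; exists K => n Kn; exact: hK.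
Qed.

Definition jump_of (w : Omega) (n : nat) : option (R * BE) :=
  if tau n w is r%:E then if r <= T then Some (r, zeta n w) else None else None.

Definition jumps (w : Omega) : seq (R * BE) :=
  if pselect (G w) is left Gw then pmap (jump_of w) (iota 1 (sval (cid (last_jump Gw))))
  else [::].

Lemma tau_lt w n m : G w -> (n < m)%N -> (tau m w < +oo)%E -> (tau n w < tau m w)%E.
Proof.
move=> Gw nm mfin.
have le k l : (k <= l)%N -> (tau k w <= tau l w)%E.
  elim: l => [|l IH]; first by rewrite leqn0 => /eqP ->.
  rewrite leq_eqVlt => /orP[/eqP ->//|kl].
  by rewrite (le_trans (IH kl))// (rn_le (regG Gw)).
rewrite (lt_le_trans _ (le _ _ nm))// (rn_lt (regG Gw))//.
by rewrite (le_lt_trans _ mfin)// le// ltnW.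
Qed.

Lemma jumps_uniq w : uniq [seq z.1 | z <- jumps w].
Proof.
rewrite /jumps; case: pselect => // Gw; apply: pmap_fst_uniq; last exact: iota_uniq.
move=> n m z z'; rewrite /jump_of.
case En : (tau n w) => [r| |] //; case: ifP => // _ [<-].
case Em : (tau m w) => [r'| |] //; case: ifP => // _ [<-] /= rr.
case: (ltngtP n m) => // nm; exfalso.
  by have := tau_lt Gw nm; rewrite Em En ltry rr ltxx => /(_ isT).
by have := tau_lt Gw nm; rewrite Em En ltry rr ltxx => /(_ isT).
Qed.

Definition jump_part (w : Omega) : {measure set (R * BE) -> \bar R} :=
  if pselect (G w) is left _ then jump_measure N w else mzero.

Lemma strip_measurable s t : measurable (strip BE s t : set (R * BE)).
Proof. exact: measurableX. Qed.

Lemma jump_part_jumps w s t (f : R * BE -> R) : 0 <= s -> t <= T ->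
  (forall z, 0 <= f z) -> measurable_fun (strip BE s t) f ->
  (\int[jump_part w]_(z in strip BE s t) (f z)%:E)%E
    = (\sum_(z <- jumps w | s < z.1 <= t) f z)%:E.
Proof.
move=> s0 tT f0 mf; rewrite /jump_part /jumps; case: pselect => [Gw|]; last first.
  by rewrite integral_measure_zero big_nil.
case: cid => K /= hK.
rewrite jump_measure_integral//; last 3 first.
- exact: strip_measurable.
- exact/measurable_EFinP.
- by move=> z _; rewrite lee_fin.
pose g z := ((\1_(strip BE s t) z)%:E * (f z)%:E)%E.
have g0 n : (0 <= atom_value N g w n)%E.
  rewrite /atom_value; case: (tau n w) => // r.
  by rewrite mule_ge0 ?lee_fin// indicE.
rewrite -/g (nneseries_split 1 K (fun k _ => g0 k)).
rewrite eseries0 => [|k Kk _]; last first.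
  have := hK k (leq_trans (leq_addl 1 K) Kk); rewrite /atom_value.
  case: (tau k w) => [r| |]// Tr; rewrite /g indicE memNset ?mul0e//.
  by rewrite /strip/= in_itv/= => -[/andP[_ rt] _]; move: Tr; rewrite lte_fin ltNge (le_trans rt).
rewrite adde0 /index_iota addKn.
elim: (iota 1 K) => [|n l IH]; first by rewrite !big_nil.
rewrite big_cons IH /= {1}/atom_value /jump_of; case: (tau n w) => [r| |] /=; last 2 first.
- by rewrite add0e.
- by rewrite add0e.
rewrite /g indicE; case: (boolP (r <= T)) => rT /=.
  rewrite big_cons/=; case: (boolP (s < r <= t)) => srt.
    by rewrite mem_set ?mul1e -?EFinD// /strip/= in_itv.
  rewrite memNset ?mul0e ?add0e// /strip/= in_itv/= => -[h _].
  by rewrite h in srt.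
rewrite memNset ?mul0e ?add0e// /strip/= in_itv/= => -[/andP[_ rt] _].
by rewrite (le_trans rt tT) in rT.
Qed.

Local Notation q := (compensator T0 hW hp hA hA0 hphi mG G0 regG).

Lemma compensator_bad_integral w (D : set (R * BE)) (f : R * BE -> \bar R) : ~ G w ->
  (\int[q w]_(z in D) f z = 0)%E.
Proof.
move=> Gw; rewrite (eq_measure_integral mzero) ?integral_measure_zero// => B _ _.
by rewrite compensator_bad.
Qed.

Lemma compensator_strip w s t : 0 <= s -> s <= t -> t <= T ->
  q w (strip BE s t) = (clockA N G t w - clockA N G s w)%:E.
Proof.
move=> s0 st tT; have [Gw|Gw] := pselect (G w); last first.
  by rewrite compensator_bad// !clockA_bad// subrr.
have mS := strip_measurable s t.
rewrite !clockA_good// -(dA_ocitv regG Gw s0 st).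
have -> : q w (strip BE s t) = (\int[q w]_z (\1_(strip BE s t) z)%:E)%E.
  by rewrite integral_indic// setIT.
rewrite compensator_integral//; last exact/measurable_EFinP/measurable_indic.
transitivity (\int[dA N w]_(r in oc 0%R T) (\1_(oc s t) (r : R))%:E)%E.
  apply: eq_integral => r _.
  rewrite (eq_integral (cst (\1_(oc s t) (r : R))%:E)) => [|e _]; last first.
    by rewrite !indicE in_setX in_setT andbT.
  by rewrite integral_cst// [X in (_ * X)%E]probability_setT mule1.
rewrite integral_indic//=; congr (dA N w _).
apply/seteqP; split=> r /=; rewrite !in_itv/=; first by case.
move=> /andP[sr rt]; split; rewrite ?sr//.
by rewrite (le_lt_trans s0 sr) (le_trans rt).
Qed.

Section compensation_formula.
Variables (s t : R) (f : R -> Omega -> BE -> R).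
Hypotheses (s0 : 0 <= s) (st : s <= t) (tT : t <= T) (f0 : forall r w e, 0 <= f r w e)
  (mf : predictable_field F `]s, t] f).

(** [f] set to 0 off G and off ]s, t]: the compensation formula is assumed for fields predictable on
    the whole half-line, and the regularity of the noise is available on G. *)
Definition cut (r : R) (w : Omega) (e : BE) : R :=
  ((fun x : Defs.predType F * BE => \1_G x.1.2 * f x.1.1 x.1.2 x.2) \_
     ((`]s, t] `*` setT) `*` setT)) ((r, w), e).

Lemma cut_meas : measurable_fun [set: Defs.predType F * BE]
  (fun x : Defs.predType F * BE => cut x.1.1 x.1.2 x.2).
Proof.
have mD := measurable_predictable_ocitv (F := F) t s0.
have -> : (fun x : Defs.predType F * BE => cut x.1.1 x.1.2 x.2) =
    (fun x : Defs.predType F * BE => \1_G x.1.2 * f x.1.1 x.1.2 x.2) \_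
     ((`]s, t] `*` setT) `*` setT).
  by apply/funext => -[[r w] e].
apply/(measurable_restrictT _ (measurableX mD measurableT)).
have mi : measurable_fun [set: g_sigma_algebraType (F s)] (\1_G : g_sigma_algebraType (F s) -> R).
  exact: indic_good_meas.
have mg := @predictable_field_past _ _ _ _ BE F _ R s t \1_G s0 mi.
exact: (measurable_funM mg mf).
Qed.

Lemma cut_ge0 r w e : 0 <= cut r w e.
Proof.
rewrite /cut patchE; case: ifP => // _.
by rewrite mulr_ge0// indicE.
Qed.

Lemma cutE r w e : G w -> cut r w e = \1_(strip BE s t) (r, e) * f r w e.
Proof.
move=> Gw; rewrite /cut patchE !in_setX !in_setT !andbT/= indicE (mem_set Gw) mul1r.
by rewrite indicE /strip in_setX in_setT andbT; case: ifP => _; rewrite ?mul1r ?mul0r.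
Qed.

Lemma cut_bad r w e : ~ G w -> cut r w e = 0.
Proof. by move=> Gw; rewrite /cut patchE indicE (memNset Gw) mul0r; case: ifP. Qed.

Lemma cut_joint : measurable_fun [set: Omega * (R * BE)]
  (fun x => cut x.2.1 x.1 x.2.2).
Proof.
have h : measurable_fun (([set: R] `*` [set: Omega]) `*` [set: BE])
    (fun x : (R * Omega) * BE => cut x.1.1 x.1.2 x.2).
  apply: (@predictable_field_joint _ _ _ _ _ F _ _ setT cut) => //.
  - by move=> r r0; exact: (filt_sub hW hp).
  - by rewrite setXTT.
  - by rewrite /predictable_field !setXTT; exact: cut_meas.
rewrite !setXTT in h.
apply: (measurableT_comp h (f := fun x : (R * Omega) * BE => cut x.1.1 x.1.2 x.2)
  (g := fun x : Omega * (R * BE) => ((x.2.1, x.1), x.2.2))).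
apply: measurable_fun_pair => /=; last exact: measurableT_comp measurable_snd.
by apply: measurable_fun_pair => /=; first exact: measurableT_comp measurable_snd.
Qed.

Lemma cut_section w : measurable_fun [set: R * BE] (fun z => cut z.1 w z.2).
Proof. exact: (measurableT_comp cut_joint (pair1_measurable w)). Qed.

Lemma f_section w : measurable_fun (strip BE s t) (fun z : R * BE => f z.1 w z.2).
Proof.
by apply: (@predictable_field_section _ _ _ _ _ F) => //; exact: measurable_predictable_ocitv.
Qed.

Lemma jump_part_cut w :
  (\int[jump_part w]_(z in strip BE s t) (f z.1 w z.2)%:E =
   \sum_(1 <= n <oo) atom_value N (fun z => (cut z.1 w z.2)%:E) w n)%E.
Proof.
rewrite /jump_part; case: pselect => [Gw|Gw].
  rewrite jump_measure_integral//; last 3 first.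
  - exact: strip_measurable.
  - by apply/measurable_EFinP; exact: f_section.
  - by move=> z _; rewrite lee_fin.
  apply: eq_eseriesr => n _; rewrite /atom_value; case: (tau n w) => // r.
  by rewrite cutE// EFinM.
rewrite integral_measure_zero eseries0// => n _ _; rewrite /atom_value.
by case: (tau n w) => // r; rewrite cut_bad.
Qed.

Lemma jump_measure_cut w :
  (\int[jump_measure N w]_(z in `]0%R, +oo[ `*` setT) (cut z.1 w z.2)%:E =
   \sum_(1 <= n <oo) atom_value N (fun z => (cut z.1 w z.2)%:E) w n)%E.
Proof.
rewrite jump_measure_integral//; last 3 first.
- exact: measurableX.
- by apply/measurable_EFinP; apply: measurable_funTS; exact: cut_section.
- by move=> z _; rewrite lee_fin cut_ge0.
apply: eq_eseriesr => n _; rewrite /atom_value; case: (tau n w) => // r.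
rewrite indicE in_setX in_setT andbT/=; have [_|] := boolP (r \in _); first by rewrite mul1e.
rewrite notin_setE/= in_itv/= andbT => /negP; rewrite -leNgt mul0e => r0.
have [Gw|Gw] := pselect (G w); last by rewrite cut_bad.
by rewrite cutE// indicE /strip in_setX memNset ?mul0r//= in_itv/= ltNge (le_trans r0 s0).
Qed.

Lemma compensator_cut w :
  (\int[q w]_(z in strip BE s t) (f z.1 w z.2)%:E = \int[q w]_z (cut z.1 w z.2)%:E)%E.
Proof.
have [Gw|Gw] := pselect (G w); last first.
  by rewrite !compensator_bad_integral.
rewrite integral_mkcond; apply: eq_integral => -[r e] _.
by rewrite cutE// patchE indicE /=; case: ifP; rewrite ?mul1r ?mul0r.
Qed.

Lemma compensator_cut_dA w :
  (\int[q w]_z (cut z.1 w z.2)%:E =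
   \int[dA N w]_(r in `]0%R, +oo[) \int[phi N r w]_e (cut r w e)%:E)%E.
Proof.
have [Gw|Gw] := pselect (G w); last first.
  rewrite compensator_bad_integral// [RHS]integral0_eq//.
  by move=> r _; apply: integral0_eq => e _; rewrite cut_bad.
rewrite compensator_integral//; last 2 first.
- by move=> z; rewrite lee_fin cut_ge0.
- by apply/measurable_EFinP; exact: cut_section.
rewrite integral_mkcond [RHS]integral_mkcond; apply: eq_integral => r _; rewrite !patchE.
rewrite !mem_setE !in_itv/= andbT; have [r0|] //= := boolP (0 < r).
have [|rT]// := boolP (r <= T); apply/esym/integral0_eq => e _.
rewrite cutE// indicE /strip in_setX memNset ?mul0r//= in_itv/= => /andP[_ rt].
by rewrite (le_trans rt) in rT.
Qed.

(** Both sides are rewritten for [cut], to which the formula in [is_compensator] applies;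
    measurability comes from a series over the atoms on one side and from the kernel on the
    other. *)
Lemma compensation_formula :
  [/\ measurable_fun setT (fun w => \int[jump_part w]_(z in strip BE s t) (f z.1 w z.2)%:E)%E,
      measurable_fun setT (fun w => \int[q w]_(z in strip BE s t) (f z.1 w z.2)%:E)%E
    & (\int[P]_w \int[jump_part w]_(z in strip BE s t) (f z.1 w z.2)%:E
       = \int[P]_w \int[q w]_(z in strip BE s t) (f z.1 w z.2)%:E)%E].
Proof.
split.
- under eq_fun do rewrite jump_part_cut.
  have [mt mz _ _] := hp.
  apply: (measurable_atom_sum (i := id) (f := fun w z => (cut z.1 w z.2)%:E)) => //.
  + by move=> w z; rewrite lee_fin cut_ge0.
  + by apply/measurable_EFinP; exact: cut_joint.
- under eq_fun do rewrite compensator_cut.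
  apply: (compensator_meas _ _ _ _ _ _ _ _ _ (f := fun x => (cut x.2.1 x.1 x.2.2)%:E)).
  + by move=> z; rewrite lee_fin cut_ge0.
  + by apply/measurable_EFinP; exact: cut_joint.
transitivity (\int[P]_w \int[jump_measure N w]_(z in `]0%R, +oo[ `*` setT)
    (cut z.1 w z.2)%:E)%E.
  by apply: eq_integral => w _; rewrite jump_part_cut jump_measure_cut.
have [_ /(_ (fun r w e => (cut r w e)%:E)) /= hH] := hcomp; rewrite hH//.
- by apply: eq_integral => w _; rewrite compensator_cut compensator_cut_dA.
- by move=> r w e; rewrite lee_fin cut_ge0.
- apply/measurable_EFinP; apply: measurable_funTS; exact: cut_meas.
Qed.

End compensation_formula.

Hypothesis G_exp : Rintegrable P setT (fun w => expR (3 * bcst M * clockA N G T w)).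

Definition noise_measures : random_measures P BE F T M.
Proof.
refine (@RandomMeasures _ _ _ P _ BE F T M (clockA N G) jump_part q jumps
  _ _ _ _ _ _ _ _ _ _ _).
- by move=> t t0; exact: (filt_sub hW hp).
- by move=> r t r0 rt; exact: filt_mono.
- by move=> t; exact: clockA_adapted.
- exact: clockA0.
- by move=> w r t r0 rt tT; exact: clockA_homo.
- exact: clockA_cont.
- exact: compensator_strip.
- exact: jumps_uniq.
- exact: jump_part_jumps.
- by move=> s t f s0 st tT f0 mf; exact: compensation_formula.
- exact: G_exp.
Defined.

End jumps.

(** * Gaps between two solutions *)

Section random_measure_paths.
Context (R : realType) d (Omega : measurableType d) (P : probability Omega R).
Context dE (E : measurableType dE) (F : R -> set (set Omega)) (T M : R).
Variables (S : random_measures P E F T M).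
Hypotheses (T0 : 0 <= T) (M0 : 0 <= M).
Local Notation A := (rmA S).
Local Notation p := (rmp S).
Local Notation q := (rmq S).

Lemma rmA_ge0 w t : 0 <= t <= T -> 0 <= A t w.
Proof. by move=> /andP[t0 tT]; rewrite -(rmA0 S w) rmA_homo. Qed.

Lemma Rintegrable_rmp w s t (f : R * E -> R) : 0 <= s -> t <= T ->
  measurable_fun (strip E s t) f -> Rintegrable (p w) (strip E s t) f.
Proof.
move=> s0 tT mf; apply/integrableP; split; first exact/measurable_EFinP.
rewrite (eq_integral (fun z => (`|f z|)%:E)); last by move=> z _.
by rewrite rmp_jumps ?ltry//; exact: measurableT_comp.
Qed.

Lemma Rintegral_rmp w s t (f : R * E -> R) : 0 <= s -> t <= T ->
  measurable_fun (strip E s t) f ->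
  \int[p w]_(z in strip E s t) f z = \sum_(z <- rmj S w | s < z.1 <= t) f z.
Proof.
move=> s0 tT mf; rewrite /Rintegral integralE.
rewrite (eq_integral (fun z => (Num.max (f z) 0)%:E)); last first.
  by move=> z _; rewrite funeposE EFin_max.
rewrite [X in (_ - X)%E](eq_integral (fun z => (Num.max (- f z) 0)%:E)); last first.
  by move=> z _; rewrite funenegE EFin_max EFinN.
rewrite !rmp_jumps//; last 4 first.
- by move=> z; rewrite le_max lexx orbT.
- by apply: measurable_maxr => //; exact: measurableT_comp.
- by move=> z; rewrite le_max lexx orbT.
- by apply: measurable_maxr.
rewrite -EFinB /= -sumrB; apply: eq_bigr => z _.
by case: (leP (f z) 0) => h; [rewrite max_l ?oppr_ge0// sub0r opprK|
  rewrite max_r ?oppr_le0 1?ltW// subr0].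
Qed.

Lemma Rintegral_rmp_isolated w (f : R * E -> R) z : z \in rmj S w ->
  measurable_fun (strip E 0 T) f ->
  exists2 delta, 0 < delta & forall s t, 0 <= s -> s < z.1 -> z.1 <= t -> t <= T ->
    z.1 - s < delta -> t - z.1 < delta -> \int[p w]_(z in strip E s t) f z = f z.
Proof.
move=> zj mf; have [g g0 hg] := jump_isolated (rmj S w) z.1.
exists g => // s t s0 sz zt tT zs tz.
rewrite Rintegral_rmp//; last first.
  by apply: measurable_funS mf; [exact: measurable_strip|exact: strip_sub].
have uj : uniq (rmj S w) by exact: map_uniq (rmj_uniq S w).
rewrite big_mkcond (bigD1_seq z)//= sz zt big_seq_cond big1 ?addr0// => z' /andP[z'j z'z].
case: ifP => // /andP[sz' z't]; exfalso; move/negP: z'z; apply.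
have e : z'.1 = z.1.
  by apply: hg => //; rewrite ltr_norml; apply/andP; split; lra.
have [i ij zi] := nthP z' z'j; have [k kj zk] := nthP z' zj.
have := rmj_uniq S w; move=> /(uniqP z'.1) h.
have : i = k by apply: h; rewrite ?inE ?size_map// !(nth_map z')// zi zk.
by move=> ik; rewrite -zi -zk ik.
Qed.

Lemma strip_split s t r : s <= t -> t <= r ->
  strip E s r = strip E s t `|` strip E t r :> set (R * E).
Proof.
move=> st tr; apply/seteqP; split=> -[x e] /=; rewrite /strip /= !in_itv/=.
  move=> [/andP[sx xr] _]; have [xt|tx] := leP x t; last by right; rewrite xr.
  by left; rewrite sx.
move=> [|] [/andP[a b] _]; split => //; first by rewrite a (le_trans b).
by rewrite b (le_lt_trans st).
Qed.

Lemma Rintegral_strip_split (mu : {measure set (R * E) -> \bar R}) (f : R * E -> R) s t r :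
  s <= t -> t <= r -> Rintegrable mu (strip E s r) f ->
  \int[mu]_(z in strip E s r) f z =
  \int[mu]_(z in strip E s t) f z + \int[mu]_(z in strip E t r) f z.
Proof.
move=> st tr fi; have mS a b : measurable (strip E a b : set (R * E)) by exact: measurableX.
rewrite (strip_split st tr) Rintegral_setU -?strip_split//.
apply/disj_setPS => -[x e] [] [] /=; rewrite !in_itv/= => /andP[_ xt] _ [].
by rewrite /= in_itv/= ltNge xt.
Qed.

Section integrand.
Variables (u rho : R -> Omega -> E -> R) (w : Omega).
Hypotheses (pu : predictable_field F `[0, T] u) (prho : predictable_field F `[0, T] rho).
Hypothesis brho : forall t w e, 0 <= t <= T -> 0 <= rho t w e <= M.
Hypothesis u2 : Rintegrable (q w) (strip E 0 T) (fun z => u z.1 w z.2 ^+ 2).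

Lemma strip_section (f : R -> Omega -> E -> R) s t : 0 <= s -> t <= T ->
  predictable_field F `[0, T] f -> measurable_fun (strip E s t) (fun z => f z.1 w z.2).
Proof.
move=> s0 tT pf; apply: measurable_funS (strip_sub s0 tT) _.
  exact: measurable_strip.
by apply: (pred_section (F := F)) => //; exact: (pred_sub (T := T)).
Qed.

Lemma rmq_cst c s t : 0 <= s -> s <= t -> t <= T ->
  Rintegrable (q w) (strip E s t) (cst c) /\
  \int[q w]_(z in strip E s t) (cst c z) = c * (A t w - A s w).
Proof.
move=> s0 st tT; have mS := measurable_strip (E := E) s t.
have h := rmq_mass S w s0 st tT.
split; last by rewrite Rintegral_cst// h.
apply/integrableP; split; first by apply/measurable_EFinP.
rewrite (_ : (fun x => _) = cst `|c|%:E) ?integral_cst//.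
by rewrite h -EFinM ltry.
Qed.

Lemma Rintegrable_young c s t : 0 <= s -> s <= t -> t <= T ->
  Rintegrable (q w) (strip E s t) (fun z => c * u z.1 w z.2 ^+ 2 + c^-1).
Proof.
move=> s0 st tT; have mS := measurable_strip (E := E) s t.
apply: RintegrableD => //; last by have [] := rmq_cst c^-1 s0 st tT.
apply: RintegrableZ => //; apply: (integrableS _ mS _ u2).
- exact: measurable_strip.
- exact: strip_sub.
Qed.

Lemma abs_young (c x : R) : 0 < c -> `|x| <= c * x ^+ 2 + c^-1.
Proof.
move=> c0; rewrite -(real_normK (num_real x)); set y := `|x|.
have y0 : 0 <= y := normr_ge0 _.
rewrite -subr_ge0.
have -> : c * y ^+ 2 + c^-1 - y = c * ((y - c^-1 / 2) ^+ 2 + 3 / 4 * c^-1 ^+ 2).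
  by field; rewrite gt_eqF.
apply: mulr_ge0; first exact: ltW.
by apply: addr_ge0; rewrite ?sqr_ge0// mulr_ge0 ?sqr_ge0// divr_ge0.
Qed.

Lemma urho_bound c s t (z : R * E) : 0 <= s -> t <= T -> 0 < c -> strip E s t z ->
  `|u z.1 w z.2 * rho z.1 w z.2| <= M * (c * u z.1 w z.2 ^+ 2 + c^-1).
Proof.
move=> s0 tT c0 [/= ]; rewrite in_itv/= => /andP[sz zt] _.
have h0 : 0 <= z.1 <= T by rewrite (le_trans s0 (ltW sz)) (le_trans zt).
have /andP[r0 rM] := brho w z.2 h0.
by rewrite normrM mulrC ler_pM ?normr_ge0 ?abs_young// ger0_norm.
Qed.

Lemma Rintegrable_u s t : 0 <= s -> s <= t -> t <= T ->
  Rintegrable (q w) (strip E s t) (fun z => u z.1 w z.2).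
Proof.
move=> s0 st tT; have mS := measurable_strip (E := E) s t.
apply: Rintegrable_le mS (strip_section s0 tT pu) _ (Rintegrable_young 1 s0 st tT).
by move=> z _; rewrite abs_young.
Qed.

Lemma Rintegrable_urho s t : 0 <= s -> s <= t -> t <= T ->
  Rintegrable (q w) (strip E s t) (fun z => u z.1 w z.2 * rho z.1 w z.2).
Proof.
move=> s0 st tT; have mS := measurable_strip (E := E) s t.
apply: (Rintegrable_le mS (g := fun z => M * (1 * u z.1 w z.2 ^+ 2 + 1^-1))).
- by apply: measurable_funM; exact: strip_section.
- by move=> z hz; apply: urho_bound hz.
- by apply: RintegrableZ => //; exact: Rintegrable_young.
Qed.

Lemma urho_small eta : 0 < eta -> exists2 delta, 0 < delta &
  forall s t, 0 <= s -> s <= t -> t <= T -> t - s < delta ->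
    `|\int[q w]_(z in strip E s t) (u z.1 w z.2 * rho z.1 w z.2)| <= eta.
Proof.
move=> eta0; set Q := \int[q w]_(z in strip E 0 T) (u z.1 w z.2 ^+ 2).
have Q0 : 0 <= Q by apply: Rintegral_ge0 => z _; exact: sqr_ge0.
(* Chosen so that the quadratic part M c Q is at most eta / 2; the mass part, M / c times the
   increment of A, is then made small by uniform continuity of A. *)
pose c := eta / 2 / ((M + 1) * (Q + 1)).
have MQ : 0 < (M + 1) * (Q + 1) by rewrite mulr_gt0// ltr_wpDl.
have c0 : 0 < c by rewrite divr_gt0// divr_gt0.
have e0 : 0 < eta / 2 * c / (M + 1).
  by rewrite divr_gt0 ?ltr_wpDl// mulr_gt0// divr_gt0.
have cA : {within `[0, T], continuous (A ^~ w)} := @rmA_cont _ _ _ _ _ _ _ _ _ S w.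
have [dl dl0 hd] := continuous_modulus cA e0.
exists dl => [//|s t s0 st tT ts]; have mS := measurable_strip (E := E) s t.
have iy := Rintegrable_young c s0 st tT.
have [ic ec] := rmq_cst c^-1 s0 st tT.
have u2s : Rintegrable (q w) (strip E s t) (fun z => u z.1 w z.2 ^+ 2).
  by apply: (integrableS _ mS _ u2); [exact: measurable_strip|exact: strip_sub].
apply: (le_trans (le_normr_Rintegral mS (Rintegrable_urho s0 st tT))).
apply: (@le_trans _ _ (\int[q w]_(z in strip E s t) (M * (c * u z.1 w z.2 ^+ 2 + c^-1)))).
  apply: le_Rintegral => //.
  - by apply: Rintegrable_abs => //; exact: Rintegrable_urho.
  - exact: RintegrableZ.
  - by move=> z hz; apply: urho_bound hz.
rewrite RintegralZl// RintegralD//; last by apply: RintegrableZ.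
rewrite RintegralZl// ec.
have Qst : \int[q w]_(z in strip E s t) (u z.1 w z.2 ^+ 2) <= Q.
  apply: fine_le; rewrite ?fin_num_integral//.
  - exact: integrable_fin_num.
  - by apply: integrable_fin_num => //; exact: measurable_strip.
  apply: ge0_subset_integral => //.
  - exact: measurable_strip.
  - by case/integrableP: u2.
  - by move=> z _; rewrite lee_fin sqr_ge0.
  - exact: strip_sub.
have At : A t w - A s w <= eta / 2 * c / (M + 1).
  apply: ltW; apply: le_lt_trans (ler_norm _) _; apply: hd.
  - by rewrite (le_trans s0 st) tT.
  - by rewrite s0 (le_trans st).
  - by rewrite ger0_norm ?subr_ge0.
apply: (@le_trans _ _ (M * (c * Q + c^-1 * (eta / 2 * c / (M + 1))))).
  by rewrite ler_wpM2l// lerD// ler_wpM2l ?invr_ge0// ltW.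
apply: (@le_trans _ _ ((M + 1) * (c * (Q + 1) + c^-1 * (eta / 2 * c / (M + 1))))).
  have X0 : 0 <= c^-1 * (eta / 2 * c / (M + 1)) by rewrite mulr_ge0// ?invr_ge0 ltW.
  have cQ : c * Q <= c * (Q + 1) by rewrite ler_wpM2l ?lerDl// ltW.
  apply: ler_pM => //; first by rewrite addr_ge0// mulr_ge0// ltW.
  - by rewrite lerDl.
  - by rewrite lerD2r.
rewrite /c le_eqVlt; apply/orP; left; apply/eqP; field.
by rewrite !gt_eqF// ltr_wpDl.
Qed.

Lemma mean_sq_bound : (\int[q w]_(z in strip E 0 T) `|u z.1 w z.2|) ^+ 2 <=
  (1 + A T w) * \int[q w]_(z in strip E 0 T) (u z.1 w z.2 ^+ 2).
Proof.
have mS := measurable_strip (E := E) 0 T.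
set v := (X in X ^+ 2); set Q := (X in _ * X).
have A0 : 0 <= A T w by rewrite rmA_ge0 ?T0/=.
(* The optimal constant, with the mass A_T replaced by 1 + A_T to avoid dividing by 0; integrating 2
   c |u| <= u^2 + c^2 gives the Cauchy-Schwarz bound. *)
pose c := v / (1 + A T w); have th0 : 0 < 1 + A T w by rewrite ltr_wpDr.
have iu : Rintegrable (q w) (strip E 0 T) (fun z => `|u z.1 w z.2|).
  by apply: Rintegrable_abs => //; exact: Rintegrable_u.
have [ic ec] := rmq_cst (c ^+ 2) (lexx 0) T0 (lexx T).
have iq : Rintegrable (q w) (strip E 0 T) (fun z => 2 * c * `|u z.1 w z.2|).
  exact: RintegrableZ.
have : \int[q w]_(z in strip E 0 T) (2 * c * `|u z.1 w z.2|) <=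
    \int[q w]_(z in strip E 0 T) (u z.1 w z.2 ^+ 2 + cst (c ^+ 2) z).
  apply: le_Rintegral => //; first exact: RintegrableD.
  move=> z _ /=; rewrite -(real_normK (num_real (u z.1 w z.2))) -subr_ge0.
  set y := `|_|; have -> : y ^+ 2 + c ^+ 2 - 2 * c * y = (y - c) ^+ 2 by ring.
  exact: sqr_ge0.
rewrite RintegralZl// RintegralD// ec rmA0 subr0 -/v -/Q => h.
have : v ^+ 2 * (1 + (1 + A T w)^-1) <= (1 + A T w) * Q.
  apply: (@le_trans _ _ ((1 + A T w) * (2 * c * v - c ^+ 2 * A T w))); last first.
    by rewrite ler_pM2l// lerBlDr.
  rewrite le_eqVlt; apply/orP; left; apply/eqP; rewrite /c; field.
  by rewrite gt_eqF.
apply: le_trans; rewrite ler_peMr ?sqr_ge0// lerDl invr_ge0 ltW//.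
Qed.

End integrand.
End random_measure_paths.

(** * Inequalities for the integrability of the dominator *)

Section weighted_psi_bounds.
Context (R : realType).
Implicit Types a v th x : R.

(** Young for the exponents 3 and 3/2, matched to psi(v)^(3/2) <= v^2. The parameter th will
    compensate the factor 1 + A_T in the squared integral of |u|. *)
Lemma weighted_psi a th v : 0 <= a -> 0 < th ->
  a * psi v <= a ^+ 3 * th ^+ 2 + v ^+ 2 / th.
Proof.
move=> a0 th0; set c := cbrt v; have c0 : 0 <= c := cbrt_ge0 v.
have c6 : c ^+ 6 <= v ^+ 2.
  have -> : c ^+ 6 = (c ^+ 3) ^+ 2 by ring.
  rewrite /c cbrt_cube; have [v0|v0] := leP 0 v; first by [].
  by rewrite expr0n sqr_ge0.
have i0 : 0 <= th^-1 by rewrite invr_ge0 ltW.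
apply: (@le_trans _ _ (a ^+ 3 * th ^+ 2 + c ^+ 6 / th)); last by rewrite lerD2l ler_wpM2r.
pose sg := c ^+ 2 / th; have sg0 : 0 <= sg by rewrite mulr_ge0// exprn_ge0.
have -> : a ^+ 3 * th ^+ 2 + c ^+ 6 / th = th ^+ 2 * (a ^+ 3 + sg ^+ 3).
  by rewrite /sg; field; rewrite gt_eqF.
have -> : a * psi v = th ^+ 2 * (a * sg ^+ 2).
  by rewrite /sg /psi -/c; field; rewrite gt_eqF.
apply: ler_wpM2l; first by rewrite exprn_ge0// ltW.
rewrite -subr_ge0.
have -> : a ^+ 3 + sg ^+ 3 - a * sg ^+ 2 =
    ((a - sg) ^+ 2 * (a + 2 * sg) + 2 * a ^+ 3 + sg ^+ 3) / 3 by field.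
apply: divr_ge0 => //; apply: addr_ge0; last exact: exprn_ge0.
apply: addr_ge0; last by apply: mulr_ge0 => //; exact: exprn_ge0.
by apply: mulr_ge0; [exact: sqr_ge0|apply: addr_ge0 => //; exact: mulr_ge0].
Qed.

Lemma psiD x v : psi (x + v) <= psi (2 * x) + psi (2 * v).
Proof.
have [xv|/ltW vx] := leP x v.
- by rewrite (le_trans (_ : _ <= psi (2 * v))) ?lerDr ?psi_ge0// le_psi// mulr2n mulrDl mul1r lerD2r.
- by rewrite (le_trans (_ : _ <= psi (2 * x))) ?lerDl ?psi_ge0// le_psi// mulr2n mulrDl mul1r lerD2l.
Qed.

(** With dl = eta - 3b and x = A_T, the strict margin in the exponential moment pays for a
    polynomial factor. *)
Lemma sqr1D_le_expR (dl x : R) : 0 < dl -> 0 <= x ->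
  (1 + x) ^+ 2 <= (1 + 2 / dl) ^+ 2 * expR (dl * x).
Proof.
move=> d0 x0.
have -> : expR (dl * x) = expR (dl * x / 2) ^+ 2 by rewrite -expRM_natl; congr expR; field.
have c0 : 0 <= 2 / dl by rewrite divr_ge0// ltW.
rewrite -exprMn; apply: lerXn2r; rewrite ?nnegrE.
- by rewrite addr_ge0.
- by rewrite mulr_ge0 ?expR_ge0// addr_ge0.
apply: (@le_trans _ _ ((1 + 2 / dl) * (1 + dl * x / 2))); last first.
  by rewrite ler_wpM2l ?expR_ge1Dx// addr_ge0// divr_ge0 ?ltW.
rewrite -subr_ge0.
have -> : (1 + 2 / dl) * (1 + dl * x / 2) - (1 + x) = 2 / dl + dl * x / 2.
  by field; rewrite gt_eqF.
by apply: addr_ge0 => //; apply: divr_ge0 => //; apply: mulr_ge0 => //; exact: ltW.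
Qed.

End weighted_psi_bounds.

(** * The difference of two backward equations *)

Section backward_paths.
Context (R : realType) d (Omega : measurableType d) (P : probability Omega R).
Context dE (E : measurableType dE) (F : R -> set (set Omega)) (T M : R).
Variables (S : random_measures P E F T M) (C : R -> Omega -> R) (rho : R -> Omega -> E -> R).
Local Notation A := (rmA S).
Local Notation p := (rmp S).
Local Notation q := (rmq S).

(** One component of a solution. The parameter [C] collects the terminal value and the two drivers;
    it is common to both solutions and cancels in their difference. *)
Record backward_path := BackwardPath {
  bpY : R -> Omega -> R;
  bpU : R -> Omega -> E -> R;
  bpI : R -> Omega -> R;
  bpK : R -> Omega -> R;
  bpY_adapted : forall t, 0 <= t <= T ->
    measurable_fun [set: g_sigma_algebraType (F t)] (bpY t);
  bpY_cadlag : forall w, cadlag_on T (bpY ^~ w);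
  bpU_pred : predictable_field F `[0, T] bpU;
  bpU_path : forall w, Rintegrable (q w) (strip E 0 T) (fun z => bpU z.1 w z.2 ^+ 2);
  bpU_sq : (\int[P]_w \int[q w]_(z in strip E 0 T) (bpU z.1 w z.2 ^+ 2)%:E < +oo)%E;
  bpI_adapted : forall t, 0 <= t <= T ->
    measurable_fun [set: g_sigma_algebraType (F t)] (bpI t);
  bpI_sq : forall t, 0 <= t <= T -> Rintegrable P setT (fun w => bpI t w ^+ 2);
  bpI_orth : forall s t, 0 <= s -> s <= t -> t <= T -> forall B, <<s F s>> B ->
    \int[P]_(w in B) (bpI t w - bpI s w) = 0;
  bpI_cont : forall w, {within `[0, T], continuous (bpI ^~ w)};
  bpI0 : {ae P, forall w, bpI 0 w = 0};
  bpK_meas : forall t, 0 <= t <= T -> measurable_fun setT (bpK t);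
  bpK_homo : forall w s t, 0 <= s -> s <= t -> t <= T -> bpK s w <= bpK t w;
  bpK0 : forall w, bpK 0 w = 0;
  bpK_cont : forall w, {within `[0, T], continuous (bpK ^~ w)};
  bpK_sq : Rintegrable P setT (fun w => bpK T w ^+ 2);
  bpY_eqn : forall w t, 0 <= t <= T ->
    bpY t w = C t w
      + \int[q w]_(z in strip E t T) (bpU z.1 w z.2 * rho z.1 w z.2)
      - \int[p w]_(z in strip E t T) bpU z.1 w z.2
      - (bpI T w - bpI t w) + (bpK T w - bpK t w)
}.

Hypotheses (T0 : 0 <= T) (M0 : 0 <= M).
Hypotheses (prho : predictable_field F `[0, T] rho)
  (brho : forall t w e, 0 <= t <= T -> 0 <= rho t w e <= M).
Variable eta : R.
Hypotheses (eta3 : 3 * bcst M < eta) (heta : Rintegrable P setT (fun w => expR (eta * A T w))).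
Variables B B' : backward_path.

Let x t w := bpY B t w - bpY B' t w.
Let u r w e := bpU B r w e - bpU B' r w e.
Let J t w := bpI B t w - bpI B' t w.
Let K := bpK B.
Let L := bpK B'.

Let T01 : 0 <= T <= T. Proof. by rewrite T0/=. Qed.

Lemma bpI_meas (X : backward_path) t : 0 <= t <= T -> measurable_fun setT (bpI X t).
Proof.
move=> ht; apply: (sub_measurable_fun (rm_sub S (_ : 0 <= t))) (bpI_adapted X ht).
by case/andP: ht.
Qed.

Lemma gap_adapted t : 0 <= t <= T -> measurable_fun [set: g_sigma_algebraType (F t)] (x t).
Proof. by move=> ht; apply: measurable_funB; exact: bpY_adapted. Qed.

Lemma gapu_pred : predictable_field F `[0, T] u.
Proof. by apply: measurable_funB; exact: bpU_pred. Qed.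

Lemma gapu_sq_le r w e : u r w e ^+ 2 <= 2 * bpU B r w e ^+ 2 + 2 * bpU B' r w e ^+ 2.
Proof.
rewrite -subr_ge0 /u; have -> : 2 * bpU B r w e ^+ 2 + 2 * bpU B' r w e ^+ 2
    - (bpU B r w e - bpU B' r w e) ^+ 2 = (bpU B r w e + bpU B' r w e) ^+ 2 by ring.
exact: sqr_ge0.
Qed.

Lemma gapu_path w : Rintegrable (q w) (strip E 0 T) (fun z => u z.1 w z.2 ^+ 2).
Proof.
have mS := measurable_strip (E := E) 0 T.
apply: (Rintegrable_le mS (g := fun z =>
    2 * bpU B z.1 w z.2 ^+ 2 + 2 * bpU B' z.1 w z.2 ^+ 2)).
- by apply: measurable_funX; exact: (strip_section T0 w _ _ gapu_pred).
- by move=> z _; rewrite ger0_norm ?sqr_ge0 ?gapu_sq_le.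
- by apply: RintegrableD => //; apply: RintegrableZ => //; exact: bpU_path.
Qed.

Let sqint (V : R -> Omega -> E -> R) w := \int[q w]_(z in strip E 0 T) (V z.1 w z.2 ^+ 2).

Lemma sqint_integrable (V : R -> Omega -> E -> R) : predictable_field F `[0, T] V ->
  (forall w, Rintegrable (q w) (strip E 0 T) (fun z => V z.1 w z.2 ^+ 2)) ->
  (\int[P]_w \int[q w]_(z in strip E 0 T) (V z.1 w z.2 ^+ 2)%:E < +oo)%E ->
  Rintegrable P setT (sqint V).
Proof.
move=> pV iV VP; have mS := measurable_strip (E := E) 0 T.
have [||_ mV _] := @rm_comp _ _ _ _ _ _ _ _ _ S 0 T (fun r w e => V r w e ^+ 2)
  (lexx 0) T0 (lexx T) _ _.
- by move=> *; exact: sqr_ge0.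
- by apply: measurable_funX; exact: (pred_sub (T := T)).
apply: ge0_Rintegrable => //.
- apply/measurable_EFinP; apply: eq_measurable_fun mV => w _ /=.
  by rewrite -EFin_Rintegral.
- by move=> w _; apply: Rintegral_ge0 => z _; exact: sqr_ge0.
- by under eq_integral do rewrite EFin_Rintegral//.
Qed.

Lemma gapu_sqint : Rintegrable P setT (sqint u).
Proof.
have mS := measurable_strip (E := E) 0 T.
have iB := sqint_integrable (bpU_pred B) (bpU_path B) (bpU_sq B).
have iB' := sqint_integrable (bpU_pred B') (bpU_path B') (bpU_sq B').
have [||_ mu _] := @rm_comp _ _ _ _ _ _ _ _ _ S 0 T (fun r w e => u r w e ^+ 2)
  (lexx 0) T0 (lexx T) _ _.
- by move=> *; exact: sqr_ge0.
- by apply: measurable_funX; apply: (pred_sub (T := T)) => //; exact: gapu_pred.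
apply: (Rintegrable_le measurableT (g := fun w => 2 * sqint (bpU B) w + 2 * sqint (bpU B') w)).
- apply/measurable_EFinP; apply: eq_measurable_fun mu => w _ /=.
  by rewrite -EFin_Rintegral//; exact: gapu_path.
- move=> w _; have iw := bpU_path B w; have iw' := bpU_path B' w.
  rewrite ger0_norm; last by apply: Rintegral_ge0 => z _; exact: sqr_ge0.
  rewrite /sqint -!RintegralZl// -RintegralD//; [|exact: RintegrableZ..].
  apply: le_Rintegral => //; first exact: gapu_path.
  + by apply: RintegrableD => //; exact: RintegrableZ.
  + by move=> z _; exact: gapu_sq_le.
- by apply: RintegrableD => //; exact: RintegrableZ.
Qed.

Lemma gapu_sq : (\int[P]_w \int[q w]_(z in strip E 0 T) (u z.1 w z.2 ^+ 2)%:E < +oo)%E.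
Proof.
have mS := measurable_strip (E := E) 0 T.
have := gapu_sqint; move=> /(EFin_Rintegral measurableT) h.
rewrite (eq_integral (fun w => (sqint u w)%:E)); first by rewrite -h ltry.
by move=> w _; rewrite EFin_Rintegral//; exact: gapu_path.
Qed.

Lemma gapJ_int t : 0 <= t <= T -> Rintegrable P setT (J t).
Proof.
move=> ht; apply: RintegrableB => //; apply: Rintegrable_sq => //.
- exact: bpI_meas.
- exact: bpI_sq.
- exact: bpI_meas.
- exact: bpI_sq.
Qed.

Lemma gapJ_orth s t : 0 <= s -> s <= t -> t <= T ->
  Rintegrable P setT (fun w => J t w - J s w) /\
  forall D, <<s F s>> D -> \int[P]_(w in D) (J t w - J s w) = 0.
Proof.
move=> s0 st tT; have hs : 0 <= s <= T by rewrite s0 (le_trans st).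
have ht : 0 <= t <= T by rewrite tT (le_trans s0).
split; first by apply: RintegrableB => //; exact: gapJ_int.
move=> D FD; have mD : measurable D := rm_sub S s0 FD.
have ii (X : backward_path) : Rintegrable P D (fun w => bpI X t w - bpI X s w).
  apply: (integrableS measurableT mD) => //; apply: RintegrableB => //;
  by apply: Rintegrable_sq => //; [exact: bpI_meas|exact: bpI_sq].
transitivity (\int[P]_(w in D) ((bpI B t w - bpI B s w) - (bpI B' t w - bpI B' s w))).
  by apply: eq_Rintegral => w _; rewrite /J; ring.
transitivity (\int[P]_(w in D) (bpI B t w - bpI B s w) -
    \int[P]_(w in D) (bpI B' t w - bpI B' s w)); first by apply: RintegralB => //; exact: ii.
by rewrite !bpI_orth// subr0.
Qed.

Lemma bpK_integrable (X : backward_path) : Rintegrable P setT (bpK X T).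
Proof. by apply: Rintegrable_sq => //; [exact: bpK_meas|exact: bpK_sq]. Qed.

Lemma gap_eqn_end w t : 0 <= t <= T ->
  x t w = \int[q w]_(z in strip E t T) (u z.1 w z.2 * rho z.1 w z.2)
    - \int[p w]_(z in strip E t T) u z.1 w z.2
    - (J T w - J t w) + (K T w - K t w) - (L T w - L t w).
Proof.
move=> ht; have /andP[t0 tT] := ht; have mS := measurable_strip (E := E) t T.
have pp (X : backward_path) : Rintegrable (p w) (strip E t T) (fun z => bpU X z.1 w z.2).
  by apply: Rintegrable_rmp => //; exact: (strip_section T0 w _ _ (bpU_pred X)).
have qq (X : backward_path) :
    Rintegrable (q w) (strip E t T) (fun z => bpU X z.1 w z.2 * rho z.1 w z.2).
  exact: (Rintegrable_urho T0 (bpU_pred X) prho brho (bpU_path X w) t0 tT (lexx T)).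
have -> : \int[p w]_(z in strip E t T) u z.1 w z.2 =
    \int[p w]_(z in strip E t T) bpU B z.1 w z.2 - \int[p w]_(z in strip E t T) bpU B' z.1 w z.2.
  by apply: RintegralB => //; exact: pp.
have -> : \int[q w]_(z in strip E t T) (u z.1 w z.2 * rho z.1 w z.2) =
    \int[q w]_(z in strip E t T) (bpU B z.1 w z.2 * rho z.1 w z.2)
    - \int[q w]_(z in strip E t T) (bpU B' z.1 w z.2 * rho z.1 w z.2).
  rewrite -(RintegralB mS (qq B) (qq B')); apply: eq_Rintegral => z _.
  by rewrite /u mulrBl.
rewrite /x !bpY_eqn// /J /K /L; ring.
Qed.

Lemma gap_eqn w s t : 0 <= s -> s <= t -> t <= T ->
  x t w - x s w =
    \int[p w]_(z in strip E s t) u z.1 w z.2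
    - \int[q w]_(z in strip E s t) (u z.1 w z.2 * rho z.1 w z.2)
    + (J t w - J s w) - (K t w - K s w) + (L t w - L s w).
Proof.
move=> s0 st tT; have sT := le_trans st tT; have t0 := le_trans s0 st.
rewrite !gap_eqn_end ?s0 ?t0 ?sT ?tT//.
rewrite (Rintegral_strip_split (mu := p w) st tT); last first.
  by apply: Rintegrable_rmp => //; exact: (strip_section T0 w _ _ gapu_pred).
rewrite (Rintegral_strip_split (mu := q w) st tT); last first.
  exact: (Rintegrable_urho T0 gapu_pred prho brho (gapu_path w) s0 sT (lexx T)).
ring.
Qed.

Lemma gap_reg w : regulated 0 T (x ^~ w).
Proof. by apply: regulatedB; apply: cadlag_regulated; exact: bpY_cadlag. Qed.

Lemma gap_end w : x T w = 0.
Proof.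
rewrite gap_eqn_end// !subrr subr0 addr0.
have -> : strip E T T = set0.
  apply/seteqP; split=> -[r e] //=; rewrite /strip/= in_itv/= => -[].
  by move=> /andP[h /(lt_le_trans h)]; rewrite ltxx.
by rewrite !Rintegral_set0 !subr0.
Qed.

(** On a short interval around z the p-integral is exactly u at z, as jumps are isolated; the four
    other terms of the equation become small with the interval and get eps / 4 each. *)
Lemma gap_jump w z eps : z \in rmj S w -> 0 < z.1 <= T -> 0 < eps ->
  exists2 delta, 0 < delta & forall s t, 0 <= s -> s < z.1 -> z.1 <= t -> t <= T ->
    z.1 - s < delta -> t - z.1 < delta -> `|x t w - x s w - u z.1 w z.2| <= eps.
Proof.
move=> zj z0T eps0; have e4 : 0 < eps / 4 by rewrite divr_gt0.
have [d1 d10 h1] := Rintegral_rmp_isolated zj (strip_section T0 w (lexx 0) (lexx T) gapu_pred).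
have [d2 d20 h2] := urho_small T0 M0 gapu_pred prho brho (gapu_path w) e4.
have cJ : {within `[0, T], continuous (fun t => J t w)}.
  by move=> t; apply: continuousB; [exact: (@bpI_cont B w t)|exact: (@bpI_cont B' w t)].
have [d3 d30 h3] := continuous_modulus cJ e4.
have [d4 d40 h4] := continuous_modulus (@bpK_cont B w) e4.
have [d5 d50 h5] := continuous_modulus (@bpK_cont B' w) e4.
pose dl := Num.min d1 (Num.min d2 (Num.min d3 (Num.min d4 d5))).
exists (dl / 2); first by rewrite divr_gt0// !lt_min d10 d20 d30 d40.
move=> s t s0 sz zt tT zs tz.
have st : s <= t := le_trans (ltW sz) zt.
have tsd : t - s < dl by lra.
have hs : 0 <= s <= T by rewrite s0 (le_trans st).
have ht : 0 <= t <= T by rewrite tT (le_trans s0).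
have ts : `|t - s| = t - s by rewrite ger0_norm ?subr_ge0.
move: (tsd); rewrite -[X in X < _]ts /dl !lt_min => /and5P[_ g2 g3 g4 g5].
have dl1 : dl / 2 < d1.
  have : dl <= d1 by rewrite /dl ge_min lexx.
  have : 0 < dl by rewrite !lt_min d10 d20 d30 d40.
  lra.
rewrite gap_eqn// h1 ?(lt_trans zs)// ?(lt_trans tz)//.
have {h2} := h2 s t s0 st tT; rewrite -ts => /(_ g2).
have := h3 t s ht hs g3; have := h4 t s ht hs g4; have := h5 t s ht hs g5.
rewrite !ltr_norml !ler_norml => /andP[a1 a2] /andP[b1 b2] /andP[c1 c2] /andP[f1 f2].
rewrite /K /L; set I := \int[q w]_(z in _) _ in f1 f2 *.
move: (u _ _ _) I a1 a2 b1 b2 c1 c2 f1 f2; clear => y I a1 a2 b1 b2 c1 c2 f1 f2.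
by apply/andP; split; lra.
Qed.

(** psi of the sum splits into a part from u and a part from K. For the first, [weighted_psi] with
    th = 1 + A_T meets [mean_sq_bound]; for the second th = 1. Both leave exp(3 b A_T) times at most
    (1 + A_T)^2, which a multiple of exp(eta A_T) dominates. *)
Lemma gap_dom : Rintegrable P setT (fun w => expR (bcst M * A T w) *
  psi ((1 + M) * \int[q w]_(z in strip E 0 T) `|u z.1 w z.2| + K T w)).
Proof.
have mS := measurable_strip (E := E) 0 T.
have mA : measurable_fun setT (A T) := sub_measurable_fun (rm_sub S T0) (rmA_adapted S T0).
have iu w := Rintegrable_u T0 gapu_pred (gapu_path w) (lexx 0) T0 (lexx T).
pose v w := \int[q w]_(z in strip E 0 T) `|u z.1 w z.2|.
have mv : measurable_fun setT v.
  have [||_ mu _] := @rm_comp _ _ _ _ _ _ _ _ _ S 0 T (fun r w e => `|u r w e|)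
    (lexx 0) T0 (lexx T) _ _.
  - by move=> *; exact: normr_ge0.
  - by apply: measurableT_comp => //; apply: (pred_sub (T := T)) => //; exact: gapu_pred.
  apply/measurable_EFinP; apply: eq_measurable_fun mu => w _ /=.
  by rewrite -EFin_Rintegral//; apply: Rintegrable_abs.
have dl0 : 0 < eta - 3 * bcst M by rewrite subr_gt0.
pose c := (1 + 2 / (eta - 3 * bcst M)) ^+ 2.
apply: (Rintegrable_le measurableT (g := fun w => 2 * c * expR (eta * A T w)
  + (2 * (1 + M)) ^+ 2 * sqint u w + 4 * K T w ^+ 2)).
- apply: measurable_funM.
    apply: (@measurableT_comp _ _ _ _ _ _ (@expR R)); first exact: measurable_expR.
    exact: measurable_funM.
  apply: measurableT_comp; first exact: measurable_psi.
  by apply: measurable_funD; [exact: measurable_funM|exact: bpK_meas].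
- move=> w _; rewrite ger0_norm; last by apply: mulr_ge0; [exact: expR_ge0|exact: psi_ge0].
  set a := expR _; have a0 : 0 <= a := expR_ge0 _.
  have A0 : 0 <= A T w by exact: rmA_ge0.
  pose th := 1 + A T w; have th0 : 0 < th by rewrite ltr_wpDr.
  have ha : a ^+ 3 * th ^+ 2 <= c * expR (eta * A T w).
    have -> : expR (eta * A T w) = a ^+ 3 * expR ((eta - 3 * bcst M) * A T w).
      by rewrite /a -expRM_natl -expRD; congr expR; ring.
    by rewrite [c * _]mulrCA; apply: ler_wpM2l; [exact: exprn_ge0|exact: sqr1D_le_expR].
  have ha1 : a ^+ 3 * 1 ^+ 2 <= c * expR (eta * A T w).
    apply: le_trans ha; apply: ler_wpM2l; first exact: exprn_ge0.
    by rewrite expr1n; apply: exprn_ege1; rewrite /th lerDl.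
  have h1 := weighted_psi (2 * ((1 + M) * v w)) a0 th0.
  have h2 := weighted_psi (2 * K T w) a0 ltr01.
  have h3 : (2 * ((1 + M) * v w)) ^+ 2 / th <= (2 * (1 + M)) ^+ 2 * sqint u w.
    have -> : (2 * ((1 + M) * v w)) ^+ 2 / th = (2 * (1 + M)) ^+ 2 * (v w ^+ 2 / th) by ring.
    rewrite ler_wpM2l ?sqr_ge0// ler_pdivrMr// mulrC.
    exact: (mean_sq_bound T0 gapu_pred (gapu_path w)).
  have h4 := ler_wpM2l a0 (psiD ((1 + M) * v w) (K T w)).
  move: h2; rewrite divr1 exprMn => h2.
  by move: h4; rewrite mulrDr -/(v w); lra.
- apply: RintegrableD => //; last by apply: RintegrableZ => //; exact: bpK_sq.
  apply: RintegrableD => //; first exact: RintegrableZ.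
  by apply: RintegrableZ => //; exact: gapu_sqint.
Qed.

Definition gap : gap_process S.
Proof.
apply: (@GapProcess _ _ _ _ _ _ _ _ _ S x u rho J K L).
- exact: gap_adapted.
- exact: gapu_pred.
- exact: prho.
- exact: brho.
- exact: gapJ_orth.
- exact: bpK_meas.
- exact: bpK_meas.
- exact: bpK_homo.
- exact: bpK_homo.
- exact: bpK0.
- exact: bpK0.
- by move=> w; exact: (@bpK_cont B w).
- exact: bpK_integrable.
- exact: bpK_integrable.
- exact: gapu_path.
- exact: gapu_sq.
- exact: gap_eqn.
- exact: gap_reg.
- exact: gap_jump.
- exact: gap_end.
- exact: gap_dom.
Defined.

End backward_paths.

(** * Uniqueness for abstract reflected systems *)

Lemma ae_eq_Rintegral d (T : measurableType d) (R : realType) (mu : {measure set T -> \bar R})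
    (D : set T) (f g : T -> R) : measurable D -> measurable_fun D f -> measurable_fun D g ->
  {ae mu, forall x, D x -> f x = g x} -> \int[mu]_(x in D) f x = \int[mu]_(x in D) g x.
Proof.
move=> mD mf mg fg; congr fine; apply: ae_eq_integral => //; try exact/measurable_EFinP.
by move: fg; apply: filterS => x h Dx; rewrite /= h.
Qed.

Lemma ge0_integral_eq0 d (T : measurableType d) (R : realType) (mu : {measure set T -> \bar R})
    (D : set T) (f : T -> \bar R) : measurable D -> measurable_fun D f ->
  (forall x, 0 <= f x)%E -> (\int[mu]_(x in D) f x = 0)%E -> {ae mu, forall x, D x -> f x = 0%E}.
Proof.
move=> mD mf f0 i0; have [+ _] := ae_eq_integral_abs mu mD mf; apply.
by rewrite -i0; apply: eq_integral => x _; rewrite gee0_abs.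
Qed.

(** * Continuous martingales of finite variation *)

Section finite_variation_martingale.
Context (R : realType) d (Omega : measurableType d) (P : probability Omega R).
Variables (F : R -> set (set Omega)) (T : R) (J K L : R -> Omega -> R).
Hypotheses (T0 : 0 <= T) (Fsub : forall t, 0 <= t -> <<s F t>> `<=` measurable).
Hypothesis J_adapted : forall t, 0 <= t <= T ->
  measurable_fun [set: g_sigma_algebraType (F t)] (J t).
Hypothesis J_sq : forall t, 0 <= t <= T -> Rintegrable P setT (fun w => J t w ^+ 2).
Hypothesis J_orth : forall s t, 0 <= s -> s <= t -> t <= T -> forall B, <<s F s>> B ->
  \int[P]_(w in B) (J t w - J s w) = 0.
Hypotheses
  (K_meas : forall t, 0 <= t <= T -> measurable_fun setT (K t))
  (L_meas : forall t, 0 <= t <= T -> measurable_fun setT (L t))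
  (K_homo : forall w s t, 0 <= s -> s <= t -> t <= T -> K s w <= K t w)
  (L_homo : forall w s t, 0 <= s -> s <= t -> t <= T -> L s w <= L t w)
  (K0 : forall w, K 0 w = 0) (L0 : forall w, L 0 w = 0)
  (K_cont : forall w, {within `[0, T], continuous (K ^~ w)})
  (L_cont : forall w, {within `[0, T], continuous (L ^~ w)})
  (K_sq : Rintegrable P setT (fun w => K T w ^+ 2))
  (L_sq : Rintegrable P setT (fun w => L T w ^+ 2)).
Hypothesis J_fv : {ae P, forall w, forall t, 0 <= t <= T -> J t w = K t w - L t w}.

Let J_meas t : 0 <= t <= T -> measurable_fun setT (J t).
Proof.
move=> ht; apply: (sub_measurable_fun (Fsub (_ : 0 <= t))) (J_adapted ht).
by case/andP: ht.
Qed.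

Lemma martingale_increment_sq s t : 0 <= s -> s <= t -> t <= T ->
  Rintegrable P setT (fun w => (J t w - J s w) ^+ 2) /\
  \int[P]_w (J t w ^+ 2) = \int[P]_w (J s w ^+ 2) + \int[P]_w ((J t w - J s w) ^+ 2).
Proof.
move=> s0 st tT; have hs : 0 <= s <= T by rewrite s0 (le_trans st).
have ht : 0 <= t <= T by rewrite tT (le_trans s0).
have mD : measurable_fun setT (fun w => J t w - J s w).
  by apply: measurable_funB; exact: J_meas.
have D2 : Rintegrable P setT (fun w => (J t w - J s w) ^+ 2).
  apply: Rintegrable_sqD; [exact: J_meas|exact: measurableT_comp (J_meas hs)|exact: J_sq|].
  by apply: Rintegrable_sqN; exact: J_sq.
have [JDi JD0] := Rintegral_orth_L2 (subset_trans (@sub_sigma_algebra _ _ _) (Fsub s0))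
  mD D2 (J_orth s0 st tT) (J_adapted hs) (J_sq hs).
split => //.
transitivity (\int[P]_w (J s w ^+ 2 + (J t w - J s w) ^+ 2 + 2 * (J s w * (J t w - J s w)))).
  by apply: eq_Rintegral => w _; ring.
have JDi2 : Rintegrable P setT (fun w => 2 * (J s w * (J t w - J s w))).
  exact: RintegrableZ.
rewrite RintegralD//; last by apply: RintegrableD => //; exact: J_sq.
by rewrite RintegralZl// JD0 mulr0 addr0 RintegralD//; exact: J_sq.
Qed.

Section fixed_time.
Variables (t : R).
Hypothesis ht : 0 <= t <= T.

Let t0 : 0 <= t. Proof. by case/andP: ht. Qed.
Let tT : t <= T. Proof. by case/andP: ht. Qed.

Let V r w := K r w - L r w.

(** Written for V = K - L, which is continuous and of finite variation at every outcome, whereas J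
    equals V only almost surely. *)
Definition quadratic_sum N w := \sum_(k < N.+1) (V (grid 0 t N k.+1) w - V (grid 0 t N k) w) ^+ 2.

Let gridT N k : (k <= N.+1)%N -> 0 <= grid 0 t N k <= T.
Proof. by move=> /(grid_itv t0)/andP[-> h]; exact: le_trans h tT. Qed.

Let grid_le N k : grid 0 t N k <= grid 0 t N k.+1.
Proof. exact: le_grid. Qed.

Lemma V_increment r s w : 0 <= r <= T -> 0 <= s <= T -> `|V r w - V s w| <= K T w + L T w.
Proof.
have H x : 0 <= x <= T -> [/\ 0 <= K x w, K x w <= K T w, 0 <= L x w & L x w <= L T w].
  move=> /andP[x0 xT]; have := K_homo w (lexx 0) x0 xT; have := L_homo w (lexx 0) x0 xT.
  rewrite K0 L0 => l0 k0; split => //; [exact: (K_homo w x0 xT)|exact: (L_homo w x0 xT)].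
move=> /H[a1 a2 a3 a4] /H[b1 b2 b3 b4]; rewrite /V ler_norml; apply/andP; split; lra.
Qed.

Lemma V_meas r : 0 <= r <= T -> measurable_fun setT (V r).
Proof. by move=> hr; apply: measurable_funB; [exact: K_meas|exact: L_meas]. Qed.

Lemma KL_sq : Rintegrable P setT (fun w => (K T w + L T w) ^+ 2).
Proof.
by apply: Rintegrable_sqD => //; [apply: K_meas|apply: L_meas]; rewrite T0/=.
Qed.

Lemma V_increment_sq r s : 0 <= r <= T -> 0 <= s <= T ->
  Rintegrable P setT (fun w => (V r w - V s w) ^+ 2).
Proof.
move=> hr hs; apply: (Rintegrable_le measurableT _ _ KL_sq).
  by apply: measurable_funX; apply: measurable_funB; exact: V_meas.
move=> w _; rewrite ger0_norm ?sqr_ge0// -(real_normK (num_real (V r w - V s w))).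
by apply: lerXn2r; rewrite ?nnegrE// ?V_increment// (le_trans _ (V_increment w hr hs)).
Qed.

Lemma quadratic_sumE N : quadratic_sum N = fun w =>
  \sum_(k <- enum 'I_N.+1) (V (grid 0 t N k.+1) w - V (grid 0 t N k) w) ^+ 2.
Proof. by apply/funext => w; rewrite big_enum. Qed.

(** Orthogonality of the increments turns the second moment into the expected sum of squares,
    whatever the grid; J_0 = 0 almost surely because K and L start at 0. *)
Lemma martingale_sqE N : \int[P]_w (J t w ^+ 2) = \int[P]_w quadratic_sum N w.
Proof.
have JV r s : 0 <= r <= T -> 0 <= s <= T ->
    \int[P]_w ((J r w - J s w) ^+ 2) = \int[P]_w ((V r w - V s w) ^+ 2).
  move=> hr hs; have mV x : 0 <= x <= T -> measurable_fun setT (V x).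
    by move=> hx; apply: measurable_funB; [exact: K_meas|exact: L_meas].
  apply: ae_eq_Rintegral => //.
  - by apply: measurable_funX; apply: measurable_funB; exact: J_meas.
  - by apply: measurable_funX; apply: measurable_funB; exact: mV.
  by move: J_fv; apply: filterS => w hw _ /=; rewrite !hw.
have H n : (n <= N.+1)%N -> \int[P]_w (J (grid 0 t N n) w ^+ 2) =
    \sum_(k < n) \int[P]_w ((J (grid 0 t N k.+1) w - J (grid 0 t N k) w) ^+ 2).
  elim: n => [_|n IH nN].
    rewrite big_ord0 grid0; have h0 : 0 <= (0 : R) <= T by rewrite lexx.
    rewrite (@ae_eq_Rintegral _ _ _ P _ (fun w => J 0 w ^+ 2) (cst 0))// ?Rintegral_cst ?mul0r//.
    + by apply: measurable_funX; exact: J_meas.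
    + by move: J_fv; apply: filterS => w hw _ /=; rewrite hw// K0 L0 subrr expr0n.
  have /andP[n0 _] := gridT (ltnW nN); have /andP[_ nT] := gridT nN.
  have [_ ->] := martingale_increment_sq n0 (grid_le N n) nT.
  by rewrite IH; [rewrite [RHS]big_ord_recr|exact: ltnW nN].
rewrite -[in LHS](gridN 0 t N) H//.
rewrite quadratic_sumE Rintegral_sum//; last first.
  by move=> k; apply: V_increment_sq; apply: gridT => //; exact: ltnW.
rewrite big_enum/=; apply: eq_bigr => k _.
by apply: JV; apply: gridT; [exact: ltn_ord|exact: ltnW (ltn_ord k)].
Qed.

Lemma quadratic_sum_ge0 N w : 0 <= quadratic_sum N w.
Proof. by apply: sumr_ge0 => k _; exact: sqr_ge0. Qed.

(** One factor of each square is bounded by c, the other by the increment of K + L, which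
    telescopes. *)
Lemma quadratic_sum_le N w c :
  (forall k, (k < N.+1)%N -> `|V (grid 0 t N k.+1) w - V (grid 0 t N k) w| <= c) ->
  quadratic_sum N w <= c * (K t w + L t w).
Proof.
move=> hc.
have -> : K t w + L t w = \sum_(k < N.+1) ((K (grid 0 t N k.+1) w + L (grid 0 t N k.+1) w)
    - (K (grid 0 t N k) w + L (grid 0 t N k) w)).
  by rewrite (telescope_grid 0 t N (fun r => K r w + L r w)) K0 L0 addr0 subr0.
rewrite mulr_sumr; apply: ler_sum => k _.
rewrite -(real_normK (num_real _)) expr2 ler_pM ?normr_ge0 ?hc//.
have kN := ltn_ord k.
have /andP[a0 _] := gridT (ltnW kN); have /andP[_ bT] := gridT kN.
have := K_homo w a0 (grid_le N k) bT; have := L_homo w a0 (grid_le N k) bT.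
by rewrite /V => h1 h2; rewrite ler_norml; apply/andP; split; lra.
Qed.

Lemma quadratic_sum_dom N w : quadratic_sum N w <= (K T w + L T w) ^+ 2.
Proof.
have tK := K_homo w t0 tT (lexx T); have tL := L_homo w t0 tT (lexx T).
have := K_homo w (lexx 0) t0 tT; rewrite K0 => K00.
have := L_homo w (lexx 0) t0 tT; rewrite L0 => L00.
apply: (@le_trans _ _ ((K T w + L T w) * (K t w + L t w))).
  apply: quadratic_sum_le => k kN; apply: V_increment; apply: gridT => //; exact: ltnW.
by rewrite expr2; apply: ler_wpM2l; lra.
Qed.

Lemma quadratic_sum_cvg w : quadratic_sum N w @[N --> \oo] --> 0.
Proof.
have cV : {within `[0, T], continuous (V ^~ w)}.
  by move=> r; apply: continuousB; [exact: (@K_cont w r)|exact: (@L_cont w r)].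
have := K_homo w (lexx 0) t0 tT; rewrite K0 => K00.
have := L_homo w (lexx 0) t0 tT; rewrite L0 => L00.
apply/cvgrPdist_le => eps eps0.
have e0 : 0 < eps / (1 + (K t w + L t w)) by rewrite divr_gt0// ltr_wpDr// addr_ge0.
have [dl dl0 hd] := continuous_modulus cV e0.
have [N0 hN0] := @grid_mesh R 0 t _ dl0.
exists N0 => // N /hN0 mesh; rewrite sub0r normrN ger0_norm ?quadratic_sum_ge0//.
apply: le_trans (quadratic_sum_le (c := eps / (1 + (K t w + L t w))) _) _.
  move=> k kN; apply: ltW; apply: hd; [exact: gridT|exact/gridT/ltnW|].
  by rewrite gridS ger0_norm// subr0 divr_ge0.
rewrite mulrAC ler_pdivrMr; last by rewrite ltr_wpDr// addr_ge0.
by apply: ler_wpM2l; [exact: ltW|rewrite lerDr].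
Qed.

Lemma fv_martingale_at : {ae P, forall w, J t w = 0}.
Proof.
have mq N : measurable_fun setT (quadratic_sum N).
  rewrite quadratic_sumE; apply: measurable_sum => k.
  apply: measurable_funX; apply: measurable_funB; apply: V_meas; apply: gridT => //.
  exact: ltnW.
have [|_ cq] := Rdominated_cvg mq quadratic_sum_cvg _ KL_sq (measurable_cst _).
  by move=> N w; rewrite ger0_norm ?quadratic_sum_ge0 ?quadratic_sum_dom.
have J2 : \int[P]_w (J t w ^+ 2) = 0.
  have c1 : \int[P]_w quadratic_sum N w @[N --> \oo] --> \int[P]_w (J t w ^+ 2).
    by rewrite (_ : (fun N => _) = cst (\int[P]_w (J t w ^+ 2)));
      [exact: cvg_cst|apply/funext => N; rewrite -(martingale_sqE N)].
  have := cvg_unique _ c1 cq; rewrite Rintegral_cst// mul0r; apply.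
  exact: norm_hausdorff.
have := Rintegral_ge0_eq0 (J_sq ht) (fun w => sqr_ge0 _) J2.
by apply: filterS => w /eqP; rewrite sqrf_eq0 => /eqP.
Qed.

End fixed_time.
End finite_variation_martingale.

Lemma continuous_within_right (R : realType) (a b : R) (f : R -> R) t :
  {within `[a, b], continuous f} -> a <= t < b -> f x @[x --> t^'+] --> f t.
Proof.
move=> cf /andP[at_ tb]; apply/cvgrPdist_lt => e e0.
have tab : a <= t <= b by rewrite at_ ltW.
have [dl dl0 hd] := continuous_within_dist cf tab e0.
near=> x; rewrite distrC; apply: hd.
  apply/andP; split; last by near: x; exact: nbhs_right_le.
  by apply: (le_trans at_); apply: ltW; near: x; exact: nbhs_right_gt.
have tx : t < x by near: x; exact: nbhs_right_gt.
rewrite gtr0_norm ?subr_gt0// ltrBlDl.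
by near: x; apply: nbhs_right_lt; rewrite ltrDl.
Unshelve. all: by end_near. Qed.

Lemma ae_forall_count d (T : measurableType d) (R : realType) (mu : {measure set T -> \bar R})
    (C : countType) (Q : C -> T -> Prop) :
  (forall c, {ae mu, forall x, Q c x}) -> {ae mu, forall x, forall c, Q c x}.
Proof.
move=> h; have : {ae mu, forall x, forall n, if unpickle n is Some c then Q c x else True}.
  by apply: ae_foralln => n; case: (unpickle n) => [c|]; [exact: h|exact: filterE].
by apply: filterS => x hx c; have := hx (pickle c); rewrite pickleK.
Qed.

(** * From fixed times to all times *)

Section dense_times.
Context (R : realType) d (Omega : measurableType d) (P : probability Omega R).
Variables (T : R) (g : R -> Omega -> R).
Hypothesis T0 : 0 <= T.
Hypothesis g_right : forall w t, 0 <= t < T -> g x w @[x --> t^'+] --> g t w.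
Hypothesis g_at : forall t, 0 <= t <= T -> {ae P, forall w, g t w = 0}.

(** Almost surely the process vanishes at all rationals of [0, T] and at T. Right limits along
    rationals reach every t < T, whereas T has to be treated on its own. *)
Lemma right_continuous_ae0 : {ae P, forall w, forall t, 0 <= t <= T -> g t w = 0}.
Proof.
have h (q : rat) : {ae P, forall w, 0 <= (ratr q : R) <= T -> g (ratr q) w = 0}.
  by have [/g_at|] := boolP (0 <= (ratr q : R) <= T); [apply: filterS|
    move=> /negP n; apply: filterE].
have hc : {ae P, forall w, forall q : rat, 0 <= (ratr q : R) <= T -> g (ratr q) w = 0}.
  exact: ae_forall_count.
have hT : {ae P, forall w, g T w = 0} by apply: g_at; rewrite T0/=.
move: hc hT; apply: filterS2 => w hq gT t /andP[t0]; rewrite le_eqVlt => /predU1P[->//|tT].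
apply/eqP; apply: contrapT => /negP g0.
have n0 : 0 < `|g t w| by rewrite normr_gt0.
have htT : 0 <= t < T by rewrite t0 tT.
have /cvgrPdist_lt/(_ _ n0) := @g_right w t htT.
move=> [e /= e0 he].
have tm : t < Num.min (t + e) T by rewrite lt_min tT ltrDl e0.
have [q] := rat_in_itvoo tm; rewrite in_itv/= lt_min => /and3P[tq qe qT].
have /= := he (ratr q) _ tq; rewrite hq ?subr0 ?ltxx; last by rewrite (le_trans t0 (ltW tq)) ltW.
suff h0 : `|t - ratr q| < e by move=> /(_ h0).
rewrite ltr_norml; apply/andP; split; lra.
Qed.

End dense_times.

(** * Identification of U and K from Y *)

Section backward_uniqueness.
Context (R : realType) d (Omega : measurableType d) (P : probability Omega R).
Context dE (E : measurableType dE) (F : R -> set (set Omega)) (T M : R).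
Variables (S : random_measures P E F T M) (C : R -> Omega -> R) (rho : R -> Omega -> E -> R).
Local Notation q := (rmq S).
Hypotheses (T0 : 0 <= T) (M0 : 0 <= M) (prho : predictable_field F `[0, T] rho)
  (brho : forall t w e, 0 <= t <= T -> 0 <= rho t w e <= M).
Variables B B' : backward_path S C rho.
Hypothesis Y_at : forall t, 0 <= t <= T -> {ae P, forall w, bpY B t w = bpY B' t w}.

Let u r w e := bpU B r w e - bpU B' r w e.
Let J t w := bpI B t w - bpI B' t w.

Lemma Y_indist : {ae P, forall w, forall t, 0 <= t <= T -> bpY B t w = bpY B' t w}.
Proof.
have : {ae P, forall w, forall t, 0 <= t <= T -> bpY B t w - bpY B' t w = 0}.
  apply: right_continuous_ae0 => //.
  - move=> w t ht; exact: (cvgB ((bpY_cadlag B w).1 t ht) ((bpY_cadlag B' w).1 t ht)).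
  - by move=> t /Y_at; apply: filterS => w ->; rewrite subrr.
by apply: filterS => w hw t /hw/eqP; rewrite subr_eq0 => /eqP.
Qed.

(** Along the path Y - Ybar is identically 0, while its jump at the atom z is u; a non-zero u would
    contradict [gap_jump] with tolerance |u| / 2. *)
Lemma jump_eq0 w z : (forall t, 0 <= t <= T -> bpY B t w = bpY B' t w) ->
  z \in rmj S w -> 0 < z.1 <= T -> u z.1 w z.2 = 0.
Proof.
move=> Yw zj zT; apply/eqP; apply: contrapT => /negP u0.
have e0 : 0 < `|u z.1 w z.2| / 2 by rewrite divr_gt0// normr_gt0.
have [dl dl0 hd] := gap_jump T0 M0 prho brho B B' zj zT e0.
have /andP[z0 zT'] := zT.
pose s := Num.max 0 (z.1 - dl / 2).
have s0 : 0 <= s by rewrite le_max lexx.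
have sz : s < z.1 by rewrite /s gt_max z0/=; lra.
have sdl : z.1 - s < dl.
  have : z.1 - dl / 2 <= s by rewrite /s le_max lexx orbT.
  lra.
have := hd s z.1 s0 sz (lexx _) zT' sdl; rewrite subrr => /(_ dl0).
rewrite !Yw ?s0 ?(ltW z0) ?(le_trans (ltW sz))// !subrr sub0r normrN.
by rewrite -/(u z.1 w z.2); move: e0; lra.
Qed.

(** Against p the integral is a sum of zeros by [jump_eq0]; compensation transfers this to phi dA in
    expectation. *)
Lemma U_sq_eq0 : (\int[P]_w \int[q w]_(z in strip E 0 T) (u z.1 w z.2 ^+ 2)%:E = 0)%E.
Proof.
have pu := gapu_pred B B'.
have [||mp _ <-] := @rm_comp _ _ _ _ _ _ _ _ _ S 0 T (fun r w e => u r w e ^+ 2)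
  (lexx 0) T0 (lexx T) _ _.
- by move=> *; exact: sqr_ge0.
- by apply: measurable_funX; exact: (pred_sub (T := T)).
rewrite (ae_eq_integral (cst 0%E)) ?integral0//.
move: Y_indist; apply: filterS => w Yw _.
rewrite rmp_jumps//; last 2 first.
- by move=> z; exact: sqr_ge0.
- by apply: measurable_funX; exact: (strip_section T0 w _ _ pu).
congr EFin; rewrite big_seq_cond big1// => z /andP[zj zT].
by rewrite jump_eq0// expr0n.
Qed.

Lemma U_eq0 : {ae P, forall w, {ae q w, forall z, strip E 0 T z -> u z.1 w z.2 = 0}}.
Proof.
have mS := measurable_strip (E := E) 0 T.
have [||_ mq _] := @rm_comp _ _ _ _ _ _ _ _ _ S 0 T (fun r w e => u r w e ^+ 2)
  (lexx 0) T0 (lexx T) _ _.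
- by move=> *; exact: sqr_ge0.
- by apply: measurable_funX; apply: (pred_sub (T := T)) => //; exact: gapu_pred.
have := ge0_integral_eq0 measurableT mq _ U_sq_eq0.
have q0 w : (0 <= \int[q w]_(z in strip E 0%R T) (u z.1 w z.2 ^+ 2)%:E)%E.
  by apply: integral_ge0 => z _; rewrite lee_fin sqr_ge0.
move=> /(_ q0); apply: filterS => w /(_ I) h.
have mu : measurable_fun (strip E 0 T) (fun z => (u z.1 w z.2 ^+ 2)%:E).
  apply/measurable_EFinP/measurable_funX.
  exact: (strip_section T0 w _ _ (gapu_pred B B')).
have := ge0_integral_eq0 mS mu _ h.
have u0 z : (0 <= (u z.1 w z.2 ^+ 2)%:E)%E by rewrite lee_fin sqr_ge0.
move=> /(_ u0); apply: filterS => z hz Dz.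
by have [/eqP] := hz Dz; rewrite sqrf_eq0 => /eqP.
Qed.

(** With Y - Ybar and u gone, the equation on ]0, t] leaves a martingale equal to a difference of
    increasing processes. *)
Lemma J_eq_KL : {ae P, forall w, forall t, 0 <= t <= T -> J t w = bpK B t w - bpK B' t w}.
Proof.
have I00 : {ae P, forall w, bpI B 0 w = 0 /\ bpI B' 0 w = 0}.
  by move: (bpI0 B) (bpI0 B'); apply: filterS2 => w; split.
move: Y_indist U_eq0 I00; apply: filterS3 => w Yw Uw [I0 I0'] t ht.
have /andP[t0 tT] := ht; have mS := measurable_strip (E := E) 0 t.
have h0 : 0 <= (0 : R) <= T by rewrite lexx.
have := gap_eqn T0 prho brho B B' w (lexx 0) t0 tT.
rewrite !Yw// !subrr I0 I0' !bpK0 !subr0.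
rewrite Rintegral_rmp//; last exact: (strip_section T0 w _ _ (gapu_pred B B')).
rewrite big_seq_cond big1 => [|z /andP[zj /andP[z0 zt]]]; last first.
  by apply: jump_eq0 => //; rewrite z0 (le_trans zt).
have -> : \int[q w]_(z in strip E 0 t) ((bpU B z.1 w z.2 - bpU B' z.1 w z.2) * rho z.1 w z.2)
    = 0.
  rewrite (@ae_eq_Rintegral _ _ _ _ _ _ (cst 0)) ?Rintegral_cst ?mul0r//.
    apply: measurable_funM; last exact: (strip_section T0 w (lexx 0) tT prho).
    exact: (strip_section T0 w (lexx 0) tT (gapu_pred B B')).
  apply: filterS Uw => z hz Dz; rewrite -/(u z.1 w z.2) hz ?mul0r//.
  exact: strip_sub Dz.
rewrite /J; lra.
Qed.

Lemma J_eq0_at t : 0 <= t <= T -> {ae P, forall w, J t w = 0}.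
Proof.
apply: (@fv_martingale_at _ _ _ P F T J (bpK B) (bpK B')) => //.
- exact: rm_sub S.
- by move=> s hs; apply: measurable_funB; exact: bpI_adapted.
- move=> s hs; apply: Rintegrable_sqD; [exact: bpI_meas|exact: measurableT_comp (bpI_meas _ hs)
    |exact: bpI_sq|].
  by apply: Rintegrable_sqN; exact: bpI_sq.
- by move=> s r s0 sr rT D; have [_] := gapJ_orth B B' s0 sr rT; exact.
- exact: bpK_meas.
- exact: bpK_meas.
- exact: bpK_homo.
- exact: bpK_homo.
- exact: bpK0.
- exact: bpK0.
- by move=> w; exact: (@bpK_cont _ _ _ _ _ _ _ _ _ _ _ _ B w).
- by move=> w; exact: (@bpK_cont _ _ _ _ _ _ _ _ _ _ _ _ B' w).
- exact: bpK_sq.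
- exact: bpK_sq.
- exact: J_eq_KL.
Qed.

Lemma K_indist : {ae P, forall w, forall t, 0 <= t <= T -> bpK B t w = bpK B' t w}.
Proof.
have : {ae P, forall w, forall t, 0 <= t <= T -> bpK B t w - bpK B' t w = 0}.
  apply: right_continuous_ae0 => //.
  - move=> w t ht; apply: cvgB.
    + exact: (continuous_within_right (@bpK_cont _ _ _ _ _ _ _ _ _ _ _ _ B w) ht).
    + exact: (continuous_within_right (@bpK_cont _ _ _ _ _ _ _ _ _ _ _ _ B' w) ht).
  - move=> t ht; move: J_eq_KL (J_eq0_at ht); apply: filterS2 => w h.
    by rewrite h.
by apply: filterS => w hw t /hw/eqP; rewrite subr_eq0 => /eqP.
Qed.

End backward_uniqueness.

Section system_uniqueness.
Context (R : realType) d (Omega : measurableType d) (P : probability Omega R).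
Context dE (E : measurableType dE) (F : R -> set (set Omega)) (T M : R) (m : nat).
Variables (S : random_measures P E F T M) (C : 'I_m -> R -> Omega -> R).
Variables (rho : 'I_m -> R -> Omega -> E -> R) (cst : 'I_m -> 'I_m -> R -> Omega -> R).
Variables (c : Omega -> R) (eta : R).
Hypotheses (T0 : 0 <= T) (M0 : 0 <= M)
  (prho : forall i, predictable_field F `[0, T] (rho i))
  (brho : forall i t w e, 0 <= t <= T -> 0 <= rho i t w e <= M)
  (eta3 : 3 * bcst M < eta) (heta : Rintegrable P setT (fun w => expR (eta * rmA S T w))).
Hypotheses
  (cst_adapted : forall i j t, 0 <= t <= T ->
     measurable_fun [set: g_sigma_algebraType (F t)] (cst i j t))
  (cst_cont : forall i j w, {within `[0, T], continuous (cst i j ^~ w)})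
  (cst_diag : forall i t w, 0 <= t <= T -> 0 <= cst i i t w)
  (cst_loop : forall i j l t w, i != j -> j != l -> 0 <= t <= T ->
     c w <= cst i j t w + cst j l t w - cst i l t w)
  (c_gt0 : forall w, 0 < c w).

Record reflected_system (B : forall i, backward_path S (C i) (rho i)) : Prop := {
  rs_obst : forall i j t w, i != j -> 0 <= t <= T ->
    bpY (B j) t w - cst i j t w <= bpY (B i) t w;
  rs_flat : forall i w s t e, 0 <= s -> s <= t -> t <= T -> 0 < e ->
    (forall r j, j != i -> s < r <= t -> e <= bpY (B i) r w - bpY (B j) r w + cst i j r w) ->
    bpK (B i) t w = bpK (B i) s w }.

Lemma system_le (B B' : forall i, backward_path S (C i) (rho i)) i t :
  reflected_system B -> reflected_system B' -> 0 <= t <= T ->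
  {ae P, forall w, bpY (B i) t w <= bpY (B' i) t w}.
Proof.
move=> hB hB' /andP[t0 tT].
pose X j := gap T0 M0 (prho j) (brho j) eta3 heta (B j) (B' j).
(* Formed with the first system; the second enters the hypotheses on [dd] through its obstacle
   inequality. *)
pose dd j l r w := bpY (B j) r w - bpY (B l) r w + cst j l r w.
have : {ae P, forall w, gpx (X i) t w <= 0}.
  apply: (@gap_at_le0 _ _ _ P _ E F T M m S X dd c) => //.
  - move=> j l r hr; apply: measurable_funD; last exact: cst_adapted.
    by apply: measurable_funB; exact: bpY_adapted.
  - move=> j l w; apply: regulatedD; last exact: continuous_regulated.
    by apply: regulatedB; apply: cadlag_regulated; exact: bpY_cadlag.
  - move=> j l r w jl hr /=; have := rs_obst hB' w jl hr; rewrite /dd; lra.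
  (* Passing from j to k through l costs at least c more than passing directly, and the direct
     distance is non-negative; for k = j this is the sign of the diagonal cost. *)
  - move=> j l k r w jl lk hr; have := cst_loop w jl lk hr.
    have dk : 0 <= dd j k r w.
      rewrite /dd; have [->|jk] := eqVneq j k; first by rewrite subrr add0r cst_diag.
      have := rs_obst hB w jk hr; lra.
    by move: dk; rewrite /dd; lra.
  - by move=> j w s r e s0 sr rT e0 h; exact: (rs_flat hB s0 sr rT e0 h).
by apply: filterS => w /=; rewrite subr_le0.
Qed.

Lemma system_unique (B B' : forall i, backward_path S (C i) (rho i)) i t :
  reflected_system B -> reflected_system B' -> 0 <= t <= T ->
  {ae P, forall w, bpY (B i) t w = bpY (B' i) t w}.
Proof.
move=> hB hB' ht; move: (system_le i hB hB' ht) (system_le i hB' hB ht).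
by apply: filterS2 => w h1 h2; apply/eqP; rewrite eq_le h1.
Qed.

End system_uniqueness.

(** * Ito isometry *)

Section increment_isometry.
Context (R : realType) dO (Omega : measurableType dO) (P : probability Omega R).
Context (E : ptopologicalType) (dim : nat) (N : noise R Omega E dim).
Local Notation W := (wiener N).
Local Notation F := (filt P N).
Hypotheses (hW : is_wiener P N) (hp : is_marked_point_process P N)
  (hI : independent_noise P N).
Local Notation incr s t k := (fun w => W t w ord0 k - W s w ord0 k).
Local Notation gauss s t := (normal_prob 0 (Num.sqrt (t - s))).
Local Notation GS G := (g_sigma_algebraType G).
Local Notation nv := (normal_var R).

Lemma measurable_fun_le_sigma (G G' : set (set Omega)) (f : Omega -> R) :
  <<s G>> `<=` <<s G'>> -> measurable_fun [set: GS G] (f : GS G -> R) ->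
  measurable_fun [set: GS G'] (f : GS G' -> R).
Proof.
move=> GG mf mT B mB; rewrite setTI; apply: GG.
by have := mf measurableT B mB; rewrite setTI.
Qed.

Lemma sigma_sub_measurable (G : set (set Omega)) : G `<=` measurable -> <<s G>> `<=` measurable.
Proof. exact: (smallest_sub (@sigma_algebra_measurable _ Omega)). Qed.

Lemma measurable_fun_sub_sigma (G : set (set Omega)) (f : Omega -> R) : G `<=` measurable ->
  measurable_fun [set: GS G] (f : GS G -> R) -> measurable_fun setT f.
Proof.
move=> Gm mf; apply: (sub_measurable_fun (G := G)) mf.
exact: sigma_sub_measurable.
Qed.

(** The squared increment is centred by its variance [nv * (t - s)]. *)
Lemma increment_sq_orth s t k B : 0 <= s -> s < t -> <<s F s>> B ->
  \int[P]_(w in B) (incr s t k w ^+ 2 - nv * (t - s)) = 0.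
Proof.
move=> s0 st sB; have st' : 0 <= s < t by rewrite s0.
have q : 0 < Num.sqrt (t - s) by rewrite sqrtr_gt0 subr_gt0.
have i2 := Rintegrable_normal_sqr q.
have ic : Rintegrable (gauss s t) setT (fun=> nv * (t - s)).
  exact: finite_measure_integrable_cst.
apply: (increment_filt_orth hW hp hI k (g := fun x => x ^+ 2 - nv * (t - s)) st') => //.
  exact: RintegrableB.
rewrite RintegralB// Rintegral_cst// [X in fine X]probability_setT mulr1 /Rintegral normal_varE//=.
by rewrite sqr_sqrtr ?subr_ge0 1?ltW// mulrC subrr.
Qed.

Lemma bounded_sq (f : Omega -> R) c : measurable_fun setT f -> (forall w, `|f w| <= c) ->
  Rintegrable P setT (fun w => f w ^+ 2).
Proof.
move=> mf fc; have ic : Rintegrable P setT (fun=> c ^+ 2).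
  exact: finite_measure_integrable_cst.
apply: (Rintegrable_le measurableT _ _ ic); first exact: measurable_funX.
move=> w _; rewrite ger0_norm ?sqr_ge0// -(real_normK (num_real (f w))).
by apply: lerXn2r; rewrite ?nnegrE// (le_trans _ (fc w)).
Qed.

Lemma bounded_mul_sq (f g : Omega -> R) c : measurable_fun setT f -> measurable_fun setT g ->
  Rintegrable P setT (fun w => f w ^+ 2) -> (forall w, `|g w| <= c) ->
  Rintegrable P setT (fun w => (f w * g w) ^+ 2).
Proof.
move=> mf mg f2 gc.
apply: (Rintegrable_le measurableT _ _ (RintegrableZ (c ^+ 2) measurableT f2)).
  by apply: measurable_funX; exact: measurable_funM.
move=> w _; rewrite ger0_norm ?sqr_ge0// exprMn mulrC; apply: ler_wpM2r; first exact: sqr_ge0.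
rewrite -(real_normK (num_real (g w))).
by apply: lerXn2r; rewrite ?nnegrE// (le_trans _ (gc w)).
Qed.

(** V may depend on the other components of the same increment, hence [joint_events]. Expanding the
    square, the cross term vanishes by orthogonality to that sigma-algebra, and the centred squared
    increment vanishes against H^2. *)
Lemma add_increment_sq s t k (V H : Omega -> R) c : 0 <= s -> s <= t ->
  measurable_fun [set: GS (joint_events P N s t k)] (V : GS (joint_events P N s t k) -> R) ->
  Rintegrable P setT (fun w => V w ^+ 2) ->
  measurable_fun [set: GS (F s)] (H : GS (F s) -> R) -> (forall w, `|H w| <= c) ->
  Rintegrable P setT (fun w => (H w * incr s t k w + V w) ^+ 2) /\
  \int[P]_w ((H w * incr s t k w + V w) ^+ 2) =
    nv * (t - s) * \int[P]_w (H w ^+ 2) + \int[P]_w (V w ^+ 2).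
Proof.
move=> s0; rewrite le_eqVlt => /orP[/eqP <-|st] mV V2 mH Hc.
  under eq_fun do rewrite subrr mulr0 add0r; split => //.
  by rewrite subrr mulr0 mul0r add0r.
have st' : 0 <= s < t by rewrite s0.
have q : 0 < Num.sqrt (t - s) by rewrite sqrtr_gt0 subr_gt0.
have jm := joint_events_measurable hW hp s0 (ltW st) (k := k).
have fm := filt_sub hW hp (t := s).
have mV' := measurable_fun_sub_sigma jm mV.
have mH' : measurable_fun setT H by exact: (sub_measurable_fun fm mH).
have mD := increment_meas hW k s0 (ltW st).
have D2 := increment_sq_int hW hI k s0 (ltW st).
have HD2 : Rintegrable P setT (fun w => (H w * incr s t k w) ^+ 2).
  exact: (weighted_increment_sq hW hI k s0 (ltW st) mH' Hc).
have VH2 := bounded_mul_sq mV' mH' V2 Hc.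
have [iVD VD0] : Rintegrable P setT (fun w => V w * H w * incr s t k w) /\
    \int[P]_w (V w * H w * incr s t k w) = 0.
  apply: (Rintegral_orth_L2 jm mD D2 (H := fun w => V w * H w)) => //.
    by move=> B; exact: (increment_orth hW hp hI st' (g := id)
      (Rintegrable_normal_id q) (normal_mean q)).
  apply: measurable_funM mV _.
  apply: (measurable_fun_le_sigma _ mH); exact: filt_joint.
have [iHD HD0] : Rintegrable P setT (fun w => H w ^+ 2 * (incr s t k w ^+ 2 - nv * (t - s))) /\
    \int[P]_w (H w ^+ 2 * (incr s t k w ^+ 2 - nv * (t - s))) = 0.
  apply: (Rintegral_orth (G := F s) fm (c := c ^+ 2)).
  - by apply: RintegrableB => //; exact: finite_measure_integrable_cst.
  - by move=> B; exact: increment_sq_orth.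
  - exact: measurable_funX.
  - move=> w; rewrite normrX; apply: lerXn2r; rewrite ?nnegrE//.
    by rewrite (le_trans _ (Hc w)).
have H2 := bounded_sq mH' Hc.
split; first by apply: Rintegrable_sqD => //; exact: measurable_funM.
transitivity (\int[P]_w (H w ^+ 2 * (incr s t k w ^+ 2 - nv * (t - s))
    + nv * (t - s) * H w ^+ 2 + 2 * (V w * H w * incr s t k w) + V w ^+ 2)).
  by apply: eq_Rintegral => w _; ring.
have i1 : Rintegrable P setT (fun w => nv * (t - s) * H w ^+ 2) by exact: RintegrableZ.
have i2 : Rintegrable P setT (fun w => 2 * (V w * H w * incr s t k w)) by exact: RintegrableZ.
have i12 : Rintegrable P setT (fun w => H w ^+ 2 * (incr s t k w ^+ 2 - nv * (t - s))
    + nv * (t - s) * H w ^+ 2) by exact: RintegrableD.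
rewrite RintegralD//; last exact: RintegrableD.
rewrite RintegralD// RintegralD// HD0 add0r RintegralZl// RintegralZl//.
by rewrite VD0 mulr0 addr0.
Qed.

Section row.
Variables (s t c : R) (V : Omega -> R) (D : Omega -> 'rV[R]_dim).
Hypotheses (s0 : 0 <= s) (st : s <= t)
  (mV : measurable_fun [set: GS (F s)] (V : GS (F s) -> R))
  (V2 : Rintegrable P setT (fun w => V w ^+ 2))
  (mD : forall j, measurable_fun [set: GS (F s)] ((fun w => D w ord0 j) : GS (F s) -> R))
  (Dc : forall w j, `|D w ord0 j| <= c).

(** The components are added one at a time. The first conclusion, for every k still absent from
    [js], is what lets component k be added next. *)
Lemma row_increment_sq (js : seq 'I_dim) : uniq js ->
  [/\ forall k, k \notin js ->
        measurable_fun [set: GS (joint_events P N s t k)]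
          ((fun w => \sum_(j <- js) D w ord0 j * incr s t j w + V w)
           : GS (joint_events P N s t k) -> R),
      Rintegrable P setT (fun w => (\sum_(j <- js) D w ord0 j * incr s t j w + V w) ^+ 2)
    & \int[P]_w ((\sum_(j <- js) D w ord0 j * incr s t j w + V w) ^+ 2) =
      nv * (t - s) * \sum_(j <- js) \int[P]_w (D w ord0 j ^+ 2) + \int[P]_w (V w ^+ 2)].
Proof.
have toj f k : measurable_fun [set: GS (F s)] (f : GS (F s) -> R) ->
    measurable_fun [set: GS (joint_events P N s t k)] (f : GS (joint_events P N s t k) -> R).
  move=> mf; apply: (measurable_fun_le_sigma _ mf).
  exact: filt_joint.
elim: js => [_|j js IH /= /andP[jjs ujs]].
  split; first by move=> k _; under eq_fun do rewrite big_nil add0r; exact: toj.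
    by under eq_fun do rewrite big_nil add0r.
  by under eq_Rintegral do rewrite big_nil add0r; rewrite big_nil mulr0 add0r.
have [IH1 IH2 IH3] := IH ujs.
have [h1 h2] := add_increment_sq s0 st (IH1 j jjs) IH2 (mD j) (fun w => Dc w j).
have e w : \sum_(i <- j :: js) D w ord0 i * incr s t i w + V w =
    D w ord0 j * incr s t j w + (\sum_(i <- js) D w ord0 i * incr s t i w + V w).
  by rewrite big_cons addrA.
split.
- move=> k; rewrite inE negb_or => /andP[kj kjs].
  under eq_fun do rewrite e.
  apply: measurable_funD; last exact: IH1.
  by apply: measurable_funM; [exact: toj|apply: increment_joint_meas; rewrite eq_sym].
- by under eq_fun do rewrite e.
under eq_Rintegral do rewrite e.
by rewrite h2 IH3 big_cons (mulrDr (nv * (t - s))) addrA.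
Qed.

Lemma row_increment_adapted : measurable_fun [set: GS (F t)]
  ((fun w => \sum_(j < dim) D w ord0 j * incr s t j w + V w) : GS (F t) -> R).
Proof.
have toF f : measurable_fun [set: GS (F s)] (f : GS (F s) -> R) ->
    measurable_fun [set: GS (F t)] (f : GS (F t) -> R).
  by apply: measurable_fun_le_sigma; exact: filt_mono.
apply: measurable_funD; last exact: toF.
apply: measurable_sum => j; apply: measurable_funM; first exact: toF.
by apply: measurable_funB; apply: wiener_adapted => //; exact: le_trans st.
Qed.

End row.

Section grid_sum.
Variables (n : nat) (tau : nat -> R) (D : nat -> Omega -> 'rV[R]_dim) (c : R).
Hypotheses (tau0 : 0 <= tau 0%N) (tau_le : forall l, (l < n)%N -> tau l <= tau l.+1)
  (mD : forall l j, (l < n)%N -> measurable_fun [set: GS (F (tau l))]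
     ((fun w => D l w ord0 j) : GS (F (tau l)) -> R))
  (Dc : forall l w j, (l < n)%N -> `|D l w ord0 j| <= c).

Lemma grid_sum_isometry :
  \int[P]_w ((\sum_(l < n) \sum_(j < dim) D l w ord0 j * incr (tau l) (tau l.+1) j w) ^+ 2) =
  \sum_(l < n) nv * (tau l.+1 - tau l) * \sum_(j < dim) \int[P]_w (D l w ord0 j ^+ 2).
Proof.
suff H k : (k <= n)%N -> [/\ 0 <= tau k,
    measurable_fun [set: GS (F (tau k))] ((fun w => \sum_(l < k) \sum_(j < dim)
      D l w ord0 j * incr (tau l) (tau l.+1) j w) : GS (F (tau k)) -> R),
    Rintegrable P setT (fun w => (\sum_(l < k) \sum_(j < dim)
      D l w ord0 j * incr (tau l) (tau l.+1) j w) ^+ 2)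
  & \int[P]_w ((\sum_(l < k) \sum_(j < dim) D l w ord0 j * incr (tau l) (tau l.+1) j w) ^+ 2) =
  \sum_(l < k) nv * (tau l.+1 - tau l) * \sum_(j < dim) \int[P]_w (D l w ord0 j ^+ 2)].
  by have [] := H n (leqnn n).
elim: k => [_|k IH kn].
  split => //.
  - by under eq_fun do rewrite big_ord0; exact: measurable_cst.
  - by under eq_fun do rewrite big_ord0 expr0n; exact: finite_measure_integrable_cst.
  - under eq_Rintegral do rewrite big_ord0 expr0n.
    by rewrite Rintegral_cst// mul0r big_ord0.
have [t0 m1 i1 e1] := IH (ltnW kn).
have tk := tau_le kn.
have e w : \sum_(l < k.+1) \sum_(j < dim) D l w ord0 j * incr (tau l) (tau l.+1) j w =
    \sum_(j < dim) D k w ord0 j * incr (tau k) (tau k.+1) j w +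
    \sum_(l < k) \sum_(j < dim) D l w ord0 j * incr (tau l) (tau l.+1) j w.
  by rewrite big_ord_recr/= addrC.
have mDk j := mD j kn; have Dck w j := Dc w j kn.
have [_ i2 e2] := row_increment_sq t0 tk m1 i1 mDk Dck (index_enum_uniq 'I_dim).
split.
- exact: le_trans tk.
- under eq_fun do rewrite e.
  exact: row_increment_adapted.
- by under eq_fun do rewrite e.
under eq_Rintegral do rewrite e.
by rewrite e2 e1 [RHS]big_ord_recr/= addrC.
Qed.

End grid_sum.
End increment_isometry.

(** * Isometry for the difference of two simple processes *)

Section simple_difference.
Context (R : realType) dO (Omega : measurableType dO) (P : probability Omega R).
Context (E : ptopologicalType) (dim : nat) (N : noise R Omega E dim) (T : R).
Local Notation W := (wiener N).
Local Notation F := (filt P N).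
Hypotheses (T0 : 0 <= T) (hW : is_wiener P N) (hp : is_marked_point_process P N)
  (hI : independent_noise P N).
Local Notation GS G := (g_sigma_algebraType G).
Local Notation nv := (normal_var R).

Section grid.
Variable ts : seq R.
Hypotheses (sts : sorted <=%R ts) (ts0 : head 0 ts = 0) (tsT : last 0 ts = T).
Hypothesis ts_ne : (0 < size ts)%N.

Let n := (size ts).-1.
Let tau l := nth 0 ts l.

Let size_ts : size ts = n.+1. Proof. by rewrite prednK. Qed.

Let tau_mono k l : (k <= l)%N -> (l <= n)%N -> tau k <= tau l.
Proof.
move=> kl ln; apply: (sorted_leq_nth le_trans lexx) => //; rewrite inE size_ts//.
by rewrite ltnS (leq_trans kl).
Qed.

Let tau00 : tau 0%N = 0. Proof. by rewrite /tau nth0. Qed.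

Let tauT : tau n = T. Proof. by rewrite /tau /n nth_last. Qed.

Lemma cell_dichotomy a l : a \in ts -> (l < n)%N -> a <= tau l \/ tau l.+1 <= a.
Proof.
move=> /(nthP 0)[k kn <-] ln; rewrite size_ts ltnS in kn.
have [kl|lk] := leqP k l; [left|right]; apply: tau_mono => //.
exact: ltnW.
Qed.

(** Since a and b are points of the list, every cell lies inside or outside ]a, b]; clamping the
    nodes to [a, b] makes the full sum telescope. *)
Lemma grid_telescope (g : R -> R) a b : a \in ts -> b \in ts -> a <= b ->
  \sum_(l < n) (if a < tau l.+1 <= b then g (tau l.+1) - g (tau l) else 0) = g b - g a.
Proof.
move=> ats bts ab; pose cl x := Num.max a (Num.min x b).
have range x : x \in ts -> 0 <= x <= T.
  move=> /(nthP 0)[k kn <-]; rewrite size_ts ltnS in kn.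
  by rewrite -{1}tau00 -tauT !tau_mono.
have -> : g b - g a = g (cl (tau n)) - g (cl (tau 0%N)).
  rewrite tau00 tauT /cl; have /andP[a0 aT] := range a ats; have /andP[b0 bT] := range b bts.
  by rewrite (min_r bT) (max_r ab) (min_l b0) (max_l a0).
rewrite -(telescope_sumr (fun l => g (cl (tau l))) (leq0n n)) big_mkord.
apply: eq_bigr => l _; have ln := ltn_ord l.
have tl : tau l <= tau l.+1 by apply: tau_mono.
case: (boolP (a < tau l.+1)) => [al|]; last first.
  rewrite -leNgt => la; rewrite /cl (min_l (le_trans la ab)) (max_l la).
  by rewrite (min_l (le_trans tl (le_trans la ab))) (max_l (le_trans tl la)) subrr.
have atl : a <= tau l.
  by have [//|] := cell_dichotomy ats ln; rewrite leNgt al.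
case: (boolP (tau l.+1 <= b)) => [lb|] /=.
  by rewrite /cl (min_l lb) (min_l (le_trans tl lb)) (max_r atl) (max_r (ltW al)).
rewrite -ltNge => bl; have btl : b <= tau l.
  by have [//|] := cell_dichotomy bts ln; rewrite leNgt bl.
by rewrite /cl (min_r btl) (min_r (ltW bl)) subrr.
Qed.

Section one_process.
Variable X : simple_process R Omega dim.
Hypotheses (hX : is_simple P N T X)
  (Xts : forall k, (k <= sp_size X)%N -> sp_time X k \in ts).

Lemma simple_integral_grid w : sp_integral N X T w =
  \sum_(l < n) \sum_(j < dim) sp_eval X (tau l.+1) w ord0 j *
    (W (tau l.+1) w ord0 j - W (tau l) w ord0 j).
Proof.
have tT k : (k <= sp_size X)%N -> sp_time X k <= T.
  move=> kX; have [_ _ h _ _] := hX; apply: le_trans h.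
  exact: (simple_time_le hX).
rewrite /sp_integral [RHS]exchange_big [LHS]exchange_big/=; apply: eq_bigr => j _.
under [RHS]eq_bigr do rewrite /sp_eval summxE mulr_suml big_mkcond/=.
rewrite exchange_big/=; apply: eq_bigr => k _.
have kX := ltn_ord k.
rewrite !min_l ?tT//; last exact: ltnW.
rewrite -(grid_telescope (fun r => W r w ord0 j)) ?Xts//; last 2 first.
- exact: ltnW.
- exact: (simple_time_le hX).
rewrite mulr_sumr; apply: eq_bigr => l _.
by case: ifP => _; rewrite ?mulr0.
Qed.

(** A refining grid has no partition time of X in the interior of a cell, so the index selected in
    [sp_eval] does not change there. *)
Lemma sp_eval_cell s w l : (l < n)%N -> tau l < s <= tau l.+1 ->
  sp_eval X s w = sp_eval X (tau l.+1) w.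
Proof.
move=> ln /andP[ls sl]; rewrite /sp_eval; apply: eq_bigl => k.
have kX := ltn_ord k.
have [h1|h1] := cell_dichotomy (Xts (ltnW kX)) ln;
have [h2|h2] := cell_dichotomy (Xts kX) ln.
- by rewrite [s <= _]leNgt (le_lt_trans h2 ls) [_ <= sp_time X k.+1]leNgt
    (le_lt_trans h2 (lt_le_trans ls sl)) !andbF.
- by rewrite h2 (le_trans sl h2) !andbT (le_lt_trans h1 ls) (le_lt_trans h1 (lt_le_trans ls sl)).
- by rewrite !ltNge h1 (le_trans sl h1).
- by rewrite !ltNge h1 (le_trans sl h1).
Qed.

Lemma sp_eval_adapted l j : (l < n)%N ->
  measurable_fun [set: GS (F (tau l))]
    ((fun w => sp_eval X (tau l.+1) w ord0 j) : GS (F (tau l)) -> R).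
Proof.
move=> ln; have [_ _ _ mv _] := hX.
under eq_fun do rewrite /sp_eval summxE big_mkcond.
suff h (k : 'I_(sp_size X)) : measurable_fun [set: GS (F (tau l))]
    ((fun w => if sp_time X k < tau l.+1 <= sp_time X k.+1 then sp_val X k w ord0 j else 0)
     : GS (F (tau l)) -> R) by exact: measurable_sum.
case: (boolP (sp_time X k < tau l.+1 <= sp_time X k.+1)) => [/andP[kl _]|_]; last exact: measurable_cst.
have kX := ltn_ord k.
have kt : sp_time X k <= tau l.
  by have [//|] := cell_dichotomy (Xts (ltnW kX)) ln; rewrite leNgt kl.
apply: (measurable_fun_le_sigma _ (mv k j kX)); apply: filt_mono => //.
exact: (simple_time_ge0 hX (ltnW kX)).
Qed.

Lemma sp_eval_bounded : exists c, forall s w j, `|sp_eval X s w ord0 j| <= c.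
Proof.
have [_ _ _ _ [c hc]] := hX; exists (\sum_(k < sp_size X) `|c|) => s w j.
rewrite /sp_eval summxE big_mkcond; apply: (le_trans (ler_norm_sum _ _ _)).
apply: ler_sum => k _; case: ifP => _; last by rewrite normr0.
by rewrite (le_trans (hc k w j (ltn_ord k)))// ler_norm.
Qed.

End one_process.
Lemma integral_cells (g : R -> R) (v : nat -> R) :
  (forall s l, (l < n)%N -> tau l < s <= tau l.+1 -> g s = v l) -> (forall l, 0 <= v l) ->
  (\int[lebesgue_measure]_(s in oc 0%R T) (g s)%:E)%E =
  (\sum_(l < n) (tau l.+1 - tau l) * v l)%:E.
Proof.
move=> gv v0.
suff H k : (k <= n)%N ->
  measurable_fun (oc 0 (tau k) : set (measurableTypeR R)) g /\ (forall s, oc 0 (tau k) s -> 0 <= g s) /\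
  (\int[lebesgue_measure]_(s in oc 0%R (tau k)) (g s)%:E)%E =
  (\sum_(l < k) (tau l.+1 - tau l) * v l)%:E.
  by have [_ [_]] := H n (leqnn n); rewrite tauT.
elim: k => [_|k IH kn].
  rewrite tau00 (_ : oc 0 0 = set0); last by rewrite set_itv_ge// bnd_simp ltxx.
  split; first exact: measurable_fun_set0.
  by split => //; rewrite integral_set0 big_ord0.
have [m1 [g0 e1]] := IH (ltnW kn).
have tk : tau k <= tau k.+1 by exact: tau_mono.
have t0k : 0 <= tau k by rewrite -{1}tau00 tau_mono// ltnW.
have cell s : oc (tau k) (tau k.+1) s -> g s = v k.
  by rewrite /= in_itv/=; exact: gv.
have mo a b : measurable (oc a b : set (measurableTypeR R)) by exact: measurable_itv.
have m2 : measurable_fun (oc (tau k) (tau k.+1) : set (measurableTypeR R)) g.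
  by apply: (eq_measurable_fun (cst (v k))) => // s /[!inE] /cell.
have U : oc 0 (tau k.+1) = oc 0 (tau k) `|` oc (tau k) (tau k.+1).
  apply/seteqP; split=> s /=; rewrite !in_itv/=.
    by move=> /andP[s0 sk]; have [sk'|sk'] := leP s (tau k); [left; rewrite s0|right].
  by move=> [/andP[s0 sk]|/andP[ks sk]]; rewrite ?s0 ?(le_trans sk)// (le_lt_trans t0k ks).
have m12 : measurable_fun (oc 0 (tau k.+1) : set (measurableTypeR R)) g.
  by rewrite U; apply/measurable_funU.
have g12 s : oc 0 (tau k.+1) s -> 0 <= g s.
  by rewrite U => -[/g0//|/cell ->].
split => //; split => //.
rewrite U ge0_integral_setU//=; last 3 first.
- by rewrite -U; apply/measurable_EFinP.
- by move=> s hs; rewrite lee_fin g12// U.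
- apply/disj_setPS => s [] /=; rewrite !in_itv/= => /andP[_ sk] /andP[ks _].
  by rewrite ltNge sk in ks.
rewrite e1 big_ord_recr/= EFinD; congr (_ + _)%E.
rewrite (eq_integral (cst (v k)%:E)); last by move=> s /[!inE] hs; rewrite cell.
rewrite integral_cst//= lebesgue_measure_itv/= lte_fin.
by case: ltgtP tk => // [_ _|-> _]; rewrite ?subrr ?mul0r ?mule0// muleC.
Qed.

End grid.

Section difference.
Variables X X' : simple_process R Omega dim.
Hypotheses (hX : is_simple P N T X) (hX' : is_simple P N T X').

Definition simple_times (Y : simple_process R Omega dim) : seq R :=
  [seq sp_time Y k | k <- iota 0 (sp_size Y).+1].

Lemma simple_timesP Y a : reflect (exists2 k, (k <= sp_size Y)%N & a = sp_time Y k)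
  (a \in simple_times Y).
Proof.
apply: (iffP mapP) => [[k]|[k kY ->]]; last by exists k => //; rewrite mem_iota.
by rewrite mem_iota ltnS => /andP[_ kY] ->; exists k.
Qed.

(** Common refinement of both partitions; 0 and T are included so that the cells cover ]0, T]
    exactly. *)
Definition merged_times : seq R :=
  sort <=%R (0 :: T :: simple_times X ++ simple_times X').

Lemma merged_sorted : sorted <=%R merged_times.
Proof. exact: (sort_sorted (@le_total _ _)). Qed.

Lemma merged_mem a : (a \in merged_times) =
  [|| a == 0, a == T, a \in simple_times X | a \in simple_times X'].
Proof. by rewrite mem_sort 2!in_cons mem_cat. Qed.

Lemma merged_left k : (k <= sp_size X)%N -> sp_time X k \in merged_times.
Proof.
move=> kX; rewrite merged_mem; apply/or4P/Or43/simple_timesP; by exists k.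
Qed.

Lemma merged_right k : (k <= sp_size X')%N -> sp_time X' k \in merged_times.
Proof.
move=> kX; rewrite merged_mem; apply/or4P/Or44/simple_timesP; by exists k.
Qed.

Lemma merged_range a : a \in merged_times -> 0 <= a <= T.
Proof.
have H (Y : simple_process R Omega dim) : is_simple P N T Y ->
    a \in simple_times Y -> 0 <= a <= T.
  move=> hY /simple_timesP[k kY ->].
  rewrite (simple_time_ge0 hY kY); have [_ _ h _ _] := hY.
  by rewrite (le_trans _ h)//; exact: (simple_time_le hY).
rewrite merged_mem => /or4P[/eqP->|/eqP->| |].
- by rewrite lexx.
- by rewrite T0/=.
- exact: H.
- exact: H.
Qed.

Lemma merged_size : (0 < size merged_times)%N.
Proof. by rewrite size_sort. Qed.

Lemma merged_head : head 0 merged_times = 0.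
Proof.
have h0 : 0 \in merged_times by rewrite merged_mem inE eqxx.
have := merged_range (mem_nth 0 merged_size); rewrite nth0 => /andP[a0 _].
apply/eqP; rewrite eq_le a0 andbT.
have /(nthP 0)[k kn ek] := h0; rewrite -nth0 -[X in _ <= X]ek.
by apply: (sorted_leq_nth le_trans lexx _ merged_sorted) => //; rewrite inE merged_size.
Qed.

Lemma merged_last : last 0 merged_times = T.
Proof.
have hT : T \in merged_times by rewrite merged_mem !inE eqxx orbT.
have nn : ((size merged_times).-1 < size merged_times)%N by rewrite prednK// merged_size.
have := merged_range (mem_nth 0 nn); rewrite nth_last => /andP[_ a0].
apply/eqP; rewrite eq_le a0/=.
have /(nthP 0)[k kn ek] := hT; rewrite -nth_last -{1}ek.
apply: (sorted_leq_nth le_trans lexx _ merged_sorted) => //; rewrite ?inE//.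
by rewrite -ltnS prednK// merged_size.
Qed.

(** On the common refinement the difference is again a step process, constant on each cell and known
    at its left end, so [grid_sum_isometry] applies. *)
Lemma simple_isometry :
  (\int[P]_w ((sp_integral N X T w - sp_integral N X' T w) ^+ 2)%:E =
   nv%:E * \int[P]_w \int[lebesgue_measure]_(s in oc 0%R T)
     (sqnorm (sp_eval X s w - sp_eval X' s w))%:E)%E.
Proof.
pose n := (size merged_times).-1; pose tau l := nth 0 merged_times l.
pose D l w := sp_eval X (tau l.+1) w - sp_eval X' (tau l.+1) w.
have DE l w j : D l w ord0 j = sp_eval X (tau l.+1) w ord0 j - sp_eval X' (tau l.+1) w ord0 j.
  by rewrite /D !mxE.
have tau_le l : (l < n)%N -> tau l <= tau l.+1.
  move=> ln; apply: (sorted_leq_nth le_trans lexx _ merged_sorted) => //; rewrite inE.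
    by rewrite (ltn_trans ln)// /n prednK// merged_size.
  by rewrite -(prednK merged_size) ltnS.
have tau0 : 0 <= tau 0%N by rewrite /tau nth0 merged_head.
have mD l j : (l < n)%N -> measurable_fun [set: GS (F (tau l))]
     ((fun w => D l w ord0 j) : GS (F (tau l)) -> R).
  move=> ln; under eq_fun do rewrite DE.
  apply: measurable_funB.
    exact: (sp_eval_adapted merged_sorted merged_size hX merged_left j ln).
  exact: (sp_eval_adapted merged_sorted merged_size hX' merged_right j ln).
have [c1 hc1] := sp_eval_bounded hX; have [c2 hc2] := sp_eval_bounded hX'.
have Dc l w j : `|D l w ord0 j| <= c1 + c2.
  by rewrite DE (le_trans (ler_normB _ _))// lerD.
have D2 l j : (l < n)%N -> Rintegrable P setT (fun w => D l w ord0 j ^+ 2).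
  move=> ln; apply: (bounded_sq _ (c := c1 + c2)) => // .
  exact: (sub_measurable_fun (filt_sub hW hp (t := tau l)) (mD l j ln)).
have iso := grid_sum_isometry hW hp hI tau0 tau_le mD (fun l w j _ => Dc l w j).
have e1 w : sp_integral N X T w - sp_integral N X' T w =
    \sum_(l < n) \sum_(j < dim) D l w ord0 j * (W (tau l.+1) w ord0 j - W (tau l) w ord0 j).
  rewrite (simple_integral_grid merged_sorted merged_head merged_last merged_size hX merged_left).
  rewrite (simple_integral_grid merged_sorted merged_head merged_last merged_size hX' merged_right).
  rewrite -sumrB; apply: eq_bigr => l _; rewrite -sumrB; apply: eq_bigr => j _.
  by rewrite DE mulrBl.
have [mX X2] := simple_integral_meas_sq hW hp hI hX T0.
have [mX' X2'] := simple_integral_meas_sq hW hp hI hX' T0.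
have i1 : Rintegrable P setT (fun w => (sp_integral N X T w - sp_integral N X' T w) ^+ 2).
  by apply: Rintegrable_sqD => //; [exact: measurableT_comp|exact: Rintegrable_sqN].
rewrite -EFin_Rintegral//.
under eq_Rintegral do rewrite e1.
rewrite iso.
under [in RHS]eq_integral => w _.
  rewrite (integral_cells merged_sorted merged_head merged_last merged_size
    (v := fun l => sqnorm (D l w))); first over.
  - move=> s l ln hs; congr sqnorm.
    rewrite (@sp_eval_cell merged_times merged_sorted merged_size X merged_left s w l ln hs).
    by rewrite (@sp_eval_cell merged_times merged_sorted merged_size X' merged_right s w l ln hs).
  - by move=> l; apply: sumr_ge0 => j _; exact: sqr_ge0.
have i3 (l : 'I_n) : Rintegrable P setT (fun w => sqnorm (D l w)).
  by apply: Rintegrable_sum => // j; exact: D2.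
have i2 (l : 'I_n) : Rintegrable P setT (fun w => (tau l.+1 - tau l) * sqnorm (D l w)).
  exact: RintegrableZ.
rewrite -EFin_Rintegral//; last exact: Rintegrable_sum.
rewrite Rintegral_sum// -EFinM mulr_sumr; congr EFin; apply: eq_bigr => l _.
have -> : \int[P]_w ((tau l.+1 - tau l) * sqnorm (D l w)) =
    (tau l.+1 - tau l) * \int[P]_w sqnorm (D l w) by apply: RintegralZl => //; exact: i3.
by rewrite mulrA (Rintegral_sum _ measurableT (fun j => D2 l j (ltn_ord l))).
Qed.

End difference.
End simple_difference.

(** * Iterated integrals over Omega and ]0, T] *)

Section iterated_integrals.
Context (R : realType) d (Omega : measurableType d) (P : probability Omega R) (T : R).
Local Notation RT := (measurableTypeR R).
Let D : set (Omega * RT) := setT `*` oc 0 T.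

Let mD : measurable D.
Proof. by apply: measurableX => //; exact: measurable_itv. Qed.

Lemma iterated_product (f : Omega * RT -> R) : (forall x, 0 <= f x) -> measurable_fun D f ->
  (\int[P]_w \int[lebesgue_measure]_(s in oc 0%R T) (f (w, s))%:E =
   \int[P \x lebesgue_measure]_(x in D) (f x)%:E)%E.
Proof.
move=> f0 mf; rewrite [RHS]integral_mkcond fubini_tonelli1.
- apply: eq_integral => w _; rewrite /fubini_F [LHS]integral_mkcond; congr integral.
  apply/funext => s; rewrite !patchE /D in_setX in_setT//.
- by apply/(measurable_restrictT _ mD)/measurable_EFinP.
- by move=> x; rewrite patchE; case: ifP => //; rewrite lee_fin.
Qed.

Lemma iterated_measurable (f : Omega * RT -> R) : (forall x, 0 <= f x) -> measurable_fun D f ->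
  measurable_fun setT (fun w => \int[lebesgue_measure]_(s in oc 0%R T) (f (w, s))%:E)%E.
Proof.
move=> f0 mf.
have := @measurable_fun_fubini_tonelli_F _ _ _ _ _ (@lebesgue_measure R)
  ((fun x => (f x)%:E) \_ D).
have h1 : measurable_fun setT ((fun x => (f x)%:E) \_ D).
  by apply/(measurable_restrictT _ mD)/measurable_EFinP.
have h2 x : (0 <= ((fun x => (f x)%:E) \_ D) x)%E.
  by rewrite patchE; case: ifP => //; rewrite lee_fin.
move=> /(_ h1 h2); congr measurable_fun; apply/funext => w.
rewrite /fubini_F [RHS]integral_mkcond; congr integral; apply/funext => s.
by rewrite !patchE /D in_setX in_setT.
Qed.

Lemma iterated_le3 (f f1 f2 f3 : Omega * RT -> R) (c : R) :
  [/\ forall x, 0 <= f x, forall x, 0 <= f1 x, forall x, 0 <= f2 x & forall x, 0 <= f3 x] ->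
  [/\ measurable_fun D f, measurable_fun D f1, measurable_fun D f2 & measurable_fun D f3] ->
  0 <= c -> (forall x, f x <= c * (f1 x + f2 x + f3 x)) ->
  (\int[P]_w \int[lebesgue_measure]_(s in oc 0%R T) (f (w, s))%:E <=
   c%:E * (\int[P]_w \int[lebesgue_measure]_(s in oc 0%R T) (f1 (w, s))%:E +
           \int[P]_w \int[lebesgue_measure]_(s in oc 0%R T) (f2 (w, s))%:E +
           \int[P]_w \int[lebesgue_measure]_(s in oc 0%R T) (f3 (w, s))%:E))%E.
Proof.
move=> [p p1 p2 p3] [m m1 m2 m3] c0 h; rewrite !iterated_product//.
have m12 : measurable_fun D (fun x => f1 x + f2 x) by exact: measurable_funD.
have m123 : measurable_fun D (fun x => f1 x + f2 x + f3 x) by exact: measurable_funD.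
rewrite -!ge0_integralD//; try exact/measurable_EFinP; try by move=> x _; rewrite ?adde_ge0 ?lee_fin.
  rewrite -ge0_integralZl//; last 2 first.
  - by apply/measurable_EFinP.
  - by move=> x _; rewrite -!EFinD lee_fin !addr_ge0.
  apply: ge0_le_integral => //.
  - by move=> x _; rewrite lee_fin.
  - exact/measurable_EFinP.
  - by under eq_fun do rewrite -!EFinD -EFinM; apply/measurable_EFinP; exact: measurable_funM.
  - by move=> x _; rewrite -!EFinD -EFinM lee_fin.
Qed.

End iterated_integrals.

(** Multiplying by k lets the bound on b be used in the form in which the isometry provides it,
    without division in the extended reals. *)
Lemma weighted_le3 (R : realType) (k : R) (a b c u x : \bar R) : 0 <= k ->
  (0 <= a -> 0 <= b -> 0 <= c -> x <= 3%:E * (a + b + c) -> k%:E * b <= u ->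
   k%:E * x <= 3%:E * (k%:E * a + u + k%:E * c))%E.
Proof.
move=> k0 a0 b0 c0 xabc bu; have k0' : (0 <= k%:E)%E by rewrite lee_fin.
apply: (le_trans (lee_wpmul2l k0' xabc)).
have ab0 : (0 <= a + b)%E by exact: adde_ge0.
rewrite muleCA lee_wpmul2l//.
by rewrite ge0_muleDr// ge0_muleDr// leeD2r// leeD2l.
Qed.

Section ito_uniqueness.
Context (R : realType) dO (Omega : measurableType dO) (P : probability Omega R).
Context (E : ptopologicalType) (dim : nat) (N : noise R Omega E dim) (T : R).
Local Notation F := (filt P N).
Hypotheses (T0 : 0 <= T) (hW : is_wiener P N) (hp : is_marked_point_process P N)
  (hI : independent_noise P N).
Local Notation GS G := (g_sigma_algebraType G).
Local Notation RT := (measurableTypeR R).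
Local Notation nv := (normal_var R).
Let D : set (Omega * RT) := setT `*` oc 0 T.

Let mD : measurable D.
Proof. by apply: measurableX => //; exact: measurable_itv. Qed.

Lemma progressive_joint (X : R -> Omega -> R) : progressive F T X ->
  measurable_fun D (fun x : Omega * RT => X x.2 x.1).
Proof.
move=> pX; have hT : 0 <= T <= T by rewrite T0/=.
pose h (x : Omega * RT) : RT * GS (F T) := (x.2, x.1).
have mh : measurable_fun setT h.
  apply: measurable_fun_pair => /=; first exact: measurable_snd.
  have mi : measurable_fun [set: Omega] (id : Omega -> GS (F T)).
    by move=> _ B mB; rewrite setTI preimage_id; exact: (filt_sub hW hp mB).
  exact: (measurableT_comp mi measurable_fst).
apply: (measurable_comp (F := `[0, T] `*` [set: GS (F T)] : set (RT * GS (F T)))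
  (f := fun x => X x.1 x.2) (g := h)).
- by apply: measurableX => //; exact: measurable_itv.
- move=> _ [[w s] /= [_ +] <-] /=; rewrite !in_itv/= => /andP[s0 sT].
  by split => //; apply/andP; split; [exact: ltW (s0 : 0 < (s : R))|exact: sT].
- exact: pX.
- exact: measurable_funS mh.
Qed.

Lemma sp_eval_joint (X : simple_process R Omega dim) j : is_simple P N T X ->
  measurable_fun D (fun x : Omega * RT => sp_eval X x.2 x.1 ord0 j).
Proof.
move=> hX; apply: measurable_funTS.
under eq_fun do rewrite /sp_eval summxE big_mkcond.
suff h (k : 'I_(sp_size X)) : measurable_fun [set: Omega * RT]
    ((fun x => if sp_time X k < x.2 <= sp_time X k.+1 then sp_val X k x.1 ord0 j else 0)
     : Omega * RT -> R) by exact: measurable_sum.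
have -> : (fun x : Omega * RT => if sp_time X k < x.2 <= sp_time X k.+1 then sp_val X k x.1 ord0 j
    else 0) = (fun x => \1_(oc (sp_time X k) (sp_time X k.+1)) x.2 * sp_val X k x.1 ord0 j).
  apply/funext => x; rewrite indicE mem_setE in_itv/=.
  by case: ifP; rewrite ?mul1r ?mul0r.
apply: measurable_funM.
  apply: (measurableT_comp (f := \1_(oc (sp_time X k) (sp_time X k.+1)) : RT -> R)) => //.
apply: (measurableT_comp (f := fun w => sp_val X k w ord0 j)) => //.
exact: (simple_val_meas hW hp hX j (ltn_ord k)).
Qed.

Lemma sqnorm_joint (U V : R -> Omega -> 'rV[R]_dim) :
  (forall j, measurable_fun D (fun x : Omega * RT => U x.2 x.1 ord0 j)) ->
  (forall j, measurable_fun D (fun x : Omega * RT => V x.2 x.1 ord0 j)) ->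
  measurable_fun D (fun x : Omega * RT => sqnorm (U x.2 x.1 - V x.2 x.1)).
Proof.
move=> mU mV; apply: measurable_sum => j; apply: measurable_funX.
under eq_fun do rewrite !mxE.
exact: measurable_funB.
Qed.

Lemma sqnorm_ge0 (v : 'rV[R]_dim) : 0 <= sqnorm v.
Proof. by apply: sumr_ge0 => j _; exact: sqr_ge0. Qed.

Lemma sqnorm_tri (a b c e : 'rV[R]_dim) :
  sqnorm (a - e) <= 3 * (sqnorm (b - a) + sqnorm (b - c) + sqnorm (c - e)).
Proof.
rewrite /sqnorm -!big_split/= mulr_sumr; apply: ler_sum => j _; rewrite !mxE.
move: (a _ _) (b _ _) (c _ _) (e _ _) => x y z t; rewrite -subr_ge0.
have -> : 3 * ((y + - x) ^+ 2 + (y + - z) ^+ 2 + (z + - t) ^+ 2) - (x + - t) ^+ 2 =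
    (y - x + (y - z)) ^+ 2 + (y - z - (z - t)) ^+ 2 + (y - x + (z - t)) ^+ 2 by ring.
by rewrite !addr_ge0 ?sqr_ge0.
Qed.

Section two_integrals.
Variables (Z Z' : R -> Omega -> 'rV[R]_dim) (I I' : R -> Omega -> R).
Hypotheses (pZ : forall k, progressive F T (fun s w => Z s w ord0 k))
  (pZ' : forall k, progressive F T (fun s w => Z' s w ord0 k))
  (hZ : is_ito_integral P N T Z I) (hZ' : is_ito_integral P N T Z' I')
  (II : {ae P, forall w, I T w = I' T w}).

(** Through approximating simple processes the squared norm of Z - Z' is at most three times the sum
    of two approximation errors and the squared norm between the simple processes. The isometry
    bounds the latter by the errors of their integrals, because the limits agree at T. *)
Lemma ito_integrand_unique :
  (\int[P]_w \int[lebesgue_measure]_(s in oc 0%R T)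
     (sqnorm (Z s w - Z' s w))%:E = 0)%E.
Proof.
have TT : 0 <= T <= T by rewrite T0/=.
have mI := ito_meas hW hp hZ TT; have mI' := ito_meas hW hp hZ' TT.
have [_ _ [X [sX cX eX]]] := hZ; have [_ _ [X' [sX' cX' eX']]] := hZ'.
have {}eX := eX T TT; have {}eX' := eX' T TT.
pose nrm (U V : R -> Omega -> 'rV[R]_dim) := (\int[P]_w \int[lebesgue_measure]_(s in oc 0%R T)
     (sqnorm (U s w - V s w))%:E)%E.
pose e n := (\int[P]_w ((sp_integral N (X n) T w - I T w) ^+ 2)%:E)%E.
pose e' n := (\int[P]_w ((sp_integral N (X' n) T w - I' T w) ^+ 2)%:E)%E.
have jZ j := progressive_joint (pZ j); have jZ' j := progressive_joint (pZ' j).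
have jX n j := sp_eval_joint j (sX n); have jX' n j := sp_eval_joint j (sX' n).
have nrm0 U V : (0 <= nrm U V)%E.
  by apply: integral_ge0 => w _; apply: integral_ge0 => s _; rewrite lee_fin sqnorm_ge0.
have b1 n : (nrm Z Z' <= 3%:E * (nrm (sp_eval (X n)) Z + nrm (sp_eval (X n)) (sp_eval (X' n))
    + nrm (sp_eval (X' n)) Z'))%E.
  apply: (@iterated_le3 _ _ _ P T (fun x => sqnorm (Z x.2 x.1 - Z' x.2 x.1))
    (fun x => sqnorm (sp_eval (X n) x.2 x.1 - Z x.2 x.1))
    (fun x => sqnorm (sp_eval (X n) x.2 x.1 - sp_eval (X' n) x.2 x.1))
    (fun x => sqnorm (sp_eval (X' n) x.2 x.1 - Z' x.2 x.1))) => //.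
  - by split=> x; exact: sqnorm_ge0.
  - by split; exact: sqnorm_joint.
  - by move=> x; exact: sqnorm_tri.
have b2 n : (nv%:E * nrm (sp_eval (X n)) (sp_eval (X' n)) <= 2%:E * (e n + e' n))%E.
  rewrite -(simple_isometry T0 hW hp hI (sX n) (sX' n)).
  have [mX _] := simple_integral_meas_sq hW hp hI (sX n) T0.
  have [mX' _] := simple_integral_meas_sq hW hp hI (sX' n) T0.
  have m1 : measurable_fun setT (fun w => ((sp_integral N (X n) T w - I T w) ^+ 2)%:E).
    by apply/measurable_EFinP/measurable_funX; exact: measurable_funB.
  have m2 : measurable_fun setT (fun w => ((sp_integral N (X' n) T w - I' T w) ^+ 2)%:E).
    by apply/measurable_EFinP/measurable_funX; exact: measurable_funB.
  rewrite /e /e' -ge0_integralD//; try by move=> w _; rewrite lee_fin sqr_ge0.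
  rewrite -ge0_integralZl//; first last.
  - by move=> w _; rewrite -EFinD lee_fin addr_ge0 ?sqr_ge0.
  - exact: emeasurable_funD.
  apply: ae_ge0_le_integral => //.
  - by move=> w _; rewrite lee_fin sqr_ge0.
  - by apply/measurable_EFinP/measurable_funX; exact: measurable_funB.
  - by move=> w _; rewrite -EFinD -EFinM lee_fin mulr_ge0// addr_ge0 ?sqr_ge0.
  - by apply: measurable_funeM; exact: emeasurable_funD.
  move: II; apply: filterS => w IIw _; rewrite -EFinD -EFinM lee_fin IIw.
  move: (sp_integral _ _ _ _) (sp_integral _ _ _ _) (I' T w) => x y z; rewrite -subr_ge0.
  have -> : 2 * ((y - z) ^+ 2 + (x - z) ^+ 2) - (y - x) ^+ 2 = (x + y - 2 * z) ^+ 2 by ring.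
  exact: sqr_ge0.
have nv0 : 0 < nv := normal_var_gt0 R.
have zero (u : nat -> \bar R) (c : R) : u n @[n --> \oo] --> 0%E ->
    (c%:E * u n)%E @[n --> \oo] --> 0%E.
  by move=> hu; rewrite -[X in _ --> X](mule0 c%:E); exact: cvgeZl.
have zeroD (u v : nat -> \bar R) : u n @[n --> \oo] --> 0%E -> v n @[n --> \oo] --> 0%E ->
    (u n + v n)%E @[n --> \oo] --> 0%E.
  by move=> hu hv; rewrite -[X in _ --> X](adde0 0%E); exact: cvgeD.
have lim0 : (3%:E * (nv%:E * nrm (sp_eval (X n)) Z + 2%:E * (e n + e' n) +
    nv%:E * nrm (sp_eval (X' n)) Z'))%E @[n --> \oo] --> 0%E.
  exact: (zero _ 3 (zeroD _ _ (zeroD _ _ (zero _ nv cX) (zero _ 2 (zeroD _ _ eX eX'))) (zero _ nv cX'))).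
have : (nv%:E * nrm Z Z')%E @[n --> \oo] --> 0%E.
  apply: (squeeze_cvge _ (cvg_cst 0%E) lim0); near=> n.
  apply/andP; split; first by rewrite mule_ge0// lee_fin ltW.
  exact: (weighted_le3 (ltW nv0) (nrm0 _ _) (nrm0 _ _) (nrm0 _ _) (b1 n) (b2 n)).
move=> /(cvg_unique (@ereal_hausdorff R) (cvg_cst _))/eqP.
by rewrite mule_eq0 eqe gt_eqF//= => /eqP.
Unshelve. all: by end_near. Qed.

End two_integrals.
End ito_uniqueness.

(** * Paths of the compensator *)

Lemma Rintegral_maxE d (T : measurableType d) (R : realType) (mu : {measure set T -> \bar R})
    (D : set T) (f : T -> R) : \int[mu]_(x in D) f x =
  fine (\int[mu]_(x in D) (Num.max (f x) 0)%:E - \int[mu]_(x in D) (Num.max (- f x) 0)%:E)%E.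
Proof.
rewrite /Rintegral integralE; congr (fine (_ - _)%E); apply: eq_integral => x _.
  by rewrite funeposE EFin_max.
by rewrite funenegE EFin_max EFinN.
Qed.

Section compensator_paths.
Context (R : realType) dO (Omega : measurableType dO) (P : probability Omega R).
Context (E : ptopologicalType) (dim : nat) (N : noise R Omega E dim) (T : R).
Local Notation F := (filt P N).
Local Notation A := (cA N).
Local Notation BE := (borelType E).
Local Notation RT := (measurableTypeR R).
Hypotheses (T0 : 0 <= T) (hW : is_wiener P N) (hp : is_marked_point_process P N)
  (hA : predictable F `[0, +oo[ A) (hA0 : forall w, A 0 w = 0)
  (hphi : forall C : set BE, measurable C ->
     predictable F `[0, +oo[ (fun t w => phi N t w C)).
Variable G : set Omega.
Hypotheses (mG : measurable G) (G0 : P (~` G) = 0%E)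
  (regG : forall w, G w -> regular_noise N w).
Local Notation q := (compensator T0 hW hp hA hA0 hphi mG G0 regG).

Lemma compensator_strip_integral w t (f : R * BE -> \bar R) : G w -> 0 <= t ->
  (forall z, 0 <= f z)%E -> measurable_fun (strip BE t T) f ->
  (\int[q w]_(z in strip BE t T) f z =
   \int[dA N w]_(s in oc t T) \int[phi N s w]_e f (s, e))%E /\
  measurable_fun (oc t T : set RT) (fun s : RT => \int[phi N s w]_e f (s, e))%E.
Proof.
move=> Gw t0 f0 mf; have mS : measurable (strip BE t T : set (R * BE)) := strip_measurable t T.
have g0 z : (0 <= (f \_ (strip BE t T)) z)%E by rewrite patchE; case: ifP.
have mg : measurable_fun setT (f \_ (strip BE t T)) by apply/(measurable_restrictT _ mS).
have inn s : oc t T s -> (\int[phi N s w]_e (f \_ (strip BE t T)) (s, e) =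
    \int[phi N s w]_e f (s, e))%E.
  move=> hs; apply: eq_integral => e _; rewrite patchE mem_set//.
have sub : oc t T `<=` oc 0 T.
  by move=> s /=; rewrite !in_itv/= => /andP[ts ->]; rewrite (le_lt_trans t0 ts).
have mot a : measurable (oc a T : set RT) by exact: measurable_itv.
split; last first.
  have h := measurable_funS (mot 0) sub (phi_integral_meas hW hp hphi w g0 mg).
  by apply: eq_measurable_fun h => s /[!inE]; exact: inn.
rewrite integral_mkcond (compensator_integral T0 hW hp hA hA0 hphi mG G0 regG Gw g0 mg).
rewrite integral_mkcond [RHS]integral_mkcond; apply: eq_integral => s _; rewrite !patchE.
have [st|st] := pselect (oc t T s).
  by rewrite (mem_set st) (mem_set (sub s st)); exact: inn.
rewrite (memNset st); case: ifPn => // _.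
by apply: integral0_eq => e _; rewrite patchE memNset// => -[].
Qed.

(** V is split into positive and negative parts, for which kernel and iterated integrals agree. The
    inner integrals are known to be finite for dA-almost every s, so the real-valued inner integral
    is identified off a null set. *)
Lemma int_phi_dA_compensator w t (V : R -> Omega -> E -> R) : G w -> 0 <= t ->
  Rintegrable (q w) (strip BE t T) (fun z => V z.1 w z.2) ->
  int_phi_dA N T V t w = \int[q w]_(z in strip BE t T) V z.1 w z.2.
Proof.
move=> Gw t0 iV; have mV := Rintegrable_measurable iV.
have mS : measurable (strip BE t T : set (R * BE)) := strip_measurable t T.
have mot : measurable (oc t T : set RT) by exact: measurable_itv.
pose fp (z : R * BE) := (Num.max (V z.1 w z.2) 0)%:E.
pose fn (z : R * BE) := (Num.max (- V z.1 w z.2) 0)%:E.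
have fp0 z : (0 <= fp z)%E by rewrite lee_fin le_max lexx orbT.
have fn0 z : (0 <= fn z)%E by rewrite lee_fin le_max lexx orbT.
have mfp : measurable_fun (strip BE t T) fp by apply/measurable_EFinP/measurable_maxr.
have mfn : measurable_fun (strip BE t T) fn.
  by apply/measurable_EFinP/measurable_maxr => //; exact: measurableT_comp.
have [ep mp] := compensator_strip_integral Gw t0 fp0 mfp.
have [en mn] := compensator_strip_integral Gw t0 fn0 mfn.
have fin (f : R * BE -> \bar R) : (forall z, 0 <= f z)%E -> measurable_fun (strip BE t T) f ->
    (forall z, f z <= (`|V z.1 w z.2|)%:E)%E ->
    (\int[q w]_(z in strip BE t T) f z < +oo)%E.
  move=> f0 mf fV; have /integrableP[_] := iV; apply: le_lt_trans.
  by apply: ge0_le_integral => //; apply/measurable_EFinP; exact: measurableT_comp.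
have ip : (dA N w).-integrable (oc t T) (fun s => \int[phi N s w]_e fp (s, e))%E.
  apply/integrableP; split => //.
  under eq_integral do rewrite gee0_abs ?integral_ge0//.
  rewrite -ep; apply: fin => // z; rewrite lee_fin ge_max ler_norm/=; exact: normr_ge0.
have in_ : (dA N w).-integrable (oc t T) (fun s => \int[phi N s w]_e fn (s, e))%E.
  apply/integrableP; split => //.
  under eq_integral do rewrite gee0_abs ?integral_ge0//.
  rewrite -en; apply: fin => // z; rewrite lee_fin ge_max -normrN ler_norm/=; exact: normr_ge0.
rewrite Rintegral_maxE ep en /int_phi_dA /Rintegral; congr fine.
rewrite -integralB//; apply: ae_eq_integral => //.
- apply/measurable_EFinP; apply: (eq_measurable_fun (fun s => fine
    (\int[phi N s w]_e fp (s, e) - \int[phi N s w]_e fn (s, e))%E)).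
    by move=> s _; rewrite [RHS]Rintegral_maxE.
  by apply: measurableT_comp => //; exact: emeasurable_funB.
- exact: emeasurable_funB.
have := integrable_ae mot ip; have := integrable_ae mot in_.
apply: filterS2 => s hn hp' hs.
rewrite [X in X%:E = _]Rintegral_maxE fineK// fin_numB.
by rewrite hp'// hn.
Qed.

End compensator_paths.

(** * Regular outcomes *)

Record regular_costs (R : realType) dO (Omega : measurableType dO) (E : ptopologicalType) m
    (D : bsde_data R Omega E m) (T : R) (w : Omega) : Prop := RegularCosts {
  rc_cont : forall i j, {within `[0, T], continuous (cost D i j ^~ w)};
  rc_diag : forall i t, 0 <= t <= T -> cost D i i t w = 0;
  rc_loop : forall i j l, i != j -> j != l -> (0 < ereal_inf
    [set (cost D i j t w + cost D j l t w - cost D i l t w)%R%:E | t in `[0%R, T]])%E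
}.

(** All fields but [rg_sq] are clauses of the notion of solution; [rg_sq] follows almost surely from
    the finite weighted norm of U. *)
Record regular_candidate (R : realType) dO (Omega : measurableType dO)
    (E : ptopologicalType) dim m (N : noise R Omega E dim) (D : bsde_data R Omega E m) (T : R)
    (S : candidate R Omega E dim m) (I : 'I_m -> R -> Omega -> R) (w : Omega) : Prop :=
  RegularCandidate {
  rg_cadlag : forall i, cadlag_on T (solY S i ^~ w);
  rg_Kcont : forall i, {within `[0, T], continuous (solK S i ^~ w)};
  rg_Khomo : forall i, {in `[0, T] &, {homo solK S i ^~ w : s t / s <= t}};
  rg_K0 : forall i, solK S i 0 w = 0;
  rg_Icont : forall i, {within `[0, T], continuous (I i ^~ w)};
  rg_eqn : forall i t, 0 <= t <= T ->
      solY S i t w =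
        xi D i w
        + \int[dA N w]_(s in `]t, T]) drvA D i s w
        + \int[lebesgue_measure]_(s in `]t, T]) drvW D i s w
        + int_phi_dA N T (fun s w e => solU S i s w e * (rho D i s w e - 1)) t w
        - int_q N T (solU S i) t w
        - (I i T w - I i t w)
        + (solK S i T w - solK S i t w);
  rg_obstacle : forall i t, 0 <= t <= T ->
    (obstacle D (solY S) i t w <= (solY S i t w)%R%:E)%E;
  rg_skorokhod : forall i, (\int[dK T (solK S i) w]_(t in oc 0%R T)
    ((solY S i t w)%R%:E - obstacle D (solY S) i t w) = 0)%E;
  rg_sq : forall i, (\int[dA N w]_(s in oc 0%R T)
    \int[phi N s w]_e (solU S i s w e ^+ 2)%:E < +oo)%E
}.

Lemma ae_and d (T : measurableType d) (R : realType) (mu : {measure set T -> \bar R})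
    (Q Q' : T -> Prop) : {ae mu, forall x, Q x} -> {ae mu, forall x, Q' x} ->
  {ae mu, forall x, Q x /\ Q' x}.
Proof. by apply: filterS2 => x; split. Qed.

Lemma predictable_strip (R : realType) d (Omega : measurableType d) dE (E : measurableType dE)
    (F : R -> set (set Omega)) (T t : R) (V : R -> Omega -> E -> R) w : 0 <= T -> 0 <= t ->
  predictable_field F `[0, T] V -> measurable_fun (strip E t T) (fun z => V z.1 w z.2).
Proof.
move=> T0 t0 pV; apply: (predictable_field_section (F := F)).
  exact: measurable_predictable_ocitv.
apply: predictable_field_sub pV; first exact: measurable_predictable_ccitv.
by move=> r /=; rewrite !in_itv/= => /andP[tr ->]; rewrite (le_trans t0 (ltW tr)).
Qed.

Section good_set.
Context (R : realType) (T : R) dO (Omega : measurableType dO) (P : probability Omega R).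
Context (E : ptopologicalType) (dim m : nat) (N : noise R Omega E dim)
  (D : bsde_data R Omega E m) (M b : R).
Local Notation F := (filt P N).
Local Notation A := (cA N).
Local Notation BE := (borelType E).
Hypotheses (T0 : 0 < T) (hset : is_setting P N) (hcA : continuous_cA P N)
  (hD : assumption_D P N T D M b).

Lemma regular_noise_ae : {ae P, forall w, regular_noise N w}.
Proof.
have [_ [_ _ _ hp] _ [_ hm hr _] _] := hset.
have hh : {ae P, forall w, {in `[0, +oo[ &, {homo A ^~ w : s t / s <= t}} /\
    (forall t, 0 <= t -> A x w @[x --> t^'+] --> A t w)}.
  by move: hm hr; apply: filterS2.
by move: hp hh hcA; apply: filterS3 => w [h1 h2 h3] [h4 h5] h6; split.
Qed.

Lemma regular_costs_ae : {ae P, forall w, regular_costs D T w}.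
Proof.
have [_ _ [hc _ hd hl _] _] := hD.
have h1 : {ae P, forall w, forall i j, {within `[0, T], continuous (cost D i j ^~ w)}}.
  by apply: ae_forall_count => i; apply: ae_forall_count => j; have [] := hc i j.
have h2 : {ae P, forall w, forall i t, 0 <= t <= T -> cost D i i t w = 0}.
  exact: ae_forall_count.
have h3 : {ae P, forall w, forall i j l, i != j -> j != l -> (0 < ereal_inf
    [set (cost D i j t w + cost D j l t w - cost D i l t w)%R%:E | t in `[0%R, T]])%E}.
  apply: ae_forall_count => i; apply: ae_forall_count => j; apply: ae_forall_count => l.
  have [ij|ij] := boolP (i != j); last exact: filterE.
  have [jl|jl] := boolP (j != l); last exact: filterE.
  by apply: filterS (hl i j l ij jl) => w.
by move: h1 h2 h3; apply: filterS3 => w; split.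
Qed.

Lemma weighted_predictable (beta : R) (V : R -> Omega -> BE -> R) :
  predictable_field F `[0, T] V ->
  predictable_field F `[0, T] (fun s w e => expR (beta * A s w) * V s w e ^+ 2).
Proof.
move=> pV; have [_ _ _ [_ _ _ hA] _] := hset.
apply: measurable_funM; last exact: measurable_funX.
apply: (@measurableT_comp _ _ _ _ _ _ (@expR R)); first exact: measurable_expR.
apply: measurable_funM => //.
have mI : measurable (`[0, T] `*` setT : set (Defs.predType F)).
  by apply: measurable_predictable_ccitv; exact: ltW.
apply: (measurable_comp (F := (`[0, +oo[ `*` setT : set (Defs.predType F)))
  (f := fun x : Defs.predType F => A x.1 x.2) (g := fst)).
- exact: measurable_predictable_coitv.
- by move=> _ [[[r w] e] [[/= r0 _] _] <-] /=; move: r0; rewrite !in_itv/= => /andP[->].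
- exact: hA.
- by apply: measurable_funTS; exact: measurable_fst.
Qed.

Section one_candidate.
Variables (S : candidate R Omega E dim m) (I : 'I_m -> R -> Omega -> R).
Hypothesis hS : is_solution P N T D M b S.

Let hW : is_wiener P N. Proof. by case: hset. Qed.
Let hp : is_marked_point_process P N. Proof. by case: hset. Qed.
Let hA : predictable F `[0, +oo[ A. Proof. by case: hset => _ _ _ []. Qed.
Let hA0 w : A 0 w = 0. Proof. by case: hset => _ _ _ []. Qed.
Let hI' : independent_noise P N. Proof. by case: hset. Qed.
Let hcomp : is_compensator P N. Proof. by case: hset. Qed.
Local Notation hphi := (compensator_phi hcomp).

(** The spaces of a solution are indexed by all beta strictly inside the interval; the midpoint is a
    convenient one. *)
Let beta := (Mprime M ^+ 2 + b) / 2.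

Lemma mid_beta : Mprime M ^+ 2 < beta < b.
Proof. by have [h _ _ _] := hD; rewrite /beta; apply/andP; split; lra. Qed.

Lemma mid_beta_gt0 : 0 < beta.
Proof. by have /andP[h _] := mid_beta; apply: le_lt_trans h; exact: sqr_ge0. Qed.

Let weighted (V : R -> Omega -> E -> R) s w e := expR (beta * A s w) * V s w e ^+ 2.

Lemma solU_pred i : predictable_field F `[0, T] (solU S i : R -> Omega -> BE -> R).
Proof. by have [_ /(_ _ mid_beta)[_ _ [] //]] := hS i. Qed.

Let weighted_pred i :
  predictable_field F `[0, T] (weighted (solU S i) : R -> Omega -> BE -> R).
Proof. exact: weighted_predictable (solU_pred i). Qed.

Section regular_set.
Variable G : set Omega.
Hypotheses (mG : measurable G) (G0 : P (~` G) = 0%E)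
  (regG : forall w, G w -> regular_noise N w).
Local Notation q := (compensator (ltW T0) hW hp hA hA0 hphi mG G0 regG).

(** The weighted norm of U is compared with an integral against the compensator kernel, where
    measurability in w is available. Off G the kernel integral is 0, so the norm is an upper
    bound. *)
Lemma weighted_compensator i :
  measurable_fun setT (fun w => \int[q w]_(z in strip BE 0 T)
    (weighted (solU S i) z.1 w z.2)%:E)%E /\
  (\int[P]_w \int[q w]_(z in strip BE 0%R T) (weighted (solU S i) z.1 w z.2)%:E < +oo)%E.
Proof.
have w0 r w e : 0 <= weighted (solU S i) r w e.
  by rewrite /weighted mulr_ge0 ?expR_ge0 ?sqr_ge0.
have pw : predictable_field F `]0, T] (weighted (solU S i) : R -> Omega -> BE -> R).
  apply: predictable_field_sub (weighted_pred i).
    by apply: measurable_predictable_ccitv; exact: ltW.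
  by move=> r /=; rewrite !in_itv/= => /andP[/ltW -> ->].
have [_ mq _] := compensation_formula (T := T) (ltW T0) hW hp hA hA0 hcomp mG G0 regG
  (lexx 0) (lexx T) w0 pw.
have q0 w : (0 <= \int[q w]_(z in strip BE 0%R T) (weighted (solU S i) z.1 w z.2)%:E)%E.
  by apply: integral_ge0 => z _; rewrite lee_fin.
split => //.
have [_ /(_ _ mid_beta)[_ _ [_ hU] _] _ _ _] := hS i.
apply: le_lt_trans hU; apply: lower_integral_le => // w _.
have [Gw|Gw] := pselect (G w).
  have mf : measurable_fun (strip BE 0 T) (fun z : R * BE => (weighted (solU S i) z.1 w z.2)%:E).
    by apply/measurable_EFinP; apply: predictable_field_section pw;
      exact: measurable_predictable_ocitv.
  have f0 (z : R * BE) : (0 <= (weighted (solU S i) z.1 w z.2)%:E)%E by rewrite lee_fin.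
  by have [-> _] := compensator_strip_integral (ltW T0) hW hp hA hA0 hphi mG G0 regG Gw
    (lexx 0) f0 mf.
rewrite compensator_bad_integral//.
by apply: integral_ge0 => s _; apply: integral_ge0 => e _; rewrite lee_fin; exact: w0.
Qed.

(** The weight exp(beta A) is at least 1, because beta > 0 and A >= 0 on G. *)
Lemma solU_sq_compensator i w :
  (\int[q w]_(z in strip BE 0%R T) (solU S i z.1 w z.2 ^+ 2)%:E <=
   \int[q w]_(z in strip BE 0%R T) (weighted (solU S i) z.1 w z.2)%:E)%E.
Proof.
have [Gw|Gw] := pselect (G w); last by rewrite !compensator_bad_integral.
apply: lower_integral_le => -[r e] [/=]; rewrite in_itv/= => /andP[r0 rT] _.
  by rewrite lee_fin sqr_ge0.
rewrite lee_fin /weighted ler_peMl ?sqr_ge0// -expR0 ler_expR mulr_ge0 ?(ltW mid_beta_gt0)//.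
by rewrite -(hA0 w); apply: (rn_homo (regG Gw)); rewrite ?in_itv/= ?lexx ?andbT// ltW.
Qed.

Lemma solU_sq_fin i :
  (\int[P]_w \int[q w]_(z in strip BE 0%R T) (solU S i z.1 w z.2 ^+ 2)%:E < +oo)%E.
Proof.
have [_] := weighted_compensator i; apply: le_lt_trans; apply: lower_integral_le => w _.
  by apply: integral_ge0 => z _; rewrite lee_fin sqr_ge0.
exact: solU_sq_compensator.
Qed.

Lemma solU_sq_path_ae i : {ae P, forall w, (\int[q w]_(z in strip BE 0%R T)
  (solU S i z.1 w z.2 ^+ 2)%:E < +oo)%E}.
Proof.
have [mq fq] := weighted_compensator i.
have iq : P.-integrable setT (fun w => \int[q w]_(z in strip BE 0%R T)
    (weighted (solU S i) z.1 w z.2)%:E)%E.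
  apply/integrableP; split => //.
  rewrite (eq_integral (fun w => \int[q w]_(z in strip BE 0%R T)
    (weighted (solU S i) z.1 w z.2)%:E)%E) => [|w _]; first exact: fq.
  rewrite gee0_abs// integral_ge0// => z _.
  by rewrite lee_fin /weighted mulr_ge0 ?expR_ge0 ?sqr_ge0.
apply: filterS (integrable_ae measurableT iq) => w /(_ Logic.I) h.
by apply: le_lt_trans (solU_sq_compensator i w) _; rewrite ltey_eq h.
Qed.

End regular_set.
Hypothesis hI : forall i, is_ito_integral P N T (solZ S i) (I i) /\
  {ae P, forall w, forall t, 0 <= t <= T ->
      solY S i t w =
        xi D i w
        + \int[dA N w]_(s in `]t, T]) drvA D i s w
        + \int[lebesgue_measure]_(s in `]t, T]) drvW D i s w
        + int_phi_dA N T (fun s w e => solU S i s w e * (rho D i s w e - 1)) t w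
        - int_q N T (solU S i) t w
        - (I i T w - I i t w)
        + (solK S i T w - solK S i t w)}.

Lemma regular_candidate_ae : {ae P, forall w, regular_candidate N D T S I w}.
Proof.
have [G [mG G0 regG]] := conull_set regular_noise_ae.
have Gae : {ae P, forall w, G w} by exists (~` G); split => //; exact: measurableC.
have h1 : {ae P, forall w, forall i, cadlag_on T (solY S i ^~ w)}.
  by apply: ae_forall_count => i; have [[]] := hS i.
have h2 : {ae P, forall w, forall i, [/\ {within `[0, T], continuous (solK S i ^~ w)},
    {in `[0, T] &, {homo solK S i ^~ w : s t / s <= t}} & solK S i 0 w = 0]}.
  apply: ae_forall_count => i; have [_ _ [[_ _ hm _] hc h0] _ _] := hS i.
  by move: hm hc h0; apply: filterS3 => w; split.
have h3 : {ae P, forall w, forall i, {within `[0, T], continuous (I i ^~ w)}}.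
  by apply: ae_forall_count => i; have [[]] := hI i.
have h4 := ae_forall_count (fun i => (hI i).2).
have h5 : {ae P, forall w, forall i, forall t, 0 <= t <= T ->
    (obstacle D (solY S) i t w <= (solY S i t w)%R%:E)%E}.
  by apply: ae_forall_count => i; have [_ _ _ _ []] := hS i.
have h6 : {ae P, forall w, forall i, (\int[dK T (solK S i) w]_(t in oc 0%R T)
    ((solY S i t w)%R%:E - obstacle D (solY S) i t w) = 0)%E}.
  by apply: ae_forall_count => i; have [_ _ _ _ []] := hS i.
have h7 : {ae P, forall w, forall i, (\int[dA N w]_(s in oc 0%R T)
    \int[phi N s w]_e (solU S i s w e ^+ 2)%:E < +oo)%E}.
  apply: ae_forall_count => i; move: (solU_sq_path_ae mG G0 regG i) Gae.
  apply: filterS2 => w + Gw.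
  have mf : measurable_fun (strip BE 0 T) (fun z : R * BE => (solU S i z.1 w z.2 ^+ 2)%:E).
    apply/measurable_EFinP/measurable_funX.
    exact: (predictable_strip w (ltW T0) (lexx 0) (solU_pred i)).
  have f0 (z : R * BE) : (0 <= (solU S i z.1 w z.2 ^+ 2)%:E)%E by rewrite lee_fin sqr_ge0.
  by have [-> _] := compensator_strip_integral (ltW T0) hW hp hA hA0 hphi mG G0 regG Gw
    (lexx 0) f0 mf.
have h56 : {ae P, forall w, (forall i t, 0 <= t <= T ->
      (obstacle D (solY S) i t w <= (solY S i t w)%R%:E)%E) /\
    forall i, (\int[dK T (solK S i) w]_(t in oc 0%R T)
      ((solY S i t w)%R%:E - obstacle D (solY S) i t w) = 0)%E}.
  by move: h5 h6; apply: filterS2.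
have h12 : {ae P, forall w, (forall i, cadlag_on T (solY S i ^~ w)) /\
   forall i, [/\ {within `[0, T], continuous (solK S i ^~ w)},
    {in `[0, T] &, {homo solK S i ^~ w : s t / s <= t}} & solK S i 0 w = 0]}.
  by move: h1 h2; apply: filterS2.
move: (ae_and h12 h3) (ae_and h4 (ae_and h56 h7)).
apply: filterS2 => w [[b1 b2] b3] [b4 [[b5 b6] b7]].
by split => // i; have [] := b2 i.
Qed.

Section backward.
Variables (G : set Omega) (mG : measurable G) (G0 : P (~` G) = 0%E).
Hypotheses (regG : forall w, G w -> regular_noise N w)
  (candG : forall w, G w -> regular_candidate N D T S I w)
  (hM : forall i t w e, 0 <= t <= T -> 0 <= rho D i t w e <= M)
  (prho : forall i, predictable_field F `[0, T] (rho D i : R -> Omega -> BE -> R))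
  (G_exp : Rintegrable P setT (fun w => expR (3 * bcst M * clockA N G T w))).

Local Notation NM := (noise_measures (ltW T0) hW hp hA hA0 hcomp mG G0 regG G_exp).
Local Notation q := (compensator (ltW T0) hW hp hA hA0 hphi mG G0 regG).

Definition gd (X : R -> Omega -> R) t w : R := \1_G w * X t w.

Lemma gd_good X t w : G w -> gd X t w = X t w.
Proof. by move=> Gw; rewrite /gd indicE mem_set// mul1r. Qed.

Lemma gd_bad X t w : ~ G w -> gd X t w = 0.
Proof. by move=> Gw; rewrite /gd indicE memNset// mul0r. Qed.

Definition forcing i := gd (fun t w => xi D i w
  + \int[dA N w]_(s in `]t, T]) drvA D i s w
  + \int[lebesgue_measure]_(s in `]t, T]) drvW D i s w).

Lemma gd_adapted X t : measurable_fun [set: g_sigma_algebraType (F t)] (X t) ->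
  measurable_fun [set: g_sigma_algebraType (F t)] (gd X t).
Proof.
move=> mX; have mi : measurable_fun [set: g_sigma_algebraType (F t)]
    (\1_G : g_sigma_algebraType (F t) -> R) by exact: indic_good_meas.
exact: (measurable_funM mi mX).
Qed.

Lemma gd_cont (a b' : R) X w : (G w -> {within `[a, b'], continuous (X ^~ w)}) ->
  {within `[a, b'], continuous (gd X ^~ w)}.
Proof.
have [Gw|Gw] := pselect (G w).
  move=> /(_ Gw); rewrite (_ : gd X ^~ w = X ^~ w)//.
  by apply/funext => t; rewrite gd_good.
move=> _; rewrite (_ : gd X ^~ w = cst 0); last by apply/funext => t; rewrite gd_bad.
by move=> t; exact: cvg_cst.
Qed.

Lemma gd_sq (X : R -> Omega -> R) t : measurable_fun setT (X t) ->
  Rintegrable P setT (fun w => X t w ^+ 2) ->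
  Rintegrable P setT (fun w => gd X t w ^+ 2).
Proof.
move=> mX iX; apply: (Rintegrable_le measurableT _ _ iX).
  by apply: measurable_funX; apply: measurable_funM => //; exact: measurable_indic.
move=> w _; rewrite ger0_norm ?sqr_ge0// /gd exprMn ler_piMl ?sqr_ge0//.
Qed.

Lemma gd_ae X t : {ae P, forall w, gd X t w = X t w}.
Proof.
have : {ae P, forall w, G w} by exists (~` G); split => //; exact: measurableC.
by apply: filterS => w Gw; rewrite gd_good.
Qed.

Lemma solU_path i w : Rintegrable (q w) (strip BE 0 T) (fun z => solU S i z.1 w z.2 ^+ 2).
Proof.
have mU : measurable_fun (strip BE 0 T) (fun z : R * BE => solU S i z.1 w z.2 ^+ 2).
  by apply: measurable_funX; exact: (predictable_strip w (ltW T0) (lexx 0) (solU_pred i)).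
apply: ge0_Rintegrable => //; [exact: strip_measurable|by move=> z _; exact: sqr_ge0|].
have [Gw|Gw] := pselect (G w); last by rewrite compensator_bad_integral.
have f0 (z : R * BE) : (0 <= (solU S i z.1 w z.2 ^+ 2)%:E)%E by rewrite lee_fin sqr_ge0.
have mU' : measurable_fun (strip BE 0 T) (fun z : R * BE => (solU S i z.1 w z.2 ^+ 2)%:E).
  exact/measurable_EFinP.
have [-> _] := compensator_strip_integral (ltW T0) hW hp hA hA0 hphi mG G0 regG Gw
    (lexx 0) f0 mU'.
exact: (rg_sq (candG Gw)).
Qed.

Lemma solK_meas i t : 0 <= t <= T -> measurable_fun setT (gd (solK S i) t).
Proof.
move=> /[dup] ht /andP[t0 tT]; have [_ _ [[pK _ _ _] _ _] _ _] := hS i.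
apply: measurable_funM; first exact: measurable_indic.
apply: (sub_measurable_fun (filt_sub hW hp (t := t))).
apply: (@predictable_adapted _ _ _ F _ R `[0, T]%classic (solK S i) t) => //.
- by move=> s r s0 sr; exact: filt_mono.
- by apply: measurable_predictable_ccitv; exact: ltW.
Qed.

(** On G the integral of U (rho - 1) and the compensator part of q combine into the integral of U
    rho; off G all terms are 0. *)
Lemma gd_eqn i w t : 0 <= t <= T ->
  gd (solY S i) t w = forcing i t w
      + \int[q w]_(z in strip BE t T) (solU S i z.1 w z.2 * rho D i z.1 w z.2)
      - \int[jump_part N G w]_(z in strip BE t T) solU S i z.1 w z.2
      - (gd (I i) T w - gd (I i) t w) + (gd (solK S i) T w - gd (solK S i) t w).
Proof.
move=> ht; have /andP[t0 tT] := ht; have [Gw|Gw] := pselect (G w); last first.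
  rewrite /forcing !gd_bad// {1}/Rintegral compensator_bad_integral//.
  rewrite /jump_part; case: pselect => // _.
  by rewrite /Rintegral integral_measure_zero/=; ring.
have iU := Rintegrable_u (S := NM) (ltW T0) (solU_pred i) (solU_path i w) t0 tT (lexx T).
have iUr := Rintegrable_urho (S := NM) (ltW T0) (solU_pred i) (prho i) (hM i) (solU_path i w)
  t0 tT (lexx T).
have mS := strip_measurable (E := E) t T.
have e1 : int_phi_dA N T (fun s w e => solU S i s w e * (rho D i s w e - 1)) t w =
    \int[q w]_(z in strip BE t T) (solU S i z.1 w z.2 * rho D i z.1 w z.2)
    - \int[q w]_(z in strip BE t T) solU S i z.1 w z.2.
  have iV : Rintegrable (q w) (strip BE t T)
      (fun z => solU S i z.1 w z.2 * (rho D i z.1 w z.2 - 1)).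
    by have := RintegrableB mS iUr iU; congr Rintegrable; apply/funext => z; ring.
  rewrite (int_phi_dA_compensator Gw t0 iV) -(RintegralB mS iUr iU).
  by apply: eq_Rintegral => z _; ring.
have e2 : int_phi_dA N T (solU S i) t w = \int[q w]_(z in strip BE t T) solU S i z.1 w z.2.
  exact: (int_phi_dA_compensator Gw t0 iU).
rewrite /forcing !gd_good// (rg_eqn (candG Gw))// e1 /int_q e2 /int_p.
rewrite /jump_part; case: pselect => // _; ring.
Qed.

Definition candidate_path i : backward_path NM (forcing i) (rho D i).
Proof.
refine (@BackwardPath _ _ _ _ _ _ _ _ _ NM (forcing i) (rho D i)
  (gd (solY S i)) (solU S i) (gd (I i)) (gd (solK S i)) _ _ _ _ _ _ _ _ _ _ _ _ _ _ _ _).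
- by move=> t ht; apply: gd_adapted; have [[aY _] _ _ _ _] := hS i; exact: aY.
- move=> w; have [Gw|Gw] := pselect (G w).
    rewrite (_ : gd (solY S i) ^~ w = solY S i ^~ w); first exact: (rg_cadlag (candG Gw)).
    by apply/funext => t; rewrite gd_good.
  rewrite (_ : gd (solY S i) ^~ w = cst 0); last by apply/funext => t; rewrite gd_bad.
  by split => t _; [exact: cvg_cst|exact: is_cvg_cst].
- exact: solU_pred.
- exact: solU_path.
- exact: solU_sq_fin.
- by move=> t ht; apply: gd_adapted; have [[aI _ _] _] := hI i; exact: aI.
- move=> t ht; apply: gd_sq; first exact: (ito_meas hW hp (hI i).1).
  exact: (ito_sq hW hp hI' (hI i).1).
- move=> s t s0 st tT B FB.
  have mB : measurable B := filt_sub hW hp FB.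
  rewrite -(ito_orth hW hp hI' (hI i).1 s0 st tT FB); apply: ae_eq_Rintegral => //.
  + apply: measurable_funTS; apply: measurable_funB; apply: measurable_funM;
      try exact: measurable_indic; apply: (ito_meas hW hp (hI i).1).
    * by rewrite tT (le_trans s0).
    * by rewrite s0 (le_trans st).
  + apply: measurable_funTS; apply: measurable_funB; apply: (ito_meas hW hp (hI i).1).
    * by rewrite tT (le_trans s0).
    * by rewrite s0 (le_trans st).
  by move: (gd_ae (I i) s) (gd_ae (I i) t); apply: filterS2 => w -> ->.
- by move=> w; apply: gd_cont => Gw; exact: (rg_Icont (candG Gw)).
- have := ito0 hW hp hI' (ltW T0) (hI i).1.
  by move: (gd_ae (I i) 0); apply: filterS2 => w ->.
- exact: solK_meas.
- move=> w s t s0 st tT; have [Gw|Gw] := pselect (G w); last by rewrite !gd_bad.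
  by rewrite !gd_good// (rg_Khomo (candG Gw))// in_itv/= ?s0 ?tT ?(le_trans st tT) ?(le_trans s0 st).
- move=> w; have [Gw|Gw] := pselect (G w); last by rewrite gd_bad.
  by rewrite gd_good// (rg_K0 (candG Gw)).
- by move=> w; apply: gd_cont => Gw; exact: (rg_Kcont (candG Gw)).
- have [_ _ [[pK _ _ K2] _ _] _ _] := hS i.
  have mK : measurable_fun setT (solK S i T).
    apply: (sub_measurable_fun (filt_sub hW hp (t := T))).
    apply: (@predictable_adapted _ _ _ F _ R `[0, T]%classic (solK S i) T) => //.
    + by move=> s r s0 sr; exact: filt_mono.
    + by apply: measurable_predictable_ccitv; exact: ltW.
    + exact: ltW.
    + by rewrite /= in_itv/= lexx (ltW T0).
  apply: gd_sq => //; apply: ge0_Rintegrable => //; last by move=> w _; exact: sqr_ge0.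
  exact: measurable_funX.
- exact: gd_eqn.
Defined.

End backward.
End one_candidate.
End good_set.

(** * Reflection along a path *)

(** There are finitely many triples, and for each the infimum over [0, T] is positive; the minimum
    of these infima with 1 serves the whole path. *)
Lemma regular_costs_gap (R : realType) dO (Omega : measurableType dO) (E : ptopologicalType) m
    (D : bsde_data R Omega E m) (T : R) w : regular_costs D T w ->
  exists2 c : R, 0 < c & forall i j l t, i != j -> j != l -> 0 <= t <= T ->
    c <= cost D i j t w + cost D j l t w - cost D i l t w.
Proof.
move=> hD; pose gap t (p : 'I_m * 'I_m * 'I_m) :=
  cost D p.1.1 p.1.2 t w + cost D p.1.2 p.2 t w - cost D p.1.1 p.2 t w.
have H (p : 'I_m * 'I_m * 'I_m) : exists c : R, 0 < c /\ (p.1.1 != p.1.2 -> p.1.2 != p.2 ->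
    forall t, 0 <= t <= T -> c <= gap t p).
  have [h1|h1] := boolP (p.1.1 != p.1.2); last by exists 1.
  have [h2|h2] := boolP (p.1.2 != p.2); last by exists 1.
  have := rc_loop hD h1 h2; set I := ereal_inf _ => I0.
  have lb t : 0 <= t <= T -> (I <= (gap t p)%:E)%E.
    by move=> ht; apply: ereal_inf_lbound; exists t => //=; rewrite in_itv.
  case: I I0 lb => [c| |] // c0 lb.
    by exists c; split => // _ _ t /lb; rewrite lee_fin.
  by exists 1; split => // _ _ t /lb; rewrite leye_eq.
have [c hc] := choice H.
exists (\big[Num.min/1]_p c p); first by apply/lt_bigmin => // p _; have [] := hc p.
move=> i j l t ij jl ht; have [_ /(_ ij jl t ht) h] := hc (i, j, l).
by apply: le_trans h; exact: bigmin_le_cond.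
Qed.

Section reflection.
Context (R : realType) (T : R) dO (Omega : measurableType dO) (P : probability Omega R).
Context (E : ptopologicalType) (dim m : nat) (N : noise R Omega E dim)
  (D : bsde_data R Omega E m) (M b : R).
Hypotheses (T0 : 0 < T) (S : candidate R Omega E dim m) (I : 'I_m -> R -> Omega -> R).
Variable w : Omega.
Hypothesis hS : regular_candidate N D T S I w.

Lemma obstacle_le i j t : i != j -> 0 <= t <= T ->
  solY S j t w - cost D i j t w <= solY S i t w.
Proof.
move=> ij ht; rewrite -lee_fin; apply: le_trans (rg_obstacle hS i ht).
rewrite /obstacle; apply: (@le_bigmax_cond _ _ _ -oo%E j (fun j => j != i)
  (fun j => (solY S j t w - cost D i j t w)%R%:E)).
by rewrite eq_sym.
Qed.

Let clamp (t : R) : R := Num.min (Num.max 0 t) T.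

Let clamp_itv t : 0 <= clamp t <= T.
Proof. by rewrite /clamp le_min (ltW T0) le_max lexx/= ge_min lexx orbT. Qed.

Let clampE t : 0 <= t <= T -> clamp t = t.
Proof. by move=> /andP[t0 tT]; rewrite /clamp (max_r t0) min_l. Qed.

Lemma cumulative_K i : is_cumulative (fun t => solK S i (clamp t) w).
Proof.
split.
  move=> s t st; apply: (rg_Khomo hS); rewrite ?in_itv/= ?clamp_itv//.
  rewrite /clamp le_min !ge_min ge_max !le_max !lexx/= st orbT/=.
  by rewrite orbT.
move=> t; have [t0|t0] := ltP t 0.
  apply: cvg_near_cst; near=> s.
  have s0 : s <= 0 by apply: ltW; near: s; exact: nbhs_right_lt.
  by rewrite /clamp (max_l s0) (max_l (ltW t0)).
have [tT|tT] := ltP t T.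
  have htT : 0 <= t < T by rewrite t0.
  have := continuous_within_right (@rg_Kcont _ _ _ _ _ _ _ _ _ _ _ _ hS i) htT.
  rewrite -[X in solK S i X w](clampE (t := t)) ?t0 ?(ltW tT)//.
  apply: cvg_trans; apply: near_eq_cvg; near=> s; rewrite clampE//.
  apply/andP; split; first by apply: (le_trans t0); apply: ltW; near: s; exact: nbhs_right_gt.
  by near: s; exact: nbhs_right_le.
apply: cvg_near_cst; near=> s.
have ts : t <= s by apply: ltW; near: s; exact: nbhs_right_gt.
rewrite /clamp (max_r t0) (max_r (le_trans t0 ts)) (min_r tT) min_r//.
exact: le_trans ts.
Unshelve. all: by end_near. Qed.

(** A Chebyshev argument: e times the dK-mass of ]s, t] is at most the integral of Y - obstacle,
    which is 0. [lower_integral_le] makes the comparison for the obstacle as it stands, without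
    measurability along the path. *)
Lemma flat_off_obstacle i s t e : 0 <= s -> s <= t -> t <= T -> 0 < e ->
  (forall r j, j != i -> s < r <= t ->
     e <= solY S i r w - solY S j r w + cost D i j r w) ->
  solK S i t w = solK S i s w.
Proof.
move=> s0 st tT e0 he.
have hs : 0 <= s <= T by rewrite s0 (le_trans st).
have ht : 0 <= t <= T by rewrite tT (le_trans s0).
have Kst : solK S i s w <= solK S i t w by apply: (rg_Khomo hS) => //; rewrite in_itv.
have mo a c : measurable (oc a c : set (measurableTypeR R)) by exact: measurable_itv.
have h : ((e * (solK S i t w - solK S i s w))%:E <= 0)%E.
  rewrite -(rg_skorokhod hS i).
  have -> : ((e * (solK S i t w - solK S i s w))%:E =
      \int[dK T (solK S i) w]_(r in oc 0%R T) (e%:E * (\1_(oc s t) r)%:E))%E.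
    rewrite ge0_integralZl//; last 2 first.
    - by apply/measurable_EFinP; exact: measurable_indic.
    - by rewrite lee_fin ltW.
    rewrite integral_indic// (_ : oc s t `&` oc 0 T = oc s t); last first.
      apply/seteqP; split=> r /=; rewrite !in_itv/=; first by case.
      move=> /andP[sr rt]; split; first by rewrite sr.
      by rewrite (le_lt_trans s0 sr) (le_trans rt).
    by rewrite /dK (stieltjes_ocitv (cumulative_K i) st)/= !clampE// EFinM.
  apply: lower_integral_le => r /=; rewrite in_itv/= => /andP[r0 rT].
    by rewrite -EFinM lee_fin mulr_ge0// ?ltW// indicE.
  have hr : 0 <= r <= T by rewrite (ltW r0).
  rewrite indicE; have [|_] := boolP (r \in _).
    rewrite inE/= in_itv/= mule1 => rst.
    have ob : (obstacle D (solY S) i r w <= (solY S i r w - e)%:E)%E.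
      apply: bigmax_le => [|j ji]; first exact: leNye.
      by rewrite lee_fin; have := he r j ji rst; lra.
    apply: le_trans (leeB (lexx (solY S i r w)%:E) ob).
    by rewrite -EFinB lee_fin; lra.
  rewrite mule0; apply: le_trans (leeB (lexx (solY S i r w)%:E) (rg_obstacle hS i hr)).
  by rewrite -EFinB subrr.
move: h; rewrite lee_fin pmulr_rle0// subr_le0 => Kts.
by apply/eqP; rewrite eq_le Kts.
Qed.

End reflection.

(** * Uniqueness of all components *)

Section uniqueness.
Context (R : realType) (T : R) dO (Omega : measurableType dO) (P : probability Omega R).
Context (E : ptopologicalType) (dim m : nat) (N : noise R Omega E dim)
  (D : bsde_data R Omega E m) (M b : R).
Local Notation F := (filt P N).
Local Notation A := (cA N).
Local Notation BE := (borelType E).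
Local Notation RT := (measurableTypeR R).
Local Notation driven S I := (forall i, is_ito_integral P N T (solZ S i) (I i) /\
  {ae P, forall w, forall t, 0 <= t <= T ->
      solY S i t w =
        xi D i w
        + \int[dA N w]_(s in `]t, T]) drvA D i s w
        + \int[lebesgue_measure]_(s in `]t, T]) drvW D i s w
        + int_phi_dA N T (fun s w e => solU S i s w e * (rho D i s w e - 1)) t w
        - int_q N T (solU S i) t w
        - (I i T w - I i t w)
        + (solK S i T w - solK S i t w)}).

Lemma ito_choice (S : candidate R Omega E dim m) : is_solution P N T D M b S ->
  exists I, driven S I.
Proof.
move=> hS; have H j : bsde_equation P N T D S j by have [] := hS j.
by exists (fun j => projT1 (cid2 (H j))) => j; case: (cid2 (H j)).
Qed.

Hypotheses (T0 : 0 < T) (hset : is_setting P N) (hD : assumption_D P N T D M b).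
Variables (G : set Omega) (mG : measurable G) (G0 : P (~` G) = 0%E).
Hypotheses (regG : forall w, G w -> regular_noise N w)
  (costG : forall w, G w -> regular_costs D T w)
  (hM : forall i t w e, 0 <= t <= T -> 0 <= rho D i t w e <= M)
  (prho : forall i, predictable_field F `[0, T] (rho D i : R -> Omega -> BE -> R))
  (G_exp : Rintegrable P setT (fun w => expR (3 * bcst M * clockA N G T w))).

(* Off the good set all components vanish, and the cost 1 keeps the strict
   loop inequality. *)
Definition gd_cost i j t w := gd G (cost D i j) t w + (1 - \1_G w).

Lemma gd_cost_good i j t w : G w -> gd_cost i j t w = cost D i j t w.
Proof. by move=> Gw; rewrite /gd_cost gd_good// indicE mem_set// subrr addr0. Qed.

Lemma gd_cost_bad i j t w : ~ G w -> gd_cost i j t w = 1.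
Proof. by move=> Gw; rewrite /gd_cost gd_bad// indicE memNset// subr0 add0r. Qed.

Lemma gd_cost_adapted i j t : 0 <= t <= T ->
  measurable_fun [set: g_sigma_algebraType (F t)] (gd_cost i j t).
Proof.
move=> ht; have [_ _ [hc _ _ _ _] _] := hD; have [aC _] := hc i j.
have mi : measurable_fun [set: g_sigma_algebraType (F t)]
    (\1_G : g_sigma_algebraType (F t) -> R) by exact: indic_good_meas.
apply: measurable_funD; first exact: (gd_adapted mG G0 (aC t ht)).
exact: measurable_funB.
Qed.

Lemma gd_cost_cont i j w : {within `[0, T], continuous (gd_cost i j ^~ w)}.
Proof.
have [Gw|Gw] := pselect (G w).
  rewrite (_ : gd_cost i j ^~ w = cost D i j ^~ w); first exact: (rc_cont (costG Gw)).
  by apply/funext => t; rewrite gd_cost_good.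
rewrite (_ : gd_cost i j ^~ w = cst 1); last by apply/funext => t; rewrite gd_cost_bad.
by move=> t; exact: cvg_cst.
Qed.

Lemma gd_cost_diag i t w : 0 <= t <= T -> 0 <= gd_cost i i t w.
Proof.
move=> ht; have [Gw|Gw] := pselect (G w); last by rewrite gd_cost_bad.
by rewrite gd_cost_good// (rc_diag (costG Gw) i ht).
Qed.

Lemma gd_cost_gap : exists2 c : Omega -> R, (forall w, 0 < c w) &
  forall i j l t w, i != j -> j != l -> 0 <= t <= T ->
    c w <= gd_cost i j t w + gd_cost j l t w - gd_cost i l t w.
Proof.
have H w : exists c : R, 0 < c /\ forall i j l t, i != j -> j != l -> 0 <= t <= T ->
    c <= gd_cost i j t w + gd_cost j l t w - gd_cost i l t w.
  have [Gw|Gw] := pselect (G w).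
    have [c c0 hc] := regular_costs_gap (costG Gw); exists c; split => // i j l t ij jl ht.
    by rewrite !gd_cost_good//; exact: hc.
  by exists 1; split => // i j l t _ _ _; rewrite !gd_cost_bad//; lra.
have [c hc] := choice H; exists c => [w|i j l t w]; first by have [] := hc w.
by have [_] := hc w; apply.
Qed.

Section one_candidate.
Variables (S : candidate R Omega E dim m) (I : 'I_m -> R -> Omega -> R).
Hypotheses (hS : is_solution P N T D M b S) (hI : driven S I)
  (candG : forall w, G w -> regular_candidate N D T S I w).

Lemma reflected_candidate : reflected_system gd_cost
  (candidate_path T0 hset hD hS hI mG G0 regG candG hM prho G_exp).
Proof.
split=> [i j t w ij ht|i w s t e s0 st tT e0 he] /=.
  have [Gw|Gw] := pselect (G w).
    by rewrite gd_cost_good// !gd_good//; exact: (obstacle_le (candG Gw) ij ht).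
  by rewrite gd_cost_bad// !gd_bad//; lra.
have [Gw|Gw] := pselect (G w); last by rewrite !gd_bad.
rewrite !gd_good//; apply: (flat_off_obstacle T0 (candG Gw) s0 st tT e0) => r j ji rst.
by have := he r j ji rst; rewrite /= gd_cost_good// !gd_good.
Qed.

End one_candidate.

Variables (S S' : candidate R Omega E dim m) (I I' : 'I_m -> R -> Omega -> R).
Hypotheses (hS : is_solution P N T D M b S) (hI : driven S I)
  (candG : forall w, G w -> regular_candidate N D T S I w)
  (hS' : is_solution P N T D M b S') (hI' : driven S' I')
  (candG' : forall w, G w -> regular_candidate N D T S' I' w).
Variable eta : R.
Hypotheses (eta3 : 3 * bcst M < eta)
  (heta : Rintegrable P setT (fun w => expR (eta * clockA N G T w))).
Hypothesis M0 : 0 <= M.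
Local Notation B := (candidate_path T0 hset hD hS hI mG G0 regG candG hM prho G_exp).
Local Notation B' := (candidate_path T0 hset hD hS' hI' mG G0 regG candG' hM prho G_exp).

Let Gae : {ae P, forall w, G w}.
Proof. by exists (~` G); split => //; exact: measurableC. Qed.

Let Y_at i t : 0 <= t <= T -> {ae P, forall w, bpY (B i) t w = bpY (B' i) t w}.
Proof.
move=> ht; have [c c0 hc] := gd_cost_gap.
have r := reflected_candidate hS hI candG; have r' := reflected_candidate hS' hI' candG'.
refine (system_unique (eta := eta) (c := c) _ _ _ _ _ _ _ _ _ _ _ i r r' ht).
- exact: ltW.
- exact: M0.
- exact: prho.
- exact: hM.
- exact: eta3.
- exact: heta.
- exact: gd_cost_adapted.
- exact: gd_cost_cont.
- exact: gd_cost_diag.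
- exact: hc.
- exact: c0.
Qed.

Lemma solY_unique i : indistinguishable P T (solY S i) (solY S' i).
Proof.
move: (Y_indist (ltW T0) (Y_at i)) Gae; apply: filterS2 => w h Gw t ht.
by have := h t ht; rewrite /= !gd_good.
Qed.

Lemma solK_unique i : indistinguishable P T (solK S i) (solK S' i).
Proof.
move: (K_indist (ltW T0) M0 (prho i) (hM i) (Y_at i)) Gae; apply: filterS2 => w h Gw t ht.
by have := h t ht; rewrite /= !gd_good.
Qed.

(** At almost every outcome U - Ubar vanishes phi dA-almost everywhere, so every exponential weight
    gives norm 0. *)
Lemma solU_unique i beta :
  sqnormp P N T beta (fun s w e => solU S i s w e - solU S' i s w e) = 0%E.
Proof.
have w0 s w (e : E) :
    (0 <= (expR (beta * A s w) * (solU S i s w e - solU S' i s w e) ^+ 2)%:E)%E.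
  by rewrite lee_fin mulr_ge0 ?expR_ge0 ?sqr_ge0.
apply: lower_integral_ae0 => //.
  by move=> w _; apply: integral_ge0 => s _; apply: integral_ge0 => e _; exact: w0.
move: (U_eq0 (ltW T0) M0 (prho i) (hM i) (Y_at i)) Gae; apply: filterS2 => w hU Gw _.
have pV : predictable_field F `[0, T]
    (fun s w (e : BE) => expR (beta * A s w) * (solU S i s w e - solU S' i s w e) ^+ 2).
  apply: (weighted_predictable T0 hset).
  by apply: measurable_funB; [exact: (solU_pred hD hS)|exact: (solU_pred hD hS')].
have mf : measurable_fun (strip BE 0 T) (fun z : R * BE =>
    (expR (beta * A z.1 w) * (solU S i z.1 w z.2 - solU S' i z.1 w z.2) ^+ 2)%:E).
  by apply/measurable_EFinP; exact: (predictable_strip w (ltW T0) (lexx 0) pV).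
pose f (z : R * BE) := (expR (beta * A z.1 w) * (solU S i z.1 w z.2 - solU S' i z.1 w z.2) ^+ 2)%:E.
have f0 z : (0 <= f z)%E by exact: w0.
(* Stated for arbitrary proofs of the setting hypotheses, so that it unifies with the ones stored
   inside [B]. *)
have h hW hp hA hA0 hcomp :
    (\int[rmq (noise_measures (ltW T0) hW hp hA hA0 hcomp mG G0 regG G_exp) w]_(z in strip BE 0 T) f z =
    \int[dA N w]_(s in oc 0%R T) \int[phi N s w]_e f (s, e))%E.
  by have [] := compensator_strip_integral (ltW T0) hW hp hA hA0
    (compensator_phi hcomp) mG G0 regG Gw (lexx 0) f0 mf.
refine (eq_trans (esym (h _ _ _ _ _)) _); apply: lower_integral_ae0 => //.
  exact: strip_measurable.
by apply: filterS hU => z + Dz => /(_ Dz) /= hz; rewrite /f hz expr0n mulr0.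
Qed.

(** The two Ito integrals agree at T because the martingale J vanishes there. [ito_integrand_unique]
    gives norm 0 without weight, hence equality almost everywhere and norm 0 for every beta. *)
Lemma solZ_unique i beta :
  sqnormW P N T beta (fun s w => sqnorm (solZ S i s w - solZ S' i s w)) = 0%E.
Proof.
have [hW hp hi _ _] := hset.
have pZ : forall k, progressive F T (fun s w => solZ S i s w ord0 k).
  by have [_ /(_ _ (mid_beta hD))[_ _ _ []]] := hS i.
have pZ' : forall k, progressive F T (fun s w => solZ S' i s w ord0 k).
  by have [_ /(_ _ (mid_beta hD))[_ _ _ []]] := hS' i.
have TT : 0 <= T <= T by rewrite lexx ltW.
have II : {ae P, forall w, I i T w = I' i T w}.
  move: (J_eq0_at (ltW T0) M0 (prho i) (hM i) (Y_at i) TT) Gae; apply: filterS2 => w h Gw.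
  by move: h; rewrite /= !gd_good// => /eqP; rewrite subr_eq0 => /eqP.
have Z0 := ito_integrand_unique (ltW T0) hW hp hi pZ pZ' (hI i).1 (hI' i).1 II.
pose f (x : Omega * RT) := sqnorm (solZ S i x.2 x.1 - solZ S' i x.2 x.1).
have f0 x : 0 <= f x by exact: sqnorm_ge0.
have mf : measurable_fun (setT `*` oc 0 T) f.
  by apply: sqnorm_joint => j; [exact: (progressive_joint (ltW T0) hW hp (pZ j))|
    exact: (progressive_joint (ltW T0) hW hp (pZ' j))].
have mI : measurable (oc 0 T : set RT) by exact: measurable_itv.
have i0 w : (0 <= \int[lebesgue_measure]_(s in oc 0%R T) (f (w, s))%:E)%E.
  by apply: integral_ge0 => s _; rewrite lee_fin.
have ZP := ge0_integral_eq0 measurableT (iterated_measurable f0 mf) i0 Z0.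
have w0 s w : (0 <= (expR (beta * A s w) * sqnorm (solZ S i s w - solZ S' i s w))%:E)%E.
  by rewrite lee_fin mulr_ge0 ?expR_ge0 ?sqnorm_ge0.
apply: lower_integral_ae0 => //.
  by move=> w _; apply: integral_ge0 => s _; exact: w0.
apply: filterS ZP => w /(_ Logic.I) Zw _; apply: lower_integral_ae0 => //.
have mfw : measurable_fun (oc 0 T : set RT) (fun s : RT => (f (w, s))%:E).
  apply/measurable_EFinP.
  apply: (measurable_comp (F := setT `*` oc 0 T) (f := f) (g := pair w)) => //.
  - by apply: measurableX.
  - by move=> _ [s hs <-].
  - by apply: measurable_funTS; exact: pair1_measurable.
have fw0 s : (0 <= (f (w, s))%:E)%E by rewrite lee_fin.
apply: filterS (ge0_integral_eq0 mI mfw fw0 Zw) => s + hs => /(_ hs) [].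
by rewrite /f /= => ->; rewrite mulr0.
Qed.

End uniqueness.

(** [clockA] agrees with A off a null set, so the exponential moment of (S) carries over to it. *)
Lemma clock_exp (R : realType) dO (Omega : measurableType dO) (P : probability Omega R)
    (E : ptopologicalType) (dim : nat) (N : noise R Omega E dim) (T : R) (G : set Omega) eta :
    0 <= T -> is_setting P N -> measurable G -> P (~` G) = 0%E ->
    (\int[P]_w (expR (eta * cA N T w))%:E < +oo)%E ->
  Rintegrable P setT (fun w => expR (eta * clockA N G T w)).
Proof.
move=> T0 [hW hp hi [hA0 _ _ hA] _] mG G0 hexp.
have mc : measurable_fun setT (fun w => expR (eta * clockA N G T w)).
  apply: (@measurableT_comp _ _ _ _ _ _ (@expR R)); first exact: measurable_expR.
  by apply: measurable_funM => //; exact: (clockA_meas hW hp hA mG G0 T0).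
have mA : measurable_fun setT (fun w => expR (eta * cA N T w)).
  apply: (@measurableT_comp _ _ _ _ _ _ (@expR R)); first exact: measurable_expR.
  apply: measurable_funM => //; apply: (sub_measurable_fun (filt_sub hW hp (t := T))).
  apply: (@predictable_adapted _ _ _ (filt P N) _ R `[0, +oo[%classic (cA N) T) => //.
  - by move=> s r s0 sr; exact: filt_mono.
  - exact: measurable_predictable_coitv.
  - by rewrite /= in_itv/= T0.
apply: ge0_Rintegrable; [exact: measurableT|exact: mc| |].
  by move=> w _; exact: expR_ge0.
apply: le_lt_trans hexp; apply: lower_integral_ae_le => //.
  exact/measurable_EFinP.
exists (~` G); split => //; first exact: measurableC.
by move=> w /= h Gw; apply: h => _; rewrite clockA_good.
Qed.

Theorem proposition4p1 (R : realType) (T : R)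
    (dO : measure_display) (Omega : measurableType dO)
    (P : probability Omega R) (E : ptopologicalType) (dim m : nat)
    (N : noise R Omega E dim) (D : bsde_data R Omega E m) (M betahat : R) :
  0 < T -> (2 <= m)%N ->
  borel_space R E -> is_setting P N -> continuous_cA P N ->
  measurable_rho P N T D ->
  assumption_S P N T D M -> assumption_D P N T D M betahat ->
  forall S S' : candidate R Omega E dim m,
    is_solution P N T D M betahat S -> is_solution P N T D M betahat S' ->
    forall i : 'I_m,
      [/\ indistinguishable P T (solY S i) (solY S' i),
          indistinguishable P T (solK S i) (solK S' i)
        & forall beta, Mprime M ^+ 2 < beta < betahat ->
            sqnormp P N T beta
              (fun s w e => solU S i s w e - solU S' i s w e) = 0%E /\
            sqnormW P N T beta
              (fun s w => sqnorm (solZ S i s w - solZ S' i s w)) = 0%E].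
Proof.
move=> T0 _ _ hset hcA hrho [hM [eta eta3 hexp]] hD S S' hS hS' i.
have [I hI] := ito_choice hS; have [I' hI'] := ito_choice hS'.
(* One set serves the noise, the costs and both candidates, since the two families of paths are
   compared over the same random measures, which depend on G. *)
have [G [mG G0 hG]] := conull_set (ae_and
  (ae_and (regular_noise_ae hset hcA) (regular_costs_ae hD))
  (ae_and (regular_candidate_ae T0 hset hcA hD hS hI) (regular_candidate_ae T0 hset hcA hD hS' hI'))).
have regG w : G w -> regular_noise N w by move=> /hG[[]].
have costG w : G w -> regular_costs D T w by move=> /hG[[]].
have candG w : G w -> regular_candidate N D T S I w by move=> /hG[_ []].
have candG' w : G w -> regular_candidate N D T S' I' w by move=> /hG[_ []].
have prho j := (hrho j).2.
(* The sign of M is read off from one value of rho; time 0 and the default points serve. *)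
have M0 : 0 <= M.
  have /andP[r0 rM] : 0 <= rho D i 0 point point <= M by apply: hM; rewrite lexx ltW.
  exact: le_trans r0 rM.
(* Here 3 b = 3 + M^4, the threshold in (S). *)
have {}eta3 : 3 * bcst M < eta by rewrite /bcst; move: eta3; lra.
have heta := clock_exp (ltW T0) hset mG G0 hexp.
have G_exp : Rintegrable P setT (fun w => expR (3 * bcst M * clockA N G T w)).
  have [hW hp _ [hA0 _ _ hA] _] := hset.
  apply: (Rintegrable_le measurableT _ _ heta).
    apply: (@measurableT_comp _ _ _ _ _ _ (@expR R)); first exact: measurable_expR.
    by apply: measurable_funM => //; exact: (clockA_meas hW hp hA mG G0 (ltW T0)).
  move=> w _; rewrite ger0_norm ?expR_ge0// ler_expR ler_wpM2r ?(ltW eta3)//.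
  exact: (clockA_ge0 hA0 regG w (ltW T0)).
split.
- exact: (solY_unique T0 hset hD mG G0 regG costG hM prho G_exp hS hI candG
      hS' hI' candG' eta3 heta M0 i).
- exact: (solK_unique T0 hset hD mG G0 regG costG hM prho G_exp hS hI candG
      hS' hI' candG' eta3 heta M0 i).
- move=> beta _; split.
    exact: (solU_unique T0 hset hD mG G0 regG costG hM prho G_exp hS hI candG
      hS' hI' candG' eta3 heta M0 i).
  exact: (solZ_unique T0 hset hD mG G0 regG costG hM prho G_exp hS hI candG
      hS' hI' candG' eta3 heta M0 i).
Qed.
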